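(* Let $m\ge2$ and let $(p:\mathcal P\to N,\omega)$ be a lightlike Cartan geometry with curvature $K$. Then $(p:\mathcal P\to N,\omega)$ is locally a fiber bundle of scales of a Riemannian conformal structure if and only if $$K\big(\omega^{-1}(E),\omega^{-1}(e)\big)=0\qquad\text{for every }e\in\mathfrak g_{-1}.$$
   Context: Conventions. Manifolds are smooth, Hausdorff, connected, second countable. $\mathbb L^{m+2}$ is $\mathbb R^{m+2}$ with its Lorentzian inner product of signature $(m+1,1)$ and a fixed basis $(\ell,e_1,\dots,e_m,n)$ with $\ell$ in the future lightlike cone, $\langle \ell,n\rangle=1$, $\langle e_i,e_j\rangle=\delta_{ij}$ and all other products of basis vectors zero. $G=O^+(m+1,1)$ is the group of linear isometries of $\mathbb L^{m+2}$ preserving the future lightlike cone, $H\subset G$ is the isotropy subgroup of $\ell$ and $P\supset H$ is the isotropy subgroup of the line $\mathbb R\ell$; $P/H\cong\mathbb R_{>0}$. In the fixed basis the Lie algebra $\mathfrak g$ of $G$ consists of the matrices $\begin{pmatrix} a&\zeta&0\\ X&A&-\zeta^t\\0&-X^t&-a\end{pmatrix}$ with $a\in\mathbb R$, $X\in\mathbb R^m$, $\zeta\in(\mathbb R^m)^*$, $A\in\mathfrak o(m)$; $\mathfrak g=\mathfrak g_{-1}\oplus\mathfrak g_0\oplus\mathfrak g_1$ where $\mathfrak g_{-1}$, $\mathfrak g_0$, $\mathfrak g_1$ are the $X$-part, the $(a,A)$-part and the $\zeta$-part; $E=\mathrm{diag}(1,0,\dots,0,-1)\in\mathfrak g_0$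 is the grading element. For a closed subgroup $Q\subset G$ with Lie algebra $\mathfrak q$, a Cartan geometry of type $(G,Q)$ on a manifold $M$ is a principal $Q$-bundle $\pi:\mathcal G\to M$ with $\omega\in\Omega^1(\mathcal G,\mathfrak g)$ such that each $\omega(u):T_u\mathcal G\to\mathfrak g$ is a linear isomorphism, $(r^k)^*\omega=\mathrm{Ad}(k^{-1})\circ\omega$ for $k\in Q$, and $\omega(\zeta_X)=X$ for the fundamental vector field of each $X\in\mathfrak q$. For $X\in\mathfrak g$, $\omega^{-1}(X)$ is the vector field with $\omega(\omega^{-1}(X))\equiv X$. The curvature is $K(\xi,\eta)=d\omega(\xi,\eta)+[\omega(\xi),\omega(\eta)]$. Isomorphisms are principal bundle isomorphisms pulling back one Cartan connection to the other. A lightlike Cartan geometry is a Cartan geometry of type $(G,H)$. A Cartan geometry $(\mathcal G\to M,\omega')$ of type $(G,P)$ induces a Riemannian conformal structure on $M$; its correspondence space is $\mathcal G/H$, which is the bundle of scales (the bundle of rays formed by the metrics in the conformal class) of this conformal structure, and $(\mathcal G\to\mathcal G/H,\omega')$ is a lightlike Cartan geometry. A lightlike Cartan geometry $(p:\mathcal P\to N,\omega)$ is locally a fiber bundle of scales of a Riemannian conformal structure if every point of $N$ has an open neighbourhood $U$ such that $(p^{-1}(U)\to U,\omega|_{p^{-1}(U)})$ is isomorphic to the restriction of $(\mathcal G\to\mathcal G/H,\omega')$ to an open subset of $\mathcal G/H$, for some Cartan geometry $(\mathcal G\to M,\omega')$ of type $(G,P)$. *)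

(* Defs.v *)
From mathcomp Require Import all_boot all_order all_algebra.
From mathcomp Require Import all_classical all_reals all_analysis.
Set Implicit Arguments.
Unset Strict Implicit.
Unset Printing Implicit Defensive.
Import Order.TTheory GRing.Theory Num.Theory.
Import numFieldNormedType.Exports.
Local Open Scope classical_set_scope.
Local Open Scope ring_scope.

(* Iterated directional derivatives D_{v_1} ... D_{v_r} f, for vs = v_1...v_r. *)
Fixpoint iterD (R : realType) (V W : normedModType R) (vs : seq V)
    (f : V -> W) : V -> W :=
  if vs is v :: vs' then fun x => 'D_v (iterD vs' f) x else f.

Definition smooth_open (R : realType) (V W : normedModType R) (O : set V)
    (f : V -> W) : Prop :=
  forall (vs : seq V) (x : V), O x -> differentiable (iterD vs f) x.

(* Smoothness on an arbitrary subset A: f is locally the restriction to A of a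
   C^oo map defined on an open set. For A open this is smoothness on A; for A
   an embedded submanifold (e.g. a closed matrix group) it is smoothness for
   the submanifold structure. *)
Definition smooth_on (R : realType) (V W : normedModType R) (A : set V)
    (f : V -> W) : Prop :=
  forall x, A x -> exists (O : set V) (F : V -> W),
    [/\ open O, O x, smooth_open O F & forall y, A y -> O y -> F y = f y].

(* A chart of T with values in E: a homeomorphism crd from dom onto img, with
   inverse cinv; the values of crd and cinv outside dom and img are junk. *)
Record chart (R : realType) (T : topologicalType) (E : normedModType R) :=
  Chart { dom : set T; img : set E; crd : T -> E; cinv : E -> T }.

Definition is_chart (R : realType) (T : topologicalType) (E : normedModType R)
    (c : chart T E) : Prop :=
  [/\ open (dom c), open (img c),
      forall x, dom c x -> img c (crd c x) /\ cinv c (crd c x) = x,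
      forall y, img c y -> dom c (cinv c y) /\ crd c (cinv c y) = y &
      {within dom c, continuous (crd c)} /\
      {within img c, continuous (cinv c)}].

Definition is_smooth_atlas (R : realType) (T : topologicalType)
    (E : normedModType R) (A : set (chart T E)) : Prop :=
  [/\ forall c, A c -> is_chart c,
      forall x, exists2 c, A c & dom c x &
      forall c c', A c -> A c' ->
        smooth_on [set y | img c y /\ dom c' (cinv c y)]
                  (crd c' \o cinv c)].

(* Connectedness is not included: the total space of a principal bundle need
   not be connected. It is required of the base in [cartan_geometry]. *)
Record manifold (R : realType) := Manifold {
  mdim : nat;
  mspace :> topologicalType;
  atlas : set (chart mspace 'rV[R]_mdim);
  atlas_smooth : is_smooth_atlas atlas;
  manifold_hausdorff : hausdorff_space mspace;
  manifold_countable : @second_countable mspace }.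
Arguments atlas {R} _ _.

(* Atlases are used directly so that M x V, for a manifold M and a vector
   space V, can be treated as well. *)
Definition vec_chart (R : realType) (E : normedModType R) : chart E E :=
  Chart setT setT id id.

Definition vec_atlas (R : realType) (E : normedModType R) : set (chart E E) :=
  [set vec_chart E].
Arguments vec_atlas {R} E _.

Definition prod_chart (R : realType) (T T' : topologicalType)
    (E E' : normedModType R) (c : chart T E) (c' : chart T' E') :
    chart (T * T')%type (E * E')%type :=
  Chart (dom c `*` dom c') (img c `*` img c')
        (fun x => (crd c x.1, crd c' x.2)) (fun y => (cinv c y.1, cinv c' y.2)).

Definition prod_atlas (R : realType) (T T' : topologicalType)
    (E E' : normedModType R) (A : set (chart T E)) (A' : set (chart T' E')) :
    set (chart (T * T')%type (E * E')%type) :=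
  [set d | exists c c', [/\ A c, A' c' & d = prod_chart c c']].

Definition smooth_map (R : realType) (T T' : topologicalType)
    (E E' : normedModType R) (A : set (chart T E)) (A' : set (chart T' E'))
    (D : set T) (f : T -> T') : Prop :=
  {within D, continuous f} /\
  forall c c', A c -> A' c' ->
    smooth_on [set y | [/\ img c y, D (cinv c y) & dom c' (f (cinv c y))]]
              (crd c' \o f \o cinv c).

Definition diffeo (R : realType) (T T' : topologicalType)
    (E E' : normedModType R) (A : set (chart T E)) (A' : set (chart T' E'))
    (D : set T) (D' : set T') (f : T -> T') : Prop :=
  [/\ smooth_map A A' D f, (forall x, D x -> D' (f x)) &
      exists g : T' -> T,
        [/\ smooth_map A' A D' g, (forall y, D' y -> D (g y)),
            (forall x, D x -> g (f x) = x) & (forall y, D' y -> f (g y) = y)]].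

(* A tangent vector of M at u is represented by its coordinates v in a chart
   c around u; the coordinates in c' are [tangent_map id c c' u v]. *)
Definition tangent_map (R : realType) (M N : manifold R) (f : M -> N)
    (c : chart M 'rV[R]_(mdim M)) (c' : chart N 'rV[R]_(mdim N)) (u : M)
    (v : 'rV[R]_(mdim M)) : 'rV[R]_(mdim N) :=
  'd (crd c' \o f \o cinv c) (crd c u) v.

(* w c u v is the value of the form at the tangent vector at u having
   coordinates v in the chart c. *)
Definition preform (R : realType) (M : manifold R) (W : normedModType R) :=
  chart M 'rV[R]_(mdim M) -> M -> 'rV[R]_(mdim M) -> W.

Definition is_smooth_1form (R : realType) (M : manifold R)
    (W : normedModType R) (w : preform M W) : Prop :=
  [/\ forall c u, atlas M c -> dom c u -> linear (w c u),
      forall c c' u v, atlas M c -> atlas M c' -> dom c u -> dom c' u ->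
        w c' u (tangent_map id c c' u v) = w c u v &
      forall c v, atlas M c -> smooth_on (img c) (fun x => w c (cinv c x) v)].

Definition ext_deriv (R : realType) (M : manifold R) (W : normedModType R)
    (w : preform M W) (c : chart M 'rV[R]_(mdim M)) (u : M)
    (v1 v2 : 'rV[R]_(mdim M)) : W :=
  'D_v1 (fun x => w c (cinv c x) v2) (crd c u)
  - 'D_v2 (fun x => w c (cinv c x) v1) (crd c u).

(* The bundle p : B -> N with structure group a matrix group Q; only the
   values act b k with k in Q are relevant. *)
Definition principal_bundle (R : realType) (k : nat) (Q : set 'M[R]_k)
    (B N : manifold R) (p : B -> N) (act : B -> 'M[R]_k -> B) : Prop :=
  [/\ smooth_map (atlas B) (atlas N) setT p,
      smooth_map (prod_atlas (atlas B) (vec_atlas 'M[R]_k)) (atlas B)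
        [set bq | Q bq.2] (fun bq => act bq.1 bq.2),
      [/\ forall b, act b 1%:M = b,
          forall b q r, Q q -> Q r -> act (act b q) r = act b (q *m r) &
          forall b q, Q q -> p (act b q) = p b] &
      forall x : N, exists (U : set N) (phi : B -> 'M[R]_k),
        [/\ open U, U x,
            forall b q, U (p b) -> Q q -> phi (act b q) = phi b *m q &
            diffeo (atlas B) (prod_atlas (atlas N) (vec_atlas 'M[R]_k))
              (p @^-1` U) [set xq | U xq.1 /\ Q xq.2]
              (fun b => (p b, phi b))]].

(* Smooth curves in Q through the identity; their velocities at 0 form the Lie
   algebra q = T_1 Q. For such a curve g with velocity X, the value at b of the
   fundamental vector field zeta_X is the velocity at 0 of t |-> act b (g t). *)
Definition curve_at_1 (R : realType) (k : nat) (Q : set 'M[R]_k)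
    (g : R -> 'M[R]_k) : Prop :=
  [/\ @smooth_on R R^o 'M[R]_k setT g, forall t, Q (g t) & g 0 = 1%:M].

Definition bracket (R : realType) (k : nat) (X Y : 'M[R]_k) : 'M[R]_k :=
  X *m Y - Y *m X.

(* A Cartan connection on the principal Q-bundle B -> N; g is the Lie algebra
   of the ambient group. *)
Definition cartan_connection (R : realType) (k : nat) (g : set 'M[R]_k)
    (Q : set 'M[R]_k) (B : manifold R) (act : B -> 'M[R]_k -> B)
    (w : preform B 'M[R]_k) : Prop :=
  [/\ is_smooth_1form w,
      forall c u, atlas B c -> dom c u -> set_bij setT g (w c u),
      forall c c' u q v, atlas B c -> atlas B c' -> Q q ->
        dom c u -> dom c' (act u q) ->
        w c' (act u q) (tangent_map (fun b => act b q) c c' u v)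
        = invmx q *m w c u v *m q &
      forall c u gam, atlas B c -> dom c u -> curve_at_1 Q gam ->
        w c u (derive1 (fun t : R => crd c (act u (gam t))) 0) = derive1 gam 0].

Definition cartan_geometry (R : realType) (k : nat) (g Q : set 'M[R]_k)
    (B N : manifold R) (p : B -> N) (act : B -> 'M[R]_k -> B)
    (w : preform B 'M[R]_k) : Prop :=
  [/\ connected [set: N], principal_bundle Q p act &
      cartan_connection g Q act w].

(* The vector field omega^{-1}(X), in the coordinates of c. *)
Definition const_field (R : realType) (k : nat) (B : manifold R)
    (w : preform B 'M[R]_k) (X : 'M[R]_k) (c : chart B 'rV[R]_(mdim B))
    (u : B) : 'rV[R]_(mdim B) :=
  xget 0 [set v | w c u v = X].

Definition curvature (R : realType) (k : nat) (B : manifold R)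
    (w : preform B 'M[R]_k) (c : chart B 'rV[R]_(mdim B)) (u : B)
    (v1 v2 : 'rV[R]_(mdim B)) : 'M[R]_k :=
  ext_deriv w c u v1 v2 + bracket (w c u v1) (w c u v2).

(* Matrices act on column vectors of coordinates in the basis
   (l, e_1, ..., e_m, n), split as 1 + (m + 1). *)
Definition gram (R : realType) (m : nat) : 'M[R]_(1 + (m + 1)) :=
  block_mx 0 (row_mx 0 1%:M) (col_mx 0 1%:M) (block_mx 1%:M 0 0 0).

Definition lorentz (R : realType) (m : nat) (x y : 'cV[R]_(1 + (m + 1))) : R :=
  (x^T *m gram R m *m y) 0 0.

Definition vec_l (R : realType) (m : nat) : 'cV[R]_(1 + (m + 1)) :=
  col_mx 1%:M 0.

Definition vec_n (R : realType) (m : nat) : 'cV[R]_(1 + (m + 1)) :=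
  col_mx 0 (col_mx 0 1%:M).

(* l - n is timelike and <l, l - n> = -1 < 0, so it lies in the same time cone
   as l; a nonzero lightlike x is future iff <x, l - n> < 0. *)
Definition future_lightcone (R : realType) (m : nat) :
    set 'cV[R]_(1 + (m + 1)) :=
  [set x | [/\ x != 0, lorentz x x = 0 & lorentz x (vec_l R m - vec_n R m) < 0]].
Arguments future_lightcone : clear implicits.

Definition groupG (R : realType) (m : nat) : set 'M[R]_(1 + (m + 1)) :=
  [set q | (forall x y, lorentz (q *m x) (q *m y) = lorentz x y) /\
           (forall x, future_lightcone R m x -> future_lightcone R m (q *m x))].
Arguments groupG : clear implicits.

Definition groupH (R : realType) (m : nat) : set 'M[R]_(1 + (m + 1)) :=
  [set q | groupG R m q /\ q *m vec_l R m = vec_l R m].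
Arguments groupH : clear implicits.

Definition groupP (R : realType) (m : nat) : set 'M[R]_(1 + (m + 1)) :=
  [set q | groupG R m q /\ exists t : R, q *m vec_l R m = t *: vec_l R m].
Arguments groupP : clear implicits.

Definition lie_mx (R : realType) (m : nat) (a : R) (X : 'cV[R]_m)
    (A : 'M[R]_m) (zeta : 'rV[R]_m) : 'M[R]_(1 + (m + 1)) :=
  block_mx a%:M (row_mx zeta 0)
           (col_mx X 0) (block_mx A (- zeta^T) (- X^T) (- a)%:M).

Definition lie_g (R : realType) (m : nat) : set 'M[R]_(1 + (m + 1)) :=
  [set Y | exists a X A zeta, A^T = - A /\ Y = lie_mx a X A zeta].
Arguments lie_g : clear implicits.

Definition lie_g_minus1 (R : realType) (m : nat) : set 'M[R]_(1 + (m + 1)) :=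
  [set Y | exists X : 'cV[R]_m, Y = lie_mx 0 X 0 0].
Arguments lie_g_minus1 : clear implicits.

Definition grading (R : realType) (m : nat) : 'M[R]_(1 + (m + 1)) :=
  lie_mx 1 0 0 0.

Definition lightlike_cartan_geometry (R : realType) (m : nat)
    (B N : manifold R) (p : B -> N) (act : B -> 'M[R]_(1 + (m + 1)) -> B)
    (w : preform B 'M[R]_(1 + (m + 1))) : Prop :=
  cartan_geometry (lie_g R m) (groupH R m) p act w.

Definition conformal_cartan_geometry (R : realType) (m : nat)
    (B M : manifold R) (p : B -> M) (act : B -> 'M[R]_(1 + (m + 1)) -> B)
    (w : preform B 'M[R]_(1 + (m + 1))) : Prop :=
  cartan_geometry (lie_g R m) (groupP R m) p act w.

(* Q with the projection q : B -> Q is the quotient manifold B / H: it is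
   characterised by q being a principal H-bundle for the restricted action. *)
Definition correspondence_space (R : realType) (m : nat) (B Q : manifold R)
    (q : B -> Q) (act : B -> 'M[R]_(1 + (m + 1)) -> B) : Prop :=
  principal_bundle (groupH R m) q act.

(* The restrictions to the open sets U and U' of two Cartan geometries with
   structure group Q are isomorphic. *)
Definition isomorphic_over (R : realType) (k : nat) (Q : set 'M[R]_k)
    (B N B' N' : manifold R)
    (p : B -> N) (act : B -> 'M[R]_k -> B) (w : preform B 'M[R]_k) (U : set N)
    (p' : B' -> N') (act' : B' -> 'M[R]_k -> B') (w' : preform B' 'M[R]_k)
    (U' : set N') : Prop :=
  exists (F : B -> B') (f : N -> N'),
    [/\ diffeo (atlas B) (atlas B') (p @^-1` U) (p' @^-1` U') F,
        diffeo (atlas N) (atlas N') U U' f,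
        forall b, U (p b) -> p' (F b) = f (p b),
        forall b q, U (p b) -> Q q -> F (act b q) = act' (F b) q &
        forall c c' b v, atlas B c -> atlas B' c' ->
          U (p b) -> dom c b -> dom c' (F b) ->
          w' c' (F b) (tangent_map F c c' b v) = w c b v].

Definition locally_bundle_of_scales (R : realType) (m : nat)
    (B N : manifold R) (p : B -> N) (act : B -> 'M[R]_(1 + (m + 1)) -> B)
    (w : preform B 'M[R]_(1 + (m + 1))) : Prop :=
  forall x : N, exists U : set N, [/\ open U, U x &
    exists (B' M : manifold R) (pi : B' -> M)
      (act' : B' -> 'M[R]_(1 + (m + 1)) -> B')
      (w' : preform B' 'M[R]_(1 + (m + 1))),
      conformal_cartan_geometry pi act' w' /\
      exists (N' : manifold R) (q : B' -> N') (U' : set N'),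
        [/\ correspondence_space q act', open U' &
            isomorphic_over (groupH R m) p act w U q act' w' U']].

(* Main.v *)
Require Import Defs.
From mathcomp Require Import all_boot all_order all_algebra.
From mathcomp Require Import all_classical all_reals all_analysis.
From mathcomp Require Import ring lra.
From HB Require Import structures.
Set Implicit Arguments.
Unset Strict Implicit.
Unset Printing Implicit Defensive.
Import Order.TTheory GRing.Theory Num.Theory.
Import numFieldNormedType.Exports.
Local Open Scope classical_set_scope.
Local Open Scope ring_scope.

(** A vector omega^-1(X) with X in the Lie algebra of the structure group annihilates
    the curvature: by equivariance its flow acts on omega through Ad, and Cartan's
    formula gives d omega(omega^-1(X), v) = - [X, omega(v)]. For a conformal geometry
    this applies to X = E, which yields the necessity of the condition, the curvature
    being natural. In the lightlike case it applies to X in h, so that the condition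
    makes the curvature vanish on E + h in its first argument.

    Conversely, let alpha be the pullback of omega by a local section sigma of the
    H-bundle and let Z be the field on the base with alpha(Z) in E + h. If k solves
    k' = k alpha(Z) along the flow of Z, the vanishing of the curvature on E + h says
    that the gauge transform k alpha k^-1 - (dk) k^-1 is basic for this flow, hence the
    pullback of a form theta on the space of integral curves of Z, an open piece of R^m.
    Then q^-1 theta q + q^-1 dq is a Cartan connection of type (G, P) on R^m x P, and
    b = sigma(z) . phi |-> (f(z), K(z) phi), with f the projection and K the value of k,
    identifies the lightlike geometry near a point with an open part of its
    correspondence space; the position along the flow becomes the scale of K. *)

(** * Classes of differentiability *)

(** The obstacle to the converse is globality: a geometry of type (G, P) must live on a whole
    manifold, while Z exists only near a point. A retraction onto a small neighbourhood makes Z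
    complete, so the space of integral curves is all of R^m, theta and K are defined everywhere, and
    scale space is one copy of R^(m+1). Only the gauge identity is confined to an open set C.
    Outside C no structure equation is claimed, and none is required: any theta that is injective
    modulo p gives a Cartan connection on R^m x P.

    No inverse function theorem is used for straightening: Z is rescaled to unit speed in one
    coordinate, which makes the inverse of the flow box explicit. Smooth dependence on parameters
    comes from difference quotients that themselves solve linear equations. P receives its manifold
    structure from Cayley transforms, and in the connection form q^-1 is written J q^T J, a
    polynomial in q. The dimension of N is not given in advance; it is m + 1 because omega
    identifies tangent spaces of N with g/h. *)

Section FrechetDerivative.
Variables (R : realType) (V W : normedModType R).

Lemma differentiable_eps (f : V -> W) (x : V) : differentiable f x ->
  forall e, 0 < e -> \forall h \near (0 : V),
    `|f (h + x) - f x - 'd f x h| <= e * `|h|.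
Proof.
move=> /diff_locally df e e0.
have /eqaddoP/(_ e e0) := df.
apply: filterS => h /=.
by rewrite /shift /= opprD addrA.
Qed.

Lemma eps_differentiable (f : V -> W) (x : V) (df : {linear V -> W}) :
  continuous df ->
  (forall e, 0 < e -> \forall h \near (0 : V),
    `|f (h + x) - f x - df h| <= e * `|h|) ->
  differentiable f x /\ 'd f x = df :> (V -> W).
Proof.
move=> cdf H.
have E : f \o shift x = cst (f x) + df +o_ 0 id.
  apply/eqaddoP => e e0; have := H e e0.
  by apply: filterS => h /=; rewrite /shift /= opprD addrA.
have dE := diff_unique cdf E.
split=> //; apply/diff_locallyP; rewrite dE; split=> //.
Qed.

Lemma near_eq_differentiable (f g : V -> W) (x : V) :
  (\forall y \near x, f y = g y) -> differentiable f x ->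
  differentiable g x /\ 'd g x = 'd f x :> (V -> W).
Proof.
move=> fg df; apply: (@eps_differentiable g x ('d f x)).
  exact: diff_continuous.
move=> e e0; have fg0 : \forall h \near (0 : V), f (h + x) = g (h + x).
  by move: fg; rewrite (near_shift 0) subr0.
have fgx : f x = g x by apply: (nbhs_singleton fg).
near=> h; rewrite -fgx -(near fg0 h) //; near: h.
exact: differentiable_eps.
Unshelve. all: by end_near. Qed.

End FrechetDerivative.

Section ContinuouslyDifferentiable.
Variable R : realType.

(** The class C^r, with derivatives taken in fixed directions so that they keep their values in [W]
    and no norm on spaces of linear maps is needed. Finite classes are introduced because the
    product and chain rules are proved by induction on [r], for which [smooth_open] offers no
    starting point. *)
Fixpoint Ck (r : nat) (V W : normedModType R) (O : set V) (f : V -> W) : Prop :=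
  if r is r'.+1 then
    (forall x, O x -> differentiable f x) /\ forall v, Ck r' O ('D_v f)
  else forall x, O x -> {for x, continuous f}.

Lemma CkW r (V W : normedModType R) (O : set V) (f : V -> W) :
  Ck r.+1 O f -> Ck r O f.
Proof.
elim: r f => [|r IH] f [df Df]; first by move=> x Ox; apply: differentiable_continuous; exact: df.
by split=> // v; apply: IH.
Qed.

Lemma Ck_continuous r (V W : normedModType R) (O : set V) (f : V -> W) x :
  Ck r O f -> O x -> {for x, continuous f}.
Proof. by elim: r => [|r IH] H Ox; [exact: H|apply: IH => //; exact: CkW]. Qed.

(** [iterD] peels off the outermost derivative, [Ck] the innermost one; appending a direction at the
    end of the list passes from one recursion to the other. *)
Lemma iterD_rcons (V W : normedModType R) (vs : seq V) v (f : V -> W) :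
  Defs.iterD (rcons vs v) f = Defs.iterD vs ('D_v f).
Proof. by elim: vs => //= u vs ->. Qed.

Lemma smooth_openP (V W : normedModType R) (O : set V) (f : V -> W) :
  smooth_open O f <-> forall r, Ck r O f.
Proof.
split=> [sf r|H vs].
  elim: r f sf => [|r IH] f sf.
    move=> x Ox; apply: differentiable_continuous.
    exact: (sf [::]).
  split=> [x Ox|v]; first exact: (sf [::]).
  apply: IH => vs x Ox; rewrite -iterD_rcons; exact: sf.
elim/last_ind: vs f H => [|vs v IH] f H x Ox.
  by have [df _] := H 1; exact: df.
rewrite iterD_rcons; apply: IH => // r.
by have [_] := H r.+1; exact.
Qed.

Lemma Ck_ext r (V W : normedModType R) (O : set V) (f g : V -> W) : open O ->
  (forall x, O x -> f x = g x) -> Ck r O f -> Ck r O g.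
Proof.
move=> oO; elim: r f g => [|r IH] f g fg /=.
  move=> H x Ox; have nO : \forall y \near x, f y = g y.
    by have := open_nbhs_nbhs (conj oO Ox); apply: filterS.
  have gx : g @ x --> f x.
    apply: cvg_trans (H x Ox).
    by apply: near_eq_cvg; exact: nO.
  by rewrite /prop_for /continuous_at -(fg x Ox).
move=> [df Df]; split=> [x Ox|v].
  have nO : \forall y \near x, f y = g y.
    by have := open_nbhs_nbhs (conj oO Ox); apply: filterS.
  by have [] := near_eq_differentiable nO (df x Ox).
apply: IH (Df v) => x Ox; apply: near_eq_derive.
by have := open_nbhs_nbhs (conj oO Ox); apply: filterS.
Qed.

Lemma Ck_cst r (V W : normedModType R) (O : set V) (a : W) : Ck r O (cst a : V -> W).
Proof.
elim: r a => [|r IH] a /=; first by move=> x _; exact: cst_continuous.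
split=> [x _|v]; first exact: differentiable_cst.
rewrite (_ : 'D_v (cst a) = cst 0); first exact: IH.
by apply/funext => x; rewrite derive_cst.
Qed.

Lemma CkD r (V W : normedModType R) (O : set V) (f g : V -> W) : open O ->
  Ck r O f -> Ck r O g -> Ck r O (fun x => f x + g x).
Proof.
move=> oO; elim: r f g => [|r IH] f g /=.
  by move=> cf cg x Ox; apply: cvgD; [exact: cf|exact: cg].
move=> [df Df] [dg Dg]; split=> [x Ox|v].
  by apply: differentiableD; [exact: df|exact: dg].
apply: Ck_ext (IH _ _ (Df v) (Dg v)) => // x Ox /=.
by rewrite -deriveD //; apply: diff_derivable; [exact: df|exact: dg].
Qed.

Lemma Ck_sum r (V W : normedModType R) (O : set V) (I : Type) (s : seq I)
    (P : pred I) (f : I -> V -> W) : open O ->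
  (forall i, P i -> Ck r O (f i)) -> Ck r O (fun x => \sum_(i <- s | P i) f i x).
Proof.
move=> oO H; elim: s => [|i s IH].
  by apply: Ck_ext (Ck_cst _ _ 0) => // x _; rewrite big_nil.
have [Pi|nPi] := boolP (P i); last first.
  by apply: Ck_ext IH => // x _; rewrite big_cons (negbTE nPi).
by apply: Ck_ext (CkD oO (H i Pi) IH) => // x _; rewrite big_cons Pi.
Qed.

Lemma Ck_lin r (V W X : normedModType R) (O : set V) (f : V -> W)
    (L : {linear W -> X}) : open O -> continuous L ->
  Ck r O f -> Ck r O (L \o f).
Proof.
move=> oO cL; elim: r f => [|r IH] f /=.
  by move=> cf x Ox; apply: continuous_comp; [exact: cf|exact: cL].
move=> [df Df]; have dL y : differentiable L y by exact: linear_differentiable.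
split=> [x Ox|v]; first by apply: differentiable_comp => //; exact: df.
apply: Ck_ext (IH _ (Df v)) => // x Ox /=.
have dfx := df x Ox.
have dc : differentiable (L \o f) x by exact: differentiable_comp.
rewrite !deriveE // (diff_comp dfx (dL (f x))) /=.
by rewrite (diff_lin _ cL).
Qed.

Lemma Ck_linear r (V W : normedModType R) (O : set V) (L : {linear V -> W}) :
  continuous L -> Ck r O (L : V -> W).
Proof.
move=> cL; case: r => [|r] /=; first by move=> x _; exact: cL.
have dL y : differentiable L y by exact: linear_differentiable.
split=> [x Ox //|v].
rewrite (_ : 'D_v L = cst (L v)); first exact: Ck_cst.
by apply/funext => x; rewrite deriveE // diff_lin.
Qed.

Lemma Ck_id r (V : normedModType R) (O : set V) : Ck r O (@id V).
Proof.
case: r => [|r] /=; first by move=> x _; exact: cvg_id.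
split=> [x _ //|v].
rewrite (_ : 'D_v id = cst v); first exact: Ck_cst.
by apply/funext => x; rewrite derive_id.
Qed.


Lemma differentiable_bilinear (V U U' W : normedModType R)
    (B : {bilinear U -> U' -> W}) (f : V -> U) (g : V -> U') x :
  continuous (fun p => B p.1 p.2) ->
  differentiable f x -> differentiable g x ->
  differentiable (fun y => B (f y) (g y)) x /\
  forall v, 'D_v (fun y => B (f y) (g y)) x
            = B (f x) ('D_v g x) + B ('D_v f x) (g x).
Proof.
move=> cB df dg.
have dfg : differentiable (fun y => (f y, g y)) x by exact: differentiable_pair.
have dB : differentiable (fun p => B p.1 p.2) (f x, g x).
  exact: differentiable_bilin.
have dc : differentiable (fun y => B (f y) (g y)) x.
  by rewrite (_ : (fun y => _) = (fun p => B p.1 p.2) \o (fun y => (f y, g y))) //; exact: differentiable_comp.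
split=> // v; rewrite deriveE //.
rewrite (_ : (fun y => _) = (fun p => B p.1 p.2) \o (fun y => (f y, g y))) //.
by rewrite (diff_comp dfg dB) /= diff_bilin //= diff_pair //= !deriveE.
Qed.

(** The product rule leaves one factor undifferentiated, so each summand pairs a derivative with a
    factor lowered by [CkW]. The scalar product rule, and through entries the one for matrices, come
    from here. *)
Lemma Ck_bilinear r (V U U' W : normedModType R) (O : set V)
    (B : {bilinear U -> U' -> W}) (f : V -> U) (g : V -> U') : open O ->
  continuous (fun p => B p.1 p.2) ->
  Ck r O f -> Ck r O g -> Ck r O (fun y => B (f y) (g y)).
Proof.
move=> oO cB; elim: r f g => [|r IH] f g.
  move=> /= cf cg x Ox.
  apply: (@continuous2_cvg _ _ _ _ _ _ f g (fun a b => B a b) (f x) (g x));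
    [exact: (cB (f x, g x))|exact: cf|exact: cg].
move=> cf cg; have [df Df] := cf; have [dg Dg] := cg; split=> [x Ox|v].
  by have [] := differentiable_bilinear cB (df x Ox) (dg x Ox).
apply: (@Ck_ext _ _ _ _ (fun x => B (f x) ('D_v g x) + B ('D_v f x) (g x))) => //.
  by move=> x Ox; have [_ ->] := differentiable_bilinear cB (df x Ox) (dg x Ox).
exact: (CkD oO (IH f ('D_v g) (CkW cf) (Dg v)) (IH ('D_v f) g (Df v) (CkW cg))).
Qed.

End ContinuouslyDifferentiable.

Section ScaleBilinear.
Variables (R : realType) (W : normedModType R).

(** Scaling as a named bilinear map, with the scalar in [R^o], so that the product rule for bilinear
    maps applies to it. *)
Definition scale_op (a : R^o) (w : W) : W := a *: w.

Lemma scale_op_bilinear : bilinear_for *:%R *:%R scale_op.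
Proof.
split=> [w a b c|a b v w] /=; rewrite /scale_op.
  by rewrite scalerDl -scalerA.
by rewrite scalerDr; congr (_ + _); rewrite scalerA mulrC -scalerA.
Qed.

HB.instance Definition _ :=
  bilinear_isBilinear.Build R R^o W W _ _ scale_op scale_op_bilinear.

Lemma scale_op_continuous : continuous (fun p : R^o * W => scale_op p.1 p.2).
Proof. exact: scale_continuous. Qed.

Lemma CkZ r (V : normedModType R) (O : set V) (u : V -> R^o) (f : V -> W) :
  open O -> Ck r O u -> Ck r O f -> Ck r O (fun x => u x *: f x).
Proof. move=> oO; exact: (Ck_bilinear oO scale_op_continuous). Qed.

Lemma differentiable_scale (V : normedModType R) (u : V -> R^o) (f : V -> W) x :
  differentiable u x -> differentiable f x ->
  differentiable (fun y => u y *: f y) x /\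
  forall v, 'D_v (fun y => u y *: f y) x = u x *: 'D_v f x + 'D_v u x *: f x.
Proof. exact: (differentiable_bilinear scale_op_continuous). Qed.

End ScaleBilinear.

(** Bundles a map that is merely proved linear, such as a form at a fixed point, so that the
    rewriting rules for linear maps become available. *)
Definition linear_pack (R : realType) (V W : lmodType R) (f : V -> W)
  (lf : linear f) : {linear V -> W} := HB.pack f (GRing.isLinear.Build _ _ _ _ f lf).

Section Coordinates.
Variable R : realType.

(** Finite dimension in the form in which it is used: vectors with continuous coordinate functionals
    that reconstruct every vector. Derivatives in a variable direction are thereby reduced to
    finitely many fixed ones. *)
Definition frame (V : normedModType R) (n : nat) (e : 'I_n -> V)
    (l : 'I_n -> {linear V -> R^o}) : Prop :=
  (forall i, continuous (l i)) /\ forall w, w = \sum_(i < n) l i w *: e i.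

Class findim (V : normedModType R) : Prop :=
  findim_frame : exists n (e : 'I_n -> V) (l : 'I_n -> {linear V -> R^o}), frame e l.

Definition mx_coord m n (i : 'I_m) (j : 'I_n) (M : 'M[R]_(m, n)) : R^o := M i j.

Lemma mx_coord_linear m n i j : linear (@mx_coord m n i j).
Proof. by move=> a A B; rewrite /mx_coord !mxE. Qed.

HB.instance Definition _ m n i j :=
  GRing.isLinear.Build R 'M[R]_(m, n) R^o _ (@mx_coord m n i j) (mx_coord_linear i j).

Lemma mx_coord_continuous m n i j : continuous (@mx_coord m n i j).
Proof. exact: coord_continuous. Qed.

#[export] Instance findim_mx m n : findim 'M[R]_(m, n).
Proof.
pose p (k : 'I_(m * n)) := enum_val (cast_ord (esym (mxvec_cast m n)) k).
exists (m * n)%N, (fun k => delta_mx (p k).1 (p k).2),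
  (fun k => @mx_coord m n (p k).1 (p k).2 : {linear _ -> _}).
split=> [k|w]; first exact: mx_coord_continuous.
rewrite {1}(matrix_sum_delta w) pair_big /=.
rewrite (reindex p) //=.
exists (fun q => cast_ord (mxvec_cast m n) (enum_rank q)) => q _; rewrite /p.
  by rewrite enum_valK cast_ordKV.
by rewrite cast_ordK enum_rankK.
Qed.

#[export] Instance findim_real : findim R^o.
Proof.
exists 1%N, (fun=> 1), (fun=> idfun : {linear R^o -> R^o}).
split=> [_|w]; first by move=> x; exact: cvg_id.
by rewrite big_ord1 /= /GRing.scale /= mulr1.
Qed.

#[export] Instance findim_prod (V W : normedModType R) (hV : findim V) (hW : findim W) :
  findim (V * W)%type.
Proof.
have [n [e [l [cl El]]]] := hV; have [n' [e' [l' [cl' El']]]] := hW.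
pose f (k : 'I_(n + n')) : V * W :=
  match fintype.split k with inl i => (e i, 0) | inr i => (0, e' i) end.
pose L (k : 'I_(n + n')) : {linear (V * W)%type -> R^o} :=
  match fintype.split k with inl i => l i \o fst | inr i => l' i \o snd end.
exists (n + n')%N, f, L; split=> [k x|[v w]].
  rewrite /L; case: (fintype.split k) => i /=; apply: continuous_comp.
  - exact: cvg_fst.
  - exact: cl.
  - exact: cvg_snd.
  - exact: cl'.
rewrite big_split_ord /= /f /L.
rewrite (eq_bigr (fun i => l i v *: (e i, 0))); last first.
  by move=> i _; rewrite (unsplitK (inl i)).
rewrite [X in _ + X](eq_bigr (fun i => l' i w *: (0, e' i))); last first.
  by move=> i _; rewrite (unsplitK (inr i)).
congr pair; rewrite !raddf_sum /=.
  rewrite [X in _ = _ + X]big1 ?addr0; last by move=> i _; rewrite scaler0.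
  by rewrite [LHS]El.
rewrite [X in _ = X + _]big1 ?add0r; last by move=> i _; rewrite scaler0.
by rewrite [LHS]El'.
Qed.

Lemma findim_linear_continuous (V W : normedModType R) (hV : findim V)
  (L : {linear V -> W}) : continuous L.
Proof.
have [n [e [l [cl El]]]] := hV.
rewrite (_ : (L : V -> W) = fun w => \sum_(i < n) l i w *: L (e i)).
  apply: continuous_big => [|i _]; first exact: add_continuous.
  by move=> x; apply: cvgZr_tmp; exact: cl.
apply/funext => w; rewrite {1}[w]El linear_sum.
by apply: eq_bigr => i _; rewrite linearZ.
Qed.

Lemma derive_frame (V W : normedModType R) n (e : 'I_n -> V) l (f : V -> W) x v :
  frame e l -> differentiable f x ->
  'D_v f x = \sum_(i < n) l i v *: 'D_(e i) f x.
Proof.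
move=> [_ El] df; rewrite deriveE // {1}[v]El linear_sum.
by apply: eq_bigr => i _; rewrite linearZ deriveE.
Qed.

Lemma derive_comp (U V W : normedModType R) (f : U -> V) (g : V -> W) x v :
  differentiable f x -> differentiable g (f x) ->
  'D_v (g \o f) x = 'D_('D_v f x) g (f x).
Proof.
move=> df dg; have dc : differentiable (g \o f) x by exact: differentiable_comp.
by rewrite !deriveE // (diff_comp df dg).
Qed.

(** The chain rule differentiates [g] in a direction that varies with the point, which [Ck] does not
    handle. Expanding this direction in a frame of [V] leaves coordinate functions times derivatives
    in fixed directions, to which the induction hypothesis applies. *)
Lemma Ck_comp r (U V W : normedModType R) {hV : findim V} (O : set U) (D : set V)
  (f : U -> V) (g : V -> W) : open O ->
  (forall x, O x -> D (f x)) -> Ck r O f -> Ck r D g -> Ck r O (g \o f).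
Proof.
move=> oO OD; elim: r f g OD => [|r IH] f g OD.
  by move=> cf cg x Ox; apply: continuous_comp; [exact: cf|apply: cg; exact: OD].
move=> cf cg; have [df Df] := cf; have [dg Dg] := cg.
split=> [x Ox|v].
  by apply: differentiable_comp; [exact: df|apply: dg; exact: OD].
have [n [e [l fr]]] := hV.
apply: (@Ck_ext _ _ _ _ _
  (fun x => \sum_(i < n) l i ('D_v f x) *: 'D_(e i) g (f x))) => // [x Ox|].
  have dgx := dg _ (OD x Ox).
  by rewrite derive_comp //; [rewrite (derive_frame _ fr)|exact: df].
apply: Ck_sum => // i _; apply: CkZ => //.
  apply: Ck_lin => //; [exact: (proj1 fr)|exact: Df].
apply: (IH f ('D_(e i) g)) => //; [exact: CkW|exact: Dg].
Qed.

Lemma Ck_pair r (U V W : normedModType R) (O : set U) (f : U -> V) (g : U -> W) :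
  open O -> Ck r O f -> Ck r O g -> Ck r O (fun x => (f x, g x)).
Proof.
move=> oO; elim: r f g => [|r IH] f g.
  by move=> cf cg x Ox; apply: cvg_pair; [exact: cf|exact: cg].
move=> [df Df] [dg Dg]; split=> [x Ox|v].
  by apply: differentiable_pair; [exact: df|exact: dg].
apply: Ck_ext (IH _ _ (Df v) (Dg v)) => // x Ox.
have dfx := df x Ox; have dgx := dg x Ox.
have dfg : differentiable (fun x => (f x, g x)) x by exact: differentiable_pair.
by rewrite [RHS]deriveE // diff_pair //= !deriveE.
Qed.

Lemma Ck_mx r (V : normedModType R) (O : set V) m n (f : V -> 'M[R]_(m, n)) :
  open O -> (forall i j, Ck r O (fun x => f x i j : R^o)) -> Ck r O f.
Proof.
move=> oO H.
apply: (@Ck_ext _ _ _ _ _ (fun x => \sum_i \sum_j f x i j *: delta_mx i j)) => //.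
  by move=> x _; rewrite -matrix_sum_delta.
apply: Ck_sum => // i _; apply: Ck_sum => // j _; apply: CkZ => //.
exact: Ck_cst.
Qed.

Lemma Ck_coord r (V : normedModType R) (O : set V) m n (f : V -> 'M[R]_(m, n)) i j :
  open O -> Ck r O f -> Ck r O (fun x => f x i j : R^o).
Proof.
move=> oO H; apply: (@Ck_lin _ _ _ _ _ _ _ (@mx_coord m n i j)) => //.
exact: mx_coord_continuous.
Qed.

Lemma CkM r (V : normedModType R) (O : set V) (f g : V -> R^o) : open O ->
  Ck r O f -> Ck r O g -> Ck r O (fun x => f x * g x : R^o).
Proof. by move=> oO cf cg; apply: (CkZ oO cf cg). Qed.

Lemma Ck_prod r (V : normedModType R) (O : set V) (I : Type) (s : seq I)
    (P : pred I) (f : I -> V -> R^o) : open O ->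
  (forall i, P i -> Ck r O (f i)) ->
  Ck r O (fun x => \prod_(i <- s | P i) f i x : R^o).
Proof.
move=> oO H; elim: s => [|i s IH].
  by apply: Ck_ext (Ck_cst _ _ (1 : R^o)) => // x _; rewrite big_nil.
have [Pi|nPi] := boolP (P i); last first.
  by apply: Ck_ext IH => // x _; rewrite big_cons (negbTE nPi).
by apply: Ck_ext (CkM oO (H i Pi) IH) => // x _; rewrite big_cons Pi.
Qed.

Lemma CkN r (V W : normedModType R) (O : set V) (f : V -> W) : open O ->
  Ck r O f -> Ck r O (fun x => - f x).
Proof.
move=> oO cf; apply: (@Ck_ext _ _ _ _ _ (fun x => (-1 : R^o) *: f x)) => //.
  by move=> x _; rewrite scaleN1r.
by apply: CkZ => //; exact: Ck_cst.
Qed.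

Lemma CkB r (V W : normedModType R) (O : set V) (f g : V -> W) : open O ->
  Ck r O f -> Ck r O g -> Ck r O (fun x => f x - g x).
Proof. by move=> oO cf cg; apply: CkD => //; exact: CkN. Qed.

Lemma CkV r (V : normedModType R) (O : set V) (u : V -> R^o) : open O ->
  (forall x, O x -> u x != 0) -> Ck r O u -> Ck r O (fun x => (u x)^-1 : R^o).
Proof.
move=> oO u0; elim: r => [|r IH].
  by move=> cu x Ox; apply: cvgV; [exact: u0|exact: cu].
move=> cu; have [du Du] := cu; split=> [x Ox|v].
  by apply: differentiableV; [exact: du|exact: u0].
have cV := IH (CkW cu).
apply: (@Ck_ext _ _ _ _ _ (fun x => - ((u x)^-1 * (u x)^-1 * 'D_v u x) : R^o)) => //.
  move=> x Ox; have dux := du x Ox.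
  rewrite deriveV ?u0 //; last exact: diff_derivable.
  by rewrite /GRing.scale /= mulNr expr2 invfM.
apply: CkN => //; apply: CkM => //; first exact: CkM.
exact: Du.
Qed.

Lemma Ck_mulmx r (V : normedModType R) (O : set V) m n p (A : V -> 'M[R]_(m, n))
    (B : V -> 'M[R]_(n, p)) : open O ->
  Ck r O A -> Ck r O B -> Ck r O (fun x => A x *m B x).
Proof.
move=> oO cA cB; apply: Ck_mx => // i j.
apply: (@Ck_ext _ _ _ _ _ (fun x => \sum_k A x i k * B x k j : R^o)) => //.
  by move=> x _; rewrite mxE.
by apply: Ck_sum => // k _; apply: CkM => //; exact: Ck_coord.
Qed.

Lemma Ck_det r (V : normedModType R) (O : set V) n (A : V -> 'M[R]_n) : open O ->
  Ck r O A -> Ck r O (fun x => \det (A x) : R^o).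
Proof.
move=> oO cA; apply: Ck_sum => // s _; apply: CkM => //; first exact: Ck_cst.
by apply: Ck_prod => // i _; exact: Ck_coord.
Qed.

Lemma Ck_invmx r (V : normedModType R) (O : set V) n (A : V -> 'M[R]_n) : open O ->
  (forall x, O x -> A x \in unitmx) ->
  Ck r O A -> Ck r O (fun x => invmx (A x)).
Proof.
move=> oO uA cA.
apply: (@Ck_ext _ _ _ _ _ (fun x => ((\det (A x))^-1 : R^o) *: \adj (A x))) => //.
  by move=> x Ox; rewrite /invmx uA.
apply: CkZ => //.
  by apply: CkV => //; [move=> x Ox; rewrite -unitfE -unitmxE uA|exact: Ck_det].
apply: Ck_mx => // i j.
apply: (@Ck_ext _ _ _ _ _ (fun x => cofactor (A x) j i : R^o)) => //.
  by move=> x _; rewrite mxE.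
apply: CkM => //; first exact: Ck_cst.
apply: Ck_det => //; apply: Ck_mx => // k l.
apply: (@Ck_ext _ _ _ _ _ (fun x => A x (lift j k) (lift i l) : R^o)) => //.
  by move=> x _; rewrite !mxE.
exact: Ck_coord.
Qed.

End Coordinates.

(** * Mean value estimates and Hadamard's lemma *)

Lemma continuous_pair_at (T U V : topologicalType) (f : T -> U) (g : T -> V) x :
  {for x, continuous f} -> {for x, continuous g} ->
  {for x, continuous (fun y => (f y, g y))}.
Proof. by move=> cf cg; apply: cvg_pair. Qed.

Section MeanValue.
Variable R : realType.

Lemma is_derive_line (V W : normedModType R) (f : V -> W) x v (s : R) :
  derivable f (x + s *: v) v ->
  is_derive s 1 (fun s : R => f (x + s *: v)) ('D_v f (x + s *: v)).
Proof.
move=> df.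
have E : (fun h : R => h^-1 *: (((fun s : R => f (x + s *: v)) \o shift s) (h *: 1) - f (x + s *: v)))
       = (fun h : R => h^-1 *: ((f \o shift (x + s *: v)) (h *: v) - f (x + s *: v))).
  apply/funext => h /=; congr (_ *: (f _ - _)).
  by rewrite /shift /= -[h%:A]/(h * 1) mulr1 scalerDl addrCA.
split; first by rewrite /derivable E.
by rewrite /derive E.
Qed.

(** The increment may be negative, hence the bounds in absolute value; of the intermediate point the
    statement keeps only [|c| <= |h|]. *)
Lemma MVT_line (V : normedModType R) (f : V -> R^o) x v (h : R) :
  (forall s : R, `|s| <= `|h| -> derivable f (x + s *: v) v) ->
  exists2 c : R, `|c| <= `|h| & f (x + h *: v) - f x = h * 'D_v f (x + c *: v).
Proof.
move=> df; pose g (s : R) : R := f (x + s *: v).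
have dg (s : R) : `|s| <= `|h| -> is_derive s 1 g ('D_v f (x + s *: v)).
  by move=> sh; apply: is_derive_line; exact: df.
have cg (s : R) : `|s| <= `|h| -> {for s, continuous g}.
  move=> /dg [dgs _]; apply: differentiable_continuous.
  exact/derivable1_diffP.
have cw (a b : R) : (forall s, s \in `[a, b] -> `|s| <= `|h|) -> {within `[a, b], continuous g}.
  move=> H; apply: continuous_in_subspaceT => s; rewrite inE => /H; exact: cg.
have [h0|h0] := leP 0 h.
  have I s : s \in `[0, h] -> `|s| <= `|h|.
    by rewrite in_itv /= => /andP[s0 sh]; rewrite !ger0_norm.
  have [||c cI E] := @MVT_segment R g (fun s => 'D_v f (x + s *: v)) 0 h h0.
  - move=> s /subset_itv_oo_cc sI; exact: dg (I _ sI).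
  - exact: cw I.
  exists c; first exact: I.
  by move: E; rewrite /g scale0r addr0 subr0 mulrC => ->.
have I s : s \in `[h, 0] -> `|s| <= `|h|.
  by rewrite in_itv /= => /andP[s0 sh]; rewrite (ler0_norm sh) (ler0_norm (ltW h0)) lerN2.
have [||c cI E] := @MVT_segment R g (fun s => 'D_v f (x + s *: v)) h 0 (ltW h0).
- move=> s /subset_itv_oo_cc sI; exact: dg (I _ sI).
- exact: cw I.
exists c; first exact: I.
move: E; rewrite /g scale0r addr0 sub0r => E.
by rewrite -opprB E mulrN opprK mulrC.
Qed.

(** The difference quotient, extended by the derivative at step 0. Its joint continuity in point and
    step is what lets difference quotients of solutions of differential equations pass to the
    limit. *)
Definition diffquot (V W : normedModType R) (f : V -> W) (v : V) (p : V * R^o) : W :=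
  if p.2 == 0 then 'D_v f p.1 else p.2^-1 *: (f (p.1 + p.2 *: v) - f p.1).

Lemma diffquotE (V W : normedModType R) (f : V -> W) v x (h : R) :
  f (x + h *: v) - f x = h *: diffquot f v (x, h).
Proof.
rewrite /diffquot /=; have [->|h0] := eqVneq h 0; first by rewrite !scale0r addr0 subrr.
by rewrite scalerA divff // scale1r.
Qed.

Lemma diffquot0 (V W : normedModType R) (f : V -> W) v x : diffquot f v (x, 0) = 'D_v f x.
Proof. by rewrite /diffquot /= eqxx. Qed.

(** Off step 0 this is continuity of a quotient. At step 0 the mean value theorem turns the value at
    a nearby [(y, t)] into ['D_v f] at some [y + k *: v] with [|k| <= |t|], so continuity of the
    derivative suffices. *)
Lemma diffquot_continuous_real (V : normedModType R) (f : V -> R^o) v :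
  continuous f -> (forall x, derivable f x v) -> continuous ('D_v f) ->
  continuous (diffquot f v).
Proof.
move=> cf df cD [x h].
have [->|h0] := eqVneq h 0; last first.
  have nh : \forall p \near (x, h : R^o), (p.2 : R) != 0.
    have : \forall t \near (h : R^o), t != 0.
      exact: (open_nbhs_nbhs (conj (@open_neq R 0) h0)).
    have c2 : (p.2 : R^o) @[p --> (x, h : R^o)] --> (h : R^o) by exact: cvg_snd.
    by move=> H; exact: (c2 _ H).
  have E : \forall p \near (x, h : R^o),
      p.2^-1 *: (f (p.1 + p.2 *: v) - f p.1) = diffquot f v p.
    by apply: filterS nh => p /negbTE; rewrite /diffquot => ->.
  rewrite /continuous_at; have -> : diffquot f v (x, h) = h^-1 *: (f (x + h *: v) - f x).
    by rewrite /diffquot /= (negbTE h0).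
  apply: cvg_trans (near_eq_cvg E) _.
  have c2 : (p.2 : R^o) @[p --> (x, h : R^o)] --> (h : R^o) by exact: cvg_snd.
  have c1 : (p.1 : V) @[p --> (x, h : R^o)] --> x by exact: cvg_fst.
  apply: cvgZ; first by apply: cvgV.
  apply: cvgB; last by apply: continuous_cvg => //; exact: cf.
  apply: continuous_cvg; first exact: cf.
  by apply: cvgD => //; apply: cvgZr_tmp.
have cg : {for (x, 0 : R^o), continuous (fun p : V * R^o => 'D_v f (p.1 + p.2 *: v))}.
  have -> : (fun p : V * R^o => 'D_v f (p.1 + p.2 *: v)) =
     'D_v f \o (fun p : V * R^o => p.1 + p.2 *: v) by [].
  apply: continuous_comp; last exact: cD.
  by apply: cvgD; [exact: cvg_fst|apply: cvgZr_tmp; exact: cvg_snd].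
rewrite /continuous_at diffquot0; apply/cvgrPdist_lt => e e0.
suff K : \forall p \near (x, 0 : R^o), `|'D_v f x - diffquot f v p| < e by exact: K.
have {cg} : \forall p \near (x, 0 : R^o), `|'D_v f x - 'D_v f (p.1 + p.2 *: v)| < e.
  by move/cvgrPdist_lt/(_ e e0): cg; rewrite [(x, 0).1]/= [(x, 0).2]/= scale0r addr0.
move=> /nbhs_ballP [d /= d0 Hd]; apply/nbhs_ballP; exists d => //= -[y t] [yx t0].
rewrite /= in yx t0.
have [c ct E] := @MVT_line V f y v t (fun s _ => df _).
have [k [kt ->]] : exists k : R, `|k| <= `|t : R| /\ diffquot f v (y, t) = 'D_v f (y + k *: v).
  rewrite /diffquot /=; have [_|tn0] := eqVneq t 0.
    by exists 0; rewrite normr0 scale0r addr0.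
  by exists c; rewrite E /GRing.scale /= mulKf.
apply: (Hd (y, _)); split => //=.
move: t0; rewrite -ball_normE /ball_ /= !sub0r !normrN => t0.
exact: le_lt_trans t0.
Qed.

Lemma mx_cvg (T : topologicalType) m n (f : T -> 'M[R]_(m, n)) x :
  (forall i j, {for x, continuous (fun y => f y i j : R^o)}) -> {for x, continuous f}.
Proof.
move=> H; rewrite (_ : f = fun y => \sum_i \sum_j f y i j *: delta_mx i j); last first.
  by apply/funext => y; rewrite -matrix_sum_delta.
have cZ i j : f y i j *: delta_mx i j @[y --> x] --> f x i j *: (delta_mx i j : 'M[R]_(m, n)).
  by apply: cvgZr_tmp; exact: H.
apply: (@cvg_big _ _ _ _ _ add_continuous _ _ _ (fun i y => \sum_j f y i j *: delta_mx i j)) => i _.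
exact: (@cvg_big _ _ _ _ _ add_continuous _ _ _ (fun j y => f y i j *: delta_mx i j)).
Qed.

Lemma diffquot_continuous (V : normedModType R) m n (f : V -> 'M[R]_(m, n)) v :
  continuous f -> (forall x, derivable f x v) -> continuous ('D_v f) ->
  continuous (diffquot f v).
Proof.
move=> cf df cD p; apply: mx_cvg => i j.
pose g : V -> R^o := fun x => f x i j.
have E x : 'D_v g x = 'D_v f x i j.
  by rewrite (derive_mx (df x)) mxE.
rewrite (_ : (fun q => _) = diffquot g v); last first.
  by apply/funext => q; rewrite /diffquot E; case: ifP => // _; rewrite !mxE.
apply: diffquot_continuous_real.
- by move=> x; apply: (@continuous_comp _ _ _ f (@mx_coord R m n i j)); [exact: cf|exact: mx_coord_continuous].
- by move=> x; have /derivable_mxP := df x; exact.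
- by rewrite (_ : 'D_v g = fun x => 'D_v f x i j); [|exact/funext]; move=> x; apply: (@continuous_comp _ _ _ ('D_v f) (@mx_coord R m n i j)); [exact: cD|exact: mx_coord_continuous].
Qed.

End MeanValue.

Section Hadamard.
Variables (R : realType) (V : normedModType R) (n : nat) (e : 'I_n -> V)
  (l : 'I_n -> {linear V -> R^o}) (fr : frame e l).
Variables (p q : nat) (f : V -> 'M[R]_(p, q)).
Hypothesis cf : continuous f.
Hypothesis df : forall i x, derivable f x (e i).
Hypothesis cD : forall i, continuous ('D_(e i) f).

(* The first k coordinates of x' followed by the other ones of x: the difference
   f x' - f x telescopes along k. *)
Definition staircase (k : nat) (x x' : V) : V :=
  x + \sum_(i < n | (i < k)%N) l i (x' - x) *: e i.

Definition hadamard (i : 'I_n) (z : V * V) : 'M[R]_(p, q) :=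
  diffquot f (e i) (staircase i z.1 z.2, l i (z.2 - z.1)).

Lemma hadamard_continuous i : continuous (hadamard i).
Proof.
have cs (j : 'I_n) : continuous (fun z : V * V => l j (z.2 - z.1)).
  move=> z; apply: (@continuous_comp _ _ _ (fun z : V * V => z.2 - z.1) (l j)); last exact: (proj1 fr).
  by apply: cvgB; [exact: cvg_snd|exact: cvg_fst].
move=> z; apply: (@continuous_comp _ _ _ (fun z : V * V => (staircase i z.1 z.2, l i (z.2 - z.1) : R^o)) (diffquot f (e i))); last exact: diffquot_continuous.
apply: continuous_pair_at; last exact: cs.
apply: cvgD; first exact: cvg_fst.
apply: (@cvg_big _ _ _ _ _ add_continuous _ _ _ (fun j (z : V * V) => l j (z.2 - z.1) *: e j)) => j _.
by apply: cvgZr_tmp; exact: cs.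
Qed.

Lemma staircaseS (i : 'I_n) x x' : staircase i.+1 x x' = staircase i x x' + l i (x' - x) *: e i.
Proof.
rewrite /staircase (bigD1 i) //= addrA addrAC; congr (_ + _ + _).
by apply: eq_bigl => j; rewrite ltnS ltn_neqAle andbC.
Qed.

Lemma hadamardE x x' : f x' - f x = \sum_(i < n) l i (x' - x) *: hadamard i (x, x').
Proof.
have E0 : staircase 0 x x' = x by rewrite /staircase big1 ?addr0.
have En : staircase n x x' = x'.
  rewrite /staircase (eq_bigl xpredT) => [|i]; last by rewrite ltn_ord.
  by rewrite -(proj2 fr) addrC subrK.
rewrite -{1}En -{2}E0.
rewrite -(telescope_sumr (fun k => f (staircase k x x'))) // big_mkord.
by apply: eq_bigr => i _; rewrite staircaseS diffquotE.
Qed.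

Lemma hadamard_diag i x : hadamard i (x, x) = 'D_(e i) f x.
Proof.
have E : staircase i x x = x.
  rewrite /staircase big1 ?addr0 // => j _.
  by rewrite subrr (linear0 (l j)) scale0r.
by rewrite /hadamard [(x, x).1]/= [(x, x).2]/= E subrr (linear0 (l i)) diffquot0.
Qed.

(** By [hadamardE] the error of the linear approximation is a sum of coordinates of [h] times
    differences between a Hadamard factor and its value on the diagonal, and these differences are
    small by continuity. *)
Lemma C1_differentiable x : differentiable f x.
Proof.
pose d (v : V) := \sum_(i < n) l i v *: 'D_(e i) f x.
have ld : linear d.
  move=> a u v; rewrite /d scaler_sumr -big_split /=; apply: eq_bigr => i _.
  by rewrite linearP scalerDl scalerA.
have hV : findim V by exists n, e, l.
have [] // := @eps_differentiable R V _ f x (linear_pack ld).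
  exact: findim_linear_continuous.
move=> eps eps0.
have /choice [k Hk] : forall i, exists k : R, 0 < k /\ forall h : V, `|l i h| <= k * `|h|.
  by move=> i; have [k k0 Hk] := linear_lipschitz (proj1 fr i); exists k.
(* Accuracy [eps / C] in every Hadamard factor gives accuracy [eps] in total, since the [k i] are
   Lipschitz constants of the coordinates; the 1 keeps [C] positive. *)
pose C : R := 1 + \sum_(i < n) k i.
have C0 : 0 < C.
  by rewrite /C ltr_pwDl // sumr_ge0 // => i _; exact: ltW (proj1 (Hk i)).
have near_i i : \forall h \near (0 : V), `|hadamard i (x, h + x) - 'D_(e i) f x| < eps / C.
  have c : hadamard i (x, h + x) @[h --> (0:V)] --> 'D_(e i) f x.
    rewrite -(hadamard_diag i x).
    rewrite (_ : (fun h => _) = hadamard i \o (fun h => (x, h + x))) //.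
    apply: continuous_cvg; first exact: hadamard_continuous.
    apply: cvg_pair; first exact: cvg_cst.
    have cx : (h + x) @[h --> (0 : V)] --> (0 + x).
      by apply: cvgD; [exact: cvg_id|exact: cvg_cst].
    by move: cx; rewrite add0r.
  move/cvgrPdist_lt/(_ (eps / C)): c => /(_ (divr_gt0 eps0 C0)).
  by apply: filterS => h; rewrite distrC.
have : \forall h \near (0 : V), forall i, `|hadamard i (x, h + x) - 'D_(e i) f x| < eps / C.
  by apply: filter_forall.
apply: filterS => h Hh.
rewrite hadamardE addrK /= /d -sumrB.
apply: le_trans (ler_norm_sum _ _ _) _.
apply: (@le_trans _ _ (\sum_(i < n) (k i * `|h|) * (eps / C))).
  apply: ler_sum => i _; rewrite -scalerBr normrZ; apply: ler_pM => //.
  - exact: (proj2 (Hk i)).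
  - exact: ltW.
rewrite -mulr_suml -mulr_suml mulrAC; apply: ler_wpM2r => //.
by rewrite mulrCA -[leRHS]mulr1 ler_pM2l // ler_pdivrMr // mul1r /C lerDr.
Qed.

End Hadamard.

(** Regularity of flows and of solutions is raised through this lemma: their time and space
    derivatives are found separately and recognised as functions of class C^r. *)
Lemma CkS_partials (R : realType) (V : normedModType R) n (e : 'I_n -> V) l
   p q (f : V -> 'M[R]_(p, q)) r : frame e l -> continuous f ->
  (forall i x, derivable f x (e i)) -> (forall i, Ck r setT ('D_(e i) f)) ->
  Ck r.+1 setT f.
Proof.
move=> fr cf df cD.
have dff x : differentiable f x.
  by apply: (C1_differentiable fr) => // i x'; apply: (@Ck_continuous _ r _ _ setT).
split=> // v.
apply: (@Ck_ext _ _ _ _ _ (fun x => \sum_(i < n) l i v *: 'D_(e i) f x)).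
- exact: openT.
- by move=> x _; rewrite (derive_frame _ fr).
- apply: Ck_sum; first exact: openT.
  by move=> i _; apply: CkZ => //; [exact: openT|exact: Ck_cst].
Qed.

(** * Smooth maps between normed spaces *)

Section Schwarz.
Variable R : realType.

Lemma near_plane (V : normedModType R) (x u v : V) (P : V -> Prop) :
  (\forall y \near x, P y) ->
  exists2 d : R, 0 < d & forall a b : R, `|a| <= d -> `|b| <= d -> P (x + a *: u + b *: v).
Proof.
move=> H.
have c : {for (0 : R^o, 0 : R^o), continuous (fun p : R^o * R^o => x + p.1 *: u + p.2 *: v)}.
  by apply: cvgD; [apply: cvgD; first exact: cvg_cst|]; apply: cvgZr_tmp; [exact: cvg_fst|exact: cvg_snd].
have : \forall p \near (0 : R^o, 0 : R^o), P (x + p.1 *: u + p.2 *: v).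
  by apply: (c P); rewrite /= !scale0r !addr0.
move=> /nbhs_ballP [d /= d0 Hd]; exists (d / 2); first exact: divr_gt0.
move=> a b ad bd; apply: (Hd (a, b)); split => /=;
  rewrite -ball_normE /ball_ /= sub0r normrN; apply: (le_lt_trans (y := d / 2)) => //;
  by rewrite gtr_pMr // invf_lt1 // ltr1n.
Qed.

Lemma derive_translate (V W : normedModType R) (f : V -> W) (w x v : V) :
  derivable f (x + w) v ->
  derivable (fun y => f (y + w)) x v /\ 'D_v (fun y => f (y + w)) x = 'D_v f (x + w).
Proof.
move=> df.
have E : (fun h : R => h^-1 *: (((fun y => f (y + w)) \o shift x) (h *: v) - f (x + w)))
       = (fun h : R => h^-1 *: ((f \o shift (x + w)) (h *: v) - f (x + w))).
  by apply/funext => h /=; rewrite addrA.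
by split; [rewrite /derivable E|rewrite /derive E].
Qed.

(** The mean value theorem is applied twice: in direction [u] to the increment of [g] along
    [h *: v], then in direction [v] to ['D_u g]. *)
Lemma second_difference (V : normedModType R) (g : V -> R^o) O x u v (h : R) :
  Ck 2 O g ->
  (forall a b : R, `|a| <= `|h| -> `|b| <= `|h| -> O (x + a *: u + b *: v)) ->
  exists a b : R, [/\ `|a| <= `|h|, `|b| <= `|h| &
   g (x + h *: u + h *: v) - g (x + h *: u) - (g (x + h *: v) - g x)
   = h * (h * 'D_v ('D_u g) (x + a *: u + b *: v))].
Proof.
move=> [dg Dg] HO; have [dDg _] := Dg u.
pose phi (y : V) : R^o := g (y + h *: v) - g y.
have O1 (s : R) : `|s| <= `|h| -> O (x + s *: u).
  by move=> sh; have := HO s 0 sh; rewrite normr0 scale0r addr0; apply.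
have O2 (s : R) : `|s| <= `|h| -> O (x + s *: u + h *: v).
  by move=> sh; apply: HO.
have dphi (s : R) : `|s| <= `|h| -> derivable phi (x + s *: u) u /\
    'D_u phi (x + s *: u) = 'D_u g (x + s *: u + h *: v) - 'D_u g (x + s *: u).
  move=> sh.
  have d1 : derivable g (x + s *: u) u by apply: diff_derivable; apply: dg; exact: O1.
  have d2 : derivable g (x + s *: u + h *: v) u by apply: diff_derivable; apply: dg; exact: O2.
  have [d3 E3] := derive_translate d2.
  split; first exact: derivableB d3 d1.
  by rewrite -E3 -(deriveB d3 d1).
have [a ah Ea] := MVT_line (fun s sh => proj1 (dphi s sh)).
have [|b bh Eb] := @MVT_line _ V ('D_u g) (x + a *: u) v h.
  by move=> s sh; apply: diff_derivable; apply: dDg; exact: HO.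
exists a, b; split=> //.
by rewrite -Eb -(proj2 (dphi a ah)) -Ea.
Qed.

(** The second difference is symmetric in the two directions, so both mixed derivatives, each at
    some point near [x], take a common value; by continuity they cannot differ at [x]. *)
Lemma schwarz_real (V : normedModType R) (g : V -> R^o) O x u v : open O -> O x ->
  Ck 2 O g -> 'D_v ('D_u g) x = 'D_u ('D_v g) x.
Proof.
move=> oO Ox cg; apply/eqP/negPn/negP => neq.
(* [e] is half of the supposed gap: both mixed derivatives at [x] will be strictly within [e] of the
   common value. *)
have [e [e0 eE]] : exists e : R, 0 < e /\ e + e = `|'D_v ('D_u g) x - 'D_u ('D_v g) x|.
  exists (`|'D_v ('D_u g) x - 'D_u ('D_v g) x| / 2); rewrite -splitr; split=> //.
  by rewrite divr_gt0 // normr_gt0 subr_eq0.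
have tri (A B C : R) : `|A - B| < e -> `|C - B| < e -> `|A - C| < e + e.
  by move=> AB CB; rewrite -(subrKA B); apply: le_lt_trans (ler_normD _ _) _; rewrite ltrD // distrC.
have cD w1 w2 : {for x, continuous ('D_w1 ('D_w2 g))}.
  have [_ Dg] := cg; have [_ DDg] := Dg w2.
  exact: (DDg w1 x Ox).
have [d1 d10 H1] : exists2 d : R, 0 < d & forall a b : R, `|a| <= d -> `|b| <= d ->
    O (x + a *: u + b *: v) /\ `|'D_v ('D_u g) x - 'D_v ('D_u g) (x + a *: u + b *: v)| < e.
  apply: (@near_plane _ x _ _ (fun y => O y /\ `|'D_v ('D_u g) x - 'D_v ('D_u g) y| < e)).
  apply: filterI; first exact: (open_nbhs_nbhs (conj oO Ox)).
  by move/cvgrPdist_lt: (cD v u); exact.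
have [d2 d20 H2] : exists2 d : R, 0 < d & forall a b : R, `|a| <= d -> `|b| <= d ->
    O (x + a *: v + b *: u) /\ `|'D_u ('D_v g) x - 'D_u ('D_v g) (x + a *: v + b *: u)| < e.
  apply: (@near_plane _ x _ _ (fun y => O y /\ `|'D_u ('D_v g) x - 'D_u ('D_v g) y| < e)).
  apply: filterI; first exact: (open_nbhs_nbhs (conj oO Ox)).
  by move/cvgrPdist_lt: (cD u v); exact.
have [h [h0 hd1 hd2]] : exists h : R, [/\ 0 < h, `|h| <= d1 & `|h| <= d2].
  have m0 : 0 < Num.min d1 d2 by rewrite lt_min d10 d20.
  by exists (Num.min d1 d2); rewrite gtr0_norm // !ge_min !lexx orbT.
have [|a [b [ah bh E1]]] := @second_difference V g O x u v h cg.
  by move=> a b ah bh; have [] := H1 a b (le_trans ah hd1) (le_trans bh hd1).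
have [|a' [b' [ah' bh' E2]]] := @second_difference V g O x v u h cg.
  by move=> a' b' ah' bh'; have [] := H2 a' b' (le_trans ah' hd2) (le_trans bh' hd2).
have [_ L1] := H1 a b (le_trans ah hd1) (le_trans bh hd1).
have [_ L2] := H2 a' b' (le_trans ah' hd2) (le_trans bh' hd2).
have E : 'D_v ('D_u g) (x + a *: u + b *: v) = 'D_u ('D_v g) (x + a' *: v + b' *: u).
  have h0' : h != 0 by rewrite gt_eqF.
  have key (A B : R) : h * (h * A) = h * (h * B) -> A = B by move=> /(mulfI h0') /(mulfI h0').
  apply: key; apply: (etrans (esym E1)); apply: (etrans _ E2).
  rewrite [x + h *: v + h *: u]addrAC.
  have alg (p q r s : R) : p - q - (r - s) = p - r - (q - s) by ring.
  exact: alg.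
rewrite E in L1; have := tri _ _ _ L1 L2.
by rewrite eE ltxx.
Qed.

Lemma schwarz (V : normedModType R) m n (f : V -> 'M[R]_(m, n)) O x u v :
  open O -> O x -> Ck 2 O f -> 'D_v ('D_u f) x = 'D_u ('D_v f) x.
Proof.
move=> oO Ox cf; apply/matrixP => i j.
pose g : V -> R^o := fun y => f y i j.
have cg : Ck 2 O g by exact: Ck_coord.
have [df Df] := cf.
have E1 w y : O y -> ('D_w f y) i j = 'D_w g y.
  by move=> Oy; rewrite derive_mx ?mxE //; apply: diff_derivable; exact: df.
have E w1 w2 : ('D_w1 ('D_w2 f) x) i j = 'D_w1 ('D_w2 g) x.
  have [dDf _] := Df w2.
  rewrite derive_mx ?mxE; last by apply: diff_derivable; exact: dDf.
  apply: near_eq_derive; have := open_nbhs_nbhs (conj oO Ox).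
  by apply: filterS => y Oy; exact: E1.
apply: (etrans (E v u)); apply: (etrans _ (esym (E u v))).
exact: (schwarz_real u v oO Ox cg).
Qed.

End Schwarz.

Section Smooth.
Variable R : realType.
Implicit Types U V W : normedModType R.

Lemma smooth_ext V W (O : set V) (f g : V -> W) : open O ->
  (forall x, O x -> f x = g x) -> smooth_open O f -> smooth_open O g.
Proof. by move=> oO fg /smooth_openP H; apply/smooth_openP => r; exact: Ck_ext (H r). Qed.

Lemma smooth_sub V W (O D : set V) (f : V -> W) :
  D `<=` O -> smooth_open O f -> smooth_open D f.
Proof. by move=> DO H vs x Dx; apply: H; exact: DO. Qed.

Lemma smooth_local V W (O : set V) (f : V -> W) :
  (forall x, O x -> exists2 D, D x & smooth_open D f) -> smooth_open O f.
Proof. by move=> H vs x Ox; have [D Dx Hf] := H x Ox; exact: Hf. Qed.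

Lemma smooth_differentiable V W (O : set V) (f : V -> W) x :
  smooth_open O f -> O x -> differentiable f x.
Proof. by move=> H; exact: (H [::]). Qed.

Lemma smooth_continuous V W (O : set V) (f : V -> W) x :
  smooth_open O f -> O x -> {for x, continuous f}.
Proof. by move=> H Ox; apply: differentiable_continuous; exact: smooth_differentiable H Ox. Qed.

Lemma smooth_derive V W (O : set V) (f : V -> W) v :
  smooth_open O f -> smooth_open O ('D_v f).
Proof. by move=> H vs x Ox; rewrite -iterD_rcons; exact: H. Qed.

Lemma smooth_cst V W (O : set V) (a : W) : smooth_open O (cst a : V -> W).
Proof. by apply/smooth_openP => r; exact: Ck_cst. Qed.

Lemma smooth_id V (O : set V) : smooth_open O (@id V).
Proof. by apply/smooth_openP => r; exact: Ck_id. Qed.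

Lemma smoothD V W (O : set V) (f g : V -> W) : open O ->
  smooth_open O f -> smooth_open O g -> smooth_open O (fun x => f x + g x).
Proof. by move=> oO /smooth_openP H /smooth_openP K; apply/smooth_openP => r; exact: CkD. Qed.

Lemma smoothN V W (O : set V) (f : V -> W) : open O ->
  smooth_open O f -> smooth_open O (fun x => - f x).
Proof. by move=> oO /smooth_openP H; apply/smooth_openP => r; exact: CkN. Qed.

Lemma smoothB V W (O : set V) (f g : V -> W) : open O ->
  smooth_open O f -> smooth_open O g -> smooth_open O (fun x => f x - g x).
Proof. by move=> oO /smooth_openP H /smooth_openP K; apply/smooth_openP => r; exact: CkB. Qed.

Lemma smoothZ V W (O : set V) (u : V -> R^o) (f : V -> W) : open O ->
  smooth_open O u -> smooth_open O f -> smooth_open O (fun x => u x *: f x).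
Proof. by move=> oO /smooth_openP H /smooth_openP K; apply/smooth_openP => r; exact: CkZ. Qed.

Lemma smoothM V (O : set V) (u f : V -> R^o) : open O ->
  smooth_open O u -> smooth_open O f -> smooth_open O (fun x => u x * f x : R^o).
Proof. by move=> oO /smooth_openP H /smooth_openP K; apply/smooth_openP => r; exact: CkM. Qed.

Lemma smoothV V (O : set V) (u : V -> R^o) : open O -> (forall x, O x -> u x != 0) ->
  smooth_open O u -> smooth_open O (fun x => (u x)^-1 : R^o).
Proof. by move=> oO u0 /smooth_openP H; apply/smooth_openP => r; exact: CkV. Qed.

Lemma smooth_sum V W (O : set V) (I : Type) (s : seq I) (P : pred I) (f : I -> V -> W) :
  open O -> (forall i, P i -> smooth_open O (f i)) ->
  smooth_open O (fun x => \sum_(i <- s | P i) f i x).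
Proof.
move=> oO H; apply/smooth_openP => r; apply: Ck_sum => // i Pi.
by have /smooth_openP := H i Pi; exact.
Qed.

Lemma smooth_linear V W (hV : findim V) (O : set V) (L : {linear V -> W}) :
  smooth_open O L.
Proof.
by apply/smooth_openP => r; apply: Ck_linear; exact: findim_linear_continuous.
Qed.

Lemma smooth_comp U V W {hV : findim V} (O : set U) (D : set V) (f : U -> V) (g : V -> W) :
  open O -> (forall x, O x -> D (f x)) ->
  smooth_open O f -> smooth_open D g -> smooth_open O (g \o f).
Proof.
by move=> oO OD /smooth_openP H /smooth_openP K; apply/smooth_openP => r; exact: (Ck_comp oO OD).
Qed.

Lemma smooth_lin U V W {hV : findim V} (O : set U) (f : U -> V) (L : {linear V -> W}) :
  open O -> smooth_open O f -> smooth_open O (fun x => L (f x)).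
Proof.
move=> oO sf; apply: (@smooth_comp _ _ _ hV O setT f L) => //.
exact: smooth_linear.
Qed.

Lemma smooth_pair U V W (O : set U) (f : U -> V) (g : U -> W) : open O ->
  smooth_open O f -> smooth_open O g -> smooth_open O (fun x => (f x, g x)).
Proof. by move=> oO /smooth_openP H /smooth_openP K; apply/smooth_openP => r; exact: Ck_pair. Qed.

Lemma smooth_fst V W {hV : findim V} {hW : findim W} (O : set (V * W)) :
  smooth_open O (@fst V W).
Proof. exact: (@smooth_linear _ _ _ O (@fst V W : {linear _ -> _})). Qed.

Lemma smooth_snd V W {hV : findim V} {hW : findim W} (O : set (V * W)) :
  smooth_open O (@snd V W).
Proof. exact: (@smooth_linear _ _ _ O (@snd V W : {linear _ -> _})). Qed.

Lemma smooth_mx V (O : set V) m n (f : V -> 'M[R]_(m, n)) : open O ->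
  (forall i j, smooth_open O (fun x => f x i j : R^o)) -> smooth_open O f.
Proof.
move=> oO H; apply/smooth_openP => r; apply: Ck_mx => // i j.
by have /smooth_openP := H i j; exact.
Qed.

Lemma smooth_coord V (O : set V) m n (f : V -> 'M[R]_(m, n)) i j : open O ->
  smooth_open O f -> smooth_open O (fun x => f x i j : R^o).
Proof. by move=> oO /smooth_openP H; apply/smooth_openP => r; exact: Ck_coord. Qed.

Lemma smooth_mulmx V (O : set V) m n p (f : V -> 'M[R]_(m, n)) (g : V -> 'M[R]_(n, p)) :
  open O -> smooth_open O f -> smooth_open O g -> smooth_open O (fun x => f x *m g x).
Proof. by move=> oO /smooth_openP H /smooth_openP K; apply/smooth_openP => r; exact: Ck_mulmx. Qed.

Lemma smooth_det V (O : set V) n (f : V -> 'M[R]_n) : open O ->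
  smooth_open O f -> smooth_open O (fun x => \det (f x) : R^o).
Proof. by move=> oO /smooth_openP H; apply/smooth_openP => r; exact: Ck_det. Qed.

Lemma smooth_invmx V (O : set V) n (f : V -> 'M[R]_n) : open O ->
  (forall x, O x -> f x \in unitmx) ->
  smooth_open O f -> smooth_open O (fun x => invmx (f x)).
Proof. by move=> oO u /smooth_openP H; apply/smooth_openP => r; exact: Ck_invmx. Qed.

Lemma smooth_schwarz V m n (O : set V) (f : V -> 'M[R]_(m, n)) x u v : open O -> O x ->
  smooth_open O f -> 'D_v ('D_u f) x = 'D_u ('D_v f) x.
Proof. by move=> oO Ox /smooth_openP H; exact: (schwarz u v oO Ox (H 2)). Qed.

Lemma open_preimage_within V W (O : set V) (D : set W) (f : V -> W) :
  open O -> (forall x, O x -> {for x, continuous f}) -> open D ->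
  open [set x | O x /\ D (f x)].
Proof.
move=> oO cf oD; rewrite openE => x [Ox Dfx]; rewrite /interior.
apply: filterI; first exact: (open_nbhs_nbhs (conj oO Ox)).
exact: (cf x Ox _ (open_nbhs_nbhs (conj oD Dfx))).
Qed.

Lemma smooth_open_on V W (O A : set V) (f : V -> W) : open O -> A `<=` O ->
  smooth_open O f -> smooth_on A f.
Proof. by move=> oO AO sf x Ax; exists O, f; split=> //; exact: AO. Qed.

Lemma smooth_on_open V W (A : set V) (f : V -> W) : open A ->
  smooth_on A f -> smooth_open A f.
Proof.
move=> oA sf; apply: smooth_local => x Ax.
have [ O [F [oO Ox sF FE]]] := sf x Ax.
exists (O `&` A); first by split.
apply: (smooth_ext (f := F)); first exact: openI.
  by move=> y [Oy Ay]; exact: FE.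
by apply: smooth_sub sF => y [].
Qed.

Lemma smooth_on_sub V W (A B : set V) (f : V -> W) : B `<=` A ->
  smooth_on A f -> smooth_on B f.
Proof.
move=> BA sf x Bx; have [ O [F [oO Ox sF FE]]] := sf x (BA _ Bx).
by exists O, F; split=> // y By; apply: FE; exact: BA.
Qed.

Lemma smooth_on_ext V W (A : set V) (f g : V -> W) : (forall x, A x -> f x = g x) ->
  smooth_on A f -> smooth_on A g.
Proof.
move=> fg sf x Ax; have [ O [F [oO Ox sF FE]]] := sf x Ax.
by exists O, F; split=> // y Ay Oy; rewrite FE // fg.
Qed.

Lemma smooth_on_comp U V W {hV : findim V} (A : set U) (B : set V) (f : U -> V) (g : V -> W) :
  (forall x, A x -> B (f x)) -> smooth_on A f -> smooth_on B g -> smooth_on A (g \o f).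
Proof.
move=> AB sf sg x Ax.
have [ O [F [oO Ox sF FE]]] := sf x Ax.
have [D [G [oD Dx sG GE]]] := sg _ (AB _ Ax).
exists [set y | O y /\ D (F y)], (G \o F); split.
- by apply: open_preimage_within => // y Oy; exact: smooth_continuous sF Oy.
- by split=> //; rewrite FE.
- apply: (@smooth_comp _ _ _ hV _ D) => //.
  + by apply: open_preimage_within => // y Oy; exact: smooth_continuous sF Oy.
  + by move=> y [].
  + by apply: smooth_sub sF => y [].
- by move=> y Ay [Oy Dy] /=; rewrite GE ?FE //; [exact: AB|rewrite -FE].
Qed.

Lemma smooth_on_pair U V W (A : set U) (f : U -> V) (g : U -> W) :
  smooth_on A f -> smooth_on A g -> smooth_on A (fun x => (f x, g x)).
Proof.
move=> sf sg x Ax.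
have [ O [F [oO Ox sF FE]]] := sf x Ax.
have [D [G [oD Dx sG GE]]] := sg x Ax.
exists (O `&` D), (fun y => (F y, G y)); split=> //.
- exact: openI.
- by apply: smooth_pair; [exact: openI|apply: smooth_sub sF => y []|apply: smooth_sub sG => y []].
- by move=> y Ay [Oy Dy]; rewrite FE // GE.
Qed.

End Smooth.

(** * Gronwall's inequality and existence of solutions *)

Section Curves.
Variable R : realType.

Lemma is_derive_mxP m n (M : R -> 'M[R]_(m, n)) (t : R) (D : 'M[R]_(m, n)) :
  is_derive t (1 : R) M D <->
  forall i j, is_derive t (1 : R) (fun x : R => M x i j : R) (D i j).
Proof.
split=> [[dM <-] i j|H].
  have dMij := (derivable_mxP M t 1).1 dM i j.
  by apply: DeriveDef => //; rewrite (derive_mx dM) mxE.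
have dM : derivable M t 1 by apply/derivable_mxP => i j; have [] := H i j.
apply: DeriveDef => //; rewrite (derive_mx dM); apply/matrixP => i j; rewrite mxE.
by have [_ <-] := H i j.
Qed.

Lemma mx_norm_leP m n (M : 'M[R]_(m, n)) (c : R) : 0 <= c ->
  (forall i j, `|M i j| <= c) -> `|M| <= c.
Proof.
move=> c0 H; rewrite [leLHS]/Num.Def.normr /= mx_normrE; by apply: bigmax_le => // -[i j] _.
Qed.

Lemma mx_norm_entry m n (M : 'M[R]_(m, n)) i j : `|M i j| <= `|M|.
Proof.
rewrite [leRHS]/Num.Def.normr /= mx_normrE.
exact: (le_bigmax _ (fun ij : 'I_m * 'I_n => `|M ij.1 ij.2|) (i, j)).
Qed.

Lemma mx_norm_mul m n p (A : 'M[R]_(m, n)) (B : 'M[R]_(n, p)) :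
  `|A *m B| <= n%:R * (`|A| * `|B|).
Proof.
apply: mx_norm_leP => [|i j]; first by rewrite !mulr_ge0.
rewrite mxE; apply: le_trans (ler_norm_sum _ _ _) _.
apply: (@le_trans _ _ (\sum_(k < n) `|A| * `|B|)).
  by apply: ler_sum => k _; rewrite normrM ler_pM // mx_norm_entry.
by rewrite sumr_const card_ord mulr_natl.
Qed.

Lemma derive_continuous_at (V : normedModType R) (f : R -> V) (t : R) (d : V) :
  is_derive t (1 : R) f d -> {for t, continuous f}.
Proof. by move=> [df _]; apply: differentiable_continuous; apply/derivable1_diffP. Qed.

Lemma ge0_derive_le (f df : R -> R) (T : R) : 0 <= T ->
  (forall t, 0 <= t <= T -> is_derive t (1 : R) f (df t)) ->
  (forall t, 0 <= t <= T -> 0 <= df t) -> f 0 <= f T.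
Proof.
move=> T0 df' df0.
have [||c] := @MVT_segment R f df 0 T T0.
- by move=> t; rewrite in_itv /= => /andP[t0 tT]; apply: df'; rewrite !ltW.
- apply: continuous_in_subspaceT => t; rewrite inE /= in_itv /= => tT.
  exact: derive_continuous_at (df' t tT).
rewrite in_itv /= subr0 => cT E.
by rewrite -subr_ge0 E mulr_ge0 // df0.
Qed.

(** With the maximum norm it suffices to bound entries, and h - u_ij and h + u_ij have nonnegative
    derivative. This replaces the integration of norms in the estimates below. *)
Lemma growth_bound m n (u du : R -> 'M[R]_(m, n)) (h dh : R -> R) (T : R) : 0 <= T ->
  (forall t, 0 <= t <= T -> is_derive t (1 : R) u (du t)) ->
  (forall t, 0 <= t <= T -> is_derive t (1 : R) h (dh t)) ->
  (forall t, 0 <= t <= T -> `|du t| <= dh t) -> `|u T - u 0| <= h T - h 0.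
Proof.
move=> T0 Du Dh H.
have H0 t : 0 <= t <= T -> 0 <= dh t by move=> /H; apply: le_trans.
have h0 : 0 <= h T - h 0 by rewrite subr_ge0; exact: (ge0_derive_le T0 Dh H0).
apply: mx_norm_leP => // i j; rewrite !mxE ler_norml.
have Duij t : 0 <= t <= T -> is_derive t (1 : R) (fun s => u s i j : R) (du t i j).
  by move=> tT; have /is_derive_mxP := Du t tT; exact.
have Hij t : 0 <= t <= T -> - dh t <= du t i j <= dh t.
  by move=> tT; rewrite -ler_norml; apply: le_trans (H t tT); exact: mx_norm_entry.
have P1 : (h \- (fun s => u s i j : R)) 0 <= (h \- (fun s => u s i j : R)) T.
  apply: (@ge0_derive_le _ (fun t => dh t - du t i j)) => // t tT.
    by have := Duij t tT; have := Dh t tT => ? ?; apply: is_deriveB.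
  by have /andP[_] := Hij t tT; rewrite subr_ge0.
have P2 : (h \+ (fun s => u s i j : R)) 0 <= (h \+ (fun s => u s i j : R)) T.
  apply: (@ge0_derive_le _ (fun t => dh t + du t i j)) => // t tT.
    by have := Duij t tT; have := Dh t tT => ? ?; apply: is_deriveD.
  by have /andP[+ _] := Hij t tT; rewrite -subr_ge0 opprK addrC.
by move: P1 P2 => /= P1 P2; apply/andP; split; lra.
Qed.

Lemma is_derive_reflect (V : normedModType R) (f : R -> V) (t : R) (d : V) :
  is_derive (- t) (1 : R) f d -> is_derive t (1 : R) (fun s => f (- s)) (- d).
Proof.
move=> [df <-].
have diff1 : differentiable f (- t) by apply/derivable1_diffP.
have dn : differentiable (fun s : R => - s) t by apply: differentiableN.
have dc : differentiable (f \o (fun s : R => - s)) t by exact: differentiable_comp.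
apply: DeriveDef; first exact/derivable1_diffP.
rewrite deriveE //= (diff_comp dn diff1) /= deriveE //.
have e : 'd (fun s : R => - s) t 1 = -1.
  by rewrite -deriveE //; have [_] := is_deriveNid t (1 : R).
by rewrite e linearN.
Qed.

(** The weight exp(-2 L t) decays at twice the growth rate: at the maximum M of the weighted norm,
    the contribution of [L] amounts to at most M / 2 and is absorbed, whence the factors 2 in the
    bound. Negative times follow by reflection. *)
Lemma gronwall m n (u du : R -> 'M[R]_(m, n)) (L eta T : R) : 0 <= T -> 0 < L -> 0 <= eta ->
  (forall t, `|t| <= T -> is_derive t (1 : R) u (du t)) ->
  (forall t, `|t| <= T -> `|du t| <= L * `|u t| + eta) ->
  forall t, `|t| <= T -> `|u t| <= 2 * (`|u 0| + eta * T) * expR (2 * L * T).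
Proof.
move=> T0 L0 eta0.
have half (v dv : R -> 'M[R]_(m, n)) :
  (forall t, 0 <= t <= T -> is_derive t (1 : R) v (dv t)) ->
  (forall t, 0 <= t <= T -> `|dv t| <= L * `|v t| + eta) ->
  forall t, 0 <= t <= T -> `|v t| <= 2 * (`|v 0| + eta * T) * expR (2 * L * T).
  move=> Dv Hv.
  pose w (t : R) : R := `|v t| * expR (- (2 * L * t)).
  have Dlin (t : R) : is_derive t (1 : R) (fun s : R => 2 * L * s) (2 * L).
    by apply: is_derive_eq; rewrite /GRing.scale /= mulr1.
  have Dexp (t : R) : is_derive t (1 : R) (fun s : R => expR (2 * L * s)) (expR (2 * L * t) * (2 * L)).
    exact: (is_derive1_comp (is_derive_expR _) (Dlin t)).
  have cw : {within `[0, T], continuous w}.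
    apply: continuous_in_subspaceT => t; rewrite inE /= in_itv /= => tT.
    apply: cvgM; first by apply: cvg_norm; exact: derive_continuous_at (Dv t tT).
    apply: (@continuous_comp _ _ _ (fun s : R => - (2 * L * s)) expR); last exact: continuous_expR.
    by apply: cvgN; exact: derive_continuous_at (Dlin t).
  have [c cT Hc] := EVT_max T0 cw.
  set M := w c in Hc.
  have M0 : 0 <= M by rewrite /M mulr_ge0 // expR_ge0.
  have vM t : 0 <= t <= T -> `|v t| <= M * expR (2 * L * t).
    move=> tT; have := Hc t; rewrite in_itv /= => /(_ tT).
    by rewrite /w expRN ler_pdivrMr // expR_gt0.
  have key t : 0 <= t <= T -> `|v t| <= `|v 0| + M / 2 * (expR (2 * L * t) - 1) + eta * t.
    move=> /andP[t0 tT].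
    have S s : 0 <= s <= t -> 0 <= s <= T by move=> /andP[-> st]; exact: le_trans tT.
    (* Its derivative is M L exp(2 L s) + eta, which dominates L |v s| + eta because |v s| <= M
       exp(2 L s). *)
    pose h (s : R) : R := M / 2 * expR (2 * L * s) + eta * s.
    have Dh s : 0 <= s <= t -> is_derive s (1 : R) h (M / 2 * (expR (2 * L * s) * (2 * L)) + eta).
      move=> _; have De := Dexp s; apply: is_derive_eq.
      by rewrite /GRing.scale /= mulr1.
    have G := @growth_bound m n v dv h _ t t0 (fun s st => Dv s (S s st)) Dh.
    have {}G : `|v t - v 0| <= h t - h 0.
      apply: G => s st; apply: le_trans (Hv s (S s st)) _; rewrite lerD2r.
      have := vM s (S s st); rewrite -(ler_pM2l L0) => /le_trans; apply.
      by rewrite le_eqVlt; apply/orP; left; apply/eqP; field.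
    rewrite -(subrK (v 0) (v t)); apply: le_trans (ler_normD _ _) _.
    apply: le_trans (lerD G (lexx _)) _.
    rewrite /h !mulr0 expR0 le_eqVlt; apply/orP; left; apply/eqP; ring.
  have cT' : 0 <= c <= T by move: cT; rewrite in_itv.
  have MM : M <= 2 * (`|v 0| + eta * T).
    have c0 : 0 <= c by case/andP: cT'.
    have e1 : 1 <= expR (2 * L * c) by rewrite -expR0 ler_expR !mulr_ge0 // ltW.
    have ep : 0 < expR (2 * L * c) by exact: expR_gt0.
    have E : M * expR (2 * L * c) = `|v c|.
      by rewrite /M /w expRN mulfVK // gt_eqF.
    have K := key c cT'; rewrite -E in K.
    have ecT : eta * c <= eta * T by rewrite ler_wpM2l //; case/andP: cT'.
    rewrite -(ler_pM2r ep).
    have P : 0 <= (`|v 0| + eta * T) * (expR (2 * L * c) - 1).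
      by rewrite mulr_ge0 ?subr_ge0 // addr_ge0 // mulr_ge0.
    have := normr_ge0 (v 0); nra.
  move=> t tT; apply: le_trans (vM t tT) _.
  apply: ler_pM => //.
  rewrite ler_expR; have /andP[t0 tT'] := tT.
  by rewrite ler_wpM2l // mulr_ge0 // ltW.
move=> Du Hu t tT.
have [t0|t0] := leP 0 t.
  apply: (half u du) => // [s|s|]; rewrite ?(ger0_norm t0) in tT *; last by rewrite t0.
    by move=> /andP[s0 sT]; apply: Du; rewrite ger0_norm.
  by move=> /andP[s0 sT]; apply: Hu; rewrite ger0_norm.
have := half (fun s => u (- s)) (fun s => - du (- s)) _ _ (- t).
rewrite opprK oppr0; apply.
- move=> s /andP[s0 sT]; apply: is_derive_reflect.
  by apply: Du; rewrite normrN ger0_norm.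
- by move=> s /andP[s0 sT]; rewrite normrN; apply: Hu; rewrite normrN ger0_norm.
- by rewrite oppr_ge0 (ltW t0) -(ltr0_norm t0).
Qed.

End Curves.

Section Primitive.
Variable R : realType.

Lemma derive0_const (g : R -> R) (x : R) :
  (forall t : R, `|t| <= `|x| -> is_derive t (1 : R) g 0) -> g x = g 0.
Proof.
move=> H.
have e (a : R) : 0 + a *: (1 : R^o) = a by rewrite add0r -[_%:A]/(_ * 1) mulr1.
have [|c cx] := @MVT_line R R^o g 0 1 x.
  by move=> s sx; have [] := H s sx; rewrite e.
rewrite !e; have [_ ->] := H c cx.
by rewrite mulr0 => /eqP; rewrite subr_eq0 => /eqP.
Qed.

(** The fundamental theorem is applied from a finite left endpoint, so a primitive is formed on each
    interval (-N, N), normalised at 0, and glued; two of them agree because their difference has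
    zero derivative. *)
Lemma primitive_exists (f : R -> R) : continuous f ->
  exists F : R -> R, F 0 = 0 /\ forall t : R, is_derive t (1 : R) F (f t).
Proof.
move=> cf.
have loc (N : R) : exists G : R -> R, G 0 = 0 /\ forall t : R, `|t| < N -> is_derive t (1 : R) G (f t).
  have [H HH] : exists H : R -> R, forall t : R, `|t| < N -> derivable H t 1 /\ derive1 H t = f t.
    exists (fun x => \int[lebesgue_measure]_(t in `[- N, x]) f t) => t.
    rewrite ltr_norml => /andP[Nt tN'].
    apply: (@continuous_FTC1_closed R f (- N) t N tN' _ Nt (cf t)).
    apply: continuous_compact_integrable; first exact: segment_compact.
    by apply: continuous_subspaceT.
  exists (fun x => H x - H 0); split; first by rewrite subrr.
  move=> t tN; have [dH EH] := HH t tN.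
  have DH : is_derive t (1 : R) H (f t).
    by apply: DeriveDef => //; apply: etrans EH; apply: esym; exact: derive1E.
  by apply: is_derive_eq; exact: subr0.
have [G HG] := choice loc.
have agree (N M t : R) : `|t| < N -> `|t| < M -> G N t = G M t.
  move=> tN tM; apply/eqP; rewrite -subr_eq0; apply/eqP.
  have -> : G N t - G M t = (G N \- G M) t by [].
  have -> : (G N \- G M) t = (G N \- G M) 0; last first.
    by rewrite /= (proj1 (HG N)) (proj1 (HG M)) subrr.
  apply: derive0_const => s st; have d1 := (proj2 (HG N)) s (le_lt_trans st tN).
  have d2 := (proj2 (HG M)) s (le_lt_trans st tM).
  by apply: is_derive_eq; exact: subrr.
(* Near a given [t] this coincides with the single primitive of index [|t| + 1], so it has the right
   derivative at [t]. *)
exists (fun t => G (`|t| + 1) t); split; first exact: (proj1 (HG _)).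
move=> t.
apply: (@near_eq_is_derive _ _ _ (G (`|t| + 1))); last by apply: (proj2 (HG _)); rewrite ltrDl.
have : \forall s \near t, `|s| < `|t| + 1.
  have c : (`|s| : R) @[s --> t] --> `|t| by apply: cvg_norm; exact: cvg_id.
  by apply: (cvgr_lt _ c); rewrite ltrDl.
by apply: filterS => s st; apply: agree => //; rewrite ltrDl.
Qed.

Lemma mx_primitive_exists m n (f : R -> 'M[R]_(m, n)) : continuous f ->
  exists F : R -> 'M[R]_(m, n), F 0 = 0 /\ forall t : R, is_derive t (1 : R) F (f t).
Proof.
move=> cf.
have H (ij : 'I_m * 'I_n) : exists F : R -> R,
    F 0 = 0 /\ forall t : R, is_derive t (1 : R) F (f t ij.1 ij.2).
  apply: primitive_exists => x.
  by apply: (@continuous_comp _ _ _ f (@mx_coord R m n ij.1 ij.2)); [exact: cf|exact: mx_coord_continuous].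
have [F HF] := choice H.
exists (fun t => \matrix_(i, j) F (i, j) t); split.
  by apply/matrixP => i j; rewrite !mxE (proj1 (HF _)).
move=> t; apply/is_derive_mxP => i j.
rewrite (_ : (fun x => _) = F (i, j)); last by apply/funext => x; rewrite mxE.
exact: (proj2 (HF (i, j))).
Qed.

End Primitive.

Section GeometricLimit.
Variable R : realType.

(** The intervals of radius C / 2^k around [x k] are nested, so the supremum of their left ends lies
    in all of them. *)
Lemma geometric_limit (x : nat -> R) (C : R) : 0 <= C ->
  (forall k, `|x k.+1 - x k| <= C / 2 ^+ k.+1) ->
  exists l, forall k, `|l - x k| <= C / 2 ^+ k.
Proof.
move=> C0 H.
have E k : C / 2 ^+ k.+1 = C / 2 ^+ k / 2 by rewrite exprS invfM mulrA mulrAC.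
have Cp k : 0 <= C / 2 ^+ k by rewrite divr_ge0 // exprn_ge0.
pose a k := x k - C / 2 ^+ k; pose b k := x k + C / 2 ^+ k.
have aS k : a k <= a k.+1.
  by have := H k; have := Cp k; rewrite /a E ler_norml => ? /andP[? ?]; lra.
have bS k : b k.+1 <= b k.
  by have := H k; have := Cp k; rewrite /b E ler_norml => ? /andP[? ?]; lra.
have aM j k : a k <= a (j + k)%N.
  by elim: j => // j IH; apply: le_trans IH _; rewrite addSn.
have bM j k : b (j + k)%N <= b k.
  by elim: j => // j IH; apply: le_trans IH; rewrite addSn.
have ab j k : a j <= b k.
  apply: le_trans (aM k j) _; rewrite addnC; apply: le_trans (bM j k); rewrite addnC.
  by have := Cp (k + j)%N; rewrite /a /b addnC; lra.
pose A := [set a k | k in setT].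
have sA : has_sup A by split; [exists (a 0%N), 0%N|exists (b 0%N) => _ [k _ <-]].
exists (sup A) => k.
have l1 : a k <= sup A by apply: ub_le_sup; [exact: (proj2 sA)|exists k].
have l2 : sup A <= b k by apply: ge_sup; [exact: (proj1 sA)|move=> _ [j _ <-]].
by rewrite ler_norml; move: l1 l2; rewrite /a /b => l1 l2; apply/andP; split; lra.
Qed.

Lemma mx_geometric_limit m n (x : nat -> 'M[R]_(m, n)) (C : R) : 0 <= C ->
  (forall k, `|x k.+1 - x k| <= C / 2 ^+ k.+1) ->
  exists l, forall k, `|l - x k| <= C / 2 ^+ k.
Proof.
move=> C0 H.
have Hij (ij : 'I_m * 'I_n) : exists l, forall k, `|l - x k ij.1 ij.2| <= C / 2 ^+ k.
  apply: geometric_limit => // k; apply: le_trans (H k).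
  by apply: le_trans (mx_norm_entry _ ij.1 ij.2); rewrite !mxE.
have [l Hl] := choice Hij; exists (\matrix_(i, j) l (i, j)) => k.
apply: mx_norm_leP => [|i j]; first by rewrite divr_ge0 // exprn_ge0.
by rewrite !mxE; exact: (Hl (i, j)).
Qed.

End GeometricLimit.

Section Picard.
Variables (R : realType) (m n : nat).
Variables (g : R -> 'M[R]_(m, n) -> 'M[R]_(m, n)) (ell : R -> R) (x0 : 'M[R]_(m, n)).
Hypothesis gc : forall c : R -> 'M[R]_(m, n), continuous c -> continuous (fun t => g t (c t)).
Hypothesis ellc : continuous ell.
Hypothesis gl : forall t x y, `|g t x - g t y| <= ell t * `|x - y|.
Hypothesis g0 : forall t, `|g t x0| <= ell t.

(** With [Lam] a primitive of the Lipschitz rate [ell], integration against the weight exp(2 |Lam|)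
    halves the weighted norm. Picard iteration thus contracts on the whole line at once, without
    patching short time intervals. *)
Lemma weighted_growth (Lam : R -> R) (u du : R -> 'M[R]_(m, n)) (c : R) : 0 <= c ->
  Lam 0 = 0 -> (forall t : R, is_derive t (1 : R) Lam (ell t)) ->
  (forall t : R, is_derive t (1 : R) u (du t)) ->
  (forall t, `|du t| <= ell t * (c * expR (2 * `|Lam t|))) ->
  u 0 = 0 -> forall t, `|u t| <= c / 2 * expR (2 * `|Lam t|).
Proof.
move=> c0 L0 DL Du Hu u0 t.
have ell0 s : 0 <= ell s by apply: le_trans (g0 s).
have Dexp (a : R) (Mu : R -> R) (s : R) (d : R) : is_derive s (1 : R) Mu d ->
    is_derive s (1 : R) (fun s => c / 2 * expR (2 * Mu s)) (d * (c * expR (2 * Mu s))).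
  move=> Dm.
  have D2 : is_derive s (1 : R) (fun s => 2 * Mu s) (2 * d) by apply: is_derive_eq.
  have De : is_derive s (1 : R) (fun s => expR (2 * Mu s)) (expR (2 * Mu s) * (2 * d)).
    exact: (is_derive1_comp (is_derive_expR _) D2).
  by apply: is_derive_eq; rewrite /GRing.scale /=; field.
have Lpos s : 0 <= s -> 0 <= Lam s.
  by move=> s0; rewrite -L0; apply: (ge0_derive_le s0 (df := ell)).
have Lneg s : s <= 0 -> Lam s <= 0.
  move=> s0; have := @ge0_derive_le R (fun r => - Lam (- r)) (fun r => ell (- r)) (- s).
  rewrite oppr_ge0 oppr0 L0 opprK oppr0 oppr_ge0; apply=> // r _.
  have D : is_derive (- r) (1 : R) Lam (ell (- r)) by [].
  have {}D := is_derive_reflect D.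
  by apply: is_derive_eq; exact: opprK.
have [t0|t0] := leP 0 t.
  rewrite ger0_norm ?Lpos //.
  have := @growth_bound R m n u du (fun s => c / 2 * expR (2 * Lam s)) _ t t0
    (fun s _ => Du s) (fun s _ => Dexp 0 Lam s _ (DL s)).
  rewrite u0 subr0 L0 mulr0 expR0 mulr1 => H.
  apply: le_trans (H _) _; last by rewrite lerBlDr lerDl divr_ge0.
  by move=> s /andP[s0 _]; have := Hu s; rewrite (ger0_norm (Lpos s s0)).
rewrite (ler0_norm (Lneg t (ltW t0))).
have DLr (s : R) : is_derive s (1 : R) (fun s => - Lam (- s)) (ell (- s)).
  have D : is_derive (- s) (1 : R) Lam (ell (- s)) by [].
  have {}D := is_derive_reflect D.
  by apply: is_derive_eq; exact: opprK.
have nt0 : 0 <= - t by rewrite oppr_ge0 ltW.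
have := @growth_bound R m n (fun s => u (- s)) (fun s => - du (- s))
    (fun s => c / 2 * expR (2 * - Lam (- s))) _ (- t) nt0
    (fun s _ => is_derive_reflect (Du (- s))) (fun s _ => Dexp 0 (fun s => - Lam (- s)) s _ (DLr s)).
rewrite opprK oppr0 u0 subr0 L0 oppr0 mulr0 expR0 mulr1 => H.
apply: le_trans (H _) _; last by rewrite lerBlDr lerDl divr_ge0.
move=> s /andP[s0 _]; have := Hu (- s); rewrite normrN ler0_norm //.
by apply: Lneg; rewrite oppr_le0.
Qed.

(** Because [ell] also bounds the field along the constant curve [x0], the first increment is
    already controlled by the weight, and the following ones decay geometrically by
    [weighted_growth]. *)
Lemma picard : exists c : R -> 'M[R]_(m, n), c 0 = x0 /\
  forall t : R, is_derive t (1 : R) c (g t (c t)).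
Proof.
have ell0 s : 0 <= ell s by apply: le_trans (g0 s).
have [Lam [L0 DL]] := primitive_exists ellc.
have cL : continuous Lam by move=> t; exact: derive_continuous_at (DL t).
pose W (t : R) : R := expR (2 * `|Lam t|).
have W1 t : 1 <= W t by rewrite -expR0 ler_expR mulr_ge0.
have W0 t : 0 <= W t by exact: expR_ge0.
have cW : continuous W.
  move=> t; apply: (@continuous_comp _ _ _ (fun t => 2 * `|Lam t|) expR); last exact: continuous_expR.
  by apply: cvgM; [exact: cvg_cst|apply: cvg_norm; exact: cL].
(* [prim] is chosen for all functions but carries information only for continuous ones; every
   integrand below is continuous by [gc]. *)
have /choice [prim Hp] : forall f : R -> 'M[R]_(m, n), exists F : R -> 'M[R]_(m, n),
    continuous f -> F 0 = 0 /\ forall t : R, is_derive t (1 : R) F (f t).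
  move=> f; have [cf|ncf] := pselect (continuous f); last by exists (fun=> 0).
  by have [F HF] := mx_primitive_exists cf; exists F.
pose step (c : R -> 'M[R]_(m, n)) := fun t => x0 + prim (fun s => g s (c s)) t.
have stepD c : continuous c -> forall t : R, is_derive t (1 : R) (step c) (g t (c t)).
  move=> cc t; have [_ D] := Hp _ (gc cc); have Dt := D t.
  by apply: is_derive_eq; exact: add0r.
have step0 c : continuous c -> step c 0 = x0.
  by move=> cc; have [E _] := Hp _ (gc cc); rewrite /step E addr0.
have stepc c : continuous c -> continuous (step c).
  by move=> cc t; exact: derive_continuous_at (stepD c cc t).
have stepW c c' (a : R) : 0 <= a -> continuous c -> continuous c' ->
  (forall t, `|c t - c' t| <= a * W t) -> forall t, `|step c t - step c' t| <= a / 2 * W t.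
  move=> a0 cc cc' H t.
  apply: (@weighted_growth Lam (fun t => step c t - step c' t) (fun t => g t (c t) - g t (c' t))) => //.
  - by move=> s; have := stepD c cc s; have := stepD c' cc' s => ? ?; apply: is_deriveB.
  - by move=> s; apply: le_trans (gl _ _ _) _; rewrite ler_wpM2l.
  - by rewrite !step0 // subrr.
pose it (k : nat) := iter k step (cst x0).
have itc k : continuous (it k).
  by elim: k => [|k IH]; [move=> t; exact: cvg_cst|exact: stepc].
have p2 k : 0 <= (2 : R) ^- k by rewrite invr_ge0 exprn_ge0.
have itW k t : `|it k.+1 t - it k t| <= W t / 2 ^+ k.+1.
  elim: k t => [|k IH] t.
    rewrite /it /= expr1 [leRHS]mulrC -[X in X * _]mul1r.
    apply: (@weighted_growth Lam (fun t => step (cst x0) t - x0) (fun t => g t x0)) => //.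
    - move=> s; have := stepD (cst x0) (itc 0%N) s => ?.
      by apply: is_derive_eq; exact: subr0.
    - by move=> s; apply: le_trans (g0 s) _; rewrite mul1r; exact: (ler_peMr (ell0 s) (W1 s)).
    - by rewrite step0 ?subrr //; exact: (itc 0%N).
  rewrite [leRHS]mulrC exprS invfM [2^-1 * _]mulrC.
  apply: (stepW (it k.+1) (it k) (2 ^- k.+1) (p2 _) (itc _) (itc _)).
  by move=> s; rewrite mulrC; exact: IH.
have Hl t : exists l, forall k, `|l - it k t| <= W t / 2 ^+ k.
  by apply: mx_geometric_limit.
have [c Hc] := choice Hl.
have geo (e : R) (C : R) : 0 < e -> 0 <= C -> exists k : nat, C / 2 ^+ k < e.
  move=> e0 C0.
  have Ce0 : 0 <= C / e by rewrite divr_ge0 // ltW.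
  pose k := Num.truncn (C / e); exists k.+1.
  have : C / e < 2 ^+ k.+1.
    apply: lt_le_trans (truncnS_gt _) _.
    by rewrite -natrX ler_nat ltnW // ltn_expl.
  by rewrite ltr_pdivrMr // ltr_pdivrMr ?exprn_gt0 // mulrC.
(* Convergence is uniform where the weight is bounded, in particular near each [t]; the rest is a
   three-epsilon argument. *)
have cc : continuous c.
  move=> t; rewrite /continuous_at; apply/cvgrPdist_lt => e e0.
  have nW : \forall s \near t, W s < W t + 1 by apply: (cvgr_lt _ (cW t)); rewrite ltrDl.
  have Wt : 0 <= W t + 1 by rewrite addr_ge0.
  have e3 : 0 < e / 3 by rewrite divr_gt0.
  have [k Hk] := geo _ _ e3 Wt.
  have Hk' s : W s < W t + 1 -> `|c s - it k s| < e / 3.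
    move=> Ws; apply: le_lt_trans (Hc s k) _; apply: le_lt_trans Hk.
    by apply: ler_wpM2r; [rewrite invr_ge0 exprn_ge0|exact: ltW].
  have nI : \forall s \near t, `|it k t - it k s| < e / 3.
    by move/cvgrPdist_lt: (itc k t); exact.
  near=> s.
  have A1 := Hk' t (nbhs_singleton nW).
  have A2 : `|c s - it k s| < e / 3 by apply: Hk'; near: s.
  have A3 : `|it k t - it k s| < e / 3 by near: s.
  rewrite -(subrKA (it k t)) -[X in _ + X](subrKA (it k s)).
  apply: le_lt_trans (ler_normD _ _) _.
  apply: (@lt_le_trans _ _ (e / 3 + (e / 3 + e / 3))); last first.
    by rewrite le_eqVlt; apply/orP; left; apply/eqP; field.
  apply: ltrD => //; apply: le_lt_trans (ler_normD _ _) _; apply: ltrD => //.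
  by rewrite distrC.
have fixc t : step c t = c t.
  apply/eqP; rewrite -subr_eq0 -normr_le0; apply/ler_addgt0Pr => e e0; rewrite add0r.
  have [k Hk] := geo (e / 2) (W t) (divr_gt0 e0 (ltr0Sn _ _)) (W0 t).
  have B1 : `|step c t - it k.+1 t| <= (2 ^+ k)^-1 / 2 * W t.
    apply: (stepW c (it k) (2 ^- k) (p2 _) cc (itc _)).
    by move=> s; rewrite mulrC; exact: Hc.
  have B2 := Hc t k.+1.
  rewrite -(subrKA (it k.+1 t)); apply: le_trans (ler_normD _ _) _.
  rewrite [X in _ + X <= _]distrC.
  have E2 : W t / 2 ^+ k.+1 = W t / 2 ^+ k / 2 by rewrite exprS invfM mulrA mulrAC.
  have E1 : (2 ^+ k)^-1 / 2 * W t = W t / 2 ^+ k / 2 by rewrite mulrC mulrA.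
  rewrite E2 in B2; rewrite E1 in B1; lra.
exists c; split; first by rewrite -fixc step0.
move=> t; have := stepD c cc t.
by rewrite (_ : step c = c) //; exact/funext.
Unshelve. all: by end_near. Qed.

End Picard.

(** * Linear differential equations *)

Section MatrixProduct.
Variable R : realType.

Lemma coord_cvg (T : topologicalType) m n (f : T -> 'M[R]_(m, n)) i j x :
  {for x, continuous f} -> {for x, continuous (fun y => f y i j : R^o)}.
Proof.
move=> cf; have := @continuous_comp _ _ _ f (@mx_coord R m n i j) x cf.
by apply; exact: mx_coord_continuous.
Qed.

Lemma mulmx_cvg (T : topologicalType) m n p (f : T -> 'M[R]_(m, n)) (g : T -> 'M[R]_(n, p)) x :
  {for x, continuous f} -> {for x, continuous g} -> {for x, continuous (fun y => f y *m g y)}.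
Proof.
move=> cf cg; apply: mx_cvg => i j.
have E y : (f y *m g y) i j = \sum_k f y i k * g y k j by rewrite mxE.
rewrite (_ : (fun y => _) = fun y => \sum_k f y i k * g y k j : R^o); last exact/funext.
apply: (@cvg_big _ _ _ _ _ add_continuous _ _ _ (fun k y => f y i k * g y k j : R^o)) => k _.
by apply: cvgM; exact: coord_cvg.
Qed.

Lemma differentiable_mulmx (V : normedModType R) m n p (f : V -> 'M[R]_(m, n))
    (g : V -> 'M[R]_(n, p)) x : differentiable f x -> differentiable g x ->
  differentiable (fun y => f y *m g y) x /\
  forall v, 'D_v (fun y => f y *m g y) x = f x *m 'D_v g x + 'D_v f x *m g x.
Proof.
apply: (@differentiable_bilinear R V _ _ _ (@mulmx R m n p : {bilinear _ -> _ -> _})).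
move=> q; apply: (@mulmx_cvg _ _ _ _ (fun q => q.1) (fun q => q.2)); [exact: cvg_fst|exact: cvg_snd].
Qed.

Lemma is_derive_mulmx m n p (f : R -> 'M[R]_(m, n)) (g : R -> 'M[R]_(n, p)) (t : R) df dg :
  is_derive t (1 : R) f df -> is_derive t (1 : R) g dg ->
  is_derive t (1 : R) (fun s => f s *m g s) (f t *m dg + df *m g t).
Proof.
move=> [df1 <-] [dg1 <-].
have d1 : differentiable f t by apply/derivable1_diffP.
have d2 : differentiable g t by apply/derivable1_diffP.
have [d3 E] := differentiable_mulmx d1 d2.
by apply: DeriveDef; [exact/derivable1_diffP|exact: E].
Qed.

Lemma is_derive_block m1 m2 n1 n2 (a : R -> 'M[R]_(m1, n1)) (b : R -> 'M[R]_(m1, n2))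
    (c : R -> 'M[R]_(m2, n1)) (d : R -> 'M[R]_(m2, n2)) (t : R) a' b' c' d' :
  is_derive t (1 : R) a a' -> is_derive t (1 : R) b b' ->
  is_derive t (1 : R) c c' -> is_derive t (1 : R) d d' ->
  is_derive t (1 : R) (fun s => block_mx (a s) (b s) (c s) (d s)) (block_mx a' b' c' d').
Proof.
move=> /is_derive_mxP da /is_derive_mxP db /is_derive_mxP dc /is_derive_mxP dd.
apply/is_derive_mxP => i j; rewrite -[i]splitK -[j]splitK.
case: (fintype.split i) => i'; case: (fintype.split j) => j' /=.
- rewrite block_mxEul (_ : (fun x => _) = fun x => a x i' j') //.
  by apply/funext => x; rewrite block_mxEul.
- rewrite block_mxEur (_ : (fun x => _) = fun x => b x i' j') //.
  by apply/funext => x; rewrite block_mxEur.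
- rewrite block_mxEdl (_ : (fun x => _) = fun x => c x i' j') //.
  by apply/funext => x; rewrite block_mxEdl.
- rewrite block_mxEdr (_ : (fun x => _) = fun x => d x i' j') //.
  by apply/funext => x; rewrite block_mxEdr.
Qed.

Lemma block_mx_cvg (T : topologicalType) m1 m2 n1 n2 (a : T -> 'M[R]_(m1, n1))
    (b : T -> 'M[R]_(m1, n2)) (c : T -> 'M[R]_(m2, n1)) (d : T -> 'M[R]_(m2, n2)) x :
  {for x, continuous a} -> {for x, continuous b} -> {for x, continuous c} ->
  {for x, continuous d} ->
  {for x, continuous (fun y => block_mx (a y) (b y) (c y) (d y))}.
Proof.
move=> ca cb cc cd; apply: mx_cvg => i j; rewrite -[i]splitK -[j]splitK.
case: (fintype.split i) => i'; case: (fintype.split j) => j' /=.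
- rewrite (_ : (fun y => _) = fun y => a y i' j'); first exact: coord_cvg.
  by apply/funext => y; rewrite block_mxEul.
- rewrite (_ : (fun y => _) = fun y => b y i' j'); first exact: coord_cvg.
  by apply/funext => y; rewrite block_mxEur.
- rewrite (_ : (fun y => _) = fun y => c y i' j'); first exact: coord_cvg.
  by apply/funext => y; rewrite block_mxEdl.
- rewrite (_ : (fun y => _) = fun y => d y i' j'); first exact: coord_cvg.
  by apply/funext => y; rewrite block_mxEdr.
Qed.

Lemma ursubmx_cvg (T : topologicalType) m1 m2 n1 n2 (f : T -> 'M[R]_(m1 + m2, n1 + n2)) x :
  {for x, continuous f} -> {for x, continuous (fun y => ursubmx (f y))}.
Proof.
move=> cf; apply: mx_cvg => i j.
rewrite (_ : (fun y => _) = fun y => f y (lshift m2 i) (rshift n1 j)); first exact: coord_cvg.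
by apply/funext => y; rewrite !mxE.
Qed.

Lemma Ck_ursubmx r (V : normedModType R) (O : set V) m1 m2 n1 n2
    (f : V -> 'M[R]_(m1 + m2, n1 + n2)) : open O ->
  Ck r O f -> Ck r O (fun y => ursubmx (f y)).
Proof.
move=> oO cf; apply: Ck_mx => // i j.
apply: (Ck_ext (f := fun y => f y (lshift m2 i) (rshift n1 j))) => //; last exact: Ck_coord.
by move=> y _; rewrite !mxE.
Qed.

Lemma Ck_block r (V : normedModType R) (O : set V) m1 m2 n1 n2 (a : V -> 'M[R]_(m1, n1))
    (b : V -> 'M[R]_(m1, n2)) (c : V -> 'M[R]_(m2, n1)) (d : V -> 'M[R]_(m2, n2)) : open O ->
  Ck r O a -> Ck r O b -> Ck r O c -> Ck r O d ->
  Ck r O (fun y => block_mx (a y) (b y) (c y) (d y)).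
Proof.
move=> oO ca cb cc cd; apply: Ck_mx => // i j; rewrite -[i]splitK -[j]splitK.
case: (fintype.split i) => i'; case: (fintype.split j) => j' /=.
- apply: (Ck_ext (f := fun y => a y i' j')) => //; last exact: Ck_coord.
  by move=> y _; rewrite block_mxEul.
- apply: (Ck_ext (f := fun y => b y i' j')) => //; last exact: Ck_coord.
  by move=> y _; rewrite block_mxEur.
- apply: (Ck_ext (f := fun y => c y i' j')) => //; last exact: Ck_coord.
  by move=> y _; rewrite block_mxEdl.
- apply: (Ck_ext (f := fun y => d y i' j')) => //; last exact: Ck_coord.
  by move=> y _; rewrite block_mxEdr.
Qed.

End MatrixProduct.

Section LinearODE.
Variable R : realType.

(** The coefficient stands on the right, k' = k A, as is needed for k alpha k^-1 - (dk) k^-1 to be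
    constant along a flow. In this order a constant factor on the left maps solutions to
    solutions. *)
Definition is_lsol q (A : R -> 'M[R]_q) (k : R -> 'M[R]_q) : Prop :=
  k 0 = 1%:M /\ forall t : R, is_derive t (1 : R) k (k t *m A t).

Definition lsol q (A : R -> 'M[R]_q) : R -> 'M[R]_q := xget (fun=> 1%:M) (is_lsol A).

Lemma lsolP q (A : R -> 'M[R]_q) : continuous A -> is_lsol A (lsol A).
Proof.
move=> cA; have [k Hk] : exists k, is_lsol A k.
  pose C : R := q%:R * (1 + `|1%:M : 'M[R]_q|).
  have C1 : q%:R <= C by rewrite /C ler_peMr // lerDl.
  have C2 : q%:R * `|1%:M : 'M[R]_q| <= C by rewrite /C ler_wpM2l // lerDr.
  apply: (@picard R q q (fun t x => x *m A t) (fun t => C * `|A t|)).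
  - by move=> c cc t; apply: mulmx_cvg; [exact: cc|exact: cA].
  - by move=> t; apply: cvgM; [exact: cvg_cst|apply: cvg_norm; exact: cA].
  - move=> t x y; rewrite -mulmxBl; apply: le_trans (mx_norm_mul _ _) _.
    by rewrite [`|x - y| * _]mulrC mulrA ler_wpM2r // ler_wpM2r.
  - by move=> t; apply: le_trans (mx_norm_mul _ _) _; rewrite mulrA ler_wpM2r.
exact: (@xgetI _ _ _ k Hk).
Qed.

Lemma bounded_on_segment m n (A : R -> 'M[R]_(m, n)) (T : R) : continuous A -> 0 <= T ->
  exists C : R, 0 <= C /\ forall t, `|t| <= T -> `|A t| <= C.
Proof.
move=> cA T0.
have TT : - T <= T by apply: (le_trans _ T0); rewrite oppr_le0.
have cw : {within `[- T, T], continuous (fun t => `|A t|)}.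
  apply: continuous_in_subspaceT => t _; apply: cvg_norm; exact: cA.
have [c _ Hc] := EVT_max TT cw; exists `|A c|; split=> // t tT.
by apply: Hc; rewrite in_itv /= -ler_norml.
Qed.

Lemma lsol_unique m q (A : R -> 'M[R]_q) (y : R -> 'M[R]_(m, q)) : continuous A ->
  (forall t : R, is_derive t (1 : R) y (y t *m A t)) ->
  forall t, y t = y 0 *m lsol A t.
Proof.
move=> cA Dy t; have [l0 Dl] := lsolP cA.
apply/eqP; rewrite -subr_eq0 -normr_le0.
have [C [C0 HC]] := bounded_on_segment cA (normr_ge0 t).
pose u s := y s - y 0 *m lsol A s.
have Du s : is_derive s (1 : R) u (u s *m A s).
  have D1 := Dy s; have D2 : is_derive s (1 : R) (fun r => y 0 *m lsol A r) (y 0 *m (lsol A s *m A s) + 0 *m lsol A s).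
    by apply: is_derive_mulmx => //.
  apply: is_derive_eq; rewrite mul0mx addr0 /u mulmxBl mulmxA //.
have := @gronwall R m q u (fun s => u s *m A s) (q%:R * C + 1) 0 `|t| (normr_ge0 t) _ (lexx _) (fun s _ => Du s) _ t (lexx _).
have u0 : u 0 = 0 by rewrite /u l0 mulmx1 subrr.
rewrite u0 normr0 mul0r addr0 mulr0 mul0r; apply.
  by rewrite ltr_wpDl // mulr_ge0.
move=> s st; rewrite addr0; apply: le_trans (mx_norm_mul _ _) _.
rewrite mulrDl mul1r [`|u s| * _]mulrC mulrA.
apply: (@le_trans _ _ (q%:R * C * `|u s|)); last by rewrite lerDl.
by rewrite ler_wpM2r // ler_wpM2l // HC.
Qed.

Lemma lsol_eq q (A : R -> 'M[R]_q) k : continuous A -> is_lsol A k -> lsol A = k.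
Proof.
by move=> cA [k0 Dk]; apply/funext => t; rewrite (lsol_unique cA Dk t) k0 mul1mx.
Qed.

(** Compactness of a time segment makes the coefficients at [p] uniformly close to those at [p0].
    Gronwall is then applied to the difference of the two solutions, with forcing k2 (A_p -
    A_p0). *)
Lemma lsol_param_continuous q (P : topologicalType) (A : R * P -> 'M[R]_q) :
  continuous A -> continuous (fun z : R * P => lsol (fun t => A (t, z.2)) z.1).
Proof.
move=> cA [t0 p0].
have cAp p : continuous (fun t => A (t, p)).
  move=> t; apply: (@continuous_comp _ _ _ (fun t => (t, p)) A); last exact: cA.
  by apply: continuous_pair_at; [exact: cvg_id|exact: cvg_cst].
pose T := `|t0| + 1; have T0 : 0 <= T by rewrite addr_ge0.
have tube (eta : R) : 0 < eta -> \forall p \near p0, forall t, `|t| <= T ->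
    `|A (t, p) - A (t, p0)| < eta.
  move=> eta0.
  have K : compact `[- T, T] by exact: segment_compact.
  have /compact_near_coveringP := K.
  move=> /(_ P (nbhs p0) (fun p t => `|A (t, p) - A (t, p0)| < eta) _) H.
  have {}H : \forall p \near p0, `[- T, T] `<=` (fun t => `|A (t, p) - A (t, p0)| < eta).
    apply: H => t _.
    have e2 : 0 < eta / 2 by rewrite divr_gt0.
    have n1 : \forall z \near (t, p0), `|A (t, p0) - A z| < eta / 2.
      by move/cvgrPdist_lt: (cA (t, p0)); exact.
    have n2 : \forall s \near t, `|A (t, p0) - A (s, p0)| < eta / 2.
      by move/cvgrPdist_lt: (cAp p0 t); exact.
    case: n1 => -[U1 U2] [/= nU1 nU2] HU.
    exists (U1 `&` [set s | `|A (t, p0) - A (s, p0)| < eta / 2], U2).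
      by split=> //=; exact: filterI.
    move=> [s p] [/= [s1 s2] p2].
    rewrite -(subrKA (A (t, p0))); apply: le_lt_trans (ler_normD _ _) _.
    rewrite (splitr eta); apply: ltrD => //.
    by rewrite distrC; exact: (HU (s, p)).
  by apply: filterS H => p Hp t; rewrite ler_norml => tT; apply: Hp; rewrite /= in_itv.
have [L [L0 HL]] := bounded_on_segment (cAp p0) T0.
have [k00 Dk0] := lsolP (cAp p0).
have ck0 : continuous (lsol (fun t => A (t, p0))).
  by move=> t; exact: derive_continuous_at (Dk0 t).
have [K [K0 HK]] := bounded_on_segment ck0 T0.
rewrite /continuous_at; apply/cvgrPdist_lt => e e0.
(* The Gronwall factor for coefficients bounded by [L + 1] and forcing at most [q%:R * (K * eta)];
   [eta] is then taken with [eta * C <= e / 2]. *)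
pose C : R := 2 * (q%:R * K * T) * expR (2 * (q%:R * (L + 1) + 1) * T) + 1.
have C0 : 0 < C by rewrite /C ltr_wpDl // !mulr_ge0 // expR_ge0.
pose eta : R := Num.min 1 (e / 2 / C).
have eta0 : 0 < eta by rewrite lt_min ltr01 divr_gt0 // divr_gt0.
have eta1 : eta <= 1 by rewrite ge_min lexx.
have etaC : eta * C <= e / 2 by rewrite -ler_pdivlMr // ge_min lexx orbT.
have e2 : 0 < e / 2 by rewrite divr_gt0.
have nt : \forall s \near t0, `|lsol (fun t => A (t, p0)) t0 - lsol (fun t => A (t, p0)) s| < e / 2.
  by move/cvgrPdist_lt: (ck0 t0); exact.
have nT : \forall s \near t0, `|s| < T.
  have c : (`|s| : R) @[s --> t0] --> `|t0| by apply: cvg_norm; exact: cvg_id.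
  by apply: (cvgr_lt _ c); rewrite /T ltrDl.
exists ([set s | `|lsol (fun t => A (t, p0)) t0 - lsol (fun t => A (t, p0)) s| < e / 2 /\ `|s| < T],
        [set p | forall t, `|t| <= T -> `|A (t, p) - A (t, p0)| < eta]).
  by split=> /=; [exact: filterI|exact: tube].
move=> [s p] [/= [s1 s2] Hp].
have [kp0 Dkp] := lsolP (cAp p).
pose k1 := lsol (fun t => A (t, p)); pose k2 := lsol (fun t => A (t, p0)).
pose u t := k1 t - k2 t.
have Du t : is_derive t (1 : R) u (u t *m A (t, p) + k2 t *m (A (t, p) - A (t, p0))).
  have D1 := Dkp t; have D2 := Dk0 t; apply: is_derive_eq.
  by rewrite /u mulmxBl mulmxBr addrA subrK.
have G : `|u s| <= 2 * (`|u 0| + q%:R * (K * eta) * T) * expR (2 * (q%:R * (L + 1) + 1) * T).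
  apply: (@gronwall R q q u _ (q%:R * (L + 1) + 1) (q%:R * (K * eta)) T) => //.
  - by rewrite ltr_wpDl // mulr_ge0 // addr_ge0.
  - by rewrite !mulr_ge0 // ltW.
  - move=> t tT; apply: le_trans (ler_normD _ _) _.
    apply: lerD.
      apply: le_trans (mx_norm_mul _ _) _.
      rewrite mulrDl mul1r [`|u t| * _]mulrC mulrA.
      apply: (@le_trans _ _ (q%:R * (L + 1) * `|u t|)); last by rewrite lerDl.
      rewrite ler_wpM2r // ler_wpM2l //.
      rewrite -(subrK (A (t, p0)) (A (t, p))); apply: le_trans (ler_normD _ _) _.
      rewrite addrC lerD //; first exact: HL.
      by apply: le_trans eta1; apply: ltW; exact: Hp.
    apply: le_trans (mx_norm_mul _ _) _; rewrite ler_wpM2l // ler_pM //; first exact: HK.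
    by apply: ltW; exact: Hp.
  - exact: ltW.
have u0 : u 0 = 0 by rewrite /u /k1 /k2 kp0 k00 subrr.
have G2 : `|u s| <= e / 2.
  apply: le_trans G _; apply: le_trans etaC; rewrite u0 normr0 add0r /C.
  have : 0 <= eta by exact: ltW.
  set X := expR _; move=> ?.
  rewrite (_ : eta * (2 * (q%:R * K * T) * X + 1) = 2 * (q%:R * (K * eta) * T) * X + eta); last by ring.
  by rewrite lerDl.
rewrite (_ : e = e / 2 + e / 2); last exact: splitr.
rewrite /= -(subrKA (k2 s)); apply: le_lt_trans (ler_normD _ _) _.
by rewrite ltr_leD // distrC.
Qed.

End LinearODE.

(** * Flows and smooth dependence on parameters *)

Section ProductDerivatives.
Variable R : realType.

Lemma frame_cons (V : normedModType R) n (e : 'I_n -> V) l : frame e l ->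
  frame (fun k : 'I_n.+1 => oapp (fun j => (0, e j)) (1, 0) (unlift ord0 k) : R^o * V)
    (fun k => oapp (fun j => l j \o snd : {linear (R^o * V)%type -> R^o})
                   (fst : {linear (R^o * V)%type -> R^o}) (unlift ord0 k)).
Proof.
move=> [cl El]; split=> [k|[t w]].
  case: (unlift ord0 k) => [j|] /=.
    move=> z; apply: (@continuous_comp _ _ _ snd (l j)); [exact: cvg_snd|exact: cl].
  by move=> z; exact: cvg_fst.
rewrite big_ord_recl unlift_none /=.
rewrite (eq_bigr (fun i => l i w *: (0, e i))); last by move=> i _; rewrite liftK.
congr pair; rewrite raddf_sum /=.
  rewrite big1 ?addr0; last by move=> i _; rewrite scaler0.
  by rewrite /GRing.scale /= mulr1.
by rewrite scaler0 add0r [LHS]El.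
Qed.

Lemma is_derive_time (V W : normedModType R) (K : R^o * V -> W) (t : R) (y : V) (D : W) :
  is_derive t (1 : R) (fun s : R => K (s, y)) D ->
  derivable K (t, y) (1, 0) /\ 'D_(1, 0) K (t, y) = D.
Proof.
move=> [dK <-].
have E : (fun h : R => h^-1 *: ((K \o shift (t, y)) (h *: (1, 0)) - K (t, y)))
       = (fun h : R => h^-1 *: (((fun s : R => K (s, y)) \o shift t) (h *: 1) - K (t, y))).
  apply/funext => h; congr (_ *: (_ - _)); rewrite /shift /=.
  have -> : h *: (1, 0) + (t, y) = (h *: (1 : R^o) + t, y) :> R^o * V.
    by congr pair; rewrite /= scaler0 add0r.
  by [].
by split; [rewrite /derivable E|rewrite /derive E].
Qed.

(** [g] continues the difference quotient across step 0, and the derivative is its value there. In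
    the applications [g] is read off a linear equation that depends on the step. *)
Lemma is_derive_space (V W : normedModType R) (K : R^o * V -> W) (t : R) (y v : V)
    (g : R^o -> W) : {for (0 : R^o), continuous g} ->
  (forall h : R, h != 0 -> g h = h^-1 *: (K (t, y + h *: v) - K (t, y))) ->
  derivable K (t, y) (0, v) /\ 'D_(0, v) K (t, y) = g 0.
Proof.
move=> cg Eg.
have C : (fun h : R => h^-1 *: ((K \o shift (t, y)) (h *: (0, v)) - K (t, y))) @ 0^' --> g 0.
  apply: cvg_trans (cvg_within_filter _ cg).
  apply: near_eq_cvg.
  near=> h; rewrite Eg; last by near: h; exact: nbhs_dnbhs_neq.
  congr (_ *: (_ - _)); rewrite /shift /=.
  have -> : h *: (0, v) + (t, y) = (t, y + h *: v) :> R^o * V.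
    by congr pair; rewrite /= ?scaler0 ?add0r // addrC.
  by [].
by split; [apply/cvg_ex; exists (g 0)|exact: cvg_lim C].
Unshelve. all: by end_near. Qed.

End ProductDerivatives.

Section LinearSmooth.
Variables (R : realType) (V : normedModType R) (hV : findim V).

Lemma slice_continuous (T : topologicalType) (A : R^o * V -> T) y :
  continuous A -> continuous (fun t : R => A (t, y)).
Proof.
move=> cA t; apply: (@continuous_comp _ _ _ (fun t : R => (t : R^o, y)) A); last exact: cA.
by apply: continuous_pair_at; [exact: cvg_id|exact: cvg_cst].
Qed.

Definition psol q (A : R^o * V -> 'M[R]_q) (z : R^o * V) : 'M[R]_q :=
  lsol (fun t => A (t, z.2)) z.1.

Lemma psolP q (A : R^o * V -> 'M[R]_q) y : continuous A ->
  psol A (0, y) = 1%:M /\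
  forall t : R, is_derive t (1 : R) (fun s : R => psol A (s, y)) (psol A (t, y) *m A (t, y)).
Proof. by move=> cA; apply: lsolP; exact: slice_continuous. Qed.

(** The solutions at [y] and at [y + h *: v], together with their difference quotient, form one
    block triangular solution; the off-diagonal coefficient is the difference quotient of [A]. The
    system is continuous in the step, and at step 0 it yields the derivative as a block of a
    solution of doubled size. *)
Lemma psol_derive_space q (A : R^o * V -> 'M[R]_q) v t y :
  continuous A -> (forall z, derivable A z (0, v)) -> continuous ('D_(0, v) A) ->
  derivable (psol A) (t, y) (0, v) /\
  'D_(0, v) (psol A) (t, y) =
   ursubmx (psol (fun z => block_mx (A z) ('D_(0, v) A z) 0 (A z)) (t, y)).
Proof.
move=> cA dA cD.
pose w : R^o * V := (0, v).
pose Q := diffquot A w.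
have cQ : continuous Q by exact: diffquot_continuous.
(* The second component of [p] is the step; at step 0 the upper right block is ['D_(0, v) A]. *)
pose AA (p : R * R^o) : 'M[R]_(q + q) :=
  block_mx (A (p.1, y)) (Q ((p.1, y), p.2)) 0 (A ((p.1, y) + p.2 *: w)).
have c1 (p : R * R^o) : {for p, continuous (fun p : R * R^o => ((p.1 : R^o, y) : R^o * V))}.
  by apply: continuous_pair_at; [exact: cvg_fst|exact: cvg_cst].
have cAA : continuous AA.
  move=> p; apply: (@block_mx_cvg R (R * R^o)%type q q q q (fun p => A (p.1, y))
    (fun p => Q ((p.1, y), p.2)) (fun=> 0) (fun p => A ((p.1, y) + p.2 *: w)) p).
  - exact: (@continuous_comp _ _ _ (fun p : R * R^o => (p.1 : R^o, y)) A p (c1 p) (cA _)).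
  - apply: (@continuous_comp _ _ _ (fun p : R * R^o => ((p.1 : R^o, y), p.2)) Q p); last exact: cQ.
    by apply: continuous_pair_at; [exact: c1|exact: cvg_snd].
  - exact: cvg_cst.
  - apply: (@continuous_comp _ _ _ (fun p : R * R^o => (p.1 : R^o, y) + p.2 *: w) A p); last exact: cA.
    by apply: cvgD; [exact: c1|apply: cvgZr_tmp; exact: cvg_snd].
pose g (h : R^o) : 'M[R]_q := ursubmx (lsol (fun t => AA (t, h)) t).
have cg : continuous g.
  move=> h; have cl := @lsol_param_continuous R (q + q) R^o AA cAA (t, h).
  apply: (@ursubmx_cvg R R^o q q q q (fun h : R^o => lsol (fun t => AA (t, h)) t)).
  apply: (@continuous_comp _ _ _ (fun h : R^o => (t, h)) (fun z : R * R^o => lsol (fun s => AA (s, z.2)) z.1)); last exact: cl.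
  by apply: continuous_pair_at; [exact: cvg_cst|exact: cvg_id].
have Eg (h : R) : h != 0 -> g h = h^-1 *: (psol A (t, y + h *: v) - psol A (t, y)).
  move=> h0.
  have [k10 Dk1] := psolP y cA; have [k20 Dk2] := psolP (y + h *: v) cA.
  pose k s : 'M[R]_(q + q) := block_mx (psol A (s, y)) (h^-1 *: (psol A (s, y + h *: v) - psol A (s, y))) 0 (psol A (s, y + h *: v)).
  rewrite /g (@lsol_eq _ _ _ k); first by rewrite /k block_mxKur.
    move=> s; apply: (@continuous_comp _ _ _ (fun s : R => (s, h : R^o)) AA); last exact: cAA.
    by apply: continuous_pair_at; [exact: cvg_id|exact: cvg_cst].
  split; first by rewrite /k k10 k20 subrr scaler0 -scalar_mx_block.
  move=> s; have D1 := Dk1 s; have D2 := Dk2 s.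
  have -> : k s *m AA (s, h) = block_mx (psol A (s, y) *m A (s, y))
     (h^-1 *: (psol A (s, y + h *: v) *m A (s, y + h *: v) - psol A (s, y) *m A (s, y))) 0
     (psol A (s, y + h *: v) *m A (s, y + h *: v)).
    have Ew : ((s : R^o, y) : R^o * V) + h *: w = (s, y + h *: v).
      by congr pair; rewrite /= ?scaler0 ?addr0.
    rewrite /k /AA mulmx_block !mul0mx !mulmx0 !addr0 !add0r [(s, h).1]/= [(s, h).2]/= Ew.
    congr block_mx.
    rewrite /Q /diffquot [(_, h).2]/= (negbTE h0) [((s, y), h).1]/= Ew.
    rewrite -scalemxAl -scalemxAr -scalerDr; congr (_ *: _).
    by rewrite mulmxBr mulmxBl addrC addrA subrK.
  exact: is_derive_block.
have [d1 d2] := is_derive_space (cg 0) Eg; split=> //; rewrite d2 /g; congr ursubmx.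
rewrite /psol; congr (lsol _ t); apply/funext => s /=.
by rewrite /AA /= scale0r addr0 /Q diffquot0.
Qed.

(** The space derivative is a block of a solution of the same kind, of doubled size and with
    coefficients one class lower; hence the induction on [r] runs over all [q] and [A]. *)
Lemma psol_Ck r q (A : R^o * V -> 'M[R]_q) : Ck r setT A -> Ck r setT (psol A).
Proof.
elim: r q A => [|r IH] q A sA.
  have cA : continuous A by move=> z; exact: sA.
  by move=> z _; exact: (@lsol_param_continuous R q V A cA z).
have cA : continuous A by move=> z; exact: (Ck_continuous sA).
have [n [e [l fr]]] := hV.
have cl0 : continuous (psol A) by move=> z; exact: (@lsol_param_continuous R q V A cA z).
have [dA DA] := sA.
have cD v : continuous ('D_v A) by move=> z; exact: (Ck_continuous (DA v)).
have dA' v z : derivable A z v by apply: diff_derivable; exact: dA.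
have P0 z : derivable (psol A) z (1, 0) /\ 'D_(1, 0) (psol A) z = psol A z *m A z.
  by case: z => t y; apply: is_derive_time; have [_] := psolP y cA; exact.
have P1 v z : derivable (psol A) z (0, v) /\ 'D_(0, v) (psol A) z =
   ursubmx (psol (fun z => block_mx (A z) ('D_(0, v) A z) 0 (A z)) z).
  by case: z => t y; apply: psol_derive_space.
have IHA := IH q A (CkW sA).
apply: (CkS_partials (frame_cons fr)) => // [i z|i].
  by case: (unlift ord0 i) => [j|] /=; [exact: (proj1 (P1 _ _))|exact: (proj1 (P0 _))].
case: (unlift ord0 i) => [j|] /=.
  apply: (@Ck_ext _ _ _ _ _ (fun z => ursubmx (psol (fun z => block_mx (A z) ('D_(0, e j) A z) 0 (A z)) z))).
  - exact: openT.
  - by move=> z _; rewrite (proj2 (P1 (e j) z)).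
  - apply: Ck_ursubmx; first exact: openT.
    apply: IH; apply: Ck_block; first exact: openT.
    + exact: CkW.
    + exact: DA.
    + exact: Ck_cst.
    + exact: CkW.
apply: (@Ck_ext _ _ _ _ _ (fun z => psol A z *m A z)).
- exact: openT.
- by move=> z _; rewrite (proj2 (P0 z)).
- by apply: Ck_mulmx => //; [exact: openT|exact: CkW].
Qed.

Lemma psol_smooth q (A : R^o * V -> 'M[R]_q) :
  smooth_open setT A -> smooth_open setT (psol A).
Proof. by move=> /smooth_openP sA; apply/smooth_openP => r; exact: psol_Ck. Qed.

End LinearSmooth.

Section Flow.
Variables (R : realType) (n : nat) (Y : 'rV[R]_n -> 'rV[R]_n) (L : R).
Hypothesis L0 : 0 < L.
Hypothesis Ylip : forall x y, `|Y x - Y y| <= L * `|x - y|.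
Hypothesis Ysm : smooth_open setT Y.

Definition is_flow_line x (c : R -> 'rV[R]_n) : Prop :=
  c 0 = x /\ forall t : R, is_derive t (1 : R) c (Y (c t)).

Definition flow (z : R^o * 'rV[R]_n) : 'rV[R]_n := xget (fun=> 0) (is_flow_line z.2) z.1.

Let cY : continuous Y.
Proof. by move=> x; exact: (smooth_continuous Ysm). Qed.

Lemma flowP x : flow (0, x) = x /\
  forall t : R, is_derive t (1 : R) (fun s : R => flow (s, x)) (Y (flow (t, x))).
Proof.
have [c Hc] : exists c, is_flow_line x c.
  apply: (@picard R 1 n (fun _ => Y) (fun=> L + `|Y x|)).
  - by move=> c cc t; apply: (@continuous_comp _ _ _ c Y); [exact: cc|exact: cY].
  - by move=> t; exact: cvg_cst.
  - by move=> _ y y'; apply: le_trans (Ylip _ _) _; rewrite ler_wpM2r // lerDl.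
  - by move=> _; rewrite lerDr ltW.
exact: (@xgetI _ _ _ c Hc).
Qed.

Lemma flow_continuous_time x : continuous (fun t : R => flow (t, x)).
Proof. by move=> t; have [_ D] := flowP x; exact: derive_continuous_at (D t). Qed.

Lemma flow_lipschitz T x x' t : 0 <= T -> `|t| <= T ->
  `|flow (t, x) - flow (t, x')| <= 2 * `|x - x'| * expR (2 * L * T).
Proof.
move=> T0 tT; have [f0 Df] := flowP x; have [f0' Df'] := flowP x'.
have := @gronwall R 1 n (fun t => flow (t, x) - flow (t, x'))
  (fun t => Y (flow (t, x)) - Y (flow (t, x'))) L 0 T T0 L0 (lexx _) _ _ t tT.
rewrite mul0r addr0 f0 f0'; apply.
by move=> s _; rewrite addr0; exact: Ylip.
Qed.

Lemma flow_unique x c : is_flow_line x c -> forall t, c t = flow (t, x).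
Proof.
move=> [c0 Dc] t; have [f0 Df] := flowP x.
apply/eqP; rewrite -subr_eq0 -normr_le0.
have := @gronwall R 1 n (fun t => c t - flow (t, x))
  (fun t => Y (c t) - Y (flow (t, x))) L 0 `|t| (normr_ge0 t) L0 (lexx _) _ _ t (lexx _).
rewrite f0 c0 subrr normr0 mul0r addr0 mulr0 mul0r; apply.
by move=> s _; rewrite addr0; exact: Ylip.
Qed.

Lemma flow_continuous : continuous flow.
Proof.
move=> [t x]; rewrite /continuous_at; apply/cvgrPdist_lt => e e0.
pose T := `|t| + 1; have T0 : 0 <= T by rewrite addr_ge0.
have e2 : 0 < e / 2 by rewrite divr_gt0.
pose C : R := 2 * expR (2 * L * T); have C0 : 0 < C by rewrite mulr_gt0 // expR_gt0.
have n1 : \forall s \near t, `|flow (t, x) - flow (s, x)| < e / 2.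
  by move/cvgrPdist_lt: (@flow_continuous_time x t); exact.
have n2 : \forall s \near t, `|s| < T.
  have c : (`|s| : R) @[s --> t] --> `|t| by apply: cvg_norm; exact: cvg_id.
  by apply: (cvgr_lt _ c); rewrite /T ltrDl.
have n3 : \forall y \near x, `|x - y| < e / 2 / C.
  have c : (y : 'rV[R]_n) @[y --> x] --> x by exact: cvg_id.
  by move/cvgrPdist_lt: c; apply; rewrite divr_gt0.
exists ([set s | `|flow (t, x) - flow (s, x)| < e / 2 /\ `|s| < T], [set y | `|x - y| < e / 2 / C]).
  by split=> //=; exact: filterI.
move=> [s y] [/= [s1 s2] y1].
rewrite -(subrKA (flow (s, x))); apply: le_lt_trans (ler_normD _ _) _.
rewrite (_ : e = e / 2 + e / 2); last exact: splitr.
apply: ltrD => //; apply: le_lt_trans (flow_lipschitz x y T0 (ltW s2)) _.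
by rewrite mulrAC -/C mulrC -ltr_pdivlMr.
Qed.

Lemma flow_add s t x : flow (s + t, x) = flow (s, flow (t, x)).
Proof.
have [f0 Df] := flowP x.
apply: (@flow_unique (flow (t, x)) (fun s => flow (s + t, x))); split; first by rewrite add0r.
move=> {}s; have [d <-] := Df (s + t).
have [d1 d2] := @derive_translate R R _ (fun s => flow (s, x)) t s 1 d.
by apply: DeriveDef.
Qed.

Definition coord_frame (i : 'I_n) : 'rV[R]_n := delta_mx 0 i.

Lemma coord_frameP : frame coord_frame (fun i => @mx_coord R 1 n 0 i : {linear _ -> _}).
Proof.
split=> [i|w]; first exact: mx_coord_continuous.
by rewrite {1}(row_sum_delta w).
Qed.

Definition flow_jacobian (x : 'rV[R]_n) : 'M[R]_n := \matrix_(i, j) ('D_(coord_frame i) Y x) 0 j.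

(** Hadamard's lemma gives Y(y') - Y(y) = (y' - y) Q(y, y') with [Q] continuous, so the difference
    quotient of two flow lines solves a linear equation with coefficients continuous in time and
    step. Step 0 gives the variational equation. *)
Lemma flow_derive_space v t x :
  derivable flow (t, x) (0, v) /\
  'D_(0, v) flow (t, x) = v *m psol (fun z => flow_jacobian (flow z)) (t, x).
Proof.
have dY i x' : derivable Y x' (coord_frame i).
  by apply: diff_derivable; exact: (smooth_differentiable Ysm).
have cD i : continuous ('D_(coord_frame i) Y).
  by move=> x'; exact: (smooth_continuous (smooth_derive _ Ysm)).
have cH := hadamard_continuous coord_frameP cY dY cD.
have EH := hadamardE coord_frameP Y.
set H := hadamard _ _ Y in cH EH.
pose Q (z : 'rV[R]_n * 'rV[R]_n) : 'M[R]_n := \matrix_(i, j) H i z 0 j.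
have cQ : continuous Q.
  move=> z; apply: mx_cvg => i j.
  rewrite (_ : (fun y => _) = fun y => H i y 0 j); last by apply/funext => y; rewrite mxE.
  by apply: coord_cvg; exact: cH.
have EQ y y' : Y y' - Y y = (y' - y) *m Q (y, y').
  rewrite EH; apply/rowP => j; rewrite summxE mxE; apply: eq_bigr => i _.
  by rewrite [LHS]mxE /Q [X in _ = _ * X]mxE.
pose AA (p : R * R^o) : 'M[R]_n := Q (flow (p.1, x), flow (p.1, x + p.2 *: v)).
have cAA : continuous AA.
  move=> p; apply: (@continuous_comp _ _ _ (fun p : R * R^o => (flow (p.1, x), flow (p.1, x + p.2 *: v))) Q p); last exact: cQ.
  apply: continuous_pair_at.
    apply: (@continuous_comp _ _ _ (fun p : R * R^o => (p.1 : R^o, x)) flow); last exact: flow_continuous.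
    by apply: continuous_pair_at; [exact: cvg_fst|exact: cvg_cst].
  apply: (@continuous_comp _ _ _ (fun p : R * R^o => (p.1 : R^o, x + p.2 *: v)) flow); last exact: flow_continuous.
  apply: continuous_pair_at; first exact: cvg_fst.
  by apply: cvgD; [exact: cvg_cst|apply: cvgZr_tmp; exact: cvg_snd].
pose g (h : R^o) : 'rV[R]_n := v *m lsol (fun t => AA (t, h)) t.
have cg : continuous g.
  move=> h; have cl := @lsol_param_continuous R n R^o AA cAA (t, h).
  apply: (@mulmx_cvg R R^o _ _ _ (fun=> v) (fun h : R^o => lsol (fun t => AA (t, h)) t) h); first exact: cvg_cst.
  apply: (@continuous_comp _ _ _ (fun h : R^o => (t, h)) (fun z : R * R^o => lsol (fun s => AA (s, z.2)) z.1)); last exact: cl.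
  by apply: continuous_pair_at; [exact: cvg_cst|exact: cvg_id].
have Eg (h : R) : h != 0 -> g h = h^-1 *: (flow (t, x + h *: v) - flow (t, x)).
  move=> h0.
  have [f0 Df] := flowP x; have [f0' Df'] := flowP (x + h *: v).
  pose y s : 'rV[R]_n := h^-1 *: (flow (s, x + h *: v) - flow (s, x)).
  have cA : continuous (fun t => AA (t, h)).
    move=> s; apply: (@continuous_comp _ _ _ (fun s : R => (s, h : R^o)) AA); last exact: cAA.
    by apply: continuous_pair_at; [exact: cvg_id|exact: cvg_cst].
  have Dy (s : R) : is_derive s (1 : R) y (y s *m AA (s, h)).
    have D1 := Df s; have D2 := Df' s; have D3 := is_deriveB D2 D1.
    rewrite /y -scalemxAl -EQ; exact: is_deriveZ.
  rewrite /g -/(y t) (lsol_unique cA Dy t) /y f0 f0' addrC addKr scalerA mulVf // scale1r //.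
have [d1 d2] := is_derive_space (cg 0) Eg; split=> //; rewrite d2 /g; congr (_ *m _).
rewrite /psol; congr (lsol _ t); apply/funext => s /=.
rewrite /AA /= scale0r addr0; apply/matrixP => i j; rewrite !mxE.
by rewrite /H hadamard_diag.
Qed.

(** Bootstrapping: if the flow is of class C^r, so is the coefficient of the variational equation,
    hence by [psol_Ck] the space derivative; the time derivative is [Y \o flow]. *)
Lemma flow_smooth : smooth_open setT flow.
Proof.
apply/smooth_openP; elim=> [|r IH]; first by move=> z _; exact: flow_continuous.
have P0 z : derivable flow z (1, 0) /\ 'D_(1, 0) flow z = Y (flow z).
  by case: z => t y; apply: is_derive_time; have [_] := flowP y; exact.
have sY := (smooth_openP _ _).1 Ysm.
apply: (CkS_partials (frame_cons coord_frameP)) => [|i z|i]; first exact: flow_continuous.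
  case: (unlift ord0 i) => [j|] /=; last exact: (proj1 (P0 _)).
  by case: z => t y; exact: (proj1 (flow_derive_space _ _ _)).
case: (unlift ord0 i) => [j|] /=; last first.
  apply: (@Ck_ext _ _ _ _ _ (Y \o flow)); first exact: openT.
    by move=> z _; rewrite (proj2 (P0 z)).
  by apply: (@Ck_comp _ _ _ _ _ _ _ setT) => //; exact: openT.
apply: (@Ck_ext _ _ _ _ _ (fun z => coord_frame j *m psol (fun z => flow_jacobian (flow z)) z)).
- exact: openT.
- by move=> [t y] _; rewrite (proj2 (flow_derive_space _ _ _)).
- apply: Ck_mulmx; [exact: openT|exact: Ck_cst|].
  apply: psol_Ck.
  apply: (@Ck_comp R r _ 'rV[R]_n _ _ setT setT flow flow_jacobian openT _ IH) => //.
  apply: Ck_mx => [|k l]; first exact: openT.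
  apply: (@Ck_ext _ _ _ _ _ (fun x => ('D_(coord_frame k) Y x) 0 l : R^o)); first exact: openT.
    by move=> x _; rewrite mxE.
  apply: Ck_coord; first exact: openT.
  by have [_] := sY r.+1; exact.
Qed.

End Flow.

(** * Cut-offs *)

Section Bump.
Variable R : realType.

(* The powers of 1/x make the family stable under differentiation. *)
Definition flat (n : nat) (x : R^o) : R^o := if 0 < x then x^-1 ^+ n * expR (- x^-1) else 0.

Lemma flat_ge0 n x : 0 <= flat n x.
Proof.
rewrite /flat; case: ifP => // x0.
by rewrite mulr_ge0 ?expR_ge0 // exprn_ge0 // invr_ge0 ltW.
Qed.

Lemma flat_gt0 n x : 0 < x -> 0 < flat n x.
Proof. by move=> x0; rewrite /flat x0 mulr_gt0 ?expR_gt0 // exprn_gt0 // invr_gt0. Qed.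

Lemma flat_le0 n x : x <= 0 -> flat n x = 0.
Proof. by move=> x0; rewrite /flat ltNge x0. Qed.

Lemma expR_lower N (y : R) : 0 <= y -> (y / N.+1%:R) ^+ N.+1 <= expR y.
Proof.
move=> y0; have E : y = N.+1%:R * (y / N.+1%:R) by rewrite mulrC divfK.
rewrite [in leRHS]E expRM_natl.
have p : 0 <= y / N.+1%:R by rewrite divr_ge0.
have q : y / N.+1%:R <= expR (y / N.+1%:R).
  by apply: le_trans (expR_ge1Dx _); rewrite lerDr.
by rewrite lerXn2r // nnegrE // expR_ge0.
Qed.

(** With y = 1/x, the inequality exp(y) >= (y / (n+2))^(n+2) beats the power y^n by two orders. A
    quadratic bound is what makes the derivative at 0 vanish. *)
Lemma flat_quadratic n : exists2 C : R, 0 <= C & forall x, flat n x <= C * x ^+ 2.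
Proof.
exists (n.+2%:R ^+ n.+2) => [|x]; first by rewrite exprn_ge0.
rewrite /flat; case: ifPn => [x0|_]; last by apply: mulr_ge0; [exact: exprn_ge0|exact: sqr_ge0].
have xn0 : x != 0 by rewrite gt_eqF.
have [y [y0 E]] : exists y : R, 0 < y /\ x = y^-1 by exists x^-1; rewrite invr_gt0 invrK.
rewrite {}E invrK; have := expR_lower n.+1 (ltW y0).
rewrite expRN expr_div_n => H.
rewrite ler_pdivrMr ?expR_gt0 //.
have c0 : 0 <= n.+2%:R ^+ n.+2 / y ^+ 2 by rewrite divr_ge0 // exprn_ge0 // ltW.
rewrite exprVn; apply: le_trans (ler_wpM2l c0 H).
have yn0 : y != 0 by rewrite gt_eqF.
have nn0 : (n.+2%:R : R) ^+ n.+2 != 0 by rewrite expf_neq0.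
rewrite le_eqVlt; apply/orP; left; apply/eqP.
rewrite (_ : y ^+ n.+2 = y ^+ n * y ^+ 2); last by rewrite -exprD addn2.
move: (n.+2%:R ^+ n.+2 : R) nn0 => N nn0; field.
by rewrite yn0 nn0.
Qed.

(** For x > 0 this is the derivative of y^n exp(-y) with y = 1/x and dy/dx = -y^2. The same formula
    holds for x <= 0, where both of its terms are 0, so it can be iterated on the whole line. *)
Lemma flat_derive n (x : R) :
  is_derive x (1 : R) (flat n : R -> R) (flat n.+2 x - n%:R * flat n.+1 x).
Proof.
have [x0|x0|x0] := ltgtP 0 x.
- have nx : \forall y \near x, y^-1 ^+ n * expR (- y^-1) = flat n y.
    have : \forall y \near x, 0 < y by exact: (open_nbhs_nbhs (conj (@open_gt R 0) x0)).
    by apply: filterS => y y0; rewrite /flat y0.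
  apply: (near_eq_is_derive nx).
  have xn0 : x != 0 by rewrite gt_eqF.
  have dV : is_derive x (1 : R) (fun y : R => y^-1) (- x ^- 2).
    have := @is_deriveV R id x 1 1 xn0 (is_derive_id _ _).
    by rewrite -[_%:A]/(_ * 1) mulr1.
  have dE : is_derive x^-1 (1 : R) (fun y : R => y ^+ n * expR (- y))
      (x^-1 ^+ n * - expR (- x^-1) + expR (- x^-1) * (n%:R * x^-1 ^+ n.-1)).
    have d1 : is_derive x^-1 (1 : R) (fun y : R => expR (- y)) (- expR (- x^-1)).
      have := is_derive1_comp (is_derive_expR (- x^-1)) (is_deriveNid (x^-1) (1 : R)).
      by rewrite mulrN1.
    have d2 : is_derive x^-1 (1 : R) (fun y : R => y ^+ n) (n%:R * x^-1 ^+ n.-1).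
      apply: DeriveDef; first exact: exprn_derivable.
      by rewrite exp_derive -![_ *: _]/(_ * _) mulr1.
    exact: is_deriveM.
  have := is_derive1_comp dE dV.
  rewrite /flat x0; set D := (X in is_derive _ _ _ X -> _) => H.
  apply: is_derive_eq; rewrite /D.
  set E := expR _; rewrite -exprVn; set y := x^-1.
  by case: n {nx dE H D} => [|k]; rewrite ?expr0 /= !exprS; ring.
- have nx : \forall y \near x, 0 = flat n y.
    have : \forall y \near x, y < 0 by exact: (open_nbhs_nbhs (conj (@open_lt R 0) x0)).
    by apply: filterS => y y0; rewrite flat_le0 // ltW.
  apply: (near_eq_is_derive nx).
  by rewrite !flat_le0 ?ltW //= mulr0 subr0; exact: is_derive_cst.
- rewrite -x0 !flat_le0 // mulr0 subr0.
  have [C C0 HC] := flat_quadratic n.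
  have lz : linear (fun _ : R^o => 0 : R^o) by move=> a u v; rewrite scaler0 addr0.
  have [|e e0|d1 d2] := @eps_differentiable R R^o R^o (flat n) 0 (linear_pack lz).
  + by move=> h; exact: cvg_cst.
  + have e1 : 0 < e / (C + 1) by rewrite divr_gt0 // ltr_wpDl.
    have : \forall h \near (0 : R^o), `|0 - h| < e / (C + 1).
      by have := @cvg_id R^o (nbhs (0 : R^o)); move/cvgrPdist_lt; exact.
    apply: filterS => h; rewrite sub0r normrN ltr_pdivlMr ?ltr_wpDl // => he.
    rewrite addr0 (flat_le0 _ (lexx 0)) !subr0 ger0_norm ?flat_ge0 //.
    apply: le_trans (HC h) _.
    rewrite -real_normK ?num_real // expr2 mulrA ler_wpM2r //.
    by apply: le_trans (ltW he); rewrite mulrDr mulr1 mulrC lerDl.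
  + apply: DeriveDef; first exact/derivable1_diffP.
    by rewrite deriveE // d2.
Qed.

Lemma flat_Ck r n : Ck r setT (flat n).
Proof.
elim: r n => [|r IH] n; first by move=> x _; exact: (derive_continuous_at (flat_derive n x)).
have dn x : differentiable (flat n) x.
  by apply/derivable1_diffP; have [] := flat_derive n x.
split=> [x _ //|v].
apply: (@Ck_ext _ _ _ _ _ (fun x => (v : R^o) *: (flat n.+2 x - (n%:R : R^o) *: flat n.+1 x))).
- exact: openT.
- move=> x _; have [_ <-] := flat_derive n x.
  by rewrite !deriveE // -linearZ /= -[v%:A]/(v * 1) mulr1.
- apply: CkZ; [exact: openT|exact: Ck_cst|].
  apply: CkB; [exact: openT|exact: IH|].
  by apply: CkZ; [exact: openT|exact: Ck_cst|exact: IH].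
Qed.

Lemma flat_smooth n : smooth_open setT (flat n).
Proof. by apply/smooth_openP => r; exact: flat_Ck. Qed.

Lemma smooth_poly2 (a b : R) (O : set R^o) : smooth_open O (fun t : R^o => a * (t * t) + b : R^o).
Proof.
apply: (smooth_sub (O := setT)) => //.
apply: smoothD; [exact: openT| |exact: smooth_cst].
by apply: smoothM; [exact: openT|exact: smooth_cst|apply: smoothM; [exact: openT| |]; exact: smooth_id].
Qed.

(** The arguments are 4 - t^2 and t^2 - 1, in the shape of [smooth_poly2]. They are never both
    nonpositive, so the denominator is positive; the second term disappears for |t| <= 1 and the
    numerator for |t| >= 2. *)
Definition bump (t : R^o) : R^o :=
  flat 0 (-1 * (t * t) + 4) * (flat 0 (-1 * (t * t) + 4) + flat 0 (1 * (t * t) + -1))^-1.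

Lemma bump_den t : 0 < flat 0 (-1 * (t * t) + 4) + flat 0 (1 * (t * t) + -1).
Proof.
have [h|h] := ltP (t * t) 4.
  by rewrite ltr_wpDr ?flat_ge0 // flat_gt0 // mulN1r addrC subr_gt0.
rewrite ltr_wpDl ?flat_ge0 // flat_gt0 // mul1r subr_gt0.
by apply: lt_le_trans h; rewrite ltr1n.
Qed.

Lemma bump_smooth : smooth_open setT bump.
Proof.
have s1 a b : smooth_open setT (fun t : R^o => flat 0 (a * (t * t) + b)).
  apply: (@smooth_comp R _ R^o _ _ setT setT (fun t : R^o => a * (t * t) + b : R^o) (flat 0)) => //.
  - exact: openT.
  - exact: smooth_poly2.
  - exact: flat_smooth.
apply: smoothM; [exact: openT|exact: s1|].
apply: smoothV; [exact: openT| |].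
  by move=> t _; rewrite gt_eqF // bump_den.
by apply: smoothD; [exact: openT|exact: s1|exact: s1].
Qed.

Lemma bump1 t : `|t| <= 1 -> bump t = 1.
Proof.
move=> t1; rewrite /bump (flat_le0 _ (x := 1 * (t * t) + -1)); last first.
  by rewrite mul1r subr_le0 -expr2 -real_normK ?num_real // expr_le1.
rewrite addr0 divff // gt_eqF // flat_gt0 // mulN1r addrC subr_gt0.
rewrite -expr2 -real_normK ?num_real //; apply: (@le_lt_trans _ _ 1); first by rewrite expr_le1.
by rewrite ltr1n.
Qed.

Lemma bump0 t : 2 <= `|t| -> bump t = 0.
Proof.
move=> t2; rewrite /bump (flat_le0 _ (x := -1 * (t * t) + 4)) ?mul0r //.
rewrite mulN1r addrC subr_le0 -expr2 -real_normK ?num_real //.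
rewrite (_ : 4 = 2 ^+ 2); last by rewrite -natrX.
by rewrite lerXn2r // nnegrE.
Qed.

Lemma bump_ge0 t : 0 <= bump t.
Proof. by rewrite /bump divr_ge0 ?flat_ge0 // ltW // bump_den. Qed.

Lemma bump_le1 t : bump t <= 1.
Proof. have H (a b : R) : 0 <= b -> 0 < a + b -> a / (a + b) <= 1.
  by move=> b0 ab; rewrite ler_pdivrMr // mul1r lerDl.
by apply: H; [exact: flat_ge0|exact: bump_den]. Qed.

Definition clamp (t : R^o) : R^o := t * bump t.

Lemma clamp_smooth : smooth_open setT clamp.
Proof. by apply: smoothM; [exact: openT|exact: smooth_id|exact: bump_smooth]. Qed.

Lemma clamp_id t : `|t| <= 1 -> clamp t = t.
Proof. by move=> t1; rewrite /clamp bump1 // mulr1. Qed.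

Lemma clamp_le t : `|clamp t| <= 2.
Proof.
rewrite /clamp normrM (ger0_norm (bump_ge0 t)).
have [h|h] := leP `|t| 2; last by rewrite bump0 ?mulr0 // ltW.
by rewrite -[leRHS]mulr1 ler_pM ?bump_ge0 ?bump_le1.
Qed.

(** The derivative is bounded by its maximum on [-3, 3] and is 0 farther out, where [clamp] vanishes
    locally. *)
Lemma clamp_lipschitz : exists2 C : R, 0 < C & forall s t, `|clamp s - clamp t| <= C * `|s - t|.
Proof.
have sm := @smooth_derive R R^o R^o setT clamp 1 clamp_smooth.
have cD : continuous ('D_1 clamp) by move=> t; exact: (smooth_continuous sm).
have cw : {within `[-3, 3], continuous (fun t : R => `|'D_1 clamp t|)}.
  apply: continuous_in_subspaceT => t _; apply: cvg_norm; exact: cD.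
have le33 : (-3 : R) <= 3 by lra.
have [c _ Hc] := EVT_max le33 cw.
have HC t : `|'D_1 clamp t| <= `|'D_1 clamp c| + 1.
  have [h|h] := leP `|t| 3.
    by apply: le_trans (Hc t _) _; [rewrite in_itv /= -ler_norml|rewrite lerDl].
  rewrite (_ : 'D_1 clamp t = 0) ?normr0 ?addr_ge0 //.
  rewrite (@near_eq_derive _ _ _ clamp (cst 0) t 1) ?derive_cst //.
  have c' : (`|s| : R) @[s --> t] --> `|t| by apply: cvg_norm; exact: cvg_id.
  have : \forall s \near t, 2 < `|s|.
    by apply: (cvgr_gt _ c'); apply: lt_trans h; rewrite ltr_nat.
  by apply: filterS => s s2; rewrite /clamp bump0 ?mulr0 // ltW.
exists (`|'D_1 clamp c| + 1) => [|s t]; first by rewrite ltr_wpDl.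
have [|d _ E] := @MVT_line R R^o clamp t 1 (s - t).
  by move=> x _; apply: diff_derivable; exact: (smooth_differentiable clamp_smooth).
have e : t + (s - t) *: (1 : R^o) = s by rewrite -[(s - t)%:A]/((s - t) * 1) mulr1 addrC subrK.
by rewrite e in E; rewrite E normrM mulrC ler_wpM2r.
Qed.

End Bump.

Section Cutoff.
Variables (R : realType) (n : nat).

Lemma closed_norm_ball_compact (z0 : 'rV[R]_n) (r : R) :
  compact [set z : 'rV[R]_n | `|z - z0| <= r].
Proof.
apply: bounded_closed_compact.
  exists (`|z0| + r); split; first exact: num_real.
  move=> M HM z /= zr; apply: ltW; apply: le_lt_trans HM.
  by rewrite -(subrK z0 z) addrC; apply: le_trans (ler_normD _ _) _; rewrite lerD2l.
have c : continuous (fun z : 'rV[R]_n => `|z - z0|).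
  have sm : smooth_open setT (fun z : 'rV[R]_n => z - z0).
    by apply: smoothB; [exact: openT|exact: smooth_id|exact: smooth_cst].
  move=> z; have h : {for z, continuous (fun z : 'rV[R]_n => z - z0)} by exact: (smooth_continuous sm).
  exact: (continuous_comp h (@norm_continuous _ _ (z - z0))).
rewrite (_ : mkset _ = (fun z : 'rV[R]_n => `|z - z0|) @^-1` [set x | x <= r]) //.
by apply: closed_comp => [z _|]; [exact: c|exact: closed_le].
Qed.

Lemma bounded_on_ball p q (g : 'rV[R]_n -> 'M[R]_(p, q)) (z0 : 'rV[R]_n) (r : R) :
  0 <= r -> (forall z : 'rV[R]_n, `|z - z0| <= r -> {for z, continuous g}) ->
  exists2 C : R, 0 < C & forall z : 'rV[R]_n, `|z - z0| <= r -> `|g z| <= C.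
Proof.
move=> r0 cg.
have K := @closed_norm_ball_compact z0 r.
have ne : [set z : 'rV[R]_n | `|z - z0| <= r] !=set0 by exists z0; rewrite /= subrr normr0.
have cw : {within [set z : 'rV[R]_n | `|z - z0| <= r], continuous (fun z => `|g z|)}.
  by apply: continuous_in_subspaceT => z; rewrite inE /= => zr; exact: (continuous_comp (cg z zr) (@norm_continuous _ _ (g z))).
have [c _ Hc] := EVT_max_rV ne K cw.
exists (`|g c| + 1) => [|z zr]; first by rewrite ltr_wpDl.
by apply: le_trans (Hc z _) _; rewrite ?inE // lerDl.
Qed.

(** [MVT_line] allows an intermediate point as far back as y - (x - y), at distance up to 3 r from
    [z0]; this is why [g] is taken smooth on the ball of triple radius. *)
Lemma lipschitz_on_ball p q (D : set 'rV[R]_n) (g : 'rV[R]_n -> 'M[R]_(p, q)) (z0 : 'rV[R]_n) (r : R) :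
  0 <= r -> (forall z : 'rV[R]_n, `|z - z0| <= 3 * r -> D z) -> smooth_open D g ->
  exists2 L : R, 0 < L & forall x y : 'rV[R]_n, `|x - z0| <= r -> `|y - z0| <= r ->
     `|g x - g y| <= L * `|x - y|.
Proof.
move=> r0 HD sg.
have r3 : 0 <= 3 * r by rewrite mulr_ge0.
have /choice [C HC] : forall k : 'I_n, exists C : R, 0 < C /\ forall z : 'rV[R]_n, `|z - z0| <= 3 * r -> `|'D_(coord_frame R k) g z| <= C.
  move=> k; have [|C C0 HC] := @bounded_on_ball p q ('D_(coord_frame R k) g) z0 (3 * r) r3.
    by move=> z zr; apply: (smooth_continuous (smooth_derive (coord_frame R k) sg)); exact: HD.
  by exists C.
pose L : R := 1 + \sum_k C k.
have CL : \sum_k C k <= L by rewrite /L lerDr.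
have sC : 0 <= \sum_k C k by apply: sumr_ge0 => k _; exact: ltW (proj1 (HC k)).
have L0 : 0 < L by rewrite ltr_pwDl.
exists L => // x y xr yr.
apply: mx_norm_leP => [|i j]; first by rewrite mulr_ge0 // ltW.
pose gij : 'rV[R]_n -> R^o := fun z => g z i j.
have seg (s : R) : `|s| <= `|1 : R| -> `|y + s *: (x - y) - z0| <= 3 * r.
  rewrite normr1 => s1; rewrite addrAC; apply: le_trans (ler_normD _ _) _.
  have xy : `|x - y| <= r + r.
    rewrite -(subrKA z0); apply: le_trans (ler_normD _ _) _.
    by apply: lerD => //; rewrite distrC.
  have : `|s *: (x - y)| <= r + r.
    rewrite normrZ -[leRHS]mul1r; exact: ler_pM.
  by move: yr; lra.
have dg (s : R) : `|s| <= `|1 : R| -> differentiable g (y + s *: (x - y)).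
  by move=> s1; apply: (smooth_differentiable sg); apply: HD; exact: seg.
have [|c c1 E] := @MVT_line R _ gij y (x - y) 1.
  move=> s s1; have dgs : derivable g (y + s *: (x - y)) (x - y) by apply: diff_derivable; exact: dg.
  by have /derivable_mxP := dgs; exact.
rewrite scale1r mul1r addrCA subrr addr0 in E.
rewrite !mxE (_ : g x i j - g y i j = gij x - gij y) // E.
have dgc : derivable g (y + c *: (x - y)) (x - y) by apply: diff_derivable; exact: dg.
have -> : 'D_(x - y) gij (y + c *: (x - y)) = ('D_(x - y) g (y + c *: (x - y))) i j.
  by rewrite (derive_mx dgc) mxE.
rewrite (derive_frame (x - y) (coord_frameP R n) (dg c c1)) summxE.
apply: le_trans (ler_norm_sum _ _ _) _.
apply: (@le_trans _ _ (\sum_k C k * `|x - y|)); last by rewrite -mulr_suml ler_wpM2r.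
apply: ler_sum => k _; rewrite mxE normrM mulrC; apply: ler_pM => //.
  apply: le_trans (mx_norm_entry _ _ _) _; apply: (proj2 (HC k)); exact: seg.
exact: mx_norm_entry.
Qed.

(** The retraction applies a scaled [clamp] to every coordinate. Precomposition with it makes each
    map smooth on [D] globally bounded and Lipschitz, so that vector fields on [D] acquire complete
    flows without being changed near [z0]. *)
Lemma exists_cutoff (D : set 'rV[R]_n) (z0 : 'rV[R]_n) : open D -> D z0 ->
  exists (rho : 'rV[R]_n -> 'rV[R]_n) (r : R),
  [/\ 0 < r, smooth_open setT rho, forall z, D (rho z),
      forall z : 'rV[R]_n, `|z - z0| <= r -> rho z = z &
      forall p q (g : 'rV[R]_n -> 'M[R]_(p, q)), smooth_open D g ->
        (exists2 L : R, 0 < L & forall x y : 'rV[R]_n, `|g (rho x) - g (rho y)| <= L * `|x - y|) /\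
        (exists2 C : R, 0 < C & forall x, `|g (rho x)| <= C)].
Proof.
move=> oD Dz0; have := open_nbhs_nbhs (conj oD Dz0).
move=> /nbhs_ballP [d /= d0 Hd].
(* The image of [rho] lies within 2 r of [z0], and [lipschitz_on_ball] needs three times that radius
   inside [D]: 6 r < d. *)
pose r := d / 7; have r0 : 0 < r by rewrite divr_gt0.
pose rho (z : 'rV[R]_n) : 'rV[R]_n := \row_i (z0 0 i + r * clamp ((z 0 i - z0 0 i) / r)).
have rho2 z : `|rho z - z0| <= 2 * r.
  apply: mx_norm_leP => [|i j]; first by rewrite mulr_ge0 // ltW.
  rewrite !mxE (ord1 i) addrAC subrr add0r normrM (gtr0_norm r0) mulrC.
  by rewrite ler_pM2r // clamp_le.
have HD z : `|z - z0| <= 3 * (2 * r) -> D z.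
  move=> zr; apply: Hd; rewrite -ball_normE /ball_ /= distrC.
  by apply: le_lt_trans zr _; rewrite /r; lra.
exists rho, r; split=> //.
- apply: smooth_mx => [|i j]; first exact: openT.
  apply: (smooth_ext (f := fun z : 'rV[R]_n => z0 0 j + r * clamp ((z 0 j - z0 0 j) / r) : R^o)).
  + exact: openT.
  + by move=> z _; rewrite mxE.
  + apply: smoothD; [exact: openT|exact: smooth_cst|].
    apply: smoothM; [exact: openT|exact: smooth_cst|].
    apply: (@smooth_comp R _ R^o _ _ setT setT (fun z : 'rV[R]_n => (z 0 j - z0 0 j) / r : R^o) (@clamp R)) => //.
    * exact: openT.
    * apply: smoothM; [exact: openT| |exact: smooth_cst].
      apply: smoothB; [exact: openT| |exact: smooth_cst].
      by apply: smooth_coord; [exact: openT|exact: smooth_id].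
    * exact: clamp_smooth.
- by move=> z; apply: HD; apply: le_trans (rho2 z) _; lra.
- move=> z zr; apply/rowP => i; rewrite mxE clamp_id.
    by rewrite mulrC divfK ?gt_eqF // addrC subrK.
  rewrite normrM normfV (gtr0_norm r0) ler_pdivrMr // mul1r.
  by apply: le_trans zr; have := mx_norm_entry (z - z0) 0 i; rewrite !mxE.
- move=> p q g sg.
  have r2 : 0 <= 2 * r by rewrite mulr_ge0 // ltW.
  have [L L0 HL] := lipschitz_on_ball r2 HD sg.
  have [C C0 HC] := clamp_lipschitz R.
  split.
    exists (L * C) => [|x y]; first exact: mulr_gt0.
    apply: le_trans (HL _ _ (rho2 x) (rho2 y)) _.
    rewrite -mulrA ler_pM2l //; apply: mx_norm_leP => [|i j]; first by rewrite mulr_ge0 // ltW.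
    rewrite !mxE opprD addrACA subrr add0r -mulrBr normrM (gtr0_norm r0).
    apply: le_trans (ler_wpM2l (ltW r0) (HC _ _)) _.
    rewrite -mulrBl normrM normfV (gtr0_norm r0) mulrCA [r * _]mulrC divfK ?gt_eqF //.
    rewrite ler_pM2l // opprB addrA subrK.
    by have := mx_norm_entry (x - y) 0 j; rewrite !mxE.
  have [|M M0 HM] := @bounded_on_ball p q g z0 (2 * r) r2.
    move=> z zr; apply: (smooth_continuous sg); apply: HD; apply: le_trans zr _; lra.
  by exists M => // x; exact: HM.
Qed.

End Cutoff.

(** * The Lorentz group *)

Section Isometries.
Variables (R : realType) (k : nat) (J : 'M[R]_k).
Hypotheses (JT : J^T = J) (JJ : J *m J = 1%:M).

Definition isoJ (q : 'M[R]_k) : Prop := q^T *m J *m q = J.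
Definition skewJ (Y : 'M[R]_k) : Prop := Y^T *m J + J *m Y = 0.

Lemma isoJ_inv_mul q : isoJ q -> (J *m q^T *m J) *m q = 1%:M.
Proof. by move=> iq; rewrite -!mulmxA [q^T *m _]mulmxA iq JJ. Qed.

Lemma isoJ_unit q : isoJ q -> q \in unitmx.
Proof. by move=> /isoJ_inv_mul /mulmx1_unit []. Qed.

Lemma isoJ_invmx q : isoJ q -> invmx q = J *m q^T *m J.
Proof.
move=> iq; have u := isoJ_unit iq.
by rewrite -[RHS](mulmxK u) isoJ_inv_mul // mul1mx.
Qed.

Lemma isoJ1 : isoJ 1%:M.
Proof. by rewrite /isoJ trmx1 mul1mx mulmx1. Qed.

Lemma isoJM q r : isoJ q -> isoJ r -> isoJ (q *m r).
Proof.
by rewrite /isoJ => iq ir; rewrite trmx_mul -!mulmxA [J *m _]mulmxA [q^T *m _]mulmxA [q^T *m _]mulmxA iq mulmxA.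
Qed.

Lemma isoJ_inv q : isoJ q -> isoJ (invmx q).
Proof.
move=> iq; have u := isoJ_unit iq; rewrite /isoJ trmx_inv -{1}iq.
by rewrite !mulmxA mulVmx ?unitmx_tr // mul1mx -mulmxA mulmxV // mulmx1.
Qed.

(** Along k' = k A with [A] skew it is k J k^T that is visibly constant; one-sided inverses of
    square matrices lead back to the form used in [isoJ]. *)
Lemma isoJ_tr q : q *m J *m q^T = J -> isoJ q.
Proof.
move=> H; have H1 : q *m (J *m q^T *m J) = 1%:M by rewrite !mulmxA H JJ.
have := mulmx1C H1; rewrite /isoJ => H2.
by rewrite -[RHS]mulmx1 -H2 !mulmxA JJ mul1mx.
Qed.

Lemma skewJ0 : skewJ 0.
Proof. by rewrite /skewJ trmx0 mul0mx mulmx0 addr0. Qed.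

Lemma skewJD X Y : skewJ X -> skewJ Y -> skewJ (X + Y).
Proof.
rewrite /skewJ => sX sY; rewrite linearD /= mulmxDl mulmxDr addrACA sX sY addr0 //.
Qed.

Lemma skewJZ a X : skewJ X -> skewJ (a *: X).
Proof.
by rewrite /skewJ => sX; rewrite linearZ /= -scalemxAl -scalemxAr -scalerDr sX scaler0.
Qed.

Lemma skewJN X : skewJ X -> skewJ (- X).
Proof. by move=> sX; rewrite -scaleN1r; exact: skewJZ. Qed.

Lemma skewJ_trE Y : skewJ Y -> Y^T *m J = - (J *m Y).
Proof. by move=> /eqP; rewrite addr_eq0 => /eqP. Qed.

Lemma skewJ_swap Y : skewJ Y -> Y *m J + J *m Y^T = 0.
Proof.
move=> sY; have : J *m (Y^T *m J + J *m Y) *m J = 0 by rewrite sY mulmx0 mul0mx.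
by rewrite mulmxDr mulmxDl !mulmxA JJ mul1mx -!mulmxA JJ mulmx1 addrC.
Qed.

Lemma skewJ_conj q Y : isoJ q -> skewJ Y -> skewJ (invmx q *m Y *m q).
Proof.
move=> iq sY; have u := isoJ_unit iq.
have E : J *m invmx q = q^T *m J by rewrite isoJ_invmx // !mulmxA JJ mul1mx.
have E2 : (invmx q)^T *m J = J *m q.
  have := congr1 trmx E; rewrite !trmx_mul JT trmxK //.
rewrite /skewJ !trmx_mul.
have -> : q^T *m (Y^T *m (invmx q)^T) *m J = q^T *m (Y^T *m J) *m q.
  by rewrite -!mulmxA E2.
have -> : J *m (invmx q *m Y *m q) = q^T *m (J *m Y) *m q.
  by rewrite !mulmxA E.
by rewrite -mulmxDl -mulmxDr sY mulmx0 mul0mx.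
Qed.

(** A rational substitute for the exponential: it matches skew matrices with 1 - Y invertible with
    isometries q for which q + 1 is invertible, and both directions are smooth. *)
Definition cayley (Y : 'M[R]_k) : 'M[R]_k := (1%:M + Y) *m invmx (1%:M - Y).
Definition icayley (q : 'M[R]_k) : 'M[R]_k := (q - 1%:M) *m invmx (q + 1%:M).

Lemma isoJ_cayley Y : skewJ Y -> 1%:M - Y \in unitmx -> isoJ (cayley Y).
Proof.
move=> sY u; have YT := skewJ_trE sY.
set U := 1%:M + Y; set V := 1%:M - Y in u *.
have UT : U^T *m J = J *m V.
  by rewrite /U /V linearD /= trmx1 mulmxDl mul1mx YT mulmxBr mulmx1.
have VT : V^T *m J = J *m U.
  by rewrite /U /V linearB /= trmx1 mulmxBl mul1mx YT opprK mulmxDr mulmx1.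
have VU : V *m U = U *m V.
  by rewrite /U mulmxDr mulmxDl mulmx1 mul1mx; congr (_ + _); rewrite /V mulmxBl mulmxBr mul1mx mulmx1.
rewrite /isoJ /cayley -/U -/V trmx_mul trmx_inv -mulmxA -mulmxA [U^T *m _]mulmxA UT.
rewrite -[J *m V *m _]mulmxA [V *m _]mulmxA VU -[U *m V *m _]mulmxA mulmxV // mulmx1 -VT.
by rewrite mulmxA mulVmx ?unitmx_tr // mul1mx.
Qed.

Lemma skewJ_icayley q : isoJ q -> q + 1%:M \in unitmx -> skewJ (icayley q).
Proof.
move=> iq u; set S := q + 1%:M in u *.
have uT : S^T \in unitmx by rewrite unitmx_tr.
(* Multiplying by [S^T] and [S] clears both denominators; what remains is an identity that uses only
   [iq]. *)
have K : S^T *m ((icayley q)^T *m J + J *m icayley q) *m S = 0.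
  rewrite /icayley -/S trmx_mul trmx_inv mulmxDr !mulmxA mulmxV // mul1mx mulmxDl.
  rewrite mulmxKV // /S (linearB (@trmx R k k)) (linearD (@trmx R k k)) /= trmx1.
  rewrite !(mulmxBl, mulmxBr, mulmxDl, mulmxDr) !mul1mx !mulmx1 iq.
  have H (V : zmodType) (j a b : V) : j - a + (b - j) + (j + a - (b + j)) = 0.
    have -> : j + a - (b + j) = a - b by rewrite [j + a]addrC opprD addrACA subrr addr0.
    have -> : j - a + (b - j) = b - a by rewrite addrC addrA subrK.
    by rewrite addrA subrK subrr.
  exact: H.
by rewrite /skewJ -[LHS](mulKmx uT) -[X in _ *m X](mulmxK u) K mul0mx mulmx0.
Qed.

Let two : (2 : R) != 0. Proof. by rewrite pnatr_eq0. Qed.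

Let inv2 (S : 'M[R]_k) : S \in unitmx -> invmx (2 *: invmx S) = 2^-1 *: S.
Proof. by move=> u; rewrite invmxZ ?invmxK // unitmxZ ?unitmx_inv // unitfE. Qed.

Lemma icayley_sub q : q + 1%:M \in unitmx -> 1%:M - icayley q = 2 *: invmx (q + 1%:M).
Proof.
move=> u; rewrite /icayley -{1}(mulmxV u) -mulmxBl opprB [X in X *m _]addrC addrA subrK.
by rewrite -mulr2n -scaler_nat -scalemxAl mul1mx.
Qed.

Lemma icayley_add q : q + 1%:M \in unitmx -> 1%:M + icayley q = 2 *: (q *m invmx (q + 1%:M)).
Proof.
move=> u; rewrite /icayley -{1}(mulmxV u) -mulmxDl addrACA subrr addr0 -mulr2n.
by rewrite -scaler_nat -scalemxAl.
Qed.

Lemma icayley_unit q : q + 1%:M \in unitmx -> 1%:M - icayley q \in unitmx.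
Proof. by move=> u; rewrite icayley_sub // unitmxZ ?unitmx_inv // unitfE. Qed.

Lemma icayleyK q : q + 1%:M \in unitmx -> cayley (icayley q) = q.
Proof.
move=> u; rewrite /cayley icayley_sub // icayley_add // inv2 //.
rewrite -scalemxAl -scalemxAr scalerA divff // scale1r mulmxKV //.
Qed.

Lemma cayley_add Y : 1%:M - Y \in unitmx -> cayley Y + 1%:M = 2 *: invmx (1%:M - Y).
Proof.
move=> u; rewrite /cayley -{3}(mulmxV u) -mulmxDl addrACA subrr addr0 -mulr2n.
by rewrite -scaler_nat -scalemxAl mul1mx.
Qed.

Lemma cayley_unit Y : 1%:M - Y \in unitmx -> cayley Y + 1%:M \in unitmx.
Proof. by move=> u; rewrite cayley_add // unitmxZ ?unitmx_inv // unitfE. Qed.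

Lemma cayleyK Y : 1%:M - Y \in unitmx -> icayley (cayley Y) = Y.
Proof.
move=> u; rewrite /icayley cayley_add // inv2 //.
have -> : cayley Y - 1%:M = 2 *: (Y *m invmx (1%:M - Y)).
  rewrite /cayley -{3}(mulmxV u) -mulmxBl opprB [1%:M + Y]addrC addrACA subrr addr0.
  by rewrite -mulr2n -scaler_nat -scalemxAl.
by rewrite -scalemxAl -scalemxAr scalerA divff // scale1r mulmxKV.
Qed.

End Isometries.

Section LorentzGroup.
Variables (R : realType) (m : nat).
Local Notation J := (gram R m).
Local Notation l := (vec_l R m).

Lemma gram_tr : J^T = J.
Proof.
by rewrite /gram tr_block_mx tr_col_mx tr_row_mx tr_block_mx !trmx0 !trmx1.
Qed.

Lemma gram_mul (a : 'M[R]_1) (r : 'rV[R]_(m + 1)) (X : 'cV[R]_m) (x : 'M[R]_1)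
    (A : 'M[R]_m) (b : 'cV[R]_m) (c : 'rV[R]_m) (d : 'M[R]_1) :
  J *m block_mx a r (col_mx X x) (block_mx A b c d) =
  block_mx x (row_mx c d) (col_mx X a) (col_mx (row_mx A b) r).
Proof.
rewrite /gram mulmx_block !mul0mx !add0r mul_row_col mul0mx mul1mx add0r.
rewrite mul_row_block !mul0mx !mul1mx !add0r mul_col_mx mul0mx mul1mx.
rewrite mul_block_col !mul0mx mul1mx !addr0 mul_col_mx mul0mx mul1mx.
rewrite mulmx_block !mul0mx !mul1mx !addr0 -[X in block_mx _ _ _ (_ + X)]/(block_mx A b 0 0).
rewrite !add_col_mx addr0 add0r.
by rewrite row_mx0 addr0 add0r.
Qed.

Lemma gram_invol : J *m J = 1%:M.
Proof.
rewrite {2}/gram gram_mul.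
rewrite [RHS](scalar_mx_block 1 (m + 1)); congr block_mx.
- by rewrite row_mx0.
- by rewrite col_mx0.
- by rewrite [RHS](scalar_mx_block m 1) /block_mx.
Qed.

Lemma block_decomp (Y : 'M[R]_(1 + (m + 1))) : exists a r X x A b c d,
  Y = block_mx (a : 'M[R]_1) (r : 'rV[R]_(m + 1)) (col_mx (X : 'cV[R]_m) (x : 'M[R]_1))
        (block_mx (A : 'M[R]_m) b c d).
Proof.
exists (ulsubmx Y), (ursubmx Y), (usubmx (dlsubmx Y)), (dsubmx (dlsubmx Y)),
 (ulsubmx (drsubmx Y)), (ursubmx (drsubmx Y)), (dlsubmx (drsubmx Y)), (drsubmx (drsubmx Y)).
by rewrite vsubmxK !submxK.
Qed.

Lemma skewJ_gram Y : skewJ J Y <-> (J *m Y)^T = - (J *m Y).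
Proof.
rewrite /skewJ trmx_mul gram_tr; split=> [/eqP|->]; last by rewrite addNr.
by rewrite addr_eq0 => /eqP.
Qed.

Lemma skew11 (x : 'M[R]_1) : x^T = - x -> x = 0.
Proof.
move=> /matrixP /(_ 0 0); rewrite !mxE => /eqP; rewrite eq_sym -subr_eq0 -opprD oppr_eq0.
rewrite -mulr2n mulrn_eq0 /= => /eqP x0; apply/matrixP => i j.
by rewrite !ord1 mxE.
Qed.

(** The block shape of [lie_mx] is what antisymmetry of [J *m Y] says block by block, [J] merely
    exchanging the first and the last row. From here on g is handled through [skewJ], which is
    visibly stable under the operations that occur. *)
Lemma lie_gP Y : lie_g R m Y <-> skewJ J Y.
Proof.
rewrite skewJ_gram; split=> [[a [X [A [zeta [AT ->]]]]]|].
  rewrite /lie_mx gram_mul tr_block_mx tr_row_mx !tr_col_mx tr_row_mx.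
  rewrite opp_block_mx !linearN /= !trmxK !tr_scalar_mx trmx0 AT.
  rewrite !opp_row_mx !opp_col_mx oppr0 !opprK opp_row_mx opp_row_mx opprK oppr0.
  by rewrite tr_row_mx trmx0 -block_mxEh /block_mx raddfN /= opprK.
have [a [r [X [x [A [b [c [d ->]]]]]]]] := block_decomp Y.
rewrite -[r]hsubmxK; set z := lsubmx r; set z' := rsubmx r.
rewrite gram_mul tr_block_mx opp_block_mx => /eq_block_mx [/skew11 -> E1 _].
rewrite tr_col_mx opp_row_mx in E1; have [EX Ed] := eq_row_mx E1.
rewrite -[col_mx (row_mx A b) _]/(block_mx A b z z') tr_block_mx opp_block_mx.
move=> /eq_block_mx [EA Ez _ /skew11 ->].
exists (a 0 0), X, A, z; split=> //; rewrite /lie_mx.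
have -> : d = (- a 0 0)%:M.
  by rewrite -[LHS]opprK -Ed [a]mx11_scalar tr_scalar_mx mxE eqxx mulr1n raddfN.
have -> : c = - X^T by rewrite EX opprK.
have -> : b = - z^T by rewrite Ez opprK.
by rewrite -mx11_scalar.
Qed.

Lemma lie_mx_l a (X : 'cV[R]_m) A zeta :
  lie_mx a X A zeta *m l = col_mx a%:M (col_mx X 0).
Proof.
by rewrite /lie_mx /vec_l mul_block_col !mulmx0 !addr0 mulmx1 mulmx1.
Qed.

Lemma grading_lie : lie_g R m (grading R m).
Proof. by exists 1, 0, 0, 0; rewrite trmx0 oppr0. Qed.

Lemma grading_l : grading R m *m l = l.
Proof. by rewrite /grading lie_mx_l col_mx0. Qed.

Definition lie_h (Y : 'M[R]_(1 + (m + 1))) : Prop := skewJ J Y /\ Y *m l = 0.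

(** The class of Y in g/h is visible in Y l = (a, X, 0); subtracting the matching elements of RE and
    of g_{-1} leaves an element that kills l. *)
Lemma lie_g_decomp Y : skewJ J Y -> exists (a : R) (X : 'cV[R]_m) (h : 'M[R]_(1 + (m + 1))),
  [/\ lie_h h, Y = a *: grading R m + lie_mx 0 X 0 0 + h & Y *m l = col_mx a%:M (col_mx X 0)].
Proof.
move=> sY; have [a [X [A [z [AT EY]]]]] := (lie_gP Y).2 sY.
have El : Y *m l = col_mx a%:M (col_mx X 0) by rewrite EY lie_mx_l.
exists a, X, (Y - (a *: grading R m + lie_mx 0 X 0 0)); split=> //; last by rewrite addrC subrK.
have s1 : skewJ J (lie_mx 0 X 0 0).
  by apply/lie_gP; exists 0, X, 0, 0; rewrite trmx0 oppr0.
have s2 : skewJ J (a *: grading R m) by apply: skewJZ; apply/lie_gP; exact: grading_lie.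
split; first by apply: skewJD => //; apply: skewJN; exact: skewJD.
rewrite mulmxBl El mulmxDl -scalemxAl grading_l lie_mx_l /vec_l scale_col_mx scaler0 add_col_mx add0r.
by rewrite scalemx1 raddf0 addr0 subrr.
Qed.

Lemma lorentzE (a a' : 'M[R]_1) (X X' : 'cV[R]_m) (b b' : 'M[R]_1) :
  lorentz (col_mx a (col_mx X b)) (col_mx a' (col_mx X' b')) =
  a 0 0 * b' 0 0 + (X^T *m X') 0 0 + b 0 0 * a' 0 0.
Proof.
rewrite /lorentz /gram -mulmxA mul_block_col mul0mx add0r mul_row_col mul0mx add0r mul1mx.
rewrite mul_col_mx mul0mx mul1mx mul_block_col !mul0mx mul1mx !addr0 add_col_mx add0r addr0.
rewrite !tr_col_mx mul_row_col mul_row_col !mxE !big_ord1 !mxE addrA.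
by [].
Qed.

Lemma lorentz_isoJ q : (forall x y, lorentz (q *m x) (q *m y) = lorentz x y) <-> isoJ J q.
Proof.
split=> [H|iq x y]; last by rewrite /lorentz trmx_mul -!mulmxA [q^T *m _]mulmxA [q^T *m J *m _]mulmxA iq.
apply/matrixP => i j.
have D (M : 'M[R]_(1 + (m + 1))) : ((delta_mx i 0 : 'cV_(1 + (m + 1)))^T *m M *m (delta_mx j 0 : 'cV_(1 + (m + 1)))) 0 0 = M i j.
  by rewrite trmx_delta -rowE -colE !mxE.
have := H (delta_mx i 0) (delta_mx j 0).
by rewrite -(D (q^T *m J *m q)) -(D J) /lorentz trmx_mul !mulmxA.
Qed.

Lemma vec_l_neq0 : l != 0.
Proof.
apply/eqP => /matrixP /(_ (lshift _ 0) 0); rewrite /vec_l col_mxEu !mxE eqxx => /eqP.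
by rewrite oner_eq0.
Qed.

Lemma l_future : future_lightcone R m l.
Proof.
split; first exact: vec_l_neq0.
  by rewrite /vec_l -col_mx0 lorentzE trmx0 mul0mx !mxE mulr0 mul0r !addr0.
rewrite /vec_l /vec_n -col_mx0 opp_col_mx add_col_mx opp_col_mx add_col_mx lorentzE trmx0 mul0mx !mxE /=.
by rewrite !subr0 !sub0r mul0r !addr0 mul1r ltrN10.
Qed.

(** The sign of <x, l> decides the time cone, and <q x, l> = <x, l> / t has the same sign. A future
    lightlike x orthogonal to l is a positive multiple of l and is treated apart. Membership in P
    and H thus becomes algebraic. *)
Lemma future_preserved q t : isoJ J q -> 0 < t -> q *m l = t *: l ->
  forall x, future_lightcone R m x -> future_lightcone R m (q *m x).
Proof.
move=> iq t0 ql x; have H := (lorentz_isoJ q).2 iq.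
have dec (y : 'cV[R]_(1 + (m + 1))) : exists (a : 'M[R]_1) (X : 'cV[R]_m) (b : 'M[R]_1), y = col_mx a (col_mx X b).
  by exists (usubmx y), (usubmx (dsubmx y)), (dsubmx (dsubmx y)); rewrite !vsubmxK.
have fut (a b : 'M[R]_1) (X : 'cV[R]_m) : lorentz (col_mx a (col_mx X b)) (l - vec_n R m) = b 0 0 - a 0 0.
  rewrite /vec_l /vec_n -col_mx0 opp_col_mx add_col_mx opp_col_mx add_col_mx lorentzE !oppr0 !addr0 mulmx0 !mxE /=.
  by ring.
have lor (a b : 'M[R]_1) (X : 'cV[R]_m) : lorentz (col_mx a (col_mx X b)) l = b 0 0.
  by rewrite /vec_l -col_mx0 lorentzE mulmx0 !mxE /= mulr0 mulr1 !add0r.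
have self (a b : 'M[R]_1) (X : 'cV[R]_m) : lorentz (col_mx a (col_mx X b)) (col_mx a (col_mx X b)) = 2 * a 0 0 * b 0 0 + (X^T *m X) 0 0.
  by rewrite lorentzE; ring.
have sq0 (X : 'cV[R]_m) : 0 <= (X^T *m X) 0 0.
  by rewrite mxE sumr_ge0 // => i _; rewrite mxE -expr2 sqr_ge0.
have sqz (X : 'cV[R]_m) : (X^T *m X) 0 0 = 0 -> X = 0.
  rewrite mxE => /eqP; rewrite psumr_eq0 => [/allP X0|i _]; last by rewrite mxE -expr2 sqr_ge0.
  apply/colP => i; have := X0 i (mem_index_enum _); rewrite !mxE mulf_eq0 orbb => /eqP ->.
  by [].
move=> [xn0 xx xf]; have qx0 : q *m x != 0.
  apply: contra_neq xn0 => /(congr1 (mulmx (invmx q))).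
  by rewrite (mulKmx (isoJ_unit gram_invol iq)) mulmx0.
have qxx : lorentz (q *m x) (q *m x) = 0 by rewrite H.
split=> //.
have qxl : t * lorentz (q *m x) l = lorentz x l.
  rewrite -(H x l) ql /lorentz -scalemxAr [in RHS]mxE //.
have [a [X [b Ex]]] := dec x; have [a' [X' [b' Eqx]]] := dec (q *m x).
move: xx xf qxx qxl qx0; rewrite Eqx Ex !fut !lor !self => xx xf qxx qxl qx0.
have hX := sq0 X; have hX' := sq0 X'.
have b0 : b 0 0 <= 0 by nra.
have b'0 : b' 0 0 <= 0 by rewrite -(pmulr_rle0 _ t0) qxl.
have [b'n|b'z] := ltP (b' 0 0) 0; first by nra.
have b'e : b' 0 0 = 0 by apply/eqP; rewrite eq_le b'0 b'z.
have be : b 0 0 = 0 by rewrite -qxl b'e mulr0.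
have Xe : X = 0 by apply: sqz; move: xx; rewrite be mulr0 add0r.
have a0 : 0 < a 0 0 by move: xf; rewrite be sub0r oppr_lt0.
have : q *m x = (t * a 0 0) *: l.
  rewrite mulrC -scalerA -ql Ex Xe scalemxAr; congr (_ *m _).
  have -> : b = 0 by apply/matrixP => i j; rewrite !ord1 mxE.
  rewrite col_mx0 /vec_l scale_col_mx scaler0; congr col_mx.
  by rewrite scalemx1 -mx11_scalar.
rewrite Eqx /vec_l scale_col_mx scaler0 => /eq_col_mx [-> _].
by rewrite b'e sub0r !mxE eqxx mulr1 oppr_lt0 mulr_gt0.
Qed.

Lemma groupPE q : groupP R m q <-> isoJ J q /\ exists2 t, 0 < t & q *m l = t *: l.
Proof.
split=> [[[H F] [t qt]]|[iq [t t0 qt]]].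
  split; first exact/lorentz_isoJ.
  exists t => //; have [_ _ lq] := F _ l_future; have [_ _ ln] := l_future.
  have E : lorentz (t *: l) (l - vec_n R m) = t * lorentz l (l - vec_n R m).
    by rewrite /lorentz linearZ /= -!scalemxAl mxE.
  by move: lq; rewrite qt E nmulr_llt0.
split; last by exists t.
by split; [exact/lorentz_isoJ|exact: (future_preserved _ _ qt)].
Qed.

Lemma groupHE q : groupH R m q <-> isoJ J q /\ q *m l = l.
Proof.
split=> [[[H F] qt]|[iq qt]]; first by split=> //; exact/lorentz_isoJ.
split=> //; split; first exact/lorentz_isoJ.
by apply: (@future_preserved q 1) => //; rewrite scale1r.
Qed.

Lemma groupH_P q : groupH R m q -> groupP R m q.
Proof. by move=> /groupHE [iq ql]; apply/groupPE; split=> //; exists 1 => //; rewrite scale1r. Qed.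

Lemma groupP_unit q : groupP R m q -> q \in unitmx.
Proof. by move=> /groupPE [iq _]; exact: (isoJ_unit gram_invol iq). Qed.

Lemma groupPM q r : groupP R m q -> groupP R m r -> groupP R m (q *m r).
Proof.
move=> /groupPE [iq [t t0 qt]] /groupPE [ir [s s0 rs]]; apply/groupPE.
split; first exact: isoJM.
by exists (t * s); rewrite ?mulr_gt0 // -mulmxA rs -scalemxAr qt scalerA mulrC.
Qed.

Lemma scale_inv q t : q \in unitmx -> t != 0 -> q *m l = t *: l -> invmx q *m l = t^-1 *: l.
Proof.
move=> u t0 qt; apply: (scalerI t0); rewrite scalerA divff // scale1r scalemxAr -qt.
by rewrite mulKmx.
Qed.

Lemma groupPV q : groupP R m q -> groupP R m (invmx q).
Proof.
move=> Pq; have u := groupP_unit Pq; have /groupPE [iq [t t0 qt]] := Pq.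
apply/groupPE; split; first exact: (isoJ_inv gram_invol).
by exists t^-1; [rewrite invr_gt0|apply: scale_inv => //; rewrite gt_eqF].
Qed.

Lemma groupHM q r : groupH R m q -> groupH R m r -> groupH R m (q *m r).
Proof.
move=> /groupHE [iq qt] /groupHE [ir rt]; apply/groupHE.
by split; [exact: isoJM|rewrite -mulmxA rt].
Qed.

Lemma groupH1 : groupH R m 1%:M.
Proof. by apply/groupHE; split; [exact: isoJ1|rewrite mul1mx]. Qed.

(** Exhibits the scale as a matrix entry, hence as a smooth function of the group element. *)
Lemma scaleE q t : q *m l = t *: l -> q (lshift (m + 1) 0) (lshift (m + 1) 0) = t.
Proof.
move=> /matrixP /(_ (lshift (m + 1) 0) 0); rewrite /vec_l -[q]submxK mul_block_col mulmx1 mulmx0 addr0.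
by rewrite col_mxEu block_mxEul => ->; rewrite mxE col_mxEu mxE eqxx mulr1.
Qed.

(** There are two first integrals: k J k^T, since [A] is skew, and exp(-lam) k l, since [A]
    multiplies l by the derivative of [lam]. *)
Lemma lsol_group (A : R -> 'M[R]_(1 + (m + 1))) (a lam : R -> R) : continuous A ->
  (forall t, skewJ J (A t)) -> (forall t, A t *m l = a t *: l) ->
  lam 0 = 0 -> (forall t : R, is_derive t (1 : R) lam (a t)) ->
  forall t, isoJ J (lsol A t) /\ lsol A t *m l = expR (lam t) *: l.
Proof.
move=> cA sA Al lam0 Dlam t; have [k0 Dk] := lsolP cA.
set k := lsol A in k0 Dk *.
have const p q (u : R -> 'M[R]_(p, q)) : (forall s : R, is_derive s (1 : R) u 0) -> u t = u 0.
  move=> Du; apply/matrixP => i j.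
  apply: (@derive0_const R (fun s => u s i j)) => s _.
  by have /is_derive_mxP := Du s; move=> /(_ i j); rewrite mxE.
split.
  apply: (isoJ_tr gram_invol).
  have D (s : R) : is_derive s (1 : R) (fun s => k s *m J *m (k s)^T) 0.
    have D1 : is_derive s (1 : R) (fun s => k s *m J) (k s *m A s *m J).
      have := is_derive_mulmx (Dk s) (is_derive_cst J s (1 : R)).
      by rewrite mulmx0 add0r.
    have D2 : is_derive s (1 : R) (fun s => (k s)^T) (k s *m A s)^T.
      apply/is_derive_mxP => i j; rewrite mxE.
      rewrite (_ : (fun x => _) = fun x => k x j i); last by apply/funext => x; rewrite mxE.
      by have /is_derive_mxP := Dk s; exact.
    have := is_derive_mulmx D1 D2; rewrite trmx_mul.
    have -> : k s *m J *m ((A s)^T *m (k s)^T) + k s *m A s *m J *m (k s)^T = 0; last by [].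
    rewrite !mulmxA -mulmxDl -!mulmxA -mulmxDr addrC.
    by rewrite (skewJ_swap gram_invol (sA s)) mulmx0 mul0mx.
  by rewrite (const _ _ _ D) k0 mul1mx trmx1 mulmx1.
have D (s : R) : is_derive s (1 : R) (fun s => (expR (- lam s))%:M *m (k s *m l)) 0.
  have D1 : is_derive s (1 : R) (fun s => k s *m l) (a s *: (k s *m l)).
    have := is_derive_mulmx (Dk s) (is_derive_cst l s (1 : R)).
    by rewrite mulmx0 add0r -mulmxA Al scalemxAr.
  have D2 : is_derive s (1 : R) (fun s => expR (- lam s)) (expR (- lam s) * - a s).
    have Dn : is_derive s (1 : R) (fun s => - lam s) (- a s) by have := Dlam s => ?; exact: is_deriveN.
    exact: (is_derive1_comp (is_derive_expR _) Dn).
  have D3 : is_derive s (1 : R) (fun s => (expR (- lam s))%:M : 'M[R]_(1 + (m + 1))) (expR (- lam s) * - a s)%:M.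
    apply/is_derive_mxP => i j; rewrite mxE.
    have [->|ij] := eqVneq i j.
      by rewrite mulr1n (_ : (fun x => _) = fun x => expR (- lam x)) //; apply/funext => x; rewrite mxE eqxx mulr1n.
    rewrite mulr0n (_ : (fun x => _) = cst 0); first exact: is_derive_cst.
    by apply/funext => x; rewrite mxE (negbTE ij).
  have := is_derive_mulmx D3 D1; rewrite !mul_scalar_mx.
  by rewrite scalerA -scalerDl mulrN addrN scale0r.
have := const _ _ _ D; rewrite k0 mul1mx lam0 oppr0 expR0 mul1mx mul_scalar_mx => E.
by rewrite -[in RHS]E scalerA expRN divff ?scale1r // gt_eqF // expR_gt0.
Qed.

End LorentzGroup.

(** * Curvature in the direction of fundamental fields *)

Section FormCalculus.
Variables (R : realType) (n p q : nat) (D : set 'rV[R]_n)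
  (W : 'rV[R]_n -> 'rV[R]_n -> 'M[R]_(p, q)).
Hypotheses (oD : open D) (Wl : forall x, D x -> linear (W x))
  (Ws : forall v, smooth_open D (fun x => W x v)).

Lemma form_sum x v : D x -> W x v = \sum_i v 0 i *: W x (coord_frame R i).
Proof.
move=> Dx; have l := Wl Dx.
rewrite -[W x v]/(linear_pack l v) {1}(proj2 (coord_frameP R n) v) linear_sum.
by apply: eq_bigr => i _; rewrite linearZ.
Qed.

(** Smoothness of [W] is known only on fixed vectors. Expanding the variable vector in coordinates
    reduces the claim to the product rule for scalars. *)
Lemma derive_form (V : normedModType R) (O : set V) (s r : V -> 'rV[R]_n) z u :
  open O -> O z -> smooth_open O s -> smooth_open O r -> (forall y, O y -> D (s y)) ->
  differentiable (fun y => W (s y) (r y)) z /\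
  'D_u (fun y => W (s y) (r y)) z =
    W (s z) ('D_u r z) + 'D_('D_u s z) (fun x => W x (r z)) (s z).
Proof.
move=> oO Oz ss sr OD; have Dz := OD z Oz.
have nO : \forall y \near z, O y by exact: (open_nbhs_nbhs (conj oO Oz)).
have ds := smooth_differentiable ss Oz; have dr := smooth_differentiable sr Oz.
pose T (i : 'I_n) (y : V) := (r y 0 i : R^o) *: W (s y) (coord_frame R i).
have dri i : differentiable (fun y => r y 0 i : R^o) z.
  by apply: (smooth_differentiable (smooth_coord 0 i oO sr)).
have dWi i : differentiable (fun x => W x (coord_frame R i)) (s z).
  exact: (smooth_differentiable (Ws _)).
have dWs i : differentiable (fun y => W (s y) (coord_frame R i)) z.
  exact: (differentiable_comp ds (dWi i)).
have dT i : differentiable (T i) z by have [] := differentiable_scale (dri i) (dWs i).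
have nE : \forall y \near z, \sum_i T i y = W (s y) (r y).
  by apply: filterS nO => y Oy; rewrite form_sum //; exact: OD.
have dS : differentiable (fun y => \sum_i T i y) z.
  rewrite (_ : (fun y => _) = \sum_i T i); first exact: differentiable_sum.
  by apply/funext => y; rewrite fct_sumE.
have [dF _] := near_eq_differentiable nE dS; split=> //.
rewrite -(near_eq_derive u nE).
have -> : 'D_u (fun y => \sum_i T i y) z = \sum_i 'D_u (T i) z.
  rewrite (_ : (fun y => _) = \sum_i T i); last by apply/funext => y; rewrite fct_sumE.
  by apply: derive_sum => i; exact: diff_derivable.
rewrite (form_sum _ Dz).
have -> : 'D_('D_u s z) (fun x => W x (r z)) (s z) =
    \sum_i r z 0 i *: 'D_('D_u s z) (fun x => W x (coord_frame R i)) (s z).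
  have nD : \forall x \near s z, \sum_i r z 0 i *: W x (coord_frame R i) = W x (r z).
    have : \forall x \near s z, D x by exact: (open_nbhs_nbhs (conj oD Dz)).
    by apply: filterS => x Dx; rewrite -form_sum.
  rewrite -(near_eq_derive _ nD).
  rewrite (_ : (fun x => _) = \sum_i (r z 0 i *: (fun x => W x (coord_frame R i)))); last first.
    by apply/funext => x; rewrite fct_sumE.
  rewrite derive_sum; last by move=> i; apply: derivableZ; exact: diff_derivable.
  by apply: eq_bigr => i _; rewrite deriveZ //; exact: diff_derivable.
rewrite -big_split /=; apply: eq_bigr => i _.
have [_ ->] := differentiable_scale (dri i) (dWs i).
have E1 : 'D_u (fun y => r y 0 i : R^o) z = ('D_u r z) 0 i.
  have drz : derivable r z u by exact: diff_derivable.
  by rewrite (derive_mx drz) mxE.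
have E2 : 'D_u (fun y => W (s y) (coord_frame R i)) z =
    'D_('D_u s z) (fun x => W x (coord_frame R i)) (s z).
  exact: (derive_comp u ds (dWi i)).
rewrite addrC; apply: f_equal2.
  exact: (f_equal (fun w => r z 0 i *: w) E2).
exact: (f_equal (fun a : R => a *: W (s z) (coord_frame R i)) E1).
Qed.

(** Pullback commutes with d: the terms containing second derivatives of [s] agree by Schwarz and
    cancel. *)
Lemma pullback_exterior (V : normedModType R) (O : set V) (s : V -> 'rV[R]_n) z xi eta :
  open O -> O z -> smooth_open O s -> (forall y, O y -> D (s y)) ->
  'D_xi (fun y => W (s y) ('D_eta s y)) z - 'D_eta (fun y => W (s y) ('D_xi s y)) z =
  'D_('D_xi s z) (fun x => W x ('D_eta s z)) (s z)
  - 'D_('D_eta s z) (fun x => W x ('D_xi s z)) (s z).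
Proof.
move=> oO Oz ss OD.
have [_ ->] := derive_form xi oO Oz ss (smooth_derive eta ss) OD.
have [_ ->] := derive_form eta oO Oz ss (smooth_derive xi ss) OD.
rewrite (smooth_schwarz xi eta oO Oz ss) opprD addrACA subrr add0r //.
Qed.

End FormCalculus.

Section PartialDerivatives.
Variables (R : realType) (V W : normedModType R).

Lemma derive_slice_space (K : R^o * V -> W) (t : R) (y v : V) :
  'D_(0, v) K (t, y) = 'D_v (fun x => K (t, x)) y.
Proof.
have E : (fun h : R => h^-1 *: ((K \o shift (t, y)) (h *: (0, v)) - K (t, y)))
       = (fun h : R => h^-1 *: (((fun x => K (t, x)) \o shift y) (h *: v) - K (t, y))).
  apply/funext => h; congr (_ *: (_ - _)); rewrite /shift /=.
  have -> : h *: (0, v) + (t, y) = (t, h *: v + y) :> R^o * V.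
    by congr pair; rewrite /= ?scaler0 ?add0r.
  by [].
by rewrite /derive E.
Qed.

Lemma derive_slice_time (K : R^o * V -> W) (t : R) (y : V) :
  'D_(1, 0) K (t, y) = derive1 (fun s : R => K (s, y)) t.
Proof.
have E : (fun h : R => h^-1 *: ((K \o shift (t, y)) (h *: (1, 0)) - K (t, y)))
       = (fun h : R => h^-1 *: (((fun s : R => K (s, y)) \o shift t) (h *: 1) - K (t, y))).
  apply/funext => h; congr (_ *: (_ - _)); rewrite /shift /=.
  have -> : h *: (1, 0) + (t, y) = (h *: (1 : R^o) + t, y) :> R^o * V.
    by congr pair; rewrite /= scaler0 add0r.
  by [].
by rewrite derive1E /derive E.
Qed.

End PartialDerivatives.

Section VerticalIdentity.
Variables (R : realType) (n k : nat) (D : set 'rV[R]_n)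
  (W : 'rV[R]_n -> 'rV[R]_n -> 'M[R]_k).
Hypotheses (oD : open D) (Wl : forall x, D x -> linear (W x))
  (Ws : forall v, smooth_open D (fun x => W x v)).

(* Cartan's formula L_zeta = d i_zeta + i_zeta d, in coordinates: the flow Psi
   of a fundamental vector field zeta multiplies W by Ad, so that
   d W (zeta, v) = L_zeta W v - d (W zeta) v = - [X, W v]. *)
Lemma vertical_identity (O : set (R^o * 'rV[R]_n)) (Psi : R^o * 'rV[R]_n -> 'rV[R]_n)
    (gam gami : R -> 'M[R]_k) X x0 v :
  open O -> O (0, x0) -> smooth_open O Psi -> (forall z, O z -> D (Psi z)) ->
  gam 0 = 1%:M -> gami 0 = 1%:M ->
  is_derive (0 : R) (1 : R) gam X -> is_derive (0 : R) (1 : R) gami (- X) ->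
  (forall t x, O (t, x) -> W (Psi (t, x)) ('D_(0, v) Psi (t, x)) = gami t *m W x v *m gam t) ->
  (forall x, O (0, x) -> Psi (0, x) = x) ->
  (forall x, O (0, x) -> W x ('D_(1, 0) Psi (0, x)) = X) ->
  'D_('D_(1, 0) Psi (0, x0)) (fun x => W x v) x0
  - 'D_v (fun x => W x ('D_(1, 0) Psi (0, x0))) x0
  + bracket X (W x0 v) = 0.
Proof.
move=> oO O0 sP OD g0 gi0 Dg Dgi Eq P0 F0.
set zeta := 'D_(1, 0) Psi (0, x0).
have nO : \forall z \near (0 : R^o, x0), O z by exact: (open_nbhs_nbhs (conj oO O0)).
have nOx : \forall x \near x0, O (0, x).
  have c : {for x0, continuous (fun x => (0 : R^o, x))}.
    by apply: (@continuous_pair_at _ _ _ (fun=> 0 : R^o) (@id 'rV[R]_n) x0); [exact: cst_continuous|exact: cvg_id].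
  exact: (c _ nO).
have nOt : \forall t \near (0 : R), O (t, x0).
  have c : {for (0 : R), continuous (fun t : R => (t : R^o, x0))}.
    by apply: (@continuous_pair_at _ _ _ (fun t : R => t : R^o) (fun=> x0) 0); [exact: cvg_id|exact: cst_continuous].
  exact: (c _ nO).
have Dv : 'D_(0, v) Psi (0, x0) = v.
  rewrite derive_slice_space (@near_eq_derive _ _ _ _ id x0 v) ?derive_id //.
  by apply: filterS nOx => x Ox; rewrite P0.
have Dz w : 'D_w (fun z => W (Psi z) ('D_(1, 0) Psi z)) (0, x0) =
    W x0 ('D_w ('D_(1, 0) Psi) (0, x0)) + 'D_('D_w Psi (0, x0)) (fun x => W x zeta) x0.
  by have [_ ->] := derive_form oD Wl Ws w oO O0 sP (smooth_derive ((1, 0) : R^o * 'rV[R]_n) sP) OD; rewrite P0.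
(* The form takes the constant value X on the field at time 0; this is differentiated in direction
   [v]. *)
have A1 : W x0 ('D_(0, v) ('D_(1, 0) Psi) (0, x0)) + 'D_v (fun x => W x zeta) x0 = 0.
  rewrite -{2}Dv -Dz derive_slice_space (@near_eq_derive _ _ _ _ (cst X) x0 v) ?derive_cst //.
  by apply: filterS nOx => x Ox; rewrite P0 // F0.
(* Equivariance is differentiated in time at 0; the right side becomes a commutator. *)
have A2 : W x0 ('D_(1, 0) ('D_(0, v) Psi) (0, x0)) + 'D_zeta (fun x => W x v) x0
    = W x0 v *m X - X *m W x0 v.
  have [_ E] := derive_form oD Wl Ws ((1, 0) : R^o * 'rV[R]_n) oO O0 sP (smooth_derive ((0, v) : R^o * 'rV[R]_n) sP) OD.
  rewrite P0 // Dv in E; rewrite -E derive_slice_time derive1E.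
  have nE : \forall t \near (0 : R), gami t *m W x0 v *m gam t = W (Psi (t, x0)) ('D_(0, v) Psi (t, x0)).
    by apply: filterS nOt => t Ot; rewrite Eq.
  have D1 := is_derive_mulmx Dgi (is_derive_cst (W x0 v) (0 : R) (1 : R)).
  have [_ ->] := near_eq_is_derive nE (is_derive_mulmx D1 Dg).
  by rewrite g0 gi0 mul1mx mulmx1 mulmx0 add0r mulNmx.
(* By Schwarz both identities contain the same term, the form on the derivative of the field;
   eliminating it proves the claim. *)
rewrite (smooth_schwarz ((0, v) : R^o * 'rV[R]_n) ((1, 0) : R^o * 'rV[R]_n) oO O0 sP) in A2.
rewrite /bracket; move: A1 A2.
set w1 := W x0 ('D_(0, v) _ _); set w2 := 'D_v _ _; set w3 := 'D_zeta _ _.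
set a := X *m _; set b := _ *m X.
move=> /eqP; rewrite addrC addr_eq0 => /eqP -> /eqP; rewrite eq_sym -subr_eq => /eqP <-.
have H (U : zmodType) (x y w : U) : w - - (x - y - w) + (y - x) = 0.
  by rewrite opprK [w + _]addrC subrK addrA subrK subrr.
exact: H.
Qed.

End VerticalIdentity.

(** * Smooth maps and the group action in charts *)

Section Charts.
Variable R : realType.

Lemma within_comp (T U V : topologicalType) (D : set U) (f : U -> V) (h : T -> U) z0 :
  {within D, continuous f} -> D (h z0) -> (\forall z \near z0, D (h z)) ->
  {for z0, continuous h} -> {for z0, continuous (f \o h)}.
Proof.
move=> /subspace_continuousP cf Dz nD ch P nP.
have := cf _ Dz _ nP => H; have {}H : \forall y \near h z0, D y -> P (f y) by exact: H.
have nh := ch _ H.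
by apply: filterS2 nD nh => z Dhz /(_ Dhz).
Qed.

Lemma open_prod (T U : topologicalType) (A : set T) (D : set U) :
  open A -> open D -> open (A `*` D).
Proof.
move=> oA oD; rewrite openE => -[x y] [/= Ax Dy]; exists (A, D) => //.
by split; exact: open_nbhs_nbhs.
Qed.

Lemma within_open_at (T U : topologicalType) (D : set T) (f : T -> U) x :
  open D -> {within D, continuous f} -> D x -> {for x, continuous f}.
Proof.
move=> oD cf Dx; move: cf; rewrite continuous_open_subspace // => cf.
by apply: cf; rewrite inE.
Qed.

Variables (T T' : topologicalType) (E E' : normedModType R).
Variables (c : chart T E) (c' : chart T' E').
Hypotheses (Hc : is_chart c) (Hc' : is_chart c').

Lemma chart_dom_open : open (dom c). Proof. by case: Hc. Qed.
Lemma chart_img_open : open (img c). Proof. by case: Hc. Qed.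
Lemma chart_img x : dom c x -> img c (crd c x).
Proof. by case: Hc => _ _ H _ _ /H []. Qed.
Lemma chart_K x : dom c x -> cinv c (crd c x) = x.
Proof. by case: Hc => _ _ H _ _ /H []. Qed.
Lemma chart_dom y : img c y -> dom c (cinv c y).
Proof. by case: Hc => _ _ _ H _ /H []. Qed.
Lemma chart_invK y : img c y -> crd c (cinv c y) = y.
Proof. by case: Hc => _ _ _ H _ /H []. Qed.

Lemma crd_continuous x : dom c x -> {for x, continuous (crd c)}.
Proof. by case: Hc => od _ _ _ [cc _]; exact: within_open_at. Qed.

Lemma cinv_continuous y : img c y -> {for y, continuous (cinv c)}.
Proof. by case: Hc => _ oi _ _ [_ ci]; exact: within_open_at. Qed.

Lemma near_dom x : dom c x -> \forall y \near x, dom c y.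
Proof. by move=> dx; exact: (open_nbhs_nbhs (conj chart_dom_open dx)). Qed.

Lemma near_img y : img c y -> \forall z \near y, img c z.
Proof. by move=> dy; exact: (open_nbhs_nbhs (conj chart_img_open dy)). Qed.

Lemma smooth_map_open (A : set (chart T E)) (A' : set (chart T' E')) (D : set T) f :
  open D -> smooth_map A A' D f -> A c -> A' c' ->
  let S := [set y | [/\ img c y, D (cinv c y) & dom c' (f (cinv c y))]] in
  open S /\ smooth_open S (crd c' \o f \o cinv c).
Proof.
move=> oD [cf sf] Ac Ac' S.
have oS : open S.
  rewrite openE => y [iy Dy dy]; rewrite /interior.
  have ci := cinv_continuous iy.
  have nD : \forall z \near y, D (cinv c z) by exact: (ci _ (open_nbhs_nbhs (conj oD Dy))).
  have cfi : {for y, continuous (f \o cinv c)} by exact: within_comp.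
  have nd : \forall z \near y, dom c' (f (cinv c z)).
    have od : open (dom c') by case: Hc'.
    exact: (cfi _ (open_nbhs_nbhs (conj od dy))).
  have ni := near_img iy.
  by apply: filterS3 ni nD nd => z.
by split=> //; apply: smooth_on_open => //; exact: sf.
Qed.

End Charts.

Lemma manifold_chart (R : realType) (M : manifold R) c : atlas M c -> is_chart c.
Proof. by move=> Ac; case: (atlas_smooth M) => H _ _; exact: H. Qed.

Lemma manifold_cover (R : realType) (M : manifold R) (x : M) : exists2 c, atlas M c & dom c x.
Proof. by case: (atlas_smooth M) => _ H _; exact: H. Qed.

Lemma vec_chart_is_chart (R : realType) (E : normedModType R) : is_chart (vec_chart E).
Proof.
split=> //=; [exact: openT|exact: openT|].
by split; apply: continuous_subspaceT => x; exact: cvg_id.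
Qed.

Lemma prod_chart_is_chart (R : realType) (T T' : topologicalType) (E E' : normedModType R)
    (c : chart T E) (c' : chart T' E') : is_chart c -> is_chart c' -> is_chart (prod_chart c c').
Proof.
move=> Hc Hc'.
have od : open (dom c `*` dom c') by apply: open_prod; exact: chart_dom_open.
have oi : open (img c `*` img c') by apply: open_prod; exact: chart_img_open.
split=> //=.
- move=> [x y] [/= dx dy]; split; first by split; exact: chart_img.
  by rewrite !chart_K.
- move=> [x y] [/= dx dy]; split; first by split; exact: chart_dom.
  by rewrite !chart_invK.
split; rewrite continuous_open_subspace // => -[x y]; rewrite inE => -[/= dx dy].
- apply: (@continuous_pair_at _ _ _ (crd c \o fst) (crd c' \o snd)).
    apply: (@continuous_comp _ _ _ fst (crd c)); [exact: cvg_fst|exact: crd_continuous].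
  by apply: (@continuous_comp _ _ _ snd (crd c')); [exact: cvg_snd|exact: crd_continuous].
- apply: (@continuous_pair_at _ _ _ (cinv c \o fst) (cinv c' \o snd)).
    apply: (@continuous_comp _ _ _ fst (cinv c)); [exact: cvg_fst|exact: cinv_continuous].
  by apply: (@continuous_comp _ _ _ snd (cinv c')); [exact: cvg_snd|exact: cinv_continuous].
Qed.

Section VerticalCurvature.
Variables (R : realType) (k : nat) (J : 'M[R]_k).
Hypothesis JJ : J *m J = 1%:M.
Variables (g Q : set 'M[R]_k) (B : manifold R) (act : B -> 'M[R]_k -> B)
  (w : preform B 'M[R]_k).
Hypothesis QJ : forall q, Q q -> isoJ J q.
Hypothesis act_smooth :
  smooth_map (prod_atlas (atlas B) (vec_atlas 'M[R]_k)) (atlas B)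
    [set bq | Q bq.2] (fun bq => act bq.1 bq.2).
Hypothesis act1 : forall b, act b 1%:M = b.
Hypothesis conn : cartan_connection g Q act w.

Lemma form_linear c x : atlas B c -> img c x -> linear (w c (cinv c x)).
Proof.
move=> Ac ix; case: conn => [[H _ _] _ _ _]; apply: H => //.
exact: (chart_dom (manifold_chart Ac) ix).
Qed.

Lemma form_smooth c v : atlas B c -> smooth_open (img c) (fun x => w c (cinv c x) v).
Proof.
move=> Ac; case: conn => [[_ _ H] _ _ _]; apply: smooth_on_open; last exact: H.
exact: (chart_img_open (manifold_chart Ac)).
Qed.

Lemma form_inj c u v1 v2 : atlas B c -> dom c u -> w c u v1 = w c u v2 -> v1 = v2.
Proof.
move=> Ac du; case: conn => _ H _ _; have [_ inj _] := H c u Ac du.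
by move=> E; apply: inj => //; rewrite inE.
Qed.

Lemma form_surj c u X : atlas B c -> dom c u -> g X -> w c u (const_field w X c u) = X.
Proof.
move=> Ac du gX; case: conn => _ H _ _; have [_ _ /(_ X gX) [v _ Ev]] := H c u Ac du.
exact: (@xgetI _ 0 [set v | w c u v = X] v Ev).
Qed.

Lemma form_in c u v : atlas B c -> dom c u -> g (w c u v).
Proof.
by move=> Ac du; case: conn => _ H _ _; have [f _ _] := H c u Ac du; exact: f.
Qed.

(** Smoothness on [Q] means existence of local smooth extensions; [F] extends the action to an open
    set of matrices and has a meaning only over [Q]. It permits differentiation in the group
    variable without charts of [Q]. *)
Lemma action_chart c x0 (q0 : 'M[R]_k) c' : atlas B c -> atlas B c' -> img c x0 -> Q q0 ->
  dom c' (act (cinv c x0) q0) ->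
  exists (O : set ('rV[R]_(mdim B) * 'M[R]_k)) (F : 'rV[R]_(mdim B) * 'M[R]_k -> 'rV[R]_(mdim B)),
  [/\ open O, O (x0, q0), smooth_open O F &
   forall x q, O (x, q) -> Q q -> [/\ img c x, dom c' (act (cinv c x) q) & F (x, q) = crd c' (act (cinv c x) q)]].
Proof.
move=> Ac Ac' ix0 Qq0 d0; have Hc := manifold_chart Ac; have Hc' := manifold_chart Ac'.
case: (act_smooth) => cact sact.
have Ap : prod_atlas (atlas B) (vec_atlas 'M[R]_k) (prod_chart c (vec_chart 'M[R]_k)).
  by exists c, (vec_chart _).
have [|O0 [F [oO O0x sF FE]]] := sact _ _ Ap Ac' (x0, q0); first by split.
have ci : {for (x0, q0), continuous (cinv (prod_chart c (vec_chart 'M[R]_k)))}.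
  by apply: (cinv_continuous (prod_chart_is_chart Hc (vec_chart_is_chart _))).
have [U [oU Ux HU]] : exists U, [/\ open U, U (x0, q0) & forall x q, U (x, q) -> Q q -> dom c' (act (cinv c x) q)].
  move/subspace_continuousP : cact => /(_ (cinv c x0, q0) Qq0) H.
  have {}H := H _ (near_dom Hc' d0).
  have {}H : \forall bq \near (cinv c x0, q0), Q bq.2 -> dom c' (act bq.1 bq.2) by exact: H.
  have {}H : \forall z \near (x0, q0), Q z.2 -> dom c' (act (cinv c z.1) z.2) by exact: (ci _ H).
  exists (interior [set z | Q z.2 -> dom c' (act (cinv c z.1) z.2)]); split.
  - exact: open_interior.
  - exact: H.
  - by move=> x q /interior_subset /=; apply.
exists (O0 `&` U `&` (img c `*` setT)), F; split.
- apply: openI; first exact: openI.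
  by apply: open_prod; [exact: chart_img_open|exact: openT].
- by [].
- by apply: smooth_sub sF => z [[]].
- move=> x q [[Ox Uq] [/= ix _]] Qq; have dxq := HU _ _ Uq Qq; split=> //.
  by rewrite FE.
Qed.

(** The action along [gam], read in one chart, is a family [Psi] as in [vertical_identity]; its
    velocity at [u] is [v1] because the form is injective on tangent vectors. *)
Lemma vertical_curvature gam c u v1 v2 : curve_at_1 Q gam -> atlas B c -> dom c u ->
  w c u v1 = derive1 gam 0 -> curvature w c u v1 v2 = 0.
Proof.
move=> cg Ac du wv1; have [sg Qg g0] := cg.
have Hc := manifold_chart Ac.
have sgam : smooth_open setT (gam : R^o -> 'M[R]_k) by apply: smooth_on_open; [exact: openT|].
set X := derive1 gam 0 in wv1.
have Dgam : is_derive (0 : R) (1 : R) gam X.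
  have dg : differentiable (gam : R^o -> 'M[R]_k) 0 by exact: (smooth_differentiable sgam).
  by apply: DeriveDef; [exact/derivable1_diffP|rewrite /X derive1E].
pose gami (t : R) : 'M[R]_k := J *m (gam t)^T *m J.
have gamiK t : gami t *m gam t = 1%:M by apply: isoJ_inv_mul => //; exact: QJ.
have gami0 : gami 0 = 1%:M by rewrite -[LHS]mulmx1 -g0 gamiK.
have Dgami : is_derive (0 : R) (1 : R) gami (- X).
  have DT : is_derive (0 : R) (1 : R) (fun t => (gam t)^T) X^T.
    apply/is_derive_mxP => i j; rewrite mxE.
    rewrite (_ : (fun x => _) = fun x => gam x j i); last by apply/funext => x; rewrite mxE.
    by have /is_derive_mxP := Dgam; exact.
  have D1 := is_derive_mulmx (is_derive_cst J (0 : R) (1 : R)) DT.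
  have D2 := is_derive_mulmx D1 (is_derive_cst J (0 : R) (1 : R)).
  set Y := (X in is_derive _ _ _ X) in D2.
  have D3 := is_derive_mulmx D2 Dgam.
  (* The derivative of the inverse is found by differentiating [gami t *m gam t = 1%:M]. *)
  have E : (fun s => (cst J s *m (gam s)^T) *m cst J s *m gam s) = cst (1%:M : 'M[R]_k).
    by apply/funext => t; exact: gamiK.
  have D4 : is_derive (0 : R) (1 : R) (fun s => (cst J s *m (gam s)^T) *m cst J s *m gam s) 0.
    by rewrite E; exact: is_derive_cst.
  have [_ E3] := D3; have [_ E4] := D4; rewrite E4 in E3.
  move/eqP: E3; rewrite eq_sym -/(gami 0) gami0 g0 mul1mx mulmx1 addrC addr_eq0 => /eqP EY.
  by rewrite -EY; exact: D2.
have ix0 := chart_img Hc du; set x0 := crd c u in ix0.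
have Q1 : Q 1%:M by rewrite -g0.
have uE : cinv c x0 = u by exact: chart_K.
have [|O1 [F [oO1 O1x sF FE]]] := @action_chart c x0 1%:M c Ac Ac ix0 Q1.
  by rewrite uE act1.
pose h (z : R^o * 'rV[R]_(mdim B)) := (z.2, gam z.1).
pose Psi := F \o h.
pose O : set (R^o * 'rV[R]_(mdim B)) := [set z | O1 (h z)].
have sh : smooth_open setT h.
  apply: smooth_pair; first exact: openT; first exact: smooth_snd.
  by apply: (@smooth_comp R _ R^o _ _ setT setT fst gam) => //; [exact: openT|exact: smooth_fst].
have oO : open O.
  have := open_preimage_within openT (fun z _ => smooth_continuous sh (I : setT z)) oO1.
  by rewrite (_ : [set x | _] = O) //; apply/seteqP; split=> z // [].
have Ox0 : O (0, x0) by rewrite /O /h /= g0.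
have sP : smooth_open O Psi.
  by apply: (@smooth_comp R _ _ _ _ O O1) => //; apply: smooth_sub sh.
pose W x v := w c (cinv c x) v.
have PE t x : O (t, x) -> [/\ img c x, dom c (act (cinv c x) (gam t)) & Psi (t, x) = crd c (act (cinv c x) (gam t))].
  by move=> Otx; exact: FE.
have nOx t x : O (t, x) -> \forall y \near x, O (t, y).
  move=> Otx; have ct : {for x, continuous (fun y : 'rV[R]_(mdim B) => (t, y))}.
    by apply: (@continuous_pair_at _ _ _ (fun=> t) (@id 'rV[R]_(mdim B)) x); [exact: cst_continuous|exact: cvg_id].
  exact: (ct _ (open_nbhs_nbhs (conj oO Otx))).
have nOt x : O (0, x) -> \forall t \near (0 : R), O (t, x).
  move=> O0x; have ct : {for (0 : R), continuous (fun t : R => (t : R^o, x))}.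
    by apply: (@continuous_pair_at _ _ _ (fun t : R => t : R^o) (fun=> x) 0); [exact: cvg_id|exact: cst_continuous].
  exact: (ct _ (open_nbhs_nbhs (conj oO O0x))).
case: (conn) => [_ _ Heq Hfund].
have K1 : forall t x, O (t, x) -> W (Psi (t, x)) ('D_(0, v2) Psi (t, x)) = gami t *m W x v2 *m gam t.
  move=> t x Otx; have [ix dxt EP] := PE t x Otx.
  have u1 : gam t \in unitmx by exact: (isoJ_unit JJ (QJ (Qg t))).
  have -> : gami t = invmx (gam t) by rewrite (isoJ_invmx JJ (QJ (Qg t))).
  have dx := chart_dom Hc ix.
  rewrite /W -(Heq c c (cinv c x) (gam t) v2 Ac Ac (Qg t) dx dxt).
  rewrite EP chart_K //; congr (w c _ _).
  rewrite /tangent_map chart_invK // derive_slice_space.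
  have nE : \forall y \near x, Psi (t, y) = (crd c \o (act^~ (gam t)) \o cinv c) y.
    by apply: filterS (nOx t x Otx) => y Oty; have [_ _ ->] := PE t y Oty.
  have dP : differentiable (fun y => Psi (t, y)) x.
    have dPsi := smooth_differentiable sP Otx.
    have dpair : differentiable (fun y : 'rV[R]_(mdim B) => (t, y)) x.
      apply: differentiable_pair; first exact: differentiable_cst.
      by have [] := is_diff_id x.
    exact: (differentiable_comp dpair dPsi).
  have [d2 E2] := near_eq_differentiable nE dP.
  by apply: etrans (deriveE _ d2); exact: near_eq_derive.
have K2 : forall x, O (0, x) -> Psi (0, x) = x.
  by move=> x O0x; have [ix _ ->] := PE 0 x O0x; rewrite g0 act1 chart_invK.
have K3 : forall x, O (0, x) -> W x ('D_(1, 0) Psi (0, x)) = X.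
  move=> x O0x; have [ix _ _] := PE 0 x O0x; have dx := chart_dom Hc ix.
  rewrite /X -(Hfund c (cinv c x) gam Ac dx cg) /W; congr (w c _ _).
  rewrite derive_slice_time !derive1E; apply: near_eq_derive.
  by apply: filterS (nOt x O0x) => t Otx; have [_ _ ->] := PE t x Otx.
have Wl : forall x, img c x -> linear (W x) by move=> x; exact: form_linear.
have Ws : forall v, smooth_open (img c) (fun x => W x v) by move=> v; exact: form_smooth.
have OD : forall z, O z -> img c (Psi z).
  by move=> [t x] Otx; have [_ dxt ->] := PE t x Otx; exact: chart_img.
have := vertical_identity (chart_img_open Hc) Wl Ws oO Ox0 sP OD g0 gami0 Dgam Dgami K1 K2 K3.
have -> : 'D_(1, 0) Psi (0, x0) = v1.
  by apply: (form_inj Ac du); rewrite wv1 -(K3 x0 Ox0) /W uE.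
by rewrite /W uE /curvature /ext_deriv -/x0 -wv1.
Qed.

End VerticalCurvature.

(** * Naturality of the curvature *)

Section ExponentialCurves.
Variables (R : realType) (m : nat).
Local Notation l := (vec_l R m).

(** The one-parameter group of X, obtained as the solution of k' = k X. Its scale is exp(t a), so
    for a = 0 the same curve lies in H; every element of the Lie algebra of P or H is thus a
    velocity to which the axiom on fundamental fields applies. *)
Lemma exp_curve (X : 'M[R]_(1 + (m + 1))) (a : R) :
  skewJ (gram R m) X -> X *m l = a *: l ->
  exists gam, [/\ curve_at_1 (groupP R m) gam, derive1 gam 0 = X &
    a = 0 -> curve_at_1 (groupH R m) gam].
Proof.
move=> sX Xl; have cX : continuous (cst X : R -> 'M[R]_(1 + (m + 1))) by move=> t; exact: cst_continuous.
pose gam := lsol (cst X); exists gam.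
have Dlam (t : R) : is_derive t (1 : R) (fun s : R => s * a) a.
  have -> : (fun s : R => s * a) = a \*: (@id R) by apply/funext => s /=; rewrite mulrC.
  have := is_deriveZ a (is_derive_id t (1 : R)); rewrite /GRing.scale /= mulr1; exact.
have G := @lsol_group R m (cst X) (cst a) (fun s => s * a) cX (fun=> sX) (fun=> Xl) (mul0r a) Dlam.
have [g0 Dg] := lsolP cX.
have sg : smooth_on setT (gam : R^o -> 'M[R]_(1 + (m + 1))).
  apply: (@smooth_open_on _ _ _ setT) => //; first exact: openT.
  (* The constant coefficient is given a dummy parameter, so that smoothness of parametric solutions
     covers smoothness in time. *)
  have sA : smooth_open setT (cst X : R^o * R^o -> 'M[R]_(1 + (m + 1))) by exact: smooth_cst.
  have sp := psol_smooth (findim_real R) sA.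
  apply: (@smooth_comp R R^o (R^o * R^o)%type _ _ setT setT (fun t : R^o => (t, 0 : R^o)) (psol (cst X))) => //; first exact: openT.
  by apply: smooth_pair; [exact: openT|exact: smooth_id|exact: smooth_cst].
split.
- split=> // t; have [it tl] := G t; apply/groupPE; split=> //.
  by exists (expR (t * a)); [exact: expR_gt0|].
- by have [_] := Dg 0; rewrite derive1E => ->; rewrite g0 mul1mx.
- move=> a0; split=> // t; have [it tl] := G t; apply/groupHE; split=> //.
  by rewrite tl a0 mulr0 expR0 scale1r.
Qed.

End ExponentialCurves.

Section CurvatureNaturality.
Variables (R : realType) (k : nat) (B B' : manifold R) (w : preform B 'M[R]_k)
  (w' : preform B' 'M[R]_k) (U : set B) (F : B -> B').
Hypotheses (oU : open U) (sF : smooth_map (atlas B) (atlas B') U F)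
  (wl : forall c x, atlas B' c -> img c x -> linear (w' c (cinv c x)))
  (ws : forall c v, atlas B' c -> smooth_open (img c) (fun x => w' c (cinv c x) v))
  (Fw : forall c c' b v, atlas B c -> atlas B' c' -> U b -> dom c b -> dom c' (F b) ->
          w' c' (F b) (tangent_map F c c' b v) = w c b v).

(** By [Fw] the form w is the pullback of w' in coordinates; [pullback_exterior] takes care of d,
    and the brackets agree pointwise. *)
Lemma curvature_pullback c c' u v1 v2 : atlas B c -> atlas B' c' -> U u -> dom c u -> dom c' (F u) ->
  curvature w c u v1 v2 =
  curvature w' c' (F u) (tangent_map F c c' u v1) (tangent_map F c c' u v2).
Proof.
move=> Ac Ac' Uu du du'; have Hc := manifold_chart Ac; have Hc' := manifold_chart Ac'.
have [oS sS] := smooth_map_open Hc Hc' oU sF Ac Ac'.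
set S := [set y | _] in oS sS; set s := crd c' \o F \o cinv c in sS.
set x := crd c u; have uE : cinv c x = u by exact: chart_K.
have Sx : S x by split; rewrite ?uE //; exact: chart_img.
have WE y v : S y -> w c (cinv c y) v = w' c' (cinv c' (s y)) ('D_v s y).
  move=> Sy; have [iy Uy dy] := Sy.
  rewrite -(Fw v Ac Ac' Uy (chart_dom Hc iy) dy) /s /= chart_K //; congr (w' c' _ _).
  rewrite /tangent_map chart_invK //; apply: esym; apply: deriveE.
  exact: (smooth_differentiable sS Sy).
have nS : \forall y \near x, S y by exact: (open_nbhs_nbhs (conj oS Sx)).
have sx : s x = crd c' (F u) by rewrite /s /= uE.
have TE v : tangent_map F c c' u v = 'D_v s x.
  by apply: esym; apply: deriveE; exact: (smooth_differentiable sS Sx).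
have E (v v' : 'rV[R]_(mdim B)) : 'D_v (fun y => w c (cinv c y) v') x
    = 'D_v (fun y => w' c' (cinv c' (s y)) ('D_v' s y)) x.
  by apply: near_eq_derive; apply: filterS nS => y Sy; exact: WE.
have SD y : S y -> img c' (s y) by move=> [_ _ d]; exact: chart_img.
have PE := pullback_exterior (chart_img_open Hc') (fun x => @wl c' x Ac') (fun v => @ws c' v Ac') v1 v2 oS Sx sS SD.
have F1 := Fw v1 Ac Ac' Uu du du'; have F2 := Fw v2 Ac Ac' Uu du du'.
apply: (@f_equal2 _ _ _ (fun a b : 'M[R]_k => a + b)); last by rewrite F1 F2.
apply: etrans (f_equal2 (fun a b : 'M[R]_k => a - b) (E v1 v2) (E v2 v1)) _.
by apply: etrans PE _; rewrite -!TE sx.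
Qed.

End CurvatureNaturality.

Section Forward.
Variables (R : realType) (m : nat) (B N : manifold R) (p : B -> N)
  (act : B -> 'M[R]_(1 + (m + 1)) -> B) (w : preform B 'M[R]_(1 + (m + 1))).
Hypothesis hw : lightlike_cartan_geometry p act w.

Lemma curvature_of_bundle_of_scales : locally_bundle_of_scales p act w ->
  forall (c : chart B 'rV[R]_(mdim B)) (u : B) v1 v2, atlas B c -> dom c u ->
    w c u v1 = grading R m -> curvature w c u v1 v2 = 0.
Proof.
move=> lb c u v1 v2 Ac du wv1.
have [U [oU Ux [D [M [pi [act' [w' [cg' H]]]]]]]] := lb (p u).
have [cM [_ sact [act1 _ _] _] conn'] := cg'.
have {H} [N' [q [U' [_ _ [F [f [dF _ _ _ HF]]]]]]] := H.
have [sF _ _] := dF.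
have [c' Ac' du'] := manifold_cover (F u).
have oV : open (p @^-1` U).
  case: hw => [_ [[cp _] _ _ _] _]; apply: open_comp => // x _.
  exact: (within_open_at openT cp).
have Fw : forall c c' b v, atlas B c -> atlas D c' -> (p @^-1` U) b -> dom c b -> dom c' (F b) ->
          w' c' (F b) (tangent_map F c c' b v) = w c b v by move=> *; exact: HF.
rewrite (curvature_pullback oV sF _ _ Fw v1 v2 Ac Ac' Ux du du').
- have sE : skewJ (gram R m) (grading R m) by apply/lie_gP; exact: grading_lie.
  have [|gam [cg Dg _]] := @exp_curve R m (grading R m) 1 sE; first by rewrite scale1r grading_l.
  apply: (vertical_curvature (@gram_invol R m) _ sact act1 conn' _ cg Ac' du').
    by move=> r /groupPE [].
  by rewrite Fw // wv1 Dg.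
- by move=> *; exact: (form_linear conn').
- by move=> c0 v Ac0; apply: (form_smooth conn').
Qed.

End Forward.

(** * Flow box of the grading direction *)

Lemma derive_linear (R : realType) (V W : normedModType R) {hV : findim V}
    (L : {linear V -> W}) y w : 'D_w L y = L w.
Proof.
have cL : continuous L by exact: findim_linear_continuous.
by rewrite deriveE ?(diff_lin _ cL) //; exact: linear_differentiable.
Qed.

Lemma derive_snd (R : realType) (U V W : normedModType R) {hV : findim V} {hW : findim W}
    (f : U -> V * W) x v : differentiable f x -> 'D_v (snd \o f) x = ('D_v f x).2.
Proof.
move=> df.
have E w y : 'D_w (@snd V W) y = w.2 by exact: (derive_linear (@snd V W : {linear (V * W)%type -> W})).
rewrite derive_comp // ?E //.
by apply: linear_differentiable; exact: findim_linear_continuous.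
Qed.

Section TimeChange.
Variable R : realType.

Lemma is_derive_time_slice (V : normedModType R) m n (K : R^o * V -> 'M[R]_(m, n)) (t : R) y :
  differentiable K (t, y) -> is_derive t (1 : R) (fun s : R => K (s, y)) ('D_(1, 0) K (t, y)).
Proof.
move=> dK; rewrite derive_slice_time derive1E; apply: DeriveDef => //.
apply/derivable1_diffP.
apply: (@differentiable_comp _ _ _ _ (fun s : R^o => (s, y)) K) => //.
Qed.

(** Both sides solve x' = c(t) Y(x) with the same initial value, and Gronwall identifies them. *)
Lemma flow_time_change n (Y : 'rV[R]_n -> 'rV[R]_n) (L : R) (u : R -> 'rV[R]_n) (c C : R -> R) :
  0 < L -> (forall x y, `|Y x - Y y| <= L * `|x - y|) -> smooth_open setT Y ->
  continuous c -> C 0 = 0 -> (forall t : R, is_derive t (1 : R) C (c t)) ->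
  (forall t : R, is_derive t (1 : R) u (c t *: Y (u t))) ->
  forall t, u t = flow Y (C t, u 0).
Proof.
move=> L0 Ylip Ysm cc C0 DC Du t.
have [f0 Df] := flowP L0 Ylip Ysm (u 0).
pose v s := flow Y (C s, u 0).
have Dv (s : R) : is_derive s (1 : R) v (c s *: Y (v s)).
  apply/is_derive_mxP => i j; rewrite mxE mulrC.
  have /is_derive_mxP /(_ i j) D1 := Df (C s).
  exact: (@is_derive1_comp R (fun s => flow Y (s, u 0) i j) C s _ _ D1 (DC s)).
(* [c] is turned into a 1 by 1 matrix in order to reuse [bounded_on_segment]. *)
have cC : continuous (fun s => (c s)%:M : 'M[R]_1).
  move=> s; apply: (@mx_cvg _ _ _ _ (fun s => (c s)%:M)) => i j; rewrite !ord1.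
  suff -> : (fun y => ((c y)%:M : 'M[R]_1) 0 0) = c by exact: cc.
  by apply/funext => x; rewrite mxE eqxx mulr1n.
have [M [M0 HM]] := bounded_on_segment cC (normr_ge0 t).
have M1 : 0 < (M + 1) * L by rewrite mulr_gt0 // ltr_wpDl.
apply/eqP; rewrite -subr_eq0 -normr_le0.
have := @gronwall R 1 n (fun s => u s - v s) (fun s => c s *: Y (u s) - c s *: Y (v s))
  ((M + 1) * L) 0 `|t| (normr_ge0 t) M1 (lexx _) _ _ t (lexx _).
have -> : u 0 - v 0 = 0 by rewrite /v C0 f0 subrr.
rewrite normr0 mul0r addr0 mulr0 mul0r; apply.
move=> s st; rewrite addr0 -scalerBr normrZ -mulrA ler_pM //.
apply: le_trans (_ : M <= _); last by rewrite lerDl.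
by apply: le_trans (HM s st); have := mx_norm_entry ((c s)%:M : 'M[R]_1) 0 0; rewrite mxE.
Qed.

End TimeChange.

Section SmoothForms.
Variables (R : realType) (n p q : nat) (D : set 'rV[R]_n)
  (W : 'rV[R]_n -> 'rV[R]_n -> 'M[R]_(p, q)).
Hypotheses (oD : open D) (Wl : forall x, D x -> linear (W x))
  (Ws : forall v, smooth_open D (fun x => W x v)).

Lemma smooth_form (V : normedModType R) (O : set V) (s r : V -> 'rV[R]_n) :
  open O -> smooth_open O s -> smooth_open O r -> (forall y, O y -> D (s y)) ->
  smooth_open O (fun y => W (s y) (r y)).
Proof.
move=> oO ss sr OD.
apply: (@smooth_ext _ _ _ _ (fun y => \sum_i (r y 0 i : R^o) *: W (s y) (coord_frame R i))) => //.
  by move=> y Oy; rewrite (form_sum Wl) //; exact: OD.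
apply: smooth_sum => // i _; apply: smoothZ => //; first exact: smooth_coord.
exact: (@smooth_comp _ _ _ _ _ O D s (fun x => W x (coord_frame R i))).
Qed.

End SmoothForms.

Section Slices.
Variables (R : realType) (m : nat) (i : 'I_m.+1).

(** The identity with row [i] deleted: acting on the right it places R^m in the hyperplane z_i = 0,
    and its transpose forgets the coordinate [i]. The index stays free because only some coordinate
    of the grading field is known to be nonzero. *)
Definition slice_mx : 'M[R]_(m, m.+1) := row' i 1%:M.

Lemma slice_mx_lift (x : 'rV[R]_m) k : (x *m slice_mx) 0 (lift i k) = x 0 k.
Proof.
rewrite mxE (bigD1 k) //= !mxE eqxx mulr1 big1 ?addr0 // => j jk.
by rewrite !mxE (inj_eq (@lift_inj _ i)) (negPf jk) mulr0.
Qed.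

Lemma slice_mx_fix (x : 'rV[R]_m) : (x *m slice_mx) 0 i = 0.
Proof.
by rewrite mxE big1 // => j _; rewrite !mxE eq_sym (negPf (neq_lift _ _)) mulr0.
Qed.

Lemma slice_mx_tr (z : 'rV[R]_m.+1) k : (z *m slice_mx^T) 0 k = z 0 (lift i k).
Proof.
rewrite mxE (bigD1 (lift i k)) //= !mxE eqxx mulr1 big1 ?addr0 // => j jk.
by rewrite !mxE eq_sym (negPf jk) mulr0.
Qed.

Definition slice (a : R) (x : 'rV[R]_m) : 'rV[R]_m.+1 := x *m slice_mx + a *: delta_mx 0 i.

Lemma slice_fix a x : slice a x 0 i = a.
Proof. by rewrite mxE slice_mx_fix !mxE !eqxx mulr1 add0r. Qed.

Lemma sliceK a x : slice a x *m slice_mx^T = x.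
Proof.
apply/rowP => k; rewrite slice_mx_tr mxE slice_mx_lift !mxE eqxx /=.
by rewrite eq_sym (negPf (neq_lift _ _)) mulr0 addr0.
Qed.

Lemma slice_restrict a (z : 'rV[R]_m.+1) : z 0 i = a -> slice a (z *m slice_mx^T) = z.
Proof.
move=> za; apply/rowP => j; case: (unliftP i j) => [k ->|->]; last by rewrite slice_fix.
by rewrite mxE slice_mx_lift slice_mx_tr !mxE eqxx /= eq_sym (negPf (neq_lift _ _)) mulr0 addr0.
Qed.

Lemma slice_mx_inj (x : 'rV[R]_m) : x *m slice_mx = 0 -> x = 0.
Proof. by move=> x0; apply/rowP => k; rewrite -slice_mx_lift x0 !mxE. Qed.

Lemma smooth_slice a : smooth_open setT (slice a).
Proof.
apply: smoothD; first exact: openT; last exact: smooth_cst.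
apply: smooth_mulmx; [exact: openT|exact: smooth_id|exact: smooth_cst].
Qed.

End Slices.

Section FlowBox.
Variables (R : realType) (m : nat) (i : 'I_m.+1).
Local Notation J := (gram R m).
Local Notation l := (vec_l R m).
Variables (D : set 'rV[R]_m.+1) (z0 : 'rV[R]_m.+1)
  (al : 'rV[R]_m.+1 -> 'rV[R]_m.+1 -> 'M[R]_(1 + (m + 1)))
  (Z rho : 'rV[R]_m.+1 -> 'rV[R]_m.+1) (r LZ LY : R).
(* rho retracts onto a neighbourhood of z0, which makes the fields below complete.
   box_field is Z o rho rescaled to have i-th coordinate 1, so that its flow
   box_map, started on the slice x_i = z0_i, is a global diffeomorphism, with
   inverse box_chart; box_parallel solves k' = k al(box_field) along it. *)
Definition box_time (z : 'rV[R]_m.+1) : R := Z (rho z) 0 i.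
Definition box_field (z : 'rV[R]_m.+1) : 'rV[R]_m.+1 := (box_time z)^-1 *: Z (rho z).
Definition box_form (z : 'rV[R]_m.+1) : 'M[R]_(1 + (m + 1)) := al (rho z) (box_field z).

Hypotheses (oD : open D) (all : forall x, D x -> linear (al x))
  (als : forall v, smooth_open D (fun x => al x v))
  (alk : forall x v, D x -> skewJ J (al x v))
  (alK : forall x v1 v2 a, D x -> al x v1 *m l = a *: l ->
    'D_v1 (fun y => al y v2) x - 'D_v2 (fun y => al y v1) x + bracket (al x v1) (al x v2) = 0)
  (Zs : smooth_open D Z) (Zi : forall z, D z -> Z z 0 i != 0)
  (Zl : forall z, D z -> al z (Z z) *m l = l)
  (r0 : 0 < r) (rs : smooth_open setT rho) (rD : forall z, D (rho z))
  (rid : forall z : 'rV[R]_m.+1, `|z - z0| <= r -> rho z = z)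
  (LZ0 : 0 < LZ) (LZP : forall x y : 'rV[R]_m.+1, `|Z (rho x) - Z (rho y)| <= LZ * `|x - y|)
  (LY0 : 0 < LY) (LYP : forall x y : 'rV[R]_m.+1, `|box_field x - box_field y| <= LY * `|x - y|).

Let Zt := Z \o rho.
Let Y := box_field.
Let A := box_form.
Let io := slice i (z0 0 i).

Lemma box_time_neq0 z : box_time z != 0.
Proof. exact: Zi. Qed.

Let sZt : smooth_open setT Zt.
Proof. by apply: (@smooth_comp _ _ _ _ _ setT D rho Z) => //; exact: openT. Qed.

Let sc : smooth_open setT (box_time : _ -> R^o).
Proof. by apply: (smooth_coord 0 i _ sZt); exact: openT. Qed.

Let sY : smooth_open setT Y.
Proof.
apply: smoothZ => //; first exact: openT.
by apply: smoothV => //; [exact: openT|move=> z _; exact: box_time_neq0].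
Qed.

Let sA : smooth_open setT A.
Proof. by apply: (smooth_form all als) => //; exact: openT. Qed.

Let Yi z : Y z 0 i = 1.
Proof. by rewrite /Y /box_field mxE mulVf // box_time_neq0. Qed.

Let Al z : A z *m l = (box_time z)^-1 *: l.
Proof.
have lz := all (rD z).
rewrite /A /box_form /box_field -[al _ _]/(linear_pack lz _) linearZ -scalemxAl; congr (_ *: _).
exact: Zl.
Qed.

Definition box_map (q : R^o * 'rV[R]_m) : 'rV[R]_m.+1 := flow Y (q.1, io q.2).
Local Notation Psi := box_map.

Let sPsi : smooth_open setT Psi.
Proof.
have sf := flow_smooth LY0 LYP sY.
apply: (@smooth_comp _ _ _ _ _ setT setT (fun q : R^o * 'rV[R]_m => (q.1, io q.2)) (flow Y)) => //; first exact: openT.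
apply: smooth_pair; [exact: openT|exact: smooth_fst|].
apply: (@smooth_comp _ _ _ _ _ setT setT snd io) => //; [exact: openT|exact: smooth_snd|exact: smooth_slice].
Qed.

Definition box_parallel : R^o * 'rV[R]_m -> 'M[R]_(1 + (m + 1)) := psol (A \o Psi).
Local Notation k := box_parallel.

Let sAP : smooth_open setT (A \o Psi).
Proof. by apply: (@smooth_comp _ _ _ _ _ setT setT Psi A) => //; exact: openT. Qed.

Let cAP : continuous (A \o Psi).
Proof. by move=> q; exact: (smooth_continuous sAP (I : setT q)). Qed.

Let sk : smooth_open setT k.
Proof. exact: (psol_smooth _ sAP). Qed.

Lemma flow_box_coord t z : flow Y (t, z) 0 i = z 0 i + t.
Proof.
have [f0 Df] := flowP LY0 LYP sY z.
pose g s : R := flow Y (s, z) 0 i - s.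
have E : g t = g 0.
  apply: derive0_const => s _.
  have /is_derive_mxP /(_ 0 i) D1 := Df s.
  by have := is_deriveB D1 (is_derive_id s (1 : R)); rewrite Yi subrr; exact.
by move/eqP: E; rewrite /g f0 subr0 subr_eq => /eqP.
Qed.


(** The [i]-th coordinate grows at unit speed, so the time elapsed since the slice is z_i - (z0)_i,
    and flowing back by this time lands on the slice. The inverse of the flow box is therefore
    explicit and smooth. *)
Definition box_chart (z : 'rV[R]_m.+1) : R^o * 'rV[R]_m :=
  (z 0 i - z0 0 i, flow Y (- (z 0 i - z0 0 i), z) *m (slice_mx R i)^T).
Local Notation chi := box_chart.

Lemma box_chartK z : Psi (chi z) = z.
Proof.
rewrite /Psi /chi /= /io slice_restrict; last by rewrite flow_box_coord opprB addrC subrK.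
rewrite -(flow_add LY0 LYP sY) subrr.
by have [-> _] := flowP LY0 LYP sY z.
Qed.

Lemma box_mapK q : chi (Psi q) = q.
Proof.
case: q => t x; rewrite /chi /Psi /= flow_box_coord /io slice_fix addrAC subrr add0r.
rewrite -(flow_add LY0 LYP sY) addNr.
by have [-> _] := flowP LY0 LYP sY (slice i (z0 0 i) x); rewrite sliceK.
Qed.

Lemma smooth_box_chart : smooth_open setT chi.
Proof.
have sf := flow_smooth LY0 LYP sY.
have st : smooth_open setT (fun z : 'rV[R]_m.+1 => z 0 i - z0 0 i : R^o).
  apply: smoothB; [exact: openT| |exact: smooth_cst].
  by apply: (@smooth_coord _ _ _ _ _ (@id 'rV[R]_m.+1)); [exact: openT|exact: smooth_id].
apply: smooth_pair => //; first exact: openT.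
apply: smooth_mulmx; [exact: openT| |exact: smooth_cst].
apply: (@smooth_comp _ _ _ _ _ setT setT (fun z : 'rV[R]_m.+1 => ((- (z 0 i - z0 0 i) : R^o), z)) (flow Y)) => //; first exact: openT.
by apply: smooth_pair; [exact: openT|apply: smoothN => //; exact: openT|exact: smooth_id].
Qed.

Let skA z : skewJ J (A z).
Proof. exact: alk. Qed.

Let cZt : continuous Zt.
Proof. by move=> z; exact: (smooth_continuous sZt (I : setT z)). Qed.

Let cc : continuous box_time.
Proof. by move=> z; exact: (smooth_continuous sc (I : setT z)). Qed.

Let DPsi t x : is_derive t (1 : R) (fun s : R => Psi (s, x)) (Y (Psi (t, x))).
Proof. by have [_] := flowP LY0 LYP sY (io x); exact. Qed.

Let Psi0 x : Psi (0, x) = io x.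
Proof. by have [] := flowP LY0 LYP sY (io x). Qed.

Lemma box_parallelP x : exists lam : R -> R, [/\ lam 0 = 0,
  forall t : R, is_derive t (1 : R) lam (box_time (Psi (t, x)))^-1 &
  forall t, isoJ J (k (t, x)) /\ k (t, x) *m l = expR (lam t) *: l].
Proof.
have cP : continuous (fun t : R => Psi (t, x)).
  by move=> t; exact: (derive_continuous_at (DPsi t x)).
have ct : continuous (fun t : R => (box_time (Psi (t, x)))^-1).
  move=> t; apply: cvgV; first exact: box_time_neq0.
  by apply: (@continuous_comp _ _ _ (fun t => Psi (t, x)) box_time); [exact: cP|exact: cc].
have [lam [lam0 Dlam]] := primitive_exists ct.
exists lam; split=> // t.
have cAx : continuous (fun t : R => A (Psi (t, x))).
  move=> s; apply: (@continuous_comp _ _ _ (fun t : R => (t : R^o, x)) (A \o Psi)); last exact: cAP.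
  by apply: (@continuous_pair_at _ _ _ (fun t : R => t : R^o) (fun=> x) s); [exact: cvg_id|exact: cst_continuous].
exact: (@lsol_group R m (fun t => A (Psi (t, x))) _ _ cAx (fun t => skA _) (fun t => Al _) lam0 Dlam t).
Qed.

(* Rescaling Z only reparametrizes its flow, and the time for Z o rho is the
   logarithm of the scale of k, because al(Z) l = l. *)
Lemma box_flow t x : exists2 s, k (t, x) *m l = expR s *: l & flow Zt (s, io x) = Psi (t, x).
Proof.
have [lam [lam0 Dlam Hlam]] := box_parallelP x.
exists (lam t); first by have [] := Hlam t.
have ct : continuous (fun t : R => (box_time (Psi (t, x)))^-1).
  move=> s; apply: cvgV; first exact: box_time_neq0.
  apply: (@continuous_comp _ _ _ (fun t => Psi (t, x)) box_time); last exact: cc.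
  exact: (derive_continuous_at (DPsi s x)).
have := flow_time_change LZ0 LZP sZt ct lam0 Dlam (fun s => DPsi s x) t.
by rewrite Psi0 => ->.
Qed.

(** The opposite time change: [C s] is the [i]-th coordinate gained along the flow of Z o rho, and
    the rates of [C] and of [lam] are reciprocal, so that [lam (C s) - s] is constant. *)
Lemma box_flow_inv s x : exists2 t, flow Zt (s, io x) = Psi (t, x) & k (t, x) *m l = expR s *: l.
Proof.
have [lam [lam0 Dlam Hlam]] := box_parallelP x.
have [u0 Du] := flowP LZ0 LZP sZt (io x); set u := fun s : R => flow Zt (s, io x) in u0 Du.
pose C s := u s 0 i - z0 0 i.
have DC (a : R) : is_derive a (1 : R) C (box_time (u a)).
  have /is_derive_mxP /(_ 0 i) D1 := Du a.
  by have := is_deriveB D1 (is_derive_cst (z0 0 i) a (1 : R)); rewrite subr0; exact.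
have uE a : u a = Psi (C a, x).
  have C0 : C 0 = 0 by rewrite /C /u u0 /io slice_fix subrr.
  have ct : continuous (fun a : R => box_time (u a)).
    move=> b; apply: (@continuous_comp _ _ _ u box_time); last exact: cc.
    exact: (derive_continuous_at (Du b)).
  have Du' (b : R) : is_derive b (1 : R) u (box_time (u b) *: Y (u b)).
    by rewrite /Y /box_field scalerA mulfV ?box_time_neq0 // scale1r; exact: Du.
  by have := flow_time_change LY0 LYP sY ct C0 DC Du' a; rewrite {2}/u u0.
exists (C s); first exact: uE.
have [_ ->] := Hlam (C s).
suff : lam (C s) - s = lam (C 0) - 0.
  rewrite subr0 {2}/C /u u0 /io slice_fix subrr lam0 => /eqP; rewrite subr_eq0 => /eqP -> //.
apply: (@derive0_const R (fun a => lam (C a) - a)) => a _.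
have D1 : is_derive a (1 : R) (lam \o C) 1.
  have := is_derive1_comp (Dlam (C a)) (DC a).
  by rewrite -uE mulVf ?box_time_neq0.
by have := is_deriveB D1 (is_derive_id a (1 : R)); rewrite subrr; exact.
Qed.


(** [al] on vectors tangent to the slice, at the retracted base point so as to be defined on all of
    R^m. Where [rho] is the identity this is the gauge transformed form at time 0, since k = 1
    there. *)
Definition box_theta (x v : 'rV[R]_m) : 'M[R]_(1 + (m + 1)) := al (rho (io x)) (v *m slice_mx R i).

Let rDP (q : R^o * 'rV[R]_m) : `|Psi q - z0| < r -> rho (Psi q) = Psi q /\ D (Psi q).
Proof. by move=> /ltW /rid E; split=> //; rewrite -E. Qed.

Let oball : open [set q : R^o * 'rV[R]_m | `|Psi q - z0| < r].
Proof.
have := open_preimage_within openT (fun q _ => smooth_continuous sPsi (I : setT q)) (@ball_open R 'rV[R]_m.+1 z0 r).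
rewrite (_ : [set x | _] = [set q | `|Psi q - z0| < r]) //; apply/seteqP; split=> q /=.
  by rewrite -ball_normE /= distrC => -[].
by rewrite -ball_normE /= distrC.
Qed.

Let Dk t x : is_derive t (1 : R) (fun s : R => k (s, x)) (k (t, x) *m A (Psi (t, x))).
Proof. by have [_] := psolP x cAP; exact. Qed.

Let k0 x : k (0, x) = 1%:M.
Proof. by have [] := psolP x cAP. Qed.

Let Dk1 q : 'D_(1, 0) k q = k q *m A (Psi q).
Proof. by case: q => t x; rewrite derive_slice_time derive1E; have [] := Dk t x. Qed.

Let DPsi1 q : 'D_(1, 0) Psi q = Y (Psi q).
Proof. by case: q => t x; rewrite derive_slice_time derive1E; have [] := DPsi t x. Qed.

Let skJ q : isoJ J (k q).
Proof. by case: q => t x; have [lam [_ _ /(_ t) []]] := box_parallelP x. Qed.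

(* Since the curvature vanishes in the direction of box_field,
   (k al(D_v Psi) - D_v k) k^-1 is constant in t. *)
Lemma box_identity_space t x v : (forall s : R, `|s| <= `|t| -> `|Psi (s, x) - z0| < r) ->
  k (t, x) *m al (Psi (t, x)) ('D_(0, v) Psi (t, x)) = box_theta x v *m k (t, x) + 'D_(0, v) k (t, x).
Proof.
move=> Ht; pose O := [set q : R^o * 'rV[R]_m | `|Psi q - z0| < r].
pose b q := al (Psi q) ('D_(0, v) Psi q).
pose a := A \o Psi.
have OD q : O q -> D (Psi q) by move=> /rDP [].
have sPO : smooth_open O Psi by exact: smooth_sub sPsi.
have sb : smooth_open O b.
  by apply: (smooth_form all als oball sPO _ OD); exact: smooth_derive.
have aE q : O q -> a q = al (Psi q) ('D_(1, 0) Psi q).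
  by move=> /rDP [E _]; rewrite DPsi1 /a /= /A /box_form E.
have nO q : O q -> \forall y \near q, O y by move=> Oq; exact: (open_nbhs_nbhs (conj oball Oq)).
(* The structure equation in flow-box coordinates: with no curvature in the time direction, D_t b =
   D_v a - [a, b]. *)
have Db q : O q -> 'D_(1, 0) b q = 'D_(0, v) a q - (a q *m b q - b q *m a q).
  move=> Oq; have E := pullback_exterior oD all als ((1, 0) : R^o * 'rV[R]_m) ((0, v) : R^o * 'rV[R]_m) oball Oq sPO OD.
  have al1 : al (Psi q) ('D_(1, 0) Psi q) *m l = (box_time (Psi q))^-1 *: l.
    by have := Al (Psi q); rewrite -[A (Psi q)]/(a q) (aE q Oq).
  have E2 := alK ('D_(0, v) Psi q) (OD _ Oq) al1.
  have E3 : 'D_(0, v) (fun y => al (Psi y) ('D_(1, 0) Psi y)) q = 'D_(0, v) a q.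
    by apply: near_eq_derive; apply: filterS (nO q Oq) => y Oy; rewrite aE.
  have H (U : zmodType) (p q0 s c d : U) : p - q0 = s -> s + (c - d) = 0 -> p = q0 - (c - d).
    by move=> <- /eqP; rewrite addr_eq0 subr_eq => /eqP ->; rewrite addrC.
  apply: (H _ _ _ _ _ _ (etrans (f_equal (fun c => 'D_(1, 0) b q - c) (esym E3)) E)).
  by rewrite (aE q Oq); exact: E2.
pose ki q := J *m (k q)^T *m J.
have kiK q : ki q *m k q = 1%:M by exact: (isoJ_inv_mul (@gram_invol R m) (skJ q)).
have kKi q : k q *m ki q = 1%:M by exact: mulmx1C.
have Dki s : is_derive s (1 : R) (fun s => ki (s, x)) (- (a (s, x) *m ki (s, x))).
  have DT : is_derive s (1 : R) (fun s => (k (s, x))^T) (k (s, x) *m a (s, x))^T.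
    apply/is_derive_mxP => i' j'; rewrite mxE.
    rewrite (_ : (fun x => _) = fun s => k (s, x) j' i'); last by apply/funext => y; rewrite mxE.
    by have /is_derive_mxP := Dk s x; exact.
  have D1 := is_derive_mulmx (is_derive_cst J s (1 : R)) DT.
  have := is_derive_mulmx D1 (is_derive_cst J s (1 : R)).
  rewrite mulmx0 add0r mul0mx addr0 trmx_mul.
  have := skA (Psi (s, x)); rewrite /skewJ -/(a (s, x)) => /eqP; rewrite addr_eq0 => /eqP E.
  have -> : J *m ((a (s, x))^T *m (k (s, x))^T) *m J = - (a (s, x) *m ki (s, x)).
    rewrite /ki mulmxA -[J *m _ in LHS]mulmx1 -(@gram_invol R m) !mulmxA.
    rewrite (_ : J *m (a (s, x))^T *m J = - a (s, x)); first by rewrite !mulNmx.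
    by rewrite -mulmxA E mulmxN mulmxA gram_invol mul1mx.
  by [].
(* The cancellation behind the vanishing of the time derivative of (k b - D_v k) k^-1, with all
   derivatives treated as free symbols. *)
have alg (K a' b' da dk K' : 'M[R]_(1 + (m + 1))) : (K *m b' - dk) *m (- (a' *m K'))
    + (K *m (da - (a' *m b' - b' *m a')) + K *m a' *m b' - (K *m da + dk *m a')) *m K' = 0.
  rewrite mulmxN !(mulmxDl, mulmxDr, mulNmx, mulmxN) !mulmxA.
  have H (U : zmodType) (p q c d : U) : - (p - q) + (c - (d - p) + d - (c + q)) = 0.
    by rewrite !opprB [c + (p - d)]addrA subrK opprD [c + p + _]addrACA subrr add0r addrA subrK subrr.
  exact: H.
pose h s := (k (s, x) *m b (s, x) - 'D_(0, v) k (s, x)) *m ki (s, x).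
have Dh (s : R) : `|s| <= `|t| -> is_derive s (1 : R) h 0.
  move=> st; have Osx : O (s, x) by exact: Ht.
  have Db1 := is_derive_time_slice (smooth_differentiable sb Osx).
  have Dv1 := is_derive_time_slice (smooth_differentiable (smooth_derive ((0, v) : R^o * 'rV[R]_m) sk) (I : setT (s, x))).
  have E1 : 'D_(1, 0) ('D_(0, v) k) (s, x) = k (s, x) *m 'D_(0, v) a (s, x) + 'D_(0, v) k (s, x) *m a (s, x).
    rewrite (smooth_schwarz ((0, v) : R^o * 'rV[R]_m) ((1, 0) : R^o * 'rV[R]_m) openT (I : setT (s, x)) sk).
    rewrite (_ : 'D_(1, 0) k = fun q => k q *m a q); last by apply/funext => q; rewrite Dk1.
    have dk := smooth_differentiable sk (I : setT (s, x)).
    have da := smooth_differentiable sAP (I : setT (s, x)).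
    by have [_ ->] := differentiable_mulmx dk da.
  have := is_derive_mulmx (is_deriveB (is_derive_mulmx (Dk s x) Db1) Dv1) (Dki s).
  set Q := (X in is_derive _ _ _ X -> _); suff -> : Q = 0 by [].
  by rewrite /Q E1 Db //; exact: alg.
have hE : h t = h 0.
  apply/matrixP => i' j'; apply: (@derive0_const R (fun s => h s i' j')) => s st.
  by have /is_derive_mxP /(_ i' j') := Dh s st; rewrite mxE.
(* At time 0 the gauge is 1 for every x, so its space derivative drops out. *)
have h0 : h 0 = box_theta x v.
  have O0 : O (0, x) by apply: Ht; rewrite normr0.
  have [E0 _] := rDP O0; rewrite Psi0 in E0.
  rewrite /h k0 mul1mx /ki k0 trmx1 mulmx1 gram_invol mulmx1 derive_slice_space.
  rewrite (_ : (fun y => k (0, y)) = cst 1%:M); last by apply/funext => y; rewrite k0.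
  rewrite derive_cst subr0 /b derive_slice_space Psi0 /box_theta E0; congr (al _ _).
  rewrite (_ : (fun y => Psi (0, y)) = io); last by apply/funext => y; rewrite Psi0.
  rewrite /io /slice.
  have d1 : differentiable (fun y : 'rV[R]_m => y *m slice_mx R i) x.
    apply: (@smooth_differentiable _ _ _ setT) => //.
    by apply: smooth_mulmx; [exact: openT|exact: smooth_id|exact: smooth_cst].
  rewrite deriveD; [|exact: diff_derivable|exact: derivable_cst].
  rewrite derive_cst addr0.
  have did : differentiable (@id 'rV[R]_m) x by have [] := is_diff_id x.
  have [_ ->] := differentiable_mulmx did (@differentiable_cst _ _ _ (slice_mx R i) x).
  by rewrite derive_cst mulmx0 add0r derive_id.
move: hE; rewrite h0 => <-.
by rewrite /h -mulmxA kiK mulmx1 subrK.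
Qed.


Definition box_gauge : 'rV[R]_m.+1 -> 'M[R]_(1 + (m + 1)) := k \o chi.
Definition box_leaf (z : 'rV[R]_m.+1) : 'rV[R]_m := (chi z).2.

Lemma smooth_box_leaf : smooth_open setT box_leaf.
Proof.
by apply: (@smooth_comp _ _ _ _ _ setT setT chi snd) => //; [exact: openT|exact: smooth_box_chart|exact: smooth_snd].
Qed.

Lemma smooth_box_gauge : smooth_open setT box_gauge.
Proof.
apply: (@smooth_comp _ _ _ _ _ setT setT chi k) => //; first exact: openT.
exact: smooth_box_chart.
Qed.

Lemma box_gauge_isoJ z : isoJ J (box_gauge z).
Proof. exact: skJ. Qed.

Lemma smooth_flow_slice : smooth_open setT (fun q : R^o * 'rV[R]_m => flow Zt (q.1, io q.2)).
Proof.
have sf := flow_smooth LZ0 LZP sZt.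
apply: (@smooth_comp _ _ _ _ _ setT setT (fun q : R^o * 'rV[R]_m => (q.1, io q.2)) (flow Zt)) => //; first exact: openT.
apply: smooth_pair; [exact: openT|exact: smooth_fst|].
apply: (@smooth_comp _ _ _ _ _ setT setT snd io) => //; [exact: openT|exact: smooth_snd|exact: smooth_slice].
Qed.

Lemma box_flow_leaf z : exists2 s, box_gauge z *m l = expR s *: l & flow Zt (s, io (box_leaf z)) = z.
Proof.
have [s ks fs] := box_flow (chi z).1 (chi z).2; exists s.
  by rewrite /box_gauge /=; move: ks; rewrite -surjective_pairing.
by rewrite /box_leaf fs -surjective_pairing box_chartK.
Qed.

Lemma box_leaf_flow s x :
  box_leaf (flow Zt (s, io x)) = x /\ box_gauge (flow Zt (s, io x)) *m l = expR s *: l.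
Proof.
have [t Et kt] := box_flow_inv s x.
have E := box_mapK (t, x); rewrite Et /box_leaf E; split=> //.
by rewrite /box_gauge -[(k \o chi) _]/(k (chi _)) E.
Qed.

(** A tangent vector is split into a multiple of the flow direction and a vector tangent to a time
    slice. In the flow direction the leaf is constant and the identity is the equation k' = k A;
    along the slice it is [box_identity_space]. *)
Lemma box_identity : exists C : set 'rV[R]_m.+1, [/\ open C, C z0,
  (forall z, C z -> rho z = z) &
  forall z v, C z -> box_gauge z *m al z v =
    box_theta (box_leaf z) ('D_v box_leaf z) *m box_gauge z + 'D_v box_gauge z].
Proof.
have chi0 : (chi z0).1 = 0 by rewrite /chi /= subrr.
pose q0 := (0, box_leaf z0) : R^o * 'rV[R]_m.
have q0E : q0 = chi z0 by rewrite /q0 /box_leaf -chi0; case: (chi z0).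
have Pq0 : Psi q0 = z0 by rewrite q0E box_chartK.
have /nbhs_ballP [d /= d0 Hd] : \forall q \near q0, `|Psi q - z0| < r.
  by apply: (open_nbhs_nbhs (conj oball _)) => /=; rewrite Pq0 subrr normr0.
(* A ball in flow-box coordinates: the whole flow segment from a point of [C] back to the slice then
   stays where [rho] is the identity. *)
pose C := [set z : 'rV[R]_m.+1 | ball (q0 : R^o * 'rV[R]_m) d (chi z)].
have sch := smooth_box_chart.
have oC : open C.
  have := open_preimage_within openT (fun q _ => smooth_continuous sch (I : setT q)) (@ball_open R (R^o * 'rV[R]_m)%type q0 d).
  by rewrite (_ : [set x | _] = C) //; apply/seteqP; split=> z // [].
have HC z s : C z -> `|s| <= `|(chi z).1| -> `|Psi (s, (chi z).2) - z0| < r.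
  move=> [C1 C2] sz; apply: Hd; split=> //=.
  by move: C1; rewrite -!ball_normE /= !sub0r !normrN; exact: le_lt_trans.
have CE z : C z -> rho z = z.
  move=> Cz; have := HC z (chi z).1 Cz (lexx _); rewrite -surjective_pairing box_chartK.
  by move=> /ltW; exact: rid.
exists C; split=> //; first by rewrite /C /= -q0E; exact: ballxx.
move=> z v Cz.
have dchi := smooth_differentiable sch (I : setT z).
have dk q := smooth_differentiable sk (I : setT q).
have dPsi q := smooth_differentiable sPsi (I : setT q).
have dleaf := smooth_differentiable smooth_box_leaf (I : setT z).
set u := 'D_v box_leaf z.
have [a Ea] : exists a : R^o, 'D_v chi z = a *: ((1, 0) : R^o * 'rV[R]_m) + (0, u).
  exists ('D_v chi z).1; rewrite [LHS]surjective_pairing.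
  have -> : ('D_v chi z).2 = u.
    rewrite /u; rewrite (_ : box_leaf = snd \o chi) //.
    by rewrite derive_snd.
  by congr pair; rewrite /= ?scaler0 ?add0r // addr0 -[_ *: 1]/(_ * 1) mulr1.
have DE p q (K : R^o * 'rV[R]_m -> 'M[R]_(p, q)) : differentiable K (chi z) ->
    'D_v (K \o chi) z = a *: 'D_(1, 0) K (chi z) + 'D_(0, u) K (chi z).
  by move=> dK; rewrite (derive_comp v dchi dK) Ea !deriveE // linearD linearZ.
rewrite /box_gauge (DE _ _ k) //.
have Ev : v = a *: 'D_(1, 0) Psi (chi z) + 'D_(0, u) Psi (chi z).
  rewrite -(DE _ _ Psi) //.
  rewrite (_ : Psi \o chi = id) ?derive_id //.
  by apply/funext => y; exact: box_chartK.
have Dz : D z by rewrite -(CE z Cz).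
rewrite {1}Ev -[al z _]/(linear_pack (all Dz) _) linearD linearZ /= mulmxDr -scalemxAr.
rewrite -[in RHS]addrCA; apply: f_equal2.
  congr (_ *: _); rewrite Dk1 DPsi1 /A /box_form /Y box_chartK /=; congr (_ *m _).
  by rewrite /box_form (CE z Cz).
have := @box_identity_space (chi z).1 (chi z).2 u (fun s => @HC z s Cz).
by rewrite -surjective_pairing box_chartK.
Qed.

End FlowBox.

(** * The gauge equivalent form on the space of integral curves *)

Section LocalModel.
Variables (R : realType) (m : nat).
Local Notation J := (gram R m).
Local Notation l := (vec_l R m).

(** Coordinates (a, X) on g/h: for Y in g the last entry of Y l is 0, and it is dropped. *)
Definition column_coord (c : 'cV[R]_(1 + (m + 1))) : 'rV[R]_m.+1 :=
  (col_mx (usubmx c) (usubmx (dsubmx c)) : 'cV[R]_(1 + m))^T.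

Fact column_coord_linear : linear column_coord.
Proof. by move=> a u v; rewrite /column_coord !linearP /= -add_col_mx -scale_col_mx linearP. Qed.
HB.instance Definition _ :=
  GRing.isLinear.Build R 'cV[R]_(1 + (m + 1)) 'rV[R]_m.+1 _ column_coord column_coord_linear.

Lemma column_coord_inj Y Y' : skewJ J Y -> skewJ J Y' ->
  column_coord (Y *m l) = column_coord (Y' *m l) -> Y *m l = Y' *m l.
Proof.
move=> /lie_g_decomp [a [X [h [_ _ ->]]]] /lie_g_decomp [a' [X' [h' [_ _ ->]]]].
rewrite /column_coord !col_mxKu !col_mxKd !col_mxKu => /trmx_inj E.
have [Ea EX] := @eq_col_mx R 1 m 1 _ _ _ _ E; by rewrite EX Ea.
Qed.

Variables (D : set 'rV[R]_m.+1) (z0 : 'rV[R]_m.+1)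
  (al : 'rV[R]_m.+1 -> 'rV[R]_m.+1 -> 'M[R]_(1 + (m + 1))).
Hypotheses (oD : open D) (Dz0 : D z0) (all : forall x, D x -> linear (al x))
  (als : forall v, smooth_open D (fun x => al x v))
  (alk : forall x v, D x -> skewJ J (al x v))
  (ali : forall x v, D x -> al x v *m l = 0 -> v = 0)
  (alK : forall x v1 v2 a, D x -> al x v1 *m l = a *: l ->
    'D_v1 (fun y => al y v2) x - 'D_v2 (fun y => al y v1) x + bracket (al x v1) (al x v2) = 0).

(** [al] induces an isomorphism of R^(m+1) onto g/h, with matrix [M] in these coordinates; solving
    for the class of E with [invmx] keeps Z smooth. This prescribes al(Z) only modulo h. *)
Lemma exists_grading_field : exists Z : 'rV[R]_m.+1 -> 'rV[R]_m.+1,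
  smooth_open D Z /\ forall z, D z -> al z (Z z) *m l = l.
Proof.
pose M z : 'M[R]_m.+1 := \matrix_i column_coord (al z (coord_frame R i) *m l).
have ME z v : D z -> v *m M z = column_coord (al z v *m l).
  move=> Dz; rewrite (form_sum all v Dz) mulmx_suml linear_sum mulmx_sum_row.
  by apply: eq_bigr => i _; rewrite rowK -scalemxAl linearZ.
have Mu z : D z -> M z \in unitmx.
  move=> Dz; rewrite -row_free_unit -kermx_eq0; apply/eqP/row_matrixP => i; rewrite row0.
  have : row i (kermx (M z)) *m M z = 0 by rewrite -row_mul mulmx_ker row0.
  set v := row i _; rewrite ME // => E; apply: (ali Dz).
  rewrite -(mul0mx _ l); apply: column_coord_inj; [exact: alk|exact: skewJ0|].
  by rewrite E mul0mx linear0.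
have sM : smooth_open D M.
  apply: smooth_mx => // i j.
  apply: (@smooth_ext _ _ _ _ (fun z => column_coord (al z (coord_frame R i) *m l) 0 j : R^o)) => //.
    by move=> z _; rewrite [RHS]mxE.
  apply: (smooth_coord 0 j) => //.
  apply: (@smooth_lin R _ _ _ _ D (fun z => al z (coord_frame R i) *m l) (column_coord : {linear _ -> _})) => //.
  by apply: smooth_mulmx => //; exact: smooth_cst.
exists (fun z => column_coord l *m invmx (M z)); split.
  by apply: smooth_mulmx => //; [exact: smooth_cst|exact: smooth_invmx].
move=> z Dz; rewrite -[RHS](grading_l R m).
apply: column_coord_inj; [exact: alk|by apply/lie_gP; exact: grading_lie|].
by rewrite -ME // mulmxKV ?Mu // grading_l.
Qed.

(* The form al is gauge equivalent, through K, to the pullback of a form theta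
   on the leaf space, f being the projection; G inverts z |-> (log of the scale
   of K z, f z). *)
Lemma exists_local_model : exists (theta : 'rV[R]_m -> 'rV[R]_m -> 'M[R]_(1 + (m + 1)))
    (f : 'rV[R]_m.+1 -> 'rV[R]_m) (K : 'rV[R]_m.+1 -> 'M[R]_(1 + (m + 1)))
    (G : R^o * 'rV[R]_m -> 'rV[R]_m.+1) (C : set 'rV[R]_m.+1),
  [/\ [/\ forall x, linear (theta x), forall v, smooth_open setT (fun x => theta x v),
         forall x v, skewJ J (theta x v) & forall x v a, theta x v *m l = a *: l -> v = 0],
      [/\ smooth_open setT f, smooth_open setT K, forall z, isoJ J (K z) & smooth_open setT G],
      forall z, exists2 s, K z *m l = expR s *: l & G (s, f z) = z,
      forall s x, f (G (s, x)) = x /\ K (G (s, x)) *m l = expR s *: l &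
      [/\ open C, C z0, C `<=` D & forall z v, C z ->
         K z *m al z v = theta (f z) ('D_v f z) *m K z + 'D_v K z]].
Proof.
have [Z [sZ Zl]] := exists_grading_field.
(* Z does not vanish at [z0], since al(Z) l = l; a coordinate is chosen in which it moves, and [D]
   is then shrunk to the set where it still does. *)
have [i Zi0] : exists i, Z z0 0 i != 0.
  apply/existsP; apply: contraT => /existsPn H.
  have Z0 : Z z0 = 0 by apply/rowP => i; rewrite mxE; apply/eqP; have := H i; rewrite negbK.
  have := Zl z0 Dz0; rewrite Z0 -[al z0 0]/(linear_pack (all Dz0) 0) linear0 mul0mx => /esym /eqP.
  by rewrite (negPf (vec_l_neq0 R m)).
pose D1 := [set z | D z /\ (Z z 0 i : R^o) != 0].
have oD1 : open D1.
  have sZi := smooth_coord 0 i oD sZ.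
  have := open_preimage_within oD (fun z Dz => smooth_continuous sZi Dz) (@open_neq R 0).
  by rewrite (_ : [set x | _] = D1).
have D1D : D1 `<=` D by move=> z [].
have [rho [r [r0 rs rD rid rb]]] := exists_cutoff oD1 (conj Dz0 Zi0 : D1 z0).
have sZ1 : smooth_open D1 Z by exact: smooth_sub sZ.
(* The unit-speed field is itself the composite with [rho] of a map smooth on [D1], so it gets its
   own global Lipschitz constant. *)
have sYb : smooth_open D1 (fun z => (Z z 0 i)^-1 *: Z z).
  apply: (@smoothZ _ _ _ _ (fun z => (Z z 0 i)^-1)) => //; apply: smoothV => //; first by move=> z [].
  exact: smooth_coord.
have [[LZ LZ0 LZP] _] := rb _ _ _ sZ1; have [[LY LY0 LYP] _] := rb _ _ _ sYb.
have all1 x : D1 x -> linear (al x) by move=> /D1D; exact: all.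
have als1 v : smooth_open D1 (fun x => al x v) by exact: smooth_sub (als v).
have alk1 x v : D1 x -> skewJ J (al x v) by move=> /D1D; exact: alk.
have alK1 x v1 v2 a : D1 x -> al x v1 *m l = a *: l ->
    'D_v1 (fun y => al y v2) x - 'D_v2 (fun y => al y v1) x + bracket (al x v1) (al x v2) = 0.
  by move=> /D1D; exact: alK.
have Zi1 z : D1 z -> Z z 0 i != 0 by move=> [].
have Zl1 z : D1 z -> al z (Z z) *m l = l by move=> /D1D; exact: Zl.
have [C [oC Cz0 CE CI]] := @box_identity R m i D1 z0 al Z rho r LY oD1 all1 als1 alk1 alK1 sZ1 Zi1 Zl1 r0 rs rD rid LY0 LYP.
have rDD z : D (rho z) by exact: D1D.
exists (box_theta i z0 al rho), (box_leaf i z0 Z rho), (box_gauge i z0 al Z rho),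
  (fun q => flow (Z \o rho) (q.1, slice i (z0 0 i) q.2)), C.
split.
- split.
  + by move=> x a u v; rewrite /box_theta mulmxDl -scalemxAl all.
  + move=> v; apply: (@smooth_comp _ _ _ _ _ setT D (rho \o slice i (z0 0 i)) (fun z => al z (v *m slice_mx R i))) => //; first exact: openT.
    by move=> x _; exact: rDD.
    by apply: (@smooth_comp _ _ _ _ _ setT setT _ rho) => //; [exact: openT|exact: smooth_slice].
  + by move=> x v; exact: alk.
  (* If al(v) l = a l, then v - a Z is sent to an element killing l, so v = a Z; but v is tangent to
     the slice and Z is transversal to it, whence a = 0. *)
  + move=> x v a; rewrite /box_theta; set z := rho _ => E; apply: (@slice_mx_inj R m i).
    have D1z : D1 z by exact: rD.
    have Dz := D1D _ D1z.
    have : v *m slice_mx R i - a *: Z z = 0.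
      apply: (ali Dz); rewrite -[al z _]/(linear_pack (all Dz) _) linearB linearZ mulmxBl -scalemxAl.
      by rewrite /= (Zl _ Dz) E subrr.
    move=> /eqP; rewrite subr_eq0 => /eqP E1; rewrite E1.
    have := f_equal (fun y : 'rV[R]_m.+1 => y 0 i) E1; rewrite slice_mx_fix mxE => /esym /eqP.
    by rewrite mulf_eq0 (negPf (Zi1 _ D1z)) orbF => /eqP ->; rewrite scale0r.
- split; [exact: (smooth_box_leaf _ sZ1 Zi1 rs rD LY0 LYP)|exact: (smooth_box_gauge _ all1 als1 sZ1 Zi1 rs rD LY0 LYP)| |].
    by move=> z; exact: (box_gauge_isoJ z0 all1 als1 alk1 sZ1 Zi1 Zl1 rs rD LY0 LYP).
  exact: (@smooth_flow_slice R m i D1 z0 Z rho LZ sZ1 rs rD LZ0 LZP).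
- by move=> z; exact: (box_flow_leaf z0 all1 als1 alk1 sZ1 Zi1 Zl1 rs rD LZ0 LZP LY0 LYP).
- by move=> s x; exact: (box_leaf_flow z0 all1 als1 alk1 sZ1 Zi1 Zl1 rs rD LZ0 LZP LY0 LYP).
- by split=> // z Cz; rewrite -(CE z Cz).
Qed.

End LocalModel.

(** * Smooth maps between atlases *)

Section SmoothMaps.
Variable R : realType.

Lemma within_continuousP (T U : topologicalType) (D : set T) (f : T -> U) :
  {within D, continuous f} <->
  forall x, D x -> forall P, nbhs (f x) P -> \forall y \near x, D y -> P (f y).
Proof.
split=> [/subspace_continuousP H x Dx P nP|H]; first exact: (H x Dx _ nP).
by apply/subspace_continuousP => x Dx P nP; exact: H.
Qed.

Lemma chart_near (T U : topologicalType) (E : normedModType R) (c : chart T E) (D : set T)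
    (f : T -> U) y P : is_chart c -> {within D, continuous f} ->
  img c y -> D (cinv c y) -> nbhs (f (cinv c y)) P ->
  \forall y' \near y, D (cinv c y') -> P (f (cinv c y')).
Proof.
move=> Hc /within_continuousP cf iy Dy nP.
have ci := cinv_continuous Hc iy.
exact: (ci _ (cf _ Dy _ nP)).
Qed.

Lemma smooth_on_near (V W : normedModType R) (A : set V) (f : V -> W) :
  (forall x, A x -> exists (O : set V) (F : V -> W),
    [/\ \forall y \near x, O y, open O, smooth_open O F &
        \forall y \near x, A y -> F y = f y]) -> smooth_on A f.
Proof.
move=> H x Ax; have [ O [F [nO oO sF nF]]] := H x Ax.
exists (O `&` (interior [set y | A y -> F y = f y])), F; split.
- by apply: openI => //; exact: open_interior.
- split; [exact: nbhs_singleton nO|exact: nF].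
- exact: smooth_sub sF.
- by move=> y Ay [_ /interior_subset]; apply.
Qed.

Section Maps.
Variables (T T' T'' : topologicalType) (E E' E'' : normedModType R).
Context {hE' : findim E'}.
Variables (A : set (chart T E)) (A' : set (chart T' E')) (A'' : set (chart T'' E'')).

Lemma smooth_map_sub (D D' : set T) (f : T -> T') : D' `<=` D ->
  smooth_map A A' D f -> smooth_map A A' D' f.
Proof.
move=> DD [cf sf]; split; first exact: continuous_subspaceW cf.
by move=> c c' Ac Ac'; apply: smooth_on_sub (sf c c' Ac Ac') => y [iy /DD Dy dy].
Qed.

Lemma smooth_map_ext (D : set T) (f g : T -> T') : (forall x, D x -> f x = g x) ->
  smooth_map A A' D f -> smooth_map A A' D g.
Proof.
move=> fg [cf sf]; split.
  apply/within_continuousP => x Dx P; rewrite -fg // => nP.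
  move/within_continuousP: cf => /(_ x Dx P nP); apply: filterS => y Py Dy.
  by rewrite -fg //; exact: Py.
move=> c c' Ac Ac'; apply: (@smooth_on_ext _ _ _ _ (crd c' \o f \o cinv c)).
  by move=> y [iy Dy dy] /=; rewrite fg.
by apply: smooth_on_sub (sf c c' Ac Ac') => y [iy Dy dy]; split=> //; rewrite fg.
Qed.

Lemma smooth_map_comp (D : set T) (D' : set T') (f : T -> T') (g : T' -> T'') :
  (forall c, A c -> is_chart c) -> is_smooth_atlas A' ->
  (forall c, A'' c -> is_chart c) -> (forall x, D x -> D' (f x)) ->
  smooth_map A A' D f -> smooth_map A' A'' D' g -> smooth_map A A'' D (g \o f).
Proof.
move=> HA [HA' cov _] HA'' DD [cf sf] [cg sg]; split.
  apply/within_continuousP => x Dx P nP.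
  move/within_continuousP: cg => /(_ _ (DD _ Dx) P nP) n1.
  move/within_continuousP: cf => /(_ x Dx _ n1); apply: filterS => y Py Dy.
  by apply: Py => //; exact: DD.
move=> c c'' Ac Ac''; apply: smooth_on_near => y [iy Dy dy].
have [c' Ac' dc'] := cov (f (cinv c y)).
have [|O1 [F1 [oO1 O1y sF1 E1]]] := sf c c' Ac Ac' y; first by split.
have K' := chart_K (HA' _ Ac') dc'.
have [|O2 [F2 [oO2 O2y sF2 E2]]] := sg c' c'' Ac' Ac'' (crd c' (f (cinv c y))).
  by split; rewrite ?K' //; [exact: (chart_img (HA' _ Ac'))|exact: DD].
have F1y : F1 y = crd c' (f (cinv c y)) by rewrite E1.
exists [set y | O1 y /\ O2 (F1 y)], (F2 \o F1); split.
- have : open [set y | O1 y /\ O2 (F1 y)].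
    by apply: open_preimage_within => // x O1x; exact: smooth_continuous sF1 O1x.
  by move=> o; apply: (open_nbhs_nbhs (conj o _)); split=> //; rewrite F1y.
- by apply: open_preimage_within => // x O1x; exact: smooth_continuous sF1 O1x.
- apply: (@smooth_comp R _ _ _ hE' _ O2) => //; last by apply: smooth_sub sF1 => z [].
    by apply: open_preimage_within => // x O1x; exact: smooth_continuous sF1 O1x.
  by move=> z [].
- have n1 := chart_near (HA _ Ac) cf iy Dy (near_dom (HA' _ Ac') dc').
  have n2 : \forall z \near y, O1 z by exact: (open_nbhs_nbhs (conj oO1 O1y)).
  have n3 : \forall z \near y, O1 z /\ O2 (F1 z).
    have o : open [set y | O1 y /\ O2 (F1 y)].
      by apply: open_preimage_within => // x O1x; exact: smooth_continuous sF1 O1x.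
    by apply: (open_nbhs_nbhs (conj o _)); split=> //; rewrite F1y.
  apply: filterS3 n1 n2 n3 => z Hz O1z [_ O2z] [iz Dz dz].
  have dz' := Hz Dz; have Kz := chart_K (HA' _ Ac') dz'.
  have E1z : F1 z = crd c' (f (cinv c z)) by rewrite E1.
  rewrite /= E1z; rewrite E1z in O2z; rewrite E2 /= ?Kz //; split; rewrite ?Kz //.
    exact: (chart_img (HA' _ Ac')).
  exact: DD.
Qed.

Lemma smooth_map_pair (D : set T) (f : T -> T') (g : T -> T'') : (forall c, A c -> is_chart c) ->
  smooth_map A A' D f -> smooth_map A A'' D g ->
  smooth_map A (prod_atlas A' A'') D (fun x => (f x, g x)).
Proof.
move=> HA [cf sf] [cg sg]; split.
  apply/within_continuousP => x Dx P [[P1 P2] /= [n1 n2] PP].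
  move/within_continuousP: cf => /(_ _ Dx P1 n1) nf.
  move/within_continuousP: cg => /(_ _ Dx P2 n2) ng.
  by apply: filterS2 nf ng => y f1 g1 Dy; apply: PP; split; [exact: f1|exact: g1].
move=> c _ Ac [c' [c'' [Ac' Ac'' ->]]].
apply: (@smooth_on_sub _ _ _ ([set y | [/\ img c y, D (cinv c y) & dom c' (f (cinv c y))]] `&`
   [set y | [/\ img c y, D (cinv c y) & dom c'' (g (cinv c y))]])) => [y [iy Dy [dy dy']]|]; first by split; split.
apply: smooth_on_pair; [apply: smooth_on_sub (sf c c' Ac Ac')|apply: smooth_on_sub (sg c c'' Ac Ac'')].
  by move=> y [].
by move=> y [].
Qed.

End Maps.

Lemma vec_atlas_smooth (E : normedModType R) : is_smooth_atlas (vec_atlas E).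
Proof.
split=> [c ->|x|c c' -> ->]; first exact: vec_chart_is_chart.
  by exists (vec_chart E).
by apply: (@smooth_open_on _ _ _ setT) => //; [exact: openT|exact: smooth_id].
Qed.

Lemma smooth_map_vec (E E' : normedModType R) (D : set E) (f : E -> E') :
  smooth_on D f -> smooth_map (vec_atlas E) (vec_atlas E') D f.
Proof.
move=> sf; split; last first.
  by move=> c c' -> ->; apply: smooth_on_sub sf => y [].
apply/within_continuousP => x Dx P nP.
have [ O [F [oO Ox sF FE]]] := sf x Dx.
have n1 : \forall y \near x, O y by exact: (open_nbhs_nbhs (conj oO Ox)).
have n2 : \forall y \near x, P (F y).
  by apply: (smooth_continuous sF Ox); rewrite FE.
by apply: filterS2 n1 n2 => y Oy PF Dy; rewrite -FE.
Qed.

Section ProdAtlas.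
Variables (T T' : topologicalType) (E E' : normedModType R).
Context {hE : findim E} {hE' : findim E'}.
Variables (A : set (chart T E)) (A' : set (chart T' E')).
Hypotheses (HA : is_smooth_atlas A) (HA' : is_smooth_atlas A').

Lemma prod_atlas_smooth : is_smooth_atlas (prod_atlas A A').
Proof.
have [CA VA SA] := HA; have [CA' VA' SA'] := HA'; split.
- by move=> _ [c [c' [Ac Ac' ->]]]; apply: prod_chart_is_chart; [exact: CA|exact: CA'].
- move=> [x y]; have [c Ac dc] := VA x; have [c' Ac' dc'] := VA' y.
  by exists (prod_chart c c') => //; exists c, c'.
- move=> _ _ [c [c' [Ac Ac' ->]]] [d [d' [Ad Ad' ->]]].
  apply: smooth_on_pair.
    apply: (@smooth_on_comp _ _ _ _ _ _ [set y | img c y /\ dom d (cinv c y)] fst (crd d \o cinv c)).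
    + by move=> y [[iy iy'] [dy dy']].
    + by apply: (@smooth_open_on _ _ _ setT) => //; [exact: openT|exact: smooth_fst].
    + exact: SA.
  apply: (@smooth_on_comp _ _ _ _ _ _ [set y | img c' y /\ dom d' (cinv c' y)] snd (crd d' \o cinv c')).
  + by move=> y [[iy iy'] [dy dy']].
  + by apply: (@smooth_open_on _ _ _ setT) => //; [exact: openT|exact: smooth_snd].
  + exact: SA'.
Qed.

Lemma smooth_map_fst D : smooth_map (prod_atlas A A') A D fst.
Proof.
split; first by apply: continuous_subspaceT => x; exact: cvg_fst.
have [CA VA SA] := HA.
move=> _ d [c [c' [Ac Ac' ->]]] Ad.
apply: (@smooth_on_comp _ _ _ _ _ _ [set y | img c y /\ dom d (cinv c y)] fst (crd d \o cinv c)).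
- by move=> y [[iy iy'] _ dy].
- by apply: (@smooth_open_on _ _ _ setT) => //; [exact: openT|exact: smooth_fst].
- exact: SA.
Qed.

Lemma smooth_map_snd D : smooth_map (prod_atlas A A') A' D snd.
Proof.
split; first by apply: continuous_subspaceT => x; exact: cvg_snd.
have [CA VA SA] := HA'.
move=> _ d [c [c' [Ac Ac' ->]]] Ad.
apply: (@smooth_on_comp _ _ _ _ _ _ [set y | img c' y /\ dom d (cinv c' y)] snd (crd d \o cinv c')).
- by move=> y [[iy iy'] _ dy].
- by apply: (@smooth_open_on _ _ _ setT) => //; [exact: openT|exact: smooth_snd].
- exact: SA.
Qed.

Lemma smooth_map_crd c : A c -> smooth_map A (vec_atlas E) (dom c) (crd c).
Proof.
have [CA VA SA] := HA; move=> Ac; split; first by have [_ _ _ _ []] := CA c Ac.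
by move=> d _ Ad ->; apply: smooth_on_sub (SA d c Ad Ac) => y [].
Qed.

Lemma smooth_map_cinv c : A c -> smooth_map (vec_atlas E) A (img c) (cinv c).
Proof.
have [CA VA SA] := HA; move=> Ac; split; first by have [_ _ _ _ []] := CA c Ac.
by move=> _ d -> Ad; apply: smooth_on_sub (SA c d Ac Ad) => y [].
Qed.

Lemma smooth_map_vec_pair (T0 : topologicalType) (E0 : normedModType R) (A0 : set (chart T0 E0))
    D (f : T0 -> E) (g : T0 -> E') :
  smooth_map A0 (vec_atlas E) D f -> smooth_map A0 (vec_atlas E') D g ->
  smooth_map A0 (vec_atlas (E * E')%type) D (fun x => (f x, g x)).
Proof.
move=> [cf sf] [cg sg]; split.
  apply/within_continuousP => x Dx P [[P1 P2] /= [n1 n2] PP].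
  move/within_continuousP: cf => /(_ _ Dx P1 n1) nf.
  move/within_continuousP: cg => /(_ _ Dx P2 n2) ng.
  by apply: filterS2 nf ng => y f1 g1 Dy; apply: PP; split; [exact: f1|exact: g1].
move=> c _ Ac ->; apply: smooth_on_pair.
  by apply: smooth_on_sub (sf c _ Ac erefl) => y [].
by apply: smooth_on_sub (sg c _ Ac erefl) => y [].
Qed.

End ProdAtlas.

End SmoothMaps.

(** * Embedded manifolds *)

Section SecondCountable.
Variable R : realType.

Lemma findim_second_countable (V : normedModType R) : findim V -> @second_countable V.
Proof.
move=> hV; have [n [e [l [cl El]]]] := hV.
pose comb (c : 'rV[R]_n) : V := \sum_i c 0 i *: e i.
have ccomb : continuous comb.
  move=> c; apply: (@smooth_continuous _ _ _ setT comb c) => //.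
  apply: smooth_sum => [|i _]; first exact: openT.
  apply: smoothZ; [exact: openT| |exact: smooth_cst].
  by apply: (@smooth_coord _ _ _ _ _ (@id 'rV[R]_n)); [exact: openT|exact: smooth_id].
pose pt (q : {ffun 'I_n -> rat}) : V := comb (\row_i ratr (q i)).
have dense x (d : R) : 0 < d -> exists q, ball x d (pt q).
  move=> d0; have xE : x = comb (\row_i l i x).
    by rewrite {1}(El x); apply: eq_bigr => i _; rewrite mxE.
  have /nbhs_ballP [r /= r0 Hr] : \forall c \near (\row_i l i x : 'rV[R]_n), ball x d (comb c).
    by apply: (ccomb (\row_i l i x)); rewrite -xE; exact: nbhsx_ballx.
  have H i : exists q : rat, l i x - r < ratr q < l i x + r.
    have [|q] := @rat_in_itvoo R (l i x - r) (l i x + r); first by rewrite ltrBlDr -addrA ltrDl addr_gt0.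
    by rewrite in_itv /=; exists q.
  have [q Hq] := choice H; exists [ffun i => q i]; apply: Hr.
  by split=> // i j; rewrite !mxE ffunE -ball_normE /= ltr_distlC.
pose Bs := range (fun qk : {ffun 'I_n -> rat} * nat => ball (pt qk.1) (qk.2.+1%:R^-1 : R)).
exists Bs.
  by apply: (@sub_countable _ _ _ setT); [exact: card_image_le|exact: countableP].
split=> [_ [qk _ <-]|x]; first exact: ball_open.
move=> P /nbhs_ballP [d /= d0 Hd].
have d2 : 0 < d / 2 by rewrite divr_gt0.
have [k kd] : exists k : nat, (k.+1%:R^-1 : R) < d / 2.
  by have [k _ /(_ k (leqnn k)) Hk] := near_infty_natSinv_lt (PosNum d2); exists k.
have k0 : 0 < k.+1%:R^-1 :> R by rewrite invr_gt0.
have [q xq] := dense x _ k0.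
exists (ball (pt q) (k.+1%:R^-1)).
  by split; [exists (q, k)|exact: ball_sym].
move=> y yq; apply: Hd; apply: (@le_ball _ _ _ (k.+1%:R^-1 + k.+1%:R^-1)).
  by rewrite (splitr d) lerD // ltW.
exact: ball_triangle xq yq.
Qed.

Definition vec_manifold n : manifold R :=
  Manifold (@vec_atlas_smooth R 'rV[R]_n) (@norm_hausdorff R 'rV[R]_n)
    (findim_second_countable (findim_mx R 1 n)).

Lemma vec_connected (V : normedModType R) : connected [set: V].
Proof.
have -> : [set: V] = \bigcup_(x in [set: V]) range (fun t : R => t *: x).
  by apply/seteqP; split=> x // _; exists x => //; exists 1 => //; rewrite scale1r.
apply: bigcup_connected; first by exists 0 => x _; exists 0 => //; rewrite scale0r.
move=> x _; apply: connected_continuous_connected.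
  by apply/connected_intervalP => a b _ _ c _.
by apply: continuous_subspaceT => t; exact: scalel_continuous.
Qed.

End SecondCountable.

Section EmbeddedManifold.
Variables (R : realType) (E : normedModType R) (hE : findim E) (S : set E) (d : nat).

(** [g] and [h] are smooth between open sets of vector spaces, so chart changes and the inclusion of
    [S] are smooth without any notion of tangent space to [S]. *)
Definition local_parametrization (s : E) (O : set E) (I : set 'rV[R]_d) (g : E -> 'rV[R]_d)
    (h : 'rV[R]_d -> E) : Prop :=
  [/\ open O /\ O s, open I, smooth_open O g /\ smooth_open I h,
      forall x, S x -> O x -> I (g x) /\ h (g x) = x &
      forall y, I y -> [/\ S (h y), O (h y) & g (h y) = y]].

Hypothesis S_param : forall s, S s -> exists O I g h, local_parametrization s O I g h.

Let B := set_type S.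
Let emb : B -> E := set_val.

Let embS b : S (emb b).
Proof. exact: set_valP. Qed.

Let emb_inj : injective emb.
Proof. exact: val_inj. Qed.

Let emb_continuous : continuous emb.
Proof. exact: initial_continuous. Qed.

Let emb_nbhs (b : B) P : nbhs b P -> exists W, [/\ open W, W (emb b) & forall b', W (emb b') -> P b'].
Proof.
rewrite nbhsE => -[_ [[W oW <-] Wb] WP]; exists W; split=> // b' Wb'; exact: WP.
Qed.

(** Inverse of the inclusion, with junk value [b0] off [S]. *)
Let to_B (b0 : B) (x : E) : B := if pselect (S x) is left Sx then SigSub (mem_set Sx) else b0.

Let to_BK b0 x : S x -> emb (to_B b0 x) = x.
Proof. by move=> Sx; rewrite /to_B; case: pselect. Qed.

(** The carrier is the subtype of [S] with the induced topology. The result is recorded as a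
    diffeomorphism onto [S] in the sense of [smooth_on], and later arguments use only this map and
    its inverse. *)
Lemma embedded_manifold : S !=set0 -> exists (M : manifold R) (f : M -> E),
  mdim M = d /\ diffeo (atlas M) (vec_atlas E) setT S f.
Proof.
move=> [s0 Ss0]; pose b0 : B := SigSub (mem_set Ss0).
have H (b : B) : exists OIgh, local_parametrization (emb b) OIgh.1.1.1 OIgh.1.1.2 OIgh.1.2 OIgh.2.
  by have [ O [I [g [h H]]]] := S_param (embS b); exists (O, I, g, h).
have {H} [par Hpar] := choice H.
pose ch (b : B) : chart B 'rV[R]_d :=
  Chart (emb @^-1` (par b).1.1.1) (par b).1.1.2 ((par b).1.2 \o emb) (to_B b0 \o (par b).2).
pose A := range ch.
have HA : is_smooth_atlas A.
  split.
  - move=> _ [b _ <-]; have := Hpar b; rewrite /ch; case: (par b) => [[[Od I] g] h] /= [[oO Ob] oI [sg sh] K1 K2].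
    split=> //=.
    + by apply: open_comp => // x _; exact: emb_continuous.
    + move=> x Ox; have [Ig hg] := K1 _ (embS x) Ox; split=> //.
      by apply: emb_inj; rewrite hg to_BK.
    + by move=> y Iy; have [Sh Oh gh] := K2 y Iy; rewrite to_BK.
    + split; apply/within_continuousP => x Hx P nP.
        have c : {for x, continuous (g \o emb)}.
          by apply: continuous_comp; [exact: emb_continuous|exact: smooth_continuous sg Hx].
        have nx : \forall y \near x, P ((g \o emb) y) by exact: (c _ nP).
        by apply: filterS nx => y Py _.
      have [W [oW Wx WP]] := emb_nbhs nP.
      have [Sh Oh gh] := K2 x Hx; rewrite /= to_BK // in Wx.
      have nx : \forall y \near x, W (h y) by exact: (smooth_continuous sh Hx (open_nbhs_nbhs (conj oW Wx))).
      apply: filterS nx => y Wy Iy; apply: WP; have [Shy _ _] := K2 y Iy.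
      by rewrite /= to_BK.
  - move=> b; exists (ch b); first by exists b.
    by have [[_ Ob] _ _ _ _] := Hpar b.
  - move=> _ _ [b _ <-] [b' _ <-].
    have := Hpar b; case Eb: (par b) => [[[Od I] g] h] /= [[oO Ob] oI [sg sh] K1 K2].
    have := Hpar b'; case Eb': (par b') => [[[Oe Ie] ge] he] /= [[oO2 Ob2] oI2 [sg2 sh2] K12 K22].
    rewrite Eb /=.
    apply: (@smooth_on_ext _ _ _ _ (ge \o h)).
      by move=> y [/= Iy Oy]; have [Sh _ _] := K2 y Iy; rewrite /= to_BK.
    apply: (@smooth_on_comp _ _ _ _ _ _ Oe).
    + by move=> y [/= Iy Oy]; have [Sh _ _] := K2 y Iy; rewrite to_BK in Oy.
    + by apply: (smooth_open_on oI) => // y [].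
    + exact: (smooth_open_on oO2).
have hB : hausdorff_space B.
  move=> p q pq; apply: emb_inj; apply: (@norm_hausdorff _ E) => P Q nP nQ.
  have [b [Pb Qb]] := pq _ _ (emb_continuous nP) (emb_continuous nQ).
  by exists (emb b).
have sB : @second_countable B.
  have [Bs cB [oB bB]] := findim_second_countable hE.
  exists ((fun U => emb @^-1` U) @` Bs).
    by apply: (@sub_countable _ _ _ Bs) => //; exact: card_image_le.
  split=> [_ [U BU <-]|b P nP].
    by apply: open_comp => [x _|]; [exact: emb_continuous|exact: oB].
  have [W [oW Wb WP]] := emb_nbhs nP.
  have [U [BU Ub] UW] := bB _ _ (open_nbhs_nbhs (conj oW Wb)).
  by exists (emb @^-1` U); [split=> //; exists U|move=> b' /UW; exact: WP].
exists (Manifold HA hB sB), emb; split=> //; split; [split| |].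
- exact: continuous_subspaceT.
- move=> _ _ [b _ <-] ->.
  have := Hpar b; case Eb: (par b) => [[[Od I] g] h] /= [[oO Ob] oI [sg sh] K1 K2].
  rewrite /ch Eb /=; apply: (@smooth_on_ext _ _ _ _ h).
    by move=> y [/= Iy _ _]; have [Sh _ _] := K2 y Iy; rewrite /= to_BK.
  by apply: (smooth_open_on oI) => // y [].
- by move=> x _; exact: embS.
- exists (to_B b0); split=> //; last by move=> y Sy; exact: to_BK.
    split.
      apply/within_continuousP => x Sx P nP; have [W [oW Wx WP]] := emb_nbhs nP.
      rewrite to_BK // in Wx; have nx : \forall y \near x, W y by exact: (open_nbhs_nbhs (conj oW Wx)).
      by apply: filterS nx => y Wy Sy; apply: WP; rewrite to_BK.
    move=> _ _ -> [b _ <-].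
    have := Hpar b; case Eb: (par b) => [[[Od I] g] h] /= [[oO Ob] oI [sg sh] K1 K2].
    rewrite /ch Eb /=; apply: (@smooth_on_ext _ _ _ _ g).
      by move=> y [/= _ Sy _] /=; rewrite to_BK.
    by apply: (smooth_open_on oO) => // y [/= _ Sy]; rewrite to_BK.
  by move=> b _; apply: emb_inj; rewrite to_BK.
Qed.

End EmbeddedManifold.

Lemma open_preimage_smooth (R : realType) (V W : normedModType R) (f : V -> W) (D : set W) :
  smooth_open setT f -> open D -> open (f @^-1` D).
Proof.
by move=> sf oD; apply: open_comp => // x _; exact: (smooth_continuous sf (I : setT x)).
Qed.

Section ParabolicCharts.
Variables (R : realType) (m : nat).
Local Notation J := (gram R m).
Local Notation l := (vec_l R m).
Local Notation mx := 'M[R]_(1 + (m + 1)).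
Local Notation i0 := (lshift (m + 1) 0 : 'I_(1 + (m + 1))).

Definition lie_p : set mx := [set Y | skewJ J Y /\ exists a : R, Y *m l = a *: l].

(** The Lie algebra p is the kernel of the linear map Y |-> (Y^T J + J Y, tail of Y l), so a basis
    of this subspace provides the coordinates; the dimension is never computed. *)
Lemma lie_p_coordinates : exists d (c : {linear mx -> 'rV[R]_d}) (v : {linear 'rV[R]_d -> mx}),
  [/\ forall y, lie_p (v y), forall y, c (v y) = y & forall Y, lie_p Y -> v (c Y) = Y].
Proof.
pose L (Y : mx) : (mx * 'cV[R]_(m + 1))%type := (Y^T *m J + J *m Y, dsubmx (Y *m l)).
have Ll : linear L.
  move=> a Y Y'; rewrite /L; congr pair.
    by rewrite /= [(_ + _)^T]linearP /= mulmxDl mulmxDr -scalemxAl -scalemxAr scalerDr addrACA.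
  by rewrite mulmxDl -scalemxAl linearP.
pose U := lker (linfun (linear_pack Ll)).
have UP Y : Y \in U <-> lie_p Y.
  rewrite memv_ker lfunE /= /L; split.
    move=> /eqP [sY dY]; split=> //; exists ((Y *m l) i0 0).
    rewrite -[LHS](@vsubmxK _ 1 (m + 1)) dY /vec_l scale_col_mx scaler0; congr col_mx.
    by apply/matrixP => i j; rewrite !mxE !ord1 eqxx mulr1.
  move=> [sY [a Ya]]; apply/eqP; congr pair => //.
  by rewrite Ya linearZ /= /vec_l col_mxKd scaler0.
pose X := vbasis U; have bX : basis_of U X := vbasisP U.
have cl : linear (fun Y => \row_i coord X i Y : 'rV[R]_(\dim U)).
  by move=> a Y Y'; apply/rowP => i; rewrite !mxE linearP.
have vl : linear (fun y : 'rV[R]_(\dim U) => \sum_i y 0 i *: X`_i : mx).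
  move=> a y y'; rewrite scaler_sumr -big_split; apply: eq_bigr => i _ /=.
  by rewrite !mxE scalerDl scalerA.
exists (\dim U), (linear_pack cl), (linear_pack vl); split.
- move=> y; apply/UP; apply: memv_suml => i _; apply: memvZ.
  by apply: (basis_mem bX); apply: mem_nth; rewrite size_tuple.
- by move=> y; apply/rowP => i /=; rewrite mxE coord_sum_free // (basis_free bX).
- move=> Y /UP UY /=; rewrite [RHS](coord_basis bX UY).
  by apply: eq_bigr => i _; rewrite mxE.
Qed.

(* Cayley charts. For Y l = a l the scale of the Cayley transform of Y is
   (1 + a) / (1 - a), which is positive only for |a| < 1. *)
Lemma parabolic_param : exists d, forall s : ('rV[R]_m * mx)%type, groupP R m s.2 ->
  exists O I g h, @local_parametrization R ('rV[R]_m * mx)%type [set z | groupP R m z.2] (m + d) s O I g h.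
Proof.
have [d [c [v [vP cv vc]]]] := lie_p_coordinates; exists d => -[x0 q0] /= Pq0.
have u0 := groupP_unit Pq0; have JJ := @gram_invol R m.
have [iq0 _] := (groupPE q0).1 Pq0.
(* The chart at 1 is moved to [q0] by left translation; [O] and [Dv] are chosen so that both Cayley
   transforms are defined. *)
pose O : set ('rV[R]_m * mx) := [set z | \det (invmx q0 *m z.2 + 1%:M) != 0].
pose V (y : 'rV[R]_(m + d)) := v (rsubmx y).
pose Dv : set 'rV[R]_(m + d) := [set y | \det (1%:M - V y) != 0 /\ `|V y i0 i0| < 1].
pose g (z : 'rV[R]_m * mx) := row_mx z.1 (c (icayley (invmx q0 *m z.2))).
pose h y := (lsubmx y, q0 *m cayley (V y)).
have sO : smooth_open setT (fun z : 'rV[R]_m * mx => invmx q0 *m z.2 + 1%:M).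
  apply: smoothD; [exact: openT| |exact: smooth_cst].
  by apply: smooth_mulmx; [exact: openT|exact: smooth_cst|exact: smooth_snd].
have oO : open O.
  exact: (open_preimage_smooth (smooth_det openT sO) (@open_neq R 0)).
have sV : smooth_open setT V.
  have sr : smooth_open setT (@rsubmx R 1 m d) by exact: (@smooth_linear R _ _ _ _ (@rsubmx R 1 m d : {linear _ -> _})).
  by apply: (@smooth_comp R _ _ _ _ setT setT (@rsubmx R 1 m d) v) => //; [exact: openT|exact: smooth_linear].
have sW : smooth_open setT (fun y => 1%:M - V y) by apply: smoothB => //; [exact: openT|exact: smooth_cst].
have oI : open Dv.
  have o1 := open_preimage_smooth (smooth_det openT sW) (@open_neq R 0).
  have o2 := open_preimage_smooth (smooth_coord i0 i0 openT sV) (@ball_open R R^o 0 1).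
  have := openI o1 o2; rewrite (_ : _ `&` _ = Dv) //; apply/seteqP; split=> z.
    by move=> [H1]; rewrite /preimage -ball_normE /= sub0r normrN.
  by move=> [H1 H2]; split=> //; rewrite /preimage -ball_normE /= sub0r normrN.
have unitE (M : mx) : (\det M != 0) = (M \in unitmx) by rewrite unitmxE unitfE.
exists O, Dv, g, h; split=> //.
- split=> //; rewrite /O /= mulVmx // unitE.
  by rewrite -mulr2n -scaler_nat unitmxZ ?unitmx1 // unitfE.
- split.
    have sOO := smooth_sub (@subsetT _ O) sO.
    have lrow : linear (fun p : ('rV[R]_m * 'rV[R]_d)%type => row_mx p.1 p.2).
      by move=> a p p'; rewrite /= scale_row_mx add_row_mx.
    apply: (@smooth_lin R _ _ _ _ O (fun z : 'rV[R]_m * mx => (z.1, c (icayley (invmx q0 *m z.2)))) (linear_pack lrow)) => //.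
    apply: smooth_pair => //; first exact: smooth_fst.
    apply: (@smooth_lin R _ _ _ _ O (fun z : 'rV[R]_m * mx => icayley (invmx q0 *m z.2)) c) => //.
    apply: smooth_mulmx => //.
      apply: smoothB => //; last exact: smooth_cst.
      by apply: smooth_mulmx => //; [exact: smooth_cst|exact: smooth_snd].
    by apply: smooth_invmx => // z Oz; rewrite -unitE.
  apply: smooth_pair => //.
    exact: (@smooth_linear R _ _ _ _ (@lsubmx R 1 m d : {linear _ -> _})).
  have sVI := smooth_sub (@subsetT _ Dv) sV.
  apply: smooth_mulmx => //; first exact: smooth_cst.
  apply: smooth_mulmx => //; first by apply: smoothD => //; exact: smooth_cst.
  apply: smooth_invmx => //; first by move=> y [H _]; rewrite -unitE.
  by apply: smoothB => //; exact: smooth_cst.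
- move=> [x q] /= Pq; rewrite /O /= unitE => u1.
  set q1 := invmx q0 *m q in u1 *.
  have /groupPE [iq1 [t t0 qt]] : groupP R m q1 by apply: groupPM => //; exact: groupPV.
  have t1 : t + 1 != 0 by rewrite gt_eqF // addr_gt0.
  have icl : icayley q1 *m l = ((t - 1) / (t + 1)) *: l.
    have E : invmx (q1 + 1%:M) *m l = (t + 1)^-1 *: l.
      by apply: scale_inv => //; rewrite mulmxDl qt mul1mx scalerDl scale1r.
    by rewrite /icayley -mulmxA E -scalemxAr mulmxBl qt mul1mx -{2}[l]scale1r -scalerBl scalerA mulrC.
  have pY : lie_p (icayley q1).
    by split; [exact: skewJ_icayley|exists ((t - 1) / (t + 1))].
  have VE : V (g (x, q)) = icayley q1 by rewrite /V /g /= row_mxKr vc.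
  rewrite /Dv /= VE unitE icayley_unit //; split.
    split=> //; rewrite (scaleE icl) normrM normfV (gtr0_norm (addr_gt0 t0 ltr01)).
    by rewrite ltr_pdivrMr ?addr_gt0 // mul1r ltr_norml; apply/andP; split; lra.
  by rewrite /h VE /g /= row_mxKl icayleyK // /q1 mulKVmx.
- move=> y [+ a1]; rewrite unitE => uy; have [sY [a Ya]] := vP (rsubmx y).
  rewrite -/(V y) in sY Ya; rewrite (scaleE Ya) in a1.
  have [a2 a3] : 0 < 1 - a /\ 0 < 1 + a by move: a1; rewrite ltr_norml => /andP[]; lra.
  have cl : cayley (V y) *m l = ((1 + a) / (1 - a)) *: l.
    have E : invmx (1%:M - V y) *m l = (1 - a)^-1 *: l.
      by apply: scale_inv => //; rewrite ?gt_eqF // mulmxBl Ya mul1mx scalerBl scale1r.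
    by rewrite /cayley -mulmxA E -scalemxAr mulmxDl Ya mul1mx -{1}[l]scale1r -scalerDl scalerA mulrC.
  split.
  + apply: groupPM => //; apply/groupPE; split; first exact: isoJ_cayley.
    by exists ((1 + a) / (1 - a)) => //; rewrite divr_gt0.
  + by rewrite /O /h /= mulKmx // unitE cayley_unit.
  + by rewrite /g /h /= mulKmx // cayleyK // cv hsubmxK.
Qed.

Lemma exists_parabolic_bundle_space : exists (B : manifold R) (f : B -> ('rV[R]_m * mx)%type),
  diffeo (atlas B) (vec_atlas ('rV[R]_m * mx)%type) setT [set z | groupP R m z.2] f.
Proof.
have [d Hd] := parabolic_param.
have [|B [f [_ Hf]]] := embedded_manifold _ Hd; last by exists B, f.
by exists (0, 1%:M); exact: (groupH_P (groupH1 R m)).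
Qed.

End ParabolicCharts.

(** * The model geometry over a vector space *)

Section TrivialBundle.
Variables (R : realType) (n k : nat) (Q : set 'M[R]_k) (B : manifold R)
  (T : B -> ('rV[R]_n * 'M[R]_k)%type) (Ti : ('rV[R]_n * 'M[R]_k)%type -> B)
  (act : B -> 'M[R]_k -> B).
Local Notation E := ('rV[R]_n * 'M[R]_k)%type.
Local Notation SQ := [set z : E | Q z.2].
Hypotheses (Q1 : Q 1%:M) (QM : forall q r, Q q -> Q r -> Q (q *m r))
  (sT : smooth_map (atlas B) (vec_atlas E) setT T) (TS : forall b, Q (T b).2)
  (sTi : smooth_map (vec_atlas E) (atlas B) SQ Ti)
  (TK : forall b, Ti (T b) = b) (TiK : forall z, SQ z -> T (Ti z) = z)
  (actE : forall b q, Q q -> act b q = Ti ((T b).1, (T b).2 *m q)).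

Let sB := atlas_smooth B.
Let HB := fun c (Ac : atlas B c) => manifold_chart Ac.
Let vecc (V : normedModType R) c : vec_atlas V c -> is_chart c.
Proof. by move=> ->; exact: vec_chart_is_chart. Qed.

Lemma smooth_map_vec_fst (V W : normedModType R) {hV : findim V} {hW : findim W} (D : set (V * W)%type) :
  smooth_map (vec_atlas (V * W)%type) (vec_atlas V) D fst.
Proof.
apply: smooth_map_vec; apply: (@smooth_open_on _ _ _ setT) => //; [exact: openT|exact: smooth_fst].
Qed.

Lemma smooth_map_vec_snd (V W : normedModType R) {hV : findim V} {hW : findim W} (D : set (V * W)%type) :
  smooth_map (vec_atlas (V * W)%type) (vec_atlas W) D snd.
Proof.
apply: smooth_map_vec; apply: (@smooth_open_on _ _ _ setT) => //; [exact: openT|exact: smooth_snd].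
Qed.

(** Used twice on the same total space: as R^m x P over R^m, and as an H-bundle over the space of
    scales. *)
Lemma trivial_principal_bundle : @principal_bundle R k Q B (vec_manifold R n) (fun b => (T b).1) act.
Proof.
have sp : smooth_map (atlas B) (vec_atlas 'rV[R]_n) setT (fun b => (T b).1).
  by apply: (smooth_map_comp HB (@vec_atlas_smooth R E) (@vecc _) _ sT (smooth_map_vec_fst setT)).
have sphi : smooth_map (atlas B) (vec_atlas 'M[R]_k) setT (fun b => (T b).2).
  by apply: (smooth_map_comp HB (@vec_atlas_smooth R E) (@vecc _) _ sT (smooth_map_vec_snd setT)).
have pr : is_smooth_atlas (prod_atlas (atlas B) (vec_atlas 'M[R]_k)).
  by apply: prod_atlas_smooth => //; exact: vec_atlas_smooth.
have HP : forall c, prod_atlas (atlas B) (vec_atlas 'M[R]_k) c -> is_chart c by case: pr.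
have HT b q : Q q -> T (act b q) = ((T b).1, (T b).2 *m q).
  by move=> Qq; rewrite actE // TiK //=; apply: QM.
split=> //.
- apply: (@smooth_map_ext _ _ _ _ _ _ _ _ (fun bq => Ti ((T bq.1).1, (T bq.1).2 *m bq.2))).
    by move=> [b q] Qq; rewrite actE.
  have s1 : smooth_map (prod_atlas (atlas B) (vec_atlas 'M[R]_k)) (vec_atlas (E * 'M[R]_k)%type) setT (fun bq => (T bq.1, bq.2)).
    apply: smooth_map_vec_pair; last by apply: smooth_map_snd; exact: vec_atlas_smooth.
    have sf : smooth_map (prod_atlas (atlas B) (vec_atlas 'M[R]_k)) (atlas B) setT fst by exact: smooth_map_fst.
    exact: (smooth_map_comp HP sB (@vecc _) (fun _ _ => I) sf sT).
  have s2 : smooth_map (vec_atlas (E * 'M[R]_k)%type) (vec_atlas E) setT (fun z => (z.1.1, z.1.2 *m z.2)).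
    apply: smooth_map_vec; apply: (@smooth_open_on _ _ _ setT) => //; first exact: openT.
    have sf : smooth_open setT (@fst E 'M[R]_k) by exact: smooth_fst.
    apply: smooth_pair; first exact: openT.
      by apply: (@smooth_comp _ _ _ _ _ setT setT fst fst) => //; [exact: openT|exact: smooth_fst].
    apply: smooth_mulmx; [exact: openT| |exact: smooth_snd].
    by apply: (@smooth_comp _ _ _ _ _ setT setT fst snd) => //; [exact: openT|exact: smooth_snd].
  have s3 : smooth_map (prod_atlas (atlas B) (vec_atlas 'M[R]_k)) (vec_atlas E) setT
      (fun bq => ((T bq.1).1, (T bq.1).2 *m bq.2)).
    exact: (smooth_map_comp HP (@vec_atlas_smooth R _) (@vecc _) (fun _ _ => I) s1 s2).
  have s4 := smooth_map_sub (@subsetT _ [set bq : B * 'M[R]_k | Q bq.2]) s3.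
  apply: (smooth_map_comp HP (@vec_atlas_smooth R _) HB _ s4 sTi).
  by move=> [b q] /= Qq; exact: QM.
- split=> [b|b q r Qq Qr|b q Qq].
  + by rewrite actE // mulmx1 -surjective_pairing TK.
  + by rewrite actE // HT // actE; [rewrite /= mulmxA|exact: QM].
  + by rewrite HT.
- move=> x; exists setT, (fun b => (T b).2); split=> //; first exact: openT.
    by move=> b q _ Qq; rewrite HT.
  split.
  + rewrite preimage_setT; exact: (smooth_map_pair HB sp sphi).
  + by move=> b _; split=> //; exact: TS.
  + exists (fun z => Ti (z.1, z.2)); split=> //.
    * have prv : is_smooth_atlas (prod_atlas (vec_atlas 'rV[R]_n) (vec_atlas 'M[R]_k)).
        by apply: prod_atlas_smooth; exact: vec_atlas_smooth.
      have HPv : forall c, prod_atlas (vec_atlas 'rV[R]_n) (vec_atlas 'M[R]_k) c -> is_chart c by case: prv.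
      have s1 : smooth_map (prod_atlas (vec_atlas 'rV[R]_n) (vec_atlas 'M[R]_k)) (vec_atlas E)
          [set xq | setT xq.1 /\ Q xq.2] (fun z => (z.1, z.2)).
        apply: smooth_map_vec_pair; [apply: smooth_map_fst|apply: smooth_map_snd]; exact: vec_atlas_smooth.
      by apply: (smooth_map_comp HPv (@vec_atlas_smooth R _) HB _ s1 sTi) => -[x' q] [].
    * by move=> b _ /=; rewrite -surjective_pairing TK.
    * by move=> [x' q] [_ /= Qq]; rewrite TiK.
Qed.

End TrivialBundle.

Section LinearDerivatives.
Variable R : realType.

Lemma derive_linear_comp (U V W : normedModType R) {hV : findim V} (L : {linear V -> W})
    (f : U -> V) x v : differentiable f x ->
  differentiable (fun y => L (f y)) x /\ 'D_v (fun y => L (f y)) x = L ('D_v f x).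
Proof.
move=> df; have dL y : differentiable L y.
  by apply: linear_differentiable; exact: findim_linear_continuous.
split; first exact: (differentiable_comp df (dL _)).
by rewrite -[LHS]/('D_v (L \o f) x) derive_comp // derive_linear.
Qed.

Lemma derive_fst (U V W : normedModType R) {hV : findim V} {hW : findim W}
    (f : U -> V * W) x v : differentiable f x -> 'D_v (fun y => (f y).1) x = ('D_v f x).1.
Proof. by move=> df; have [_] := derive_linear_comp (@fst V W : {linear _ -> _}) v df. Qed.

Lemma derive_pair (U V W : normedModType R) {hV : findim V} {hW : findim W}
    (f : U -> V) (g : U -> W) x v : differentiable f x -> differentiable g x ->
  'D_v (fun y => (f y, g y)) x = ('D_v f x, 'D_v g x).
Proof.
move=> df dg; have dp : differentiable (fun y => (f y, g y)) x by exact: differentiable_pair.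
rewrite [LHS]surjective_pairing -derive_fst //; congr pair.
by rewrite -derive_snd.
Qed.

End LinearDerivatives.

Section GroupVelocity.
Variables (R : realType) (m : nat) (V : normedModType R).
Local Notation J := (gram R m).
Local Notation l := (vec_l R m).
Local Notation mx := 'M[R]_(1 + (m + 1)).
Variables (Q : V -> mx) (y v : V).
Hypothesis dQ : differentiable Q y.

(** The Maurer-Cartan form q^-1 dq has values in the Lie algebra: differentiate q^T J q = J, with
    q^-1 written J q^T J. *)
Lemma velocity_skew : (\forall z \near y, isoJ J (Q z)) ->
  skewJ J (J *m (Q y)^T *m J *m 'D_v Q y).
Proof.
move=> nQ; have [dT ET] := derive_linear_comp (@trmx R _ _ : {linear mx -> mx}) v dQ.
have [dTJ ETJ] := differentiable_mulmx dT (@differentiable_cst _ _ _ J y).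
have [_ E] := differentiable_mulmx dTJ dQ.
have E0 : 'D_v (fun z => (Q z)^T *m J *m Q z) y = 0.
  rewrite (@near_eq_derive _ _ _ _ (cst J)) ?derive_cst //.
have := E v; rewrite E0 ETJ derive_cst mulmx0 add0r ET => {}E.
rewrite /skewJ !trmx_mul !trmxK gram_tr -!mulmxA [J *m (J *m _)]mulmxA gram_invol mulmx1 mul1mx.
by rewrite !mulmxA addrC E.
Qed.

(** Expressed with the matrix entry of [scaleE], preservation of the line of l is a linear
    condition, hence inherited by derivatives. *)
Lemma velocity_line : (\forall z \near y, Q z *m l = Q z (lshift (m + 1) 0) (lshift (m + 1) 0) *: l) ->
  'D_v Q y *m l = 'D_v Q y (lshift (m + 1) 0) (lshift (m + 1) 0) *: l.
Proof.
move=> nQ; pose i0 : 'I_(1 + (m + 1)) := lshift (m + 1) 0.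
have Ll : linear (fun N : mx => N *m l - N i0 i0 *: l).
  move=> a N N'; rewrite mulmxDl -scalemxAl !mxE scalerDl -scalerA scalerBr.
  by rewrite opprD addrACA.
have [_ E] := derive_linear_comp (linear_pack Ll) v dQ.
apply/eqP; rewrite -subr_eq0 -[X in X == _]E (@near_eq_derive _ _ _ _ (cst 0)) ?derive_cst //.
by apply: filterS nQ => z /= ->; rewrite subrr.
Qed.

Lemma velocity_fix : (\forall z \near y, Q z *m l = l) -> 'D_v Q y *m l = 0.
Proof.
move=> nQ; have Ll : linear (fun N : mx => N *m l) by move=> a N N'; rewrite mulmxDl -scalemxAl.
have [_ E] := derive_linear_comp (linear_pack Ll) v dQ.
by rewrite -[LHS]E (@near_eq_derive _ _ _ _ (cst l)) ?derive_cst.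
Qed.

End GroupVelocity.

Section ModelGeometry.
Variables (R : realType) (m : nat).
Local Notation J := (gram R m).
Local Notation l := (vec_l R m).
Local Notation mx := 'M[R]_(1 + (m + 1)).
Local Notation E := ('rV[R]_m * mx)%type.
Local Notation i0 := (lshift (m + 1) 0 : 'I_(1 + (m + 1))).
Local Notation S := [set z : E | groupP R m z.2].
Variables (theta : 'rV[R]_m -> 'rV[R]_m -> mx).
Hypotheses (thl : forall x, linear (theta x))
  (ths : forall v, smooth_open setT (fun x => theta x v))
  (thk : forall x v, skewJ J (theta x v))
  (thi : forall x v a, theta x v *m l = a *: l -> v = 0).
Variables (B : manifold R) (emb : B -> E) (gb : E -> B).
Hypotheses (semb : smooth_map (atlas B) (vec_atlas E) setT emb)
  (embS : forall b, groupP R m (emb b).2)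
  (sgb : smooth_map (vec_atlas E) (atlas B) S gb)
  (embK : forall b, gb (emb b) = b) (gbK : forall z, groupP R m z.2 -> emb (gb z) = z).

Definition model_act (b : B) (r : mx) : B := gb ((emb b).1, (emb b).2 *m r).
(** The tangent vector as an element of R^m x matrices; computations take place there rather than in
    charts of [B]. *)
Definition model_velocity (c : chart B 'rV[R]_(mdim B)) (b : B) v : E :=
  'D_v (emb \o cinv c) (crd c b).
Definition model_form : preform B mx := fun c b v =>
  J *m (emb b).2^T *m J *m
    (theta (emb b).1 (model_velocity c b v).1 *m (emb b).2 + (model_velocity c b v).2).

Let sB := atlas_smooth B.
Let HB := fun c (Ac : atlas B c) => manifold_chart Ac.
Let vecc (V : normedModType R) c : vec_atlas V c -> is_chart c.
Proof. by move=> ->; exact: vec_chart_is_chart. Qed.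

Let chart_emb c : atlas B c -> smooth_open (img c) (emb \o cinv c).
Proof.
move=> Ac; have [_ s] := smooth_map_open (HB Ac) (vec_chart_is_chart _) openT semb Ac (erefl : vec_atlas E (vec_chart E)).
by apply: smooth_sub s => y iy.
Qed.

Let vel_diff c u : atlas B c -> dom c u -> differentiable (emb \o cinv c) (crd c u).
Proof. by move=> Ac du; apply: (smooth_differentiable (chart_emb Ac)); exact: (chart_img (HB Ac) du). Qed.

Let near_chart c u : atlas B c -> dom c u -> \forall y \near crd c u, img c y.
Proof. by move=> Ac du; apply: (near_img (HB Ac)); exact: (chart_img (HB Ac) du). Qed.

(** The velocity can be computed from any smooth map into [B] composed with the embedding,
    independently of the chart. Chart changes, the action and curves are all instances. *)
Lemma model_push (X : normedModType R) (D : set X) (h : X -> B) c x v : open D ->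
  smooth_map (vec_atlas X) (atlas B) D h -> atlas B c -> D x -> dom c (h x) ->
  differentiable (crd c \o h) x /\
  model_velocity c (h x) ('D_v (crd c \o h) x) = 'D_v (emb \o h) x.
Proof.
move=> oD sh Ac Dx dx.
have [oS sS] := smooth_map_open (vec_chart_is_chart X) (HB Ac) oD sh (erefl : vec_atlas X (vec_chart X)) Ac.
set S0 := [set y | _] in oS sS; have Sx : S0 x by split.
have dh : differentiable (crd c \o h) x := smooth_differentiable sS Sx.
split; first exact: dh.
apply: etrans (esym (derive_comp v dh (vel_diff Ac dx))) _.
apply: near_eq_derive; have : \forall y \near x, S0 y by exact: (open_nbhs_nbhs (conj oS Sx)).
by apply: filterS => y [_ _ dy] /=; rewrite (chart_K (HB Ac)).
Qed.

Lemma model_velocity_linear c u : atlas B c -> dom c u -> linear (model_velocity c u).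
Proof.
by move=> Ac du a v v'; have d := vel_diff Ac du; rewrite /model_velocity !deriveE // linearP.
Qed.

Lemma model_velocity_inj c u v : atlas B c -> dom c u -> model_velocity c u v = 0 -> v = 0.
Proof.
move=> Ac du v0; have iu := chart_img (HB Ac) du.
have [_ /(_ _ _ (erefl : vec_atlas E (vec_chart E)) Ac) sg] := sgb.
have uE : cinv c (crd c u) = u by exact: (chart_K (HB Ac) du).
have [|O [G [oO Ox sG GE]]] := sg (emb u); first by split=> //=; rewrite embK.
have d := vel_diff Ac du.
have Fu : (emb \o cinv c) (crd c u) = emb u by rewrite /= uE.
have dG : differentiable G ((emb \o cinv c) (crd c u)).
  by rewrite Fu; exact: (smooth_differentiable sG Ox).
have nO : \forall y \near crd c u, O ((emb \o cinv c) y).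
  by apply: (differentiable_continuous d); rewrite Fu; exact: (open_nbhs_nbhs (conj oO Ox)).
have nE : \forall y \near crd c u, (G \o (emb \o cinv c)) y = y.
  apply: filterS2 (near_chart Ac du) nO => y iy Oy.
  have dy := chart_dom (HB Ac) iy.
  by rewrite /= GE //= ?embK ?(chart_invK (HB Ac)) //; split=> //=; rewrite embK.
have E1 : 'D_v id (crd c u) = v by rewrite derive_id.
have E2 := near_eq_derive v nE; have E3 := derive_comp v d dG.
apply: etrans (esym E1) (etrans (esym E2) (etrans E3 _)).
by rewrite /model_velocity in v0; rewrite v0 deriveE // linear0.
Qed.

Let inv_mul b : J *m (emb b).2^T *m J *m (emb b).2 = 1%:M.
Proof. by apply: isoJ_inv_mul; [exact: gram_invol|have /groupPE [] := embS b]. Qed.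

Let invE b : invmx (emb b).2 = J *m (emb b).2^T *m J.
Proof. by apply: isoJ_invmx; [exact: gram_invol|have /groupPE [] := embS b]. Qed.

Let ub b : (emb b).2 \in unitmx.
Proof. exact: groupP_unit. Qed.

Lemma model_velocity_p c u v : atlas B c -> dom c u ->
  lie_p (J *m (emb u).2^T *m J *m (model_velocity c u v).2).
Proof.
move=> Ac du; pose Q y := (emb (cinv c y)).2.
have d := vel_diff Ac du.
have [dQ EQ] := derive_linear_comp (@snd 'rV[R]_m mx : {linear _ -> _}) v d.
have Qu : Q (crd c u) = (emb u).2 by rewrite /Q (chart_K (HB Ac)).
split.
  rewrite -Qu -[(model_velocity c u v).2]EQ; apply: velocity_skew => //.
  by apply: filterS (near_chart Ac du) => y _; have /groupPE [] := embS (cinv c y).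
have E1 : (model_velocity c u v).2 *m l = (model_velocity c u v).2 i0 i0 *: l.
  rewrite -[(model_velocity c u v).2]EQ; apply: velocity_line => //.
  apply: filterS (near_chart Ac du) => y _; have /groupPE [_ [t _ qt]] := embS (cinv c y).
  by rewrite /= (scaleE qt).
have /groupPE [iq [t t0 qt]] := embS u.
exists ((model_velocity c u v).2 i0 i0 / t).
by rewrite -invE -mulmxA E1 -scalemxAr (scale_inv (ub u) _ qt) ?gt_eqF // scalerA.
Qed.

(** Realised by the curve t |-> (x + t xi, q gam(t)), where gam is the one-parameter group of Y. *)
Lemma model_velocity_surj c u xi Y : atlas B c -> dom c u -> lie_p Y ->
  exists v, model_velocity c u v = (xi, (emb u).2 *m Y).
Proof.
move=> Ac du [sY [a Ya]]; have [gam [[sg Pg g0] Dg _]] := exp_curve sY Ya.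
have sgam : smooth_open setT (gam : R^o -> mx) by apply: smooth_on_open; [exact: openT|].
pose gE (t : R^o) : E := ((emb u).1 + t *: xi, (emb u).2 *m gam t).
have sgE : smooth_open setT gE.
  apply: smooth_pair; first exact: openT.
    apply: smoothD; [exact: openT|exact: smooth_cst|].
    by apply: smoothZ; [exact: openT|exact: smooth_id|exact: smooth_cst].
  apply: smooth_mulmx; [exact: openT|exact: smooth_cst|].
  exact: sgam.
have sh : smooth_map (vec_atlas R^o) (atlas B) setT (gb \o gE).
  apply: (smooth_map_comp (@vecc _) (@vec_atlas_smooth R E) HB _ _ sgb).
    by move=> t _; apply: groupPM.
  by apply: smooth_map_vec; exact: (smooth_open_on openT).
have h0 : (gb \o gE) 0 = u by rewrite /gE /= scale0r addr0 g0 mulmx1 -surjective_pairing embK.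
have [|_ E0] := @model_push R^o setT (gb \o gE) c 0 1 openT sh Ac I; first by rewrite h0.
rewrite h0 in E0; exists ('D_1 (crd c \o (gb \o gE)) 0); rewrite E0.
rewrite (_ : emb \o _ = gE); last first.
  by apply/funext => t; apply: gbK; apply: groupPM; [exact: embS|exact: Pg].
have dgam : differentiable (gam : R^o -> mx) 0.
  exact: (smooth_differentiable sgam).
have did : differentiable (@id R^o) 0 by have [] := is_diff_id (0 : R^o).
have [d1 E1] := differentiable_scale did (@differentiable_cst _ R^o _ xi 0).
have d2 : differentiable (fun t : R^o => (emb u).1 + t *: xi) 0.
  by apply: differentiableD => //; exact: differentiable_cst.
have [d3 E3] := differentiable_mulmx (@differentiable_cst _ R^o _ (emb u).2 0) dgam.
have E5 : 'D_1 gE 0 = (_, _) := derive_pair (1 : R^o) d2 d3.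
rewrite E5; congr pair.
  rewrite deriveD; [|exact: derivable_cst|exact: diff_derivable].
  by rewrite derive_cst add0r E1 derive_cst derive_id scaler0 add0r scale1r.
by rewrite E3 derive_cst mul0mx addr0 -Dg derive1E.
Qed.


Let push_curve u (gam : R -> mx) c : atlas B c -> dom c u -> curve_at_1 (groupP R m) gam ->
  model_velocity c u (derive1 (fun t : R => crd c (model_act u (gam t))) 0) =
  (0, (emb u).2 *m derive1 gam 0).
Proof.
move=> Ac du [sg Pg g0].
have sgam : smooth_open setT (gam : R^o -> mx) by apply: smooth_on_open; [exact: openT|].
pose gE (t : R^o) : E := ((emb u).1, (emb u).2 *m gam t).
have sgE : smooth_open setT gE.
  apply: smooth_pair; [exact: openT|exact: smooth_cst|].
  by apply: smooth_mulmx; [exact: openT|exact: smooth_cst|exact: sgam].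
have PgE t : groupP R m (gE t).2 by apply: groupPM; [exact: embS|exact: Pg].
have sh : smooth_map (vec_atlas R^o) (atlas B) setT (gb \o gE).
  apply: (smooth_map_comp (@vecc _) (@vec_atlas_smooth R E) HB _ _ sgb) => //.
    by move=> t _; exact: PgE.
  by apply: smooth_map_vec; exact: (smooth_open_on openT).
have h0 : (gb \o gE) 0 = u by rewrite /gE /= g0 mulmx1 -surjective_pairing embK.
have [|_ E0] := @model_push R^o setT (gb \o gE) c 0 1 openT sh Ac I; first by rewrite h0.
rewrite h0 in E0; rewrite derive1E; apply: etrans E0 _.
have -> : emb \o (gb \o gE) = gE by apply/funext => t; apply: gbK; exact: PgE.
have dgam : differentiable (gam : R^o -> mx) 0 by exact: (smooth_differentiable sgam).
have [d3 E3] := differentiable_mulmx (@differentiable_cst _ R^o _ (emb u).2 0) dgam.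
have E5 : 'D_1 gE 0 = (_, _) := derive_pair (1 : R^o) (@differentiable_cst _ R^o _ (emb u).1 0) d3.
rewrite E5; by rewrite derive_cst E3 derive_cst mul0mx addr0 derive1E.
Qed.

Let form_lin (x : 'rV[R]_m) (p q : mx) : linear (fun z : E => p *m (theta x z.1 *m q + z.2)).
Proof.
move=> a z z'.
rewrite -[(a *: z + z').1]/(a *: z.1 + z'.1) -[(a *: z + z').2]/(a *: z.2 + z'.2) thl mulmxDl -scalemxAl addrACA -scalerDr [LHS]mulmxDr -scalemxAr.
by [].
Qed.

(** Modulo p, theta at [x] is an injective map from R^m to g/p, whose dimension is m, so it is onto;
    [pr] reads off the class in g/p. *)
Let theta_surj x X : skewJ J X -> exists xi (a : R), (X - theta x xi) *m l = a *: l.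
Proof.
move=> sX; pose pr (Y : mx) : 'rV[R]_m := (usubmx (dsubmx (Y *m l)))^T.
have prl : linear pr by move=> a Y Y'; rewrite /pr mulmxDl -scalemxAl !linearP.
have pr0 Y : skewJ J Y -> pr Y = 0 -> exists a : R, Y *m l = a *: l.
  move=> /lie_g_decomp [a [X' [h [_ _ Yl]]]]; rewrite /pr Yl col_mxKd col_mxKu => /eqP.
  rewrite trmx_eq0 => /eqP ->; exists a.
  by rewrite col_mx0 /vec_l scale_col_mx scaler0 scale_scalar_mx mulr1.
pose M : 'M[R]_m := \matrix_i pr (theta x (coord_frame R i)).
have ME v : v *m M = pr (theta x v).
  rewrite (@form_sum R m _ _ setT theta (fun x _ => thl x) x v I) -[pr _]/(linear_pack prl _).
  rewrite mulmx_sum_row linear_sum; apply: eq_bigr => i _.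
  by rewrite rowK linearZ.
have Mu : M \in unitmx.
  rewrite -row_free_unit -kermx_eq0; apply/eqP/row_matrixP => i; rewrite row0.
  have : row i (kermx M) *m M = 0 by rewrite -row_mul mulmx_ker row0.
  by rewrite ME => /(pr0 _ (thk _ _)) [a /thi].
exists (pr X *m invmx M); apply: pr0.
  by apply: skewJD => //; apply: skewJN.
by rewrite -[pr _]/(linear_pack prl _) linearB /= -ME mulmxKV // subrr.
Qed.

Lemma model_connection : cartan_connection (lie_g R m) (groupP R m) model_act model_form.
Proof.
split; first split.
- move=> c u Ac du a v v'; rewrite /model_form (model_velocity_linear Ac du).
  exact: form_lin.
- move=> c c' u v Ac Ac' du du'.
  have oi := chart_img_open (HB Ac); have iu := chart_img (HB Ac) du.
  have uE := chart_K (HB Ac) du.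
  have [|d E0] := @model_push _ _ (cinv c) c' (crd c u) v oi (smooth_map_cinv sB Ac) Ac' iu; first by rewrite uE.
  rewrite uE in E0.
  have E1 : tangent_map id c c' u v = 'D_v (crd c' \o cinv c) (crd c u) by apply: esym; exact: deriveE.
  by rewrite /model_form E1 E0.
- move=> c v Ac; have oi := chart_img_open (HB Ac); apply: (smooth_open_on oi) => //.
  have sF := chart_emb Ac; set F := emb \o cinv c in sF.
  have sD := smooth_derive v sF; set DF := 'D_v F in sD.
  have s1 (f : 'rV[R]_(mdim B) -> 'rV[R]_m * mx) :
    smooth_open (img c) f -> smooth_open (img c) (fun x => (f x).1).
    by move=> sf; apply: (@smooth_comp _ _ _ _ _ _ setT f fst) => //; exact: smooth_fst.
  have s2 (f : 'rV[R]_(mdim B) -> 'rV[R]_m * mx) :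
    smooth_open (img c) f -> smooth_open (img c) (fun x => (f x).2).
    by move=> sf; apply: (@smooth_comp _ _ _ _ _ _ setT f snd) => //; exact: smooth_snd.
  have cst0 (M : mx) : smooth_open (img c) (fun _ : 'rV[R]_(mdim B) => M) by exact: smooth_cst.
  have sQ := s2 F sF.
  have sQT : smooth_open (img c) (fun x => (F x).2^T).
    exact: (@smooth_lin _ _ _ _ _ _ (fun x => (F x).2) (@trmx R _ _ : {linear mx -> mx}) oi sQ).
  have sth : smooth_open (img c) (fun x => theta (F x).1 (DF x).1).
    by apply: (@smooth_form _ _ _ _ setT theta (fun x _ => thl x) ths _ _ _ _ oi (s1 F sF) (s1 DF sD)).
  have s3 := smoothD oi (smooth_mulmx oi sth sQ) (s2 DF sD).
  have s4 := smooth_mulmx oi (smooth_mulmx oi (smooth_mulmx oi (cst0 J) sQT) (cst0 J)) s3.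
  apply: (smooth_ext oi _ s4) => x ix.
  by rewrite /model_form /model_velocity (chart_invK (HB Ac) ix).
- move=> c u Ac du; split.
  + move=> v _; apply/lie_gP; rewrite /model_form mulmxDr mulmxA -invE.
    apply: skewJD; last by rewrite invE; have [] := model_velocity_p v Ac du.
    apply: (skewJ_conj (@gram_tr R m) (@gram_invol R m)); [by have /groupPE [] := embS u|exact: thk].
  + move=> v1 v2 _ _ /eqP; rewrite -subr_eq0 => /eqP E0.
    apply/eqP; rewrite -subr_eq0; apply/eqP; apply: (model_velocity_inj Ac du).
    set v := v1 - v2; set q := (emb u).2.
    have vE : model_velocity c u v = model_velocity c u v1 - model_velocity c u v2.
      by rewrite -[LHS]/(linear_pack (model_velocity_linear Ac du) v) linearB.
    have {}E0 : J *m q^T *m J *m (theta (emb u).1 (model_velocity c u v).1 *m q + (model_velocity c u v).2) = 0.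
      rewrite -E0 vE /model_form -/q.
      by rewrite -[LHS]/(linear_pack (form_lin (emb u).1 (J *m q^T *m J) q) _) linearB.
    have [sY [a Ya]] := model_velocity_p v Ac du.
    move: E0 sY Ya; set z := model_velocity c u v; rewrite -invE -/q => E0 sY Ya.
    have {}E0 : theta (emb u).1 z.1 *m q + z.2 = 0.
      by rewrite -[LHS](mulKVmx (ub u)) E0 mulmx0.
    have /groupPE [iq [t t0 qt]] := embS u; rewrite -/q in iq qt.
    have uq : q \in unitmx := ub u.
    (* Here theta(z.1) = - q (q^-1 z.2) q^-1 preserves the line of l, since q^-1 z.2 lies in p; now
       [thi] applies. *)
    have z1 : z.1 = 0.
      apply: (@thi (emb u).1 z.1 (- a)).
      have -> : theta (emb u).1 z.1 = - (q *m (invmx q *m z.2) *m invmx q).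
        rewrite mulKVmx //; move/eqP: E0; rewrite addr_eq0 => /eqP E0.
        by rewrite -mulNmx -E0 mulmxK.
      rewrite mulNmx -[q *m _ *m _ *m l]mulmxA (scale_inv uq _ qt) ?gt_eqF // -scalemxAr.
      rewrite -[q *m _ *m l]mulmxA Ya.
      by rewrite -scalemxAr qt !scalerA scaleNr mulrAC mulVf ?gt_eqF // mul1r.
    rewrite [z]surjective_pairing z1; congr pair.
    by move: E0; rewrite z1 -[theta _ 0]/(linear_pack (thl _) 0) linear0 mul0mx add0r.
  + move=> X /lie_gP sX; have /groupPE [iq [t t0 qt]] := embS u.
    set q := (emb u).2 in iq qt *; have uq : q \in unitmx := ub u.
    have sX' : skewJ J (q *m X *m invmx q).
      have := skewJ_conj (@gram_tr R m) (@gram_invol R m) (isoJ_inv (@gram_invol R m) iq) sX.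
      by rewrite invmxK.
    (* [xi] is chosen so that the remainder of X lies in p; the remainder is then realised along the
       fibre. *)
    have [xi [a Ea]] := theta_surj (emb u).1 sX'.
    pose Y := X - invmx q *m theta (emb u).1 xi *m q.
    have pY : lie_p Y.
      split.
        apply: skewJD => //; apply: skewJN; apply: (skewJ_conj (@gram_tr R m) (@gram_invol R m)) => //.
      have -> : Y = invmx q *m (q *m X *m invmx q - theta (emb u).1 xi) *m q.
        by rewrite mulmxBr mulmxBl !mulmxA mulVmx // mul1mx mulmxKV.
      exists a; move: Ea; set W := q *m X *m invmx q - _ => Ea.
      rewrite -[_ *m q *m l]mulmxA qt -scalemxAr -[_ *m W *m l]mulmxA Ea -scalemxAr (scale_inv uq _ qt) ?gt_eqF //.
      by rewrite !scalerA mulrAC mulfV ?gt_eqF // mul1r.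
    have [v Ev] := model_velocity_surj xi Ac du pY.
    exists v => //; rewrite /model_form Ev /= -invE -/q mulmxDr mulKmx //.
    by rewrite mulmxA /Y addrC subrK.
(* Right translation sends the velocity (xi, q') to (xi, q' r); the factor r^-1 on the left comes
   from (q r)^-1. *)
- move=> c c' u r v Ac Ac' Pr du dr.
  have oi := chart_img_open (HB Ac); have iu := chart_img (HB Ac) du.
  have uE := chart_K (HB Ac) du.
  have sF := chart_emb Ac; set F := emb \o cinv c in sF.
  pose g x : E := ((F x).1, (F x).2 *m r).
  have Pg x : groupP R m (g x).2 by apply: groupPM => //; exact: embS.
  have sg : smooth_open (img c) g.
    apply: smooth_pair => //.
      by apply: (@smooth_comp _ _ _ _ _ _ setT F fst) => //; exact: smooth_fst.
    apply: smooth_mulmx => //; last exact: smooth_cst.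
    by apply: (@smooth_comp _ _ _ _ _ _ setT F snd) => //; exact: smooth_snd.
  have sh : smooth_map (vec_atlas 'rV[R]_(mdim B)) (atlas B) (img c) (gb \o g).
    apply: (smooth_map_comp (@vecc _) (@vec_atlas_smooth R E) HB _ _ sgb) => //.
      by move=> x _; exact: Pg.
    by apply: smooth_map_vec; exact: (smooth_open_on oi).
  have hu : (gb \o g) (crd c u) = model_act u r by rewrite /g /F /= uE.
  have [|d E0] := @model_push _ _ (gb \o g) c' (crd c u) v oi sh Ac' iu; first by rewrite hu.
  rewrite hu in E0.
  have TE : tangent_map (fun b => model_act b r) c c' u v = 'D_v (crd c' \o (gb \o g)) (crd c u).
    by apply: esym; exact: deriveE.
  have gE : emb \o (gb \o g) = g by apply/funext => x; apply: gbK; exact: Pg.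
  have dF := vel_diff Ac du.
  have [d1 E1] := derive_linear_comp (@fst 'rV[R]_m mx : {linear _ -> _}) v dF.
  have [d2 E2] := derive_linear_comp (@snd 'rV[R]_m mx : {linear _ -> _}) v dF.
  have [d3 E3] := differentiable_mulmx d2 (@differentiable_cst _ _ _ r (crd c u)).
  have E4 : 'D_v g (crd c u) = ((model_velocity c u v).1, (model_velocity c u v).2 *m r).
    apply: etrans (derive_pair v d1 d3) _; congr pair; first exact: E1.
    by rewrite E3 derive_cst mulmx0 add0r; congr (_ *m _); exact: E2.
  rewrite gE E4 -TE in E0.
  rewrite /model_form E0 /= {1 2 3}/model_act gbK; last by apply: groupPM => //; exact: embS.
  have /groupPE [ir _] := Pr.
  rewrite (isoJ_invmx (@gram_invol R m) ir) /= trmx_mul mulmxA -mulmxDl !mulmxA.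
  congr (_ *m _ *m _); rewrite -!mulmxA; congr (_ *m (_ *m _)).
  by rewrite [J *m (J *m _)]mulmxA gram_invol mul1mx.
- move=> c u gam Ac du cg; rewrite /model_form (push_curve Ac du cg) /=.
  rewrite -[theta _ 0]/(linear_pack (thl _) 0) linear0 mul0mx add0r mulmxA inv_mul.
  by rewrite mul1mx.
Qed.

End ModelGeometry.

(** * Local sections of a lightlike geometry *)

Lemma derive_lincomb (R : realType) (V W : normedModType R) (f g : V -> W) (a : R) x v :
  differentiable f x -> differentiable g x ->
  'D_v (fun y => a *: f y + g y) x = a *: 'D_v f x + 'D_v g x.
Proof.
move=> df dg; have d1 : derivable f x v by exact: diff_derivable.
have d2 : derivable g x v by exact: diff_derivable.
have -> : (fun y => a *: f y + g y) = a *: f + g by [].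
by rewrite deriveD // ?deriveZ //; exact: derivableZ.
Qed.

Section CurvatureAlgebra.
Variables (R : realType) (k : nat) (B : manifold R) (w : preform B 'M[R]_k).
Hypotheses (wl : forall c x, atlas B c -> img c x -> linear (w c (cinv c x)))
  (ws : forall c v, atlas B c -> smooth_open (img c) (fun x => w c (cinv c x) v)).

Lemma curvature_antisym c u v1 v2 : curvature w c u v1 v2 = - curvature w c u v2 v1.
Proof.
by rewrite /curvature /ext_deriv /bracket [in RHS]opprD !opprB.
Qed.

Lemma curvature_linear c u v2 : atlas B c -> dom c u ->
  linear (fun v1 => curvature w c u v1 v2).
Proof.
move=> Ac du a v v'; have Hc := manifold_chart Ac; have iu := chart_img Hc du.
have lu : linear (w c u) by rewrite -(chart_K Hc du); exact: wl.
have d v0 : differentiable (fun x => w c (cinv c x) v0) (crd c u) by exact: (smooth_differentiable (ws v0 Ac)).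
have E1 : 'D_(a *: v + v') (fun x => w c (cinv c x) v2) (crd c u) =
    a *: 'D_v (fun x => w c (cinv c x) v2) (crd c u) + 'D_v' (fun x => w c (cinv c x) v2) (crd c u).
  by rewrite !deriveE // linearP.
have E2 : 'D_v2 (fun x => w c (cinv c x) (a *: v + v')) (crd c u) =
    a *: 'D_v2 (fun x => w c (cinv c x) v) (crd c u) + 'D_v2 (fun x => w c (cinv c x) v') (crd c u).
  have nE : \forall x \near crd c u, w c (cinv c x) (a *: v + v') =
      a *: w c (cinv c x) v + w c (cinv c x) v'.
    by apply: filterS (near_img Hc iu) => x ix; rewrite wl.
  exact: (etrans (near_eq_derive v2 nE) (derive_lincomb a v2 (d v) (d v'))).
rewrite /curvature /ext_deriv E1 E2 lu /bracket mulmxDl mulmxDr -scalemxAl -scalemxAr.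
set p1 := 'D_v _ _; set p2 := 'D_v' _ _; set q1 := 'D_v2 _ _; set q2 := 'D_v2 _ _.
have H (U : lmodType R) (x1 x2 y1 y2 r1 r2 s1 s2 : U) :
  (a *: x1 + x2) - (a *: y1 + y2) + ((a *: r1 + r2) - (a *: s1 + s2)) =
  a *: (x1 - y1 + (r1 - s1)) + (x2 - y2 + (r2 - s2)).
  have H1 (e1 e2 f1 f2 : U) : (a *: e1 + e2) - (a *: f1 + f2) = a *: (e1 - f1) + (e2 - f2).
    by rewrite opprD addrACA -scalerBr.
  by rewrite !H1 addrACA -scalerDr.
exact: H.
Qed.

End CurvatureAlgebra.

Section CurvatureCondition.
Variables (R : realType) (m : nat).
Local Notation J := (gram R m).
Local Notation l := (vec_l R m).
Local Notation mx := 'M[R]_(1 + (m + 1)).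
Variables (B N : manifold R) (p : B -> N) (act : B -> mx -> B) (w : preform B mx).
Hypothesis hw : lightlike_cartan_geometry p act w.
Hypothesis hK : forall e : mx, lie_g_minus1 R m e ->
  forall (c : chart B 'rV[R]_(mdim B)) (u : B), atlas B c -> dom c u ->
    curvature w c u (const_field w (grading R m) c u) (const_field w e c u) = 0.

(* E + h is closed under adding multiples of E, and K vanishes on h by
   equivariance, so the condition on E spreads to RE + h in the first slot. *)
Lemma curvature_on_line c u v1 v2 a : atlas B c -> dom c u -> w c u v1 *m l = a *: l ->
  curvature w c u v1 v2 = 0.
Proof.
move=> Ac du w1l; have [_ [_ sact [act1 _ _] _] conn] := hw.
have cl v := @curvature_linear R _ B w (fun c x => @form_linear R _ _ _ _ _ _ conn c x)
  (fun c v => @form_smooth R _ _ _ _ _ _ conn c v) c u v Ac du.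
have lu : linear (w c u).
  by have Hc := manifold_chart Ac; rewrite -(chart_K Hc du); apply: (form_linear conn Ac); exact: (chart_img Hc du).
have HJ q : groupH R m q -> isoJ J q by move=> /groupHE [].
have vert v v' : w c u v *m l = 0 -> curvature w c u v v' = 0.
  move=> wl0; have sX : skewJ J (w c u v) by apply/lie_gP; exact: (form_in conn).
  have [|gam [_ Dg /(_ erefl) cg]] := @exp_curve R m (w c u v) 0 sX; first by rewrite scale0r.
  exact: (vertical_curvature (@gram_invol R m) HJ sact act1 conn v' cg Ac du (esym Dg)).
set e0 := const_field w (grading R m) c u.
have we0 : w c u e0 = grading R m by apply: (form_surj conn) => //; exact: grading_lie.
have e00 : curvature w c u e0 e0 = 0.
  have := curvature_antisym w c u e0 e0; move/eqP; rewrite -subr_eq0 opprK -mulr2n.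
  by rewrite -scaler_nat scaler_eq0 pnatr_eq0 /= => /eqP.
have e0v v : curvature w c u e0 v = 0.
  have sv : skewJ J (w c u v) by apply/lie_gP; exact: (form_in conn).
  have [b [X [h [[_ hl] Ev _]]]] := lie_g_decomp sv.
  set e := lie_mx 0 X 0 0 in Ev; have He : lie_g_minus1 R m e by exists X.
  have we : w c u (const_field w e c u) = e.
    by apply: (form_surj conn) => //; exists 0, X, 0, 0; rewrite trmx0 oppr0.
  set v0 := v - (b *: e0 + const_field w e c u).
  have wv0 : w c u v0 *m l = 0.
    rewrite /v0 -[w c u _]/(linear_pack lu _) linearB linearD linearZ /= we0 we Ev.
    by rewrite addrC addKr.
  have vE : v = b *: e0 + (1 *: const_field w e c u + v0).
    by rewrite scale1r addrA /v0 addrC subrK.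
  rewrite curvature_antisym vE cl cl.
  rewrite (vert _ _ wv0) e00 (curvature_antisym w c u (const_field w e c u)) (hK He Ac du).
  by rewrite !oppr0 !scaler0 !addr0 oppr0.
have s1 : skewJ J (w c u v1) by apply/lie_gP; exact: (form_in conn).
have -> : v1 = a *: e0 + (v1 - a *: e0) by rewrite addrC subrK.
rewrite cl e0v scaler0 add0r; apply: vert.
rewrite -[w c u _]/(linear_pack lu _) linearB linearZ /= we0 mulmxBl -scalemxAl grading_l.
by rewrite w1l subrr.
Qed.

End CurvatureCondition.

Section LocalSection.
Variables (R : realType) (m : nat).
Local Notation J := (gram R m).
Local Notation l := (vec_l R m).
Local Notation mx := 'M[R]_(1 + (m + 1)).
Variables (B N : manifold R) (p : B -> N) (act : B -> mx -> B) (w : preform B mx).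
Hypothesis hw : lightlike_cartan_geometry p act w.
Variables (U0 : set N) (phi : B -> mx) (g : N * mx -> B) (cN : chart N 'rV[R]_(mdim N))
  (c : chart B 'rV[R]_(mdim B)).
Hypotheses (oU0 : open U0)
  (phiM : forall b q, U0 (p b) -> groupH R m q -> phi (act b q) = phi b *m q)
  (sphi : smooth_map (atlas B) (prod_atlas (atlas N) (vec_atlas mx)) (p @^-1` U0) (fun b => (p b, phi b)))
  (phiH : forall b, U0 (p b) -> groupH R m (phi b))
  (sg : smooth_map (prod_atlas (atlas N) (vec_atlas mx)) (atlas B) [set xq | U0 xq.1 /\ groupH R m xq.2] g)
  (gK : forall b, U0 (p b) -> g (p b, phi b) = b)
  (pg : forall x q, U0 x -> groupH R m q -> p (g (x, q)) = x /\ phi (g (x, q)) = q)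
  (AcN : atlas N cN) (Ac : atlas B c).

(** The section on which [phi] is 1; every other point is recovered by acting on it with its own
    value of [phi]. *)
Definition local_section (z : 'rV[R]_(mdim N)) : B := g (cinv cN z, 1%:M).
Definition section_domain : set 'rV[R]_(mdim N) :=
  [set z | [/\ img cN z, U0 (cinv cN z) & dom c (local_section z)]].
Definition section_coord (z : 'rV[R]_(mdim N)) : 'rV[R]_(mdim B) := crd c (local_section z).
Definition section_form (z xi : 'rV[R]_(mdim N)) : mx :=
  w c (local_section z) ('D_xi section_coord z).
Definition base_coord (d : chart B 'rV[R]_(mdim B)) y : 'rV[R]_(mdim N) := crd cN (p (cinv d y)).
Definition fiber_coord (d : chart B 'rV[R]_(mdim B)) y : mx := phi (cinv d y).
Definition bundle_domain (d : chart B 'rV[R]_(mdim B)) : set 'rV[R]_(mdim B) :=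
  [set y | [/\ img d y, U0 (p (cinv d y)) & dom cN (p (cinv d y))]].

Let conn : cartan_connection (lie_g R m) (groupH R m) act w. Proof. by case: hw. Qed.
Let sact : smooth_map (prod_atlas (atlas B) (vec_atlas mx)) (atlas B)
    [set bq | groupH R m bq.2] (fun bq => act bq.1 bq.2).
Proof. by case: hw => _ []. Qed.
Let act1 b : act b 1%:M = b. Proof. by case: hw => _ [_ _ [H _ _] _] _. Qed.
Let actA b q r : groupH R m q -> groupH R m r -> act (act b q) r = act b (q *m r).
Proof. by case: hw => _ [_ _ [_ H _] _] _; exact: H. Qed.
Let pact b q : groupH R m q -> p (act b q) = p b.
Proof. by case: hw => _ [_ _ [_ _ H] _] _; exact: H. Qed.
Let oV : open (p @^-1` U0).
Proof.
by case: hw => _ [[cp _] _ _ _] _; apply: open_comp => // x _; exact: (within_open_at openT cp).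
Qed.
Let HN := manifold_chart AcN.
Let Hc := manifold_chart Ac.
Let H1 : groupH R m 1%:M := groupH1 R m.

Let odom : open [set z | img cN z /\ U0 (cinv cN z)].
Proof.
rewrite openE => z [iz Uz]; rewrite /interior; apply: filterI; first exact: (near_img HN).
exact: (cinv_continuous HN iz (open_nbhs_nbhs (conj oU0 Uz))).
Qed.

Let sB := atlas_smooth B.
Let sN := atlas_smooth N.
Let vecc (V : normedModType R) d : vec_atlas V d -> is_chart d.
Proof. by move=> ->; exact: vec_chart_is_chart. Qed.
Let prN : is_smooth_atlas (prod_atlas (atlas N) (vec_atlas mx)).
Proof. by apply: prod_atlas_smooth => //; exact: vec_atlas_smooth. Qed.

Lemma local_section_smooth : smooth_map (vec_atlas 'rV[R]_(mdim N)) (atlas B)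
  [set z | img cN z /\ U0 (cinv cN z)] local_section.
Proof.
have s1 : smooth_map (vec_atlas 'rV[R]_(mdim N)) (prod_atlas (atlas N) (vec_atlas mx))
    [set z | img cN z /\ U0 (cinv cN z)] (fun z => (cinv cN z, 1%:M)).
  apply: smooth_map_pair; first exact: vecc.
    by apply: smooth_map_sub (smooth_map_cinv sN AcN) => z [].
  by apply: smooth_map_vec; apply: (smooth_open_on odom) => //; exact: smooth_cst.
apply: (smooth_map_comp (@vecc _) prN (fun d Ad => manifold_chart Ad) _ s1 sg).
by move=> z [iz Uz]; split.
Qed.

Lemma section_coord_smooth : open section_domain /\ smooth_open section_domain section_coord.
Proof.
have [oS sS] := smooth_map_open (vec_chart_is_chart _) Hc odom local_section_smooth erefl Ac.
have E : [set y | [/\ img (vec_chart _) y, [set z | img cN z /\ U0 (cinv cN z)] (cinv (vec_chart 'rV[R]_(mdim N)) y)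
   & dom c (local_section (cinv (vec_chart _) y))]] = section_domain.
  by apply/seteqP; split=> z; [move=> [_ [iz Uz] dz]|move=> [iz Uz dz]; split].
by rewrite -E.
Qed.

Lemma bundle_coord_smooth d : atlas B d -> [/\ open (bundle_domain d),
  smooth_open (bundle_domain d) (base_coord d) & smooth_open (bundle_domain d) (fiber_coord d)].
Proof.
move=> Ad; have Hd := manifold_chart Ad.
have Ap : prod_atlas (atlas N) (vec_atlas mx) (prod_chart cN (vec_chart mx)) by exists cN, (vec_chart mx).
have [oS sS] := smooth_map_open Hd (prod_chart_is_chart HN (vec_chart_is_chart mx)) oV sphi Ad Ap.
set S := [set y | _] in oS sS.
have E : S = bundle_domain d.
  by apply/seteqP; split=> y; [move=> [iy Uy [dy _]]|move=> [iy Uy dy]; split].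
rewrite -E; split=> //.
  by apply: (@smooth_comp _ _ _ _ _ _ setT _ fst oS _ sS) => //; exact: smooth_fst.
by apply: (@smooth_comp _ _ _ _ _ _ setT _ snd oS _ sS) => //; exact: smooth_snd.
Qed.

Lemma section_coordK z : section_domain z -> cinv c (section_coord z) = local_section z.
Proof. by move=> [_ _ dz]; exact: (chart_K Hc dz). Qed.

Lemma section_act b : U0 (p b) -> dom cN (p b) ->
  act (local_section (crd cN (p b))) (phi b) = b.
Proof.
move=> Ub db; have Hb := phiH Ub; rewrite /local_section (chart_K HN db).
have [p1 p2] := pg Ub H1.
have E1 : p (act (g (p b, 1%:M)) (phi b)) = p b by rewrite pact.
have E2 : phi (act (g (p b, 1%:M)) (phi b)) = phi b by rewrite phiM ?p1 // p2 mul1mx.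
by rewrite -(gK (b := act _ _)) ?E1 // E2 gK.
Qed.


Lemma local_section_mem z : img cN z -> U0 (cinv cN z) ->
  p (local_section z) = cinv cN z /\ phi (local_section z) = 1%:M.
Proof. by move=> iz Uz; exact: pg. Qed.

Lemma bundle_domain_crd d b : atlas B d -> dom d b -> U0 (p b) -> dom cN (p b) ->
  bundle_domain d (crd d b).
Proof.
move=> Ad db Ub dNb; have Hd := manifold_chart Ad.
by split; rewrite ?(chart_K Hd db) //; exact: (chart_img Hd db).
Qed.

(* Differentiate b = sigma(z(b)) . phi(b): equivariance gives the first summand,
   the fundamental vector fields the second. *)
Lemma form_decomposition d b v : atlas B d -> dom d b -> U0 (p b) -> dom cN (p b) ->
  section_domain (crd cN (p b)) ->
  w d b v = J *m (phi b)^T *m J *m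
    (section_form (crd cN (p b)) ('D_v (base_coord d) (crd d b)) *m phi b
     + 'D_v (fiber_coord d) (crd d b)).
Proof.
move=> Ad db Ub dNb Dz; have Hd := manifold_chart Ad; have JJ := @gram_invol R m.
set z := crd cN (p b) in Dz *; set q := phi b; set y := crd d b.
have Hq : groupH R m q by exact: phiH.
have /groupHE [iq ql] := Hq.
have [oD sz sq] := bundle_coord_smooth Ad; have Dy := bundle_domain_crd Ad db Ub dNb.
have [oS ss] := section_coord_smooth.
have zE : base_coord d y = z by rewrite /base_coord (chart_K Hd db).
have qE : fiber_coord d y = q by rewrite /fiber_coord (chart_K Hd db).
have [iz Uz dz] := Dz; have isz := chart_img Hc dz.
have actb : act (local_section z) q = b by exact: section_act.
(* In coordinates [F] composed with (section, [phi]) is the identity, so v is the differential of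
   [F] on the two velocities. As [F] is defined on an open set of matrices, its two partial
   derivatives can be taken separately. *)
have [|O [F [oO Ox sF FE]]] := action_chart sact Ac Ad isz Hq.
  by rewrite section_coordK // actb.
pose h y' := (section_coord (base_coord d y'), fiber_coord d y').
have dzeta := smooth_differentiable sz Dy; have dfib := smooth_differentiable sq Dy.
have ds := smooth_differentiable ss Dz.
have dsz : differentiable (section_coord \o base_coord d) y.
  by apply: differentiable_comp => //; rewrite zE.
have dh : differentiable h y by exact: differentiable_pair.
have hy : h y = (section_coord z, q) by rewrite /h zE qE.
have dF : differentiable F (section_coord z, q) by exact: (smooth_differentiable sF).
set zeta := 'D_v (base_coord d) y; set qd := 'D_v (fiber_coord d) y.
have Dh : 'D_v h y = ('D_zeta section_coord z, qd).
  have -> : 'D_v h y = (_, _) := derive_pair v dsz dfib.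
  have ds' : differentiable section_coord (base_coord d y) by rewrite zE.
  congr pair; apply: etrans (derive_comp v dzeta ds') _.
  by rewrite zE.
have nO : \forall y' \near y, O (h y').
  by apply: (differentiable_continuous dh); rewrite hy; exact: (open_nbhs_nbhs (conj oO Ox)).
have nD : \forall y' \near y, bundle_domain d y' by exact: (open_nbhs_nbhs (conj oD Dy)).
have nS : \forall y' \near y, section_domain (base_coord d y').
  by apply: (differentiable_continuous dzeta); rewrite zE; exact: (open_nbhs_nbhs (conj oS Dz)).
have nE : \forall y' \near y, (F \o h) y' = y'.
  apply: filterS3 nO nD nS => y' Oy' [iy' Uy' dy'] Sy'.
  have Hq' : groupH R m (fiber_coord d y') by exact: phiH.
  have [_ _ EF] := FE _ _ Oy' Hq'; apply: etrans EF _.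
  by rewrite section_coordK // section_act // (chart_invK Hd).
have Ev : v = 'D_('D_zeta section_coord z, qd) F (section_coord z, q).
  have E1 : 'D_v id y = v by rewrite derive_id.
  have dFh : differentiable F (h y) by rewrite hy.
  have E3 := derive_comp v dh dFh; rewrite Dh hy in E3.
  exact: (etrans (esym E1) (etrans (esym (near_eq_derive v nE)) E3)).
have lw : linear (w d b).
  by rewrite -(chart_K Hd db); apply: (form_linear conn Ad); exact: (chart_img Hd db).
have Ev2 : v = 'D_('D_zeta section_coord z, 0) F (section_coord z, q) + 'D_(0, qd) F (section_coord z, q).
  rewrite {1}Ev !deriveE // -linearD; congr ('d F _ _).
  by congr pair; rewrite /= ?addr0 ?add0r.
rewrite {1}Ev2 -[w d b _]/(linear_pack lw _) linearD /= mulmxDr; congr (_ + _).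
- have nF : \forall x \near section_coord z, F (x, q) = (crd d \o (fun b' => act b' q) \o cinv c) x.
    have ct : {for section_coord z, continuous (fun x : 'rV[R]_(mdim B) => (x, q))}.
      by apply: (@continuous_pair_at _ _ _ (@id 'rV[R]_(mdim B)) (fun=> q)); [exact: cvg_id|exact: cst_continuous].
    have : \forall x \near section_coord z, O (x, q) by exact: (ct _ (open_nbhs_nbhs (conj oO Ox))).
    by apply: filterS => x Oxq; have [_ _ ->] := FE _ _ Oxq Hq.
  have did : differentiable (@id 'rV[R]_(mdim B)) (section_coord z) by have [] := is_diff_id (section_coord z).
  have dp : differentiable (fun x : 'rV[R]_(mdim B) => (x, q)) (section_coord z).
    by apply: differentiable_pair => //; exact: differentiable_cst.
  have dFp : differentiable (fun x : 'rV[R]_(mdim B) => F (x, q)) (section_coord z).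
    exact: (@differentiable_comp _ _ _ _ (fun x : 'rV[R]_(mdim B) => (x, q)) F).
  have [dA _] := near_eq_differentiable nF dFp.
  have -> : 'D_('D_zeta section_coord z, 0) F (section_coord z, q) =
      tangent_map (fun b' => act b' q) c d (local_section z) ('D_zeta section_coord z).
    have E1 : 'D_('D_zeta section_coord z) (F \o (fun x : 'rV[R]_(mdim B) => (x, q))) (section_coord z)
        = 'D_('D_zeta section_coord z, 0) F (section_coord z, q).
      rewrite (derive_comp _ dp dF); congr ('D_ _ F _).
      have -> := derive_pair ('D_zeta section_coord z) did (@differentiable_cst _ _ _ q (section_coord z)).
      by rewrite derive_id derive_cst.
    have E2 := near_eq_derive ('D_zeta section_coord z) nF.
    exact: (etrans (esym E1) (etrans E2 (deriveE _ dA))).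
  have [_ _ Heq _] := conn.
  have := Heq c d (local_section z) q ('D_zeta section_coord z) Ac Ad Hq dz; rewrite actb => -> //.
  by rewrite (isoJ_invmx JJ iq) mulmxA.
(* X = q^-1 dq lies in h, so the fibre part of v is the value at b of the fundamental field of X. *)
- set X := J *m q^T *m J *m qd.
  have nG : \forall y' \near y, groupH R m (fiber_coord d y').
    by apply: filterS nD => y' [_ Uy' _]; exact: phiH.
  have sX : skewJ J X.
    rewrite /X -qE; apply: velocity_skew => //.
    by apply: filterS nG => y' /groupHE [].
  have Xl : X *m l = 0 *: l.
    have qdl : qd *m l = 0 by apply: velocity_fix => //; apply: filterS nG => y' /groupHE [].
    by rewrite /X -mulmxA qdl mulmx0 scale0r.
  have [gam [_ Dg /(_ erefl) cg]] := exp_curve sX Xl; have [sgam Hg g0] := cg.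
  have [_ _ _ Hf] := conn.
  have Hfund := Hf d b gam Ad db cg; rewrite Dg in Hfund.
  rewrite -[RHS]Hfund; congr (w d b _); rewrite derive1E.
  have sgam' : smooth_open setT (gam : R^o -> mx) by apply: smooth_on_open; [exact: openT|].
  have dgam : differentiable (gam : R^o -> mx) 0 by exact: (smooth_differentiable sgam').
  have [d3 E3] := differentiable_mulmx (@differentiable_cst _ R^o _ q 0) dgam.
  have dp : differentiable (fun t : R^o => (section_coord z, q *m gam t)) 0.
    by apply: differentiable_pair => //; exact: differentiable_cst.
  have p0 : (section_coord z, q *m gam 0) = (section_coord z, q) by rewrite g0 mulmx1.
  have nF : \forall t \near (0 : R^o), crd d (act b (gam t)) = (F \o (fun t : R^o => (section_coord z, q *m gam t))) t.
    have : \forall t \near (0 : R^o), O (section_coord z, q *m gam t).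
      by apply: (differentiable_continuous dp); rewrite p0; exact: (open_nbhs_nbhs (conj oO Ox)).
    apply: filterS => t Ot; have [_ _ /= ->] := FE _ _ Ot (groupHM Hq (Hg t)).
    by rewrite section_coordK // -actA // actb.
  apply: esym; apply: etrans (near_eq_derive (1 : R^o) nF) _.
  have dF' : differentiable F (section_coord z, q *m gam 0) by rewrite p0.
  apply: etrans (derive_comp (1 : R^o) dp dF') _; rewrite p0; congr ('D_ _ F _).
  have -> : 'D_1 (fun t : R^o => (section_coord z, q *m gam t)) 0 = (_, _)
    := derive_pair (1 : R^o) (@differentiable_cst _ R^o _ (section_coord z) 0) d3.
  rewrite derive_cst; congr pair; rewrite E3 derive_cst mul0mx addr0 -derive1E Dg /X.
  by rewrite -(isoJ_invmx JJ iq) mulKVmx // (isoJ_unit JJ iq).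
Qed.



Lemma section_form_linear z : section_domain z -> linear (section_form z).
Proof.
move=> Dz a v v'; have [_ ss] := section_coord_smooth; have ds := smooth_differentiable ss Dz.
have [iz Uz dz] := Dz.
have lw : linear (w c (local_section z)).
  by rewrite -(chart_K Hc dz); apply: (form_linear conn Ac); exact: (chart_img Hc dz).
by rewrite /section_form !deriveE // linearP lw.
Qed.

Let sectionW z v : section_domain z -> section_form z v = w c (cinv c (section_coord z)) ('D_v section_coord z).
Proof. by move=> Dz; rewrite section_coordK. Qed.

Let section_img z : section_domain z -> img c (section_coord z).
Proof. by move=> [_ _ dz]; exact: (chart_img Hc dz). Qed.

Lemma section_form_smooth v : smooth_open section_domain (fun z => section_form z v).
Proof.
have [oS ss] := section_coord_smooth.
have sW := smooth_form (fun x => @form_linear R _ _ _ _ _ _ conn c x Ac) (fun v => @form_smooth R _ _ _ _ _ _ conn c v Ac)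
  oS ss (smooth_derive v ss) section_img.
by apply: (smooth_ext oS _ sW) => z Dz; rewrite sectionW.
Qed.

Lemma section_form_skew z v : section_domain z -> skewJ J (section_form z v).
Proof. by move=> [_ _ dz]; apply/lie_gP; exact: (form_in conn). Qed.

Lemma section_base z : section_domain z -> base_coord c (section_coord z) = z.
Proof.
move=> Dz; have [iz Uz _] := Dz; have [E _] := local_section_mem iz Uz.
by rewrite /base_coord section_coordK // E (chart_invK HN).
Qed.

(** If the form kills l on v, its value lies in h, and by injectivity of w the image of v under the
    section is the velocity of a curve in the fibre. That curve projects to a point, whereas the
    section projects to the identity. *)
Lemma section_form_inj z v : section_domain z -> section_form z v *m l = 0 -> v = 0.
Proof.
move=> Dz vl; have [iz Uz dz] := Dz; have [pz phz] := local_section_mem iz Uz.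
have [oS ss] := section_coord_smooth.
have X0 : section_form z v *m l = 0 *: l by rewrite scale0r.
have [gam [_ Dg /(_ erefl) cg]] := exp_curve (section_form_skew v Dz) X0; have [sgam Hg g0] := cg.
have [_ _ _ Hf] := conn.
have E0 := Hf c (local_section z) gam Ac dz cg; rewrite Dg in E0.
have E1 := form_inj conn Ac dz E0.
have isz := section_img Dz; have sE := section_coordK Dz.
have [|O [F [oO Ox sF FE]]] := action_chart sact Ac Ac isz H1.
  by rewrite section_coordK // act1.
have sgam' : smooth_open setT (gam : R^o -> mx) by apply: smooth_on_open; [exact: openT|].
have dgam : differentiable (gam : R^o -> mx) 0 by exact: (smooth_differentiable sgam').
have dp : differentiable (fun t : R^o => (section_coord z, gam t)) 0.
  by apply: differentiable_pair => //; exact: differentiable_cst.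
have nO : \forall t \near (0 : R^o), O (section_coord z, gam t).
  by apply: (differentiable_continuous dp); rewrite g0; exact: (open_nbhs_nbhs (conj oO Ox)).
pose e (t : R^o) := crd c (act (local_section z) (gam t)).
have nF : \forall t \near (0 : R^o), (F \o (fun t : R^o => (section_coord z, gam t))) t = e t.
  by apply: filterS nO => t Ot; have [_ _ /= ->] := FE _ _ Ot (Hg t); rewrite section_coordK.
have dFg : differentiable (F \o (fun t : R^o => (section_coord z, gam t))) 0.
  have dF1 : differentiable F (section_coord z, gam 0) by rewrite g0; exact: (smooth_differentiable sF Ox).
  exact: (differentiable_comp dp dF1).
have [de _] := near_eq_differentiable nF dFg.
have e0 : e 0 = section_coord z by rewrite /e g0 act1.
have Db : bundle_domain c (section_coord z).
  by split; [exact: isz|rewrite sE pz; exact: Uz|rewrite sE pz; exact: (chart_dom HN iz)].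
have [oD sz _] := bundle_coord_smooth Ac.
have dz0 := smooth_differentiable sz Db.
have E2 : 'D_('D_v section_coord z) (base_coord c) (section_coord z) = v.
  have ds := smooth_differentiable ss Dz.
  rewrite -(derive_comp v ds dz0).
  have nE : \forall y \near z, (base_coord c \o section_coord) y = y.
    have : \forall y \near z, section_domain y by exact: (open_nbhs_nbhs (conj oS Dz)).
    by apply: filterS => y; exact: section_base.
  by rewrite (near_eq_derive v nE) derive_id.
have E3 : 'D_1 (base_coord c \o e) 0 = 'D_('D_v section_coord z) (base_coord c) (section_coord z).
  have dz1 : differentiable (base_coord c) (e 0) by rewrite e0.
  by apply: etrans (derive_comp (1 : R^o) de dz1) _; rewrite e0 -E1 derive1E.
rewrite -E2 -E3.
have nC : \forall t \near (0 : R^o), (base_coord c \o e) t = cst z t.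
  apply: filterS nO => t Ot; have [_ dt _] := FE _ _ Ot (Hg t).
  rewrite sE in dt.
  by rewrite /= /base_coord /e (chart_K Hc dt) pact // pz (chart_invK HN).
by rewrite (near_eq_derive (1 : R^o) nC) derive_cst.
Qed.

(** A tangent vector with value Y at a point of the section differs from one tangent to the section
    by a vertical one, whose value kills l; this is [form_decomposition] at phi = 1. *)
Lemma section_form_onto z Y : section_domain z -> lie_g R m Y ->
  exists v, section_form z v *m l = Y *m l.
Proof.
move=> Dz gY; have [iz Uz dz] := Dz; have [pz phz] := local_section_mem iz Uz.
have E0 := form_surj conn Ac dz gY; set v := const_field _ _ _ _ in E0.
have Ub : U0 (p (local_section z)) by rewrite pz.
have dNb : dom cN (p (local_section z)) by rewrite pz; exact: (chart_dom HN).
have zE : crd cN (p (local_section z)) = z by rewrite pz (chart_invK HN).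
have := form_decomposition v Ac dz Ub dNb; rewrite zE => /(_ Dz).
rewrite E0 phz trmx1 mulmx1 gram_invol mul1mx mulmx1 => ->.
exists ('D_v (base_coord c) (crd c (local_section z))).
rewrite mulmxDl velocity_fix ?addr0 //.
  have [oD sz sq] := bundle_coord_smooth Ac.
  exact: (smooth_differentiable sq (bundle_domain_crd Ac dz Ub dNb)).
have [oD _ _] := bundle_coord_smooth Ac.
have nD : \forall y \near crd c (local_section z), bundle_domain c y.
  exact: (open_nbhs_nbhs (conj oD (bundle_domain_crd Ac dz Ub dNb))).
by apply: filterS nD => y [_ Uy _]; have /groupHE [] := phiH Uy.
Qed.

(** The map v |-> al(v) l is injective and reaches all columns (a, X, 0), so its matrix in
    [column_coord] is both row free and row full. *)
Lemma section_dim z : section_domain z -> mdim N = m.+1.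
Proof.
move=> Dz; have lf := section_form_linear Dz.
have lM : linear (fun v => column_coord (section_form z v *m l)).
  by move=> a v v'; rewrite lf mulmxDl -scalemxAl linearP.
pose M := lin1_mx (linear_pack lM).
have ME v : v *m M = column_coord (section_form z v *m l) by rewrite mul_rV_lin1.
have fM : row_free M.
  rewrite -kermx_eq0; apply/eqP/row_matrixP => i; rewrite row0.
  have : row i (kermx M) *m M = 0 by rewrite -row_mul mulmx_ker row0.
  rewrite ME => E; apply: (section_form_inj Dz); rewrite -(mul0mx _ l).
  apply: column_coord_inj; [exact: section_form_skew|exact: skewJ0|].
  by rewrite E mul0mx linear0.
have uM : row_full M.
  rewrite -sub1mx; apply/row_subP => i; set y := row i _.
  pose a := y 0 (@lshift 1 m 0); pose X : 'cV[R]_m := (@rsubmx R 1 1 m y)^T.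
  have gY : lie_g R m (lie_mx a X 0 0) by exists a, X, 0, 0; rewrite trmx0 oppr0.
  have [v Ev] := section_form_onto Dz gY.
  apply/submxP; exists v; rewrite ME Ev lie_mx_l /column_coord col_mxKu col_mxKd col_mxKu.
  apply: etrans (esym (@hsubmxK R 1 1 m y)) _; rewrite (@tr_col_mx R 1 m 1) /X trmxK.
  congr row_mx; apply/matrixP => j k; rewrite [LHS]mxE !mxE !ord1 eqxx mulr1n.
  by rewrite /a /y !mxE.
by move/eqP: fM => E1; move/eqP: uM => E2; rewrite -E1 -[RHS]E2.
Qed.

Hypothesis hK : forall e : mx, lie_g_minus1 R m e ->
  forall (c : chart B 'rV[R]_(mdim B)) (u : B), atlas B c -> dom c u ->
    curvature w c u (const_field w (grading R m) c u) (const_field w e c u) = 0.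

Lemma section_curvature z v1 v2 a : section_domain z -> section_form z v1 *m l = a *: l ->
  'D_v1 (fun y => section_form y v2) z - 'D_v2 (fun y => section_form y v1) z
  + bracket (section_form z v1) (section_form z v2) = 0.
Proof.
move=> Dz v1l; have [iz Uz dz] := Dz; have [oS ss] := section_coord_smooth.
have nS : \forall y \near z, section_domain y by exact: (open_nbhs_nbhs (conj oS Dz)).
have K0 := curvature_on_line hw hK ('D_v2 section_coord z) Ac dz v1l.
have PE := pullback_exterior (chart_img_open Hc) (fun x => @form_linear R _ _ _ _ _ _ conn c x Ac)
  (fun v => @form_smooth R _ _ _ _ _ _ conn c v Ac) v1 v2 oS Dz ss section_img.
have E v v' : 'D_v (fun y => section_form y v') z =
    'D_v (fun y => w c (cinv c (section_coord y)) ('D_v' section_coord y)) z.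
  by apply: near_eq_derive; apply: filterS nS => y Sy; exact: sectionW.
have E12 := f_equal2 (fun a b : mx => a - b) (E v1 v2) (E v2 v1).
exact: (etrans (f_equal (fun a : mx => a + bracket (section_form z v1) (section_form z v2)) (etrans E12 PE)) K0).
Qed.

End LocalSection.

(** * The bundle of scales of the model *)

Section ScaleModel.
Variable R : realType.

Lemma smooth_ln : smooth_open [set x : R^o | 0 < x] (@ln R : R^o -> R^o).
Proof.
have oP : open [set x : R^o | 0 < x] by exact: open_gt.
have d (x : R^o) : 0 < x -> is_derive x (1 : R^o) (@ln R : R^o -> R^o) x^-1 by exact: is_derive1_ln.
have df (x : R^o) : 0 < x -> differentiable (@ln R : R^o -> R^o) x.
  by move=> x0; apply/derivable1_diffP; have [] := d x x0.
have sV : smooth_open [set x : R^o | 0 < x] (fun x : R^o => x^-1 : R^o).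
  apply: (@smoothV _ _ _ (@id R^o)) => //; last exact: smooth_id.
  by move=> x /= /gt_eqF ->.
apply/smooth_openP; case=> [|r].
  by move=> x x0; apply: differentiable_continuous; exact: df.
split=> [x|v]; first exact: df.
have sv : smooth_open [set x : R^o | 0 < x] (fun x : R^o => (v : R^o) *: (x^-1 : R^o)).
  by apply: smoothZ => //; exact: smooth_cst.
apply: (Ck_ext oP _ ((smooth_openP _ _).1 sv r)) => x x0 /=.
rewrite deriveE; last exact: df.
have -> : v = v *: (1 : R^o) by rewrite -[_ *: _]/(_ * _) mulr1.
by rewrite linearZ -deriveE; [have [_ ->] := d x x0; rewrite -[v *: 1]/(v * 1) mulr1|exact: df].
Qed.

Variables (m n : nat).
Local Notation J := (gram R m).
Local Notation l := (vec_l R m).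
Local Notation mx := 'M[R]_(1 + (m + 1)).
Local Notation E := ('rV[R]_m * mx)%type.
Local Notation i0 := (lshift (m + 1) 0 : 'I_(1 + (m + 1))).
Variables (B : manifold R) (emb : B -> E) (gb : E -> B).
Hypotheses (semb : smooth_map (atlas B) (vec_atlas E) setT emb)
  (embS : forall b, groupP R m (emb b).2)
  (sgb : smooth_map (vec_atlas E) (atlas B) [set z : E | groupP R m z.2] gb)
  (embK : forall b, gb (emb b) = b) (gbK : forall z, groupP R m z.2 -> emb (gb z) = z).
Variables (f : 'rV[R]_n -> 'rV[R]_m) (K : 'rV[R]_n -> mx) (G : R^o * 'rV[R]_m -> 'rV[R]_n).
Hypotheses (sf : smooth_open setT f) (sK : smooth_open setT K) (iK : forall z, isoJ J (K z))
  (sG : smooth_open setT G)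
  (GK : forall z, exists2 s, K z *m l = expR s *: l & G (s, f z) = z)
  (fG : forall s x, f (G (s, x)) = x /\ K (G (s, x)) *m l = expR s *: l).

(* The quotient of R^m x P by H is R^m x R_{>0}; it is identified with R^n by G,
   and z |-> (f z, K z) is a section over it. *)
Definition scale_point (y : E) : 'rV[R]_n := G (ln (y.2 i0 i0), y.1).
Definition scale_frame (y : E) : mx := J *m (K (scale_point y))^T *m J *m y.2.
Definition scale_trivialization (b : B) : ('rV[R]_n * mx)%type :=
  (scale_point (emb b), scale_frame (emb b)).
Definition scale_assemble (z : 'rV[R]_n * mx) : B := gb (f z.1, K z.1 *m z.2).

Let JJ := @gram_invol R m.

Let KP z : groupP R m (K z).
Proof.
have [s Ks _] := GK z; apply/groupPE; split=> //.
by exists (expR s) => //; exact: expR_gt0.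
Qed.

Let invK z : J *m (K z)^T *m J = invmx (K z).
Proof. by rewrite (isoJ_invmx JJ). Qed.

Let uK z : K z \in unitmx. Proof. exact: (isoJ_unit JJ). Qed.

(** At [scale_point y] the frame K has, by the choice of the point, the same scale as [y.2]; the
    scales cancel in K^-1 q. *)
Lemma scale_frameH y : groupP R m y.2 -> groupH R m (scale_frame y).
Proof.
move=> Py; have /groupPE [iq [t t0 qt]] := Py; apply/groupHE.
rewrite /scale_frame invK; split.
  by apply: isoJM => //; exact: isoJ_inv.
have [_ Ks] := fG (ln (y.2 i0 i0)) y.1.
rewrite (scaleE qt) lnK ?posrE // in Ks.
rewrite -mulmxA qt -scalemxAr /scale_point (scaleE qt) (scale_inv (uK _) _ Ks) ?gt_eqF //.
by rewrite scalerA mulfV ?gt_eqF // scale1r.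
Qed.

Lemma scale_assembleK z : groupH R m z.2 -> scale_trivialization (scale_assemble z) = z.
Proof.
move=> Hz; have Pz : groupP R m (K z.1 *m z.2) by apply: groupPM => //; exact: groupH_P.
rewrite /scale_trivialization /scale_assemble gbK //.
have /groupHE [iz zl] := Hz; have [s Ks Gs] := GK z.1.
have E1 : (K z.1 *m z.2) *m l = expR s *: l by rewrite -mulmxA zl.
have E2 : scale_point (f z.1, K z.1 *m z.2) = z.1 by rewrite /scale_point /= (scaleE E1) expRK.
by rewrite /scale_frame E2 invK /= mulKmx // -surjective_pairing.
Qed.

Lemma scale_trivializationK b : scale_assemble (scale_trivialization b) = b.
Proof.
rewrite /scale_assemble /scale_trivialization /scale_frame invK /= mulKVmx //.
by have [-> _] := fG (ln ((emb b).2 i0 i0)) (emb b).1; rewrite -surjective_pairing.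
Qed.

Lemma scale_trivializationH b : groupH R m (scale_trivialization b).2.
Proof. by apply: scale_frameH. Qed.

Lemma scale_act b r : groupH R m r -> model_act emb gb b r =
  scale_assemble ((scale_trivialization b).1, (scale_trivialization b).2 *m r).
Proof.
move=> Hr; rewrite /scale_assemble /scale_trivialization /scale_frame invK /= !mulmxA mulmxV // mul1mx.
by have [-> _] := fG (ln ((emb b).2 i0 i0)) (emb b).1.
Qed.

Let oP : open [set y : E | 0 < y.2 i0 i0].
Proof.
have s2 : smooth_open setT (@snd 'rV[R]_m mx) by exact: smooth_snd.
exact: (open_preimage_smooth (smooth_coord i0 i0 openT s2) (@open_gt R 0)).
Qed.

Let sT : smooth_open [set y : E | 0 < y.2 i0 i0] (fun y => (scale_point y, scale_frame y)).
Proof.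
have s2 : smooth_open [set y : E | 0 < y.2 i0 i0] (@snd 'rV[R]_m mx) by exact: smooth_snd.
have sc := smooth_coord i0 i0 oP s2.
have sl : smooth_open [set y : E | 0 < y.2 i0 i0] (fun y : E => ln (y.2 i0 i0) : R^o).
  exact: (@smooth_comp _ _ _ _ _ _ [set x : R^o | 0 < x] (fun y : E => y.2 i0 i0 : R^o) (@ln R) oP (fun _ H => H) sc smooth_ln).
have sp : smooth_open [set y : E | 0 < y.2 i0 i0] scale_point.
  apply: (@smooth_comp _ _ _ _ _ _ setT (fun y : E => ((ln (y.2 i0 i0) : R^o), y.1)) G oP) => //.
  by apply: smooth_pair => //; exact: smooth_fst.
have sKp : smooth_open [set y : E | 0 < y.2 i0 i0] (fun y => K (scale_point y)).
  exact: (@smooth_comp _ _ _ _ _ _ setT scale_point K oP (fun _ _ => I) sp sK).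
have sKT : smooth_open [set y : E | 0 < y.2 i0 i0] (fun y => (K (scale_point y))^T).
  exact: (@smooth_lin _ _ _ _ _ _ (fun y => K (scale_point y)) (@trmx R _ _ : {linear mx -> mx}) oP sKp).
have cJ : smooth_open [set y : E | 0 < y.2 i0 i0] (fun _ : E => J) by exact: smooth_cst.
apply: (smooth_pair oP sp).
exact: (smooth_mulmx oP (smooth_mulmx oP (smooth_mulmx oP cJ sKT) cJ) s2).
Qed.

Let posP (y : E) : groupP R m y.2 -> 0 < y.2 i0 i0.
Proof. by move=> /groupPE [_ [t t0 qt]]; rewrite (scaleE qt). Qed.

Let vecc (V : normedModType R) c : vec_atlas V c -> is_chart c.
Proof. by move=> ->; exact: vec_chart_is_chart. Qed.
Let HB := fun c (Ac : atlas B c) => manifold_chart Ac.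

Lemma scale_trivialization_smooth :
  smooth_map (atlas B) (vec_atlas ('rV[R]_n * mx)%type) setT scale_trivialization.
Proof.
have s1 : smooth_map (vec_atlas E) (vec_atlas ('rV[R]_n * mx)%type) [set y : E | groupP R m y.2]
    (fun y => (scale_point y, scale_frame y)).
  by apply: smooth_map_vec; apply: (smooth_open_on oP) => // y; exact: posP.
apply: (smooth_map_comp HB (@vec_atlas_smooth R E) (@vecc _) _ semb s1).
by move=> b _; exact: embS.
Qed.

Lemma scale_assemble_smooth : smooth_map (vec_atlas ('rV[R]_n * mx)%type) (atlas B)
  [set z | groupH R m z.2] scale_assemble.
Proof.
have s1 : smooth_open setT (@fst 'rV[R]_n mx) by exact: smooth_fst.
have sfz : smooth_open setT (fun z : 'rV[R]_n * mx => f z.1).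
  exact: (@smooth_comp _ _ _ _ _ setT setT fst f openT (fun _ _ => I) s1 sf).
have sKz : smooth_open setT (fun z : 'rV[R]_n * mx => K z.1).
  exact: (@smooth_comp _ _ _ _ _ setT setT fst K openT (fun _ _ => I) s1 sK).
have s2 : smooth_open setT (@snd 'rV[R]_n mx) by exact: smooth_snd.
have s3 := smooth_pair openT sfz (smooth_mulmx openT sKz s2).
have s4 : smooth_map (vec_atlas ('rV[R]_n * mx)%type) (vec_atlas E) [set z | groupH R m z.2]
    (fun z => (f z.1, K z.1 *m z.2)).
  by apply: smooth_map_vec; exact: (smooth_open_on openT).
apply: (smooth_map_comp (@vecc _) (@vec_atlas_smooth R E) HB _ s4 sgb).
by move=> z Hz /=; apply: groupPM => //; exact: groupH_P.
Qed.

Lemma scale_correspondence : @correspondence_space R m B (vec_manifold R n)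
  (fun b => (scale_trivialization b).1) (model_act emb gb).
Proof.
apply: (@trivial_principal_bundle R n _ (groupH R m) B scale_trivialization scale_assemble).
- exact: groupH1.
- by move=> q r; exact: groupHM.
- exact: scale_trivialization_smooth.
- exact: scale_trivializationH.
- exact: scale_assemble_smooth.
- exact: scale_trivializationK.
- by move=> z; exact: scale_assembleK.
- by move=> b q; exact: scale_act.
Qed.

End ScaleModel.

(** [mdim N] equals m + 1 only propositionally; the dimension is made a variable so that the
    equation can be substituted. *)
Lemma exists_local_model_dim (R : realType) (m n : nat) (D : set 'rV[R]_n) (z0 : 'rV[R]_n)
    (al : 'rV[R]_n -> 'rV[R]_n -> 'M[R]_(1 + (m + 1))) : n = m.+1 -> open D -> D z0 ->
  (forall x, D x -> linear (al x)) -> (forall v, smooth_open D (fun x => al x v)) ->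
  (forall x v, D x -> skewJ (gram R m) (al x v)) ->
  (forall x v, D x -> al x v *m vec_l R m = 0 -> v = 0) ->
  (forall x v1 v2 a, D x -> al x v1 *m vec_l R m = a *: vec_l R m ->
    'D_v1 (fun y => al y v2) x - 'D_v2 (fun y => al y v1) x + bracket (al x v1) (al x v2) = 0) ->
  exists (theta : 'rV[R]_m -> 'rV[R]_m -> 'M[R]_(1 + (m + 1)))
    (f : 'rV[R]_n -> 'rV[R]_m) (K : 'rV[R]_n -> 'M[R]_(1 + (m + 1)))
    (G : R^o * 'rV[R]_m -> 'rV[R]_n) (C : set 'rV[R]_n),
  [/\ [/\ forall x, linear (theta x), forall v, smooth_open setT (fun x => theta x v),
         forall x v, skewJ (gram R m) (theta x v) &
         forall x v a, theta x v *m vec_l R m = a *: vec_l R m -> v = 0],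
      [/\ smooth_open setT f, smooth_open setT K, forall z, isoJ (gram R m) (K z) & smooth_open setT G],
      forall z, exists2 s, K z *m vec_l R m = expR s *: vec_l R m & G (s, f z) = z,
      forall s x, f (G (s, x)) = x /\ K (G (s, x)) *m vec_l R m = expR s *: vec_l R m &
      [/\ open C, C z0, C `<=` D & forall z v, C z ->
         K z *m al z v = theta (f z) ('D_v f z) *m K z + 'D_v K z]].
Proof. by move=> n_eq; move: D z0 al; rewrite n_eq => D z0 al; exact: exists_local_model. Qed.

(** * The isomorphism with an open part of the model *)

Section Assembly.
Variables (R : realType) (m : nat).
Local Notation J := (gram R m).
Local Notation l := (vec_l R m).
Local Notation mx := 'M[R]_(1 + (m + 1)).
Variables (B N : manifold R) (p : B -> N) (act : B -> mx -> B) (w : preform B mx).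
Hypothesis hw : lightlike_cartan_geometry p act w.
Hypothesis hK : forall e : mx, lie_g_minus1 R m e ->
  forall (c : chart B 'rV[R]_(mdim B)) (u : B), atlas B c -> dom c u ->
    curvature w c u (const_field w (grading R m) c u) (const_field w e c u) = 0.

Lemma bundle_of_scales_of_curvature : locally_bundle_of_scales p act w.
Proof.
move=> x0; have [_ [sp sact [act1 actA pact] triv] conn] := hw.
have [U0 [phi [oU0 U0x phiM [sphi phimem [g [sg gmem gK0 gK2]]]]]] := triv x0.
have [cN AcN dNx] := manifold_cover x0; have HN := manifold_chart AcN.
have [c Ac dc] := manifold_cover (local_section g cN (crd cN x0)).
have phiH b : U0 (p b) -> groupH R m (phi b) by move=> Ub; have [] := phimem b Ub.
have gK b : U0 (p b) -> g (p b, phi b) = b by move=> Ub; exact: gK0.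
have pg x q : U0 x -> groupH R m q -> p (g (x, q)) = x /\ phi (g (x, q)) = q.
  by move=> Ux Hq; have [-> ->] := gK2 (x, q) (conj Ux Hq).
pose D := section_domain U0 g cN c; pose al := section_form w g cN c.
have Dz0 : D (crd cN x0).
  by split=> //; [exact: (chart_img HN dNx)|rewrite (chart_K HN dNx)].
have [oD _] := section_coord_smooth oU0 sg AcN Ac.
have dimN : mdim N = m.+1 by exact: (section_dim hw oU0 phiM sphi phiH sg gK pg AcN Ac Dz0).
have all x : D x -> linear (al x) by exact: (section_form_linear hw oU0 sg AcN Ac).
have als v : smooth_open D (fun x => al x v) by exact: (section_form_smooth hw oU0 sg AcN Ac).
have alk x v : D x -> skewJ J (al x v) by exact: (section_form_skew hw Ac).
have ali x v : D x -> al x v *m l = 0 -> v = 0.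
  by exact: (section_form_inj hw oU0 sphi sg pg AcN Ac).
have alK x v1 v2 a : D x -> al x v1 *m l = a *: l ->
    'D_v1 (fun y => al y v2) x - 'D_v2 (fun y => al y v1) x + bracket (al x v1) (al x v2) = 0.
  by exact: (section_curvature hw oU0 sg AcN Ac hK).
have [theta [f [K [G [C [[thl ths thk thi] [sf sK iK sG] GK fG [oC Cz0 CD CI]]]]]]] :=
  exists_local_model_dim dimN oD Dz0 all als alk ali alK.
have [D' [emb [semb embS0 [gb [sgb _ embK0 gbK0]]]]] := exists_parabolic_bundle_space R m.
have embS b : groupP R m (emb b).2 by exact: embS0.
have embK b : gb (emb b) = b by exact: embK0.
have gbK z : groupP R m z.2 -> emb (gb z) = z by exact: gbK0.
(* Restricted to points with coordinates in [C], where the gauge identity is available. *)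
pose U := [set x : N | [/\ U0 x, dom cN x & C (crd cN x)]].
have oU : open U.
  rewrite openE => x [Ux dx Cx]; rewrite /interior.
  have n1 : \forall y \near x, U0 y by exact: (open_nbhs_nbhs (conj oU0 Ux)).
  have n3 : \forall y \near x, C (crd cN y) by exact: (crd_continuous HN dx (open_nbhs_nbhs (conj oC Cx))).
  by apply: filterS3 n1 (near_dom HN dx) n3 => y.
exists U; split=> //.
exists D', (vec_manifold R m), (fun b => (emb b).1), (model_act emb gb), (model_form theta emb); split.
  split; [exact: vec_connected| |exact: model_connection].
  apply: (@trivial_principal_bundle R m _ (groupP R m) D' emb gb) => //.
  - exact: (groupH_P (groupH1 R m)).
  - by move=> q r; exact: groupPM.
pose T := scale_trivialization emb K G; pose Ti := scale_assemble gb f K.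
exists (vec_manifold R (mdim N)), (fun b => (T b).1), C; split=> //.
  exact: (scale_correspondence semb embS sgb embK gbK sf sK iK sG GK fG).
have TiK z : groupH R m z.2 -> T (Ti z) = z by exact: (scale_assembleK gbK iK GK).
have TK b : Ti (T b) = b by exact: (scale_trivializationK embK iK fG).
have TH b : groupH R m (T b).2 by exact: (scale_trivializationH embS iK fG).
have sT := scale_trivialization_smooth semb embS sK sG.
have sTi : smooth_map (vec_atlas ('rV[R]_(mdim N) * mx)%type) (atlas D') [set z | groupH R m z.2] Ti.
  exact: (scale_assemble_smooth sgb sf sK iK GK).
have CN z : C z -> [/\ img cN z, U0 (cinv cN z) & U (cinv cN z)].
  move=> Cz; have [iz Uz dz] := CD _ Cz; split=> //.
  by split=> //; [exact: (chart_dom HN iz)|rewrite (chart_invK HN iz)].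
(* In the two H-trivializations, given by the section of [B] and by the section (f, K) of the model,
   this is the identity; smoothness, bijectivity and equivariance are then formal, and only the
   comparison of the forms has content. *)
pose F b := Ti (crd cN (p b), phi b).
have UF b : U (p b) -> T (F b) = (crd cN (p b), phi b).
  by move=> [Ub _ _]; apply: TiK; exact: phiH.
have vecc (V : normedModType R) e : vec_atlas V e -> is_chart e by move=> ->; exact: vec_chart_is_chart.
have prN : is_smooth_atlas (prod_atlas (atlas N) (vec_atlas mx)).
  by apply: prod_atlas_smooth; [exact: atlas_smooth|exact: vec_atlas_smooth].
have HprN e : prod_atlas (atlas N) (vec_atlas mx) e -> is_chart e by case: prN => H _ _; exact: H.
have HB e : atlas B e -> is_chart e by exact: manifold_chart.
have HD e : atlas D' e -> is_chart e by exact: manifold_chart.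
have sF : smooth_map (atlas B) (atlas D') (p @^-1` U) F.
  have s1 : smooth_map (atlas B) (prod_atlas (atlas N) (vec_atlas mx)) (p @^-1` U) (fun b => (p b, phi b)).
    by apply: smooth_map_sub sphi => b [].
  have sfst : smooth_map (prod_atlas (atlas N) (vec_atlas mx)) (atlas N) [set xq | U xq.1] fst.
    by apply: smooth_map_fst; exact: atlas_smooth.
  have s2 : smooth_map (prod_atlas (atlas N) (vec_atlas mx)) (vec_atlas ('rV[R]_(mdim N) * mx)%type)
      [set xq | U xq.1] (fun xq => (crd cN xq.1, xq.2)).
    apply: smooth_map_vec_pair; last by apply: smooth_map_snd; exact: vec_atlas_smooth.
    apply: (smooth_map_comp HprN (atlas_smooth N) (@vecc _) _ sfst (smooth_map_crd (atlas_smooth N) AcN)).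
    by move=> xq [].
  have s3 : smooth_map (atlas B) (vec_atlas ('rV[R]_(mdim N) * mx)%type) (p @^-1` U) (fun b => (crd cN (p b), phi b)).
    by apply: (smooth_map_comp HB prN (@vecc _) _ s1 s2).
  apply: (smooth_map_comp HB (@vec_atlas_smooth R _) HD _ s3 sTi).
  by move=> b [Ub _ _] /=; exact: phiH.
exists F, (crd cN); split.
- split=> //.
    move=> b Ub; have [_ _ Cb] := Ub; have E := UF b Ub.
    by suff : C (T (F b)).1 by []; rewrite E.
  exists (fun b => g (cinv cN (T b).1, (T b).2)); split.
  + have s1 : smooth_map (vec_atlas ('rV[R]_(mdim N) * mx)%type) (vec_atlas 'rV[R]_(mdim N)) [set z | C z.1] fst.
      exact: smooth_map_vec_fst.
    have s2 : smooth_map (vec_atlas ('rV[R]_(mdim N) * mx)%type) (atlas N) [set z | C z.1] (fun z => cinv cN z.1).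
      apply: (smooth_map_comp (@vecc _) (@vec_atlas_smooth R _) (fun e Ae => manifold_chart Ae) _ s1 (smooth_map_cinv (atlas_smooth N) AcN)).
      by move=> z /CN [].
    have s3 : smooth_map (vec_atlas ('rV[R]_(mdim N) * mx)%type) (prod_atlas (atlas N) (vec_atlas mx)) [set z | C z.1]
        (fun z => (cinv cN z.1, z.2)).
      by apply: (smooth_map_pair (@vecc _) s2); exact: smooth_map_vec_snd.
    have sTC : smooth_map (atlas D') (vec_atlas ('rV[R]_(mdim N) * mx)%type) [set b | C (T b).1] T.
      by apply: smooth_map_sub sT.
    have s4 : smooth_map (atlas D') (prod_atlas (atlas N) (vec_atlas mx)) [set b | C (T b).1]
        (fun b => (cinv cN (T b).1, (T b).2)).
      by apply: (smooth_map_comp HD (@vec_atlas_smooth R _) HprN _ sTC s3).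
    apply: (smooth_map_comp HD prN HB _ s4 sg).
    by move=> b /CN [_ Ub _]; split=> //; exact: TH.
  + move=> b /CN [iz Uz Ux]; have [pb _] := pg _ _ Uz (TH b).
    by suff : U (p (g (cinv cN (T b).1, (T b).2))) by []; rewrite pb.
  + move=> b Ub; have [U0b dNb _] := Ub; have E := UF b Ub.
    by rewrite E (chart_K HN dNb) gK.
  + move=> b /CN [iz Uz Ux]; have [pb phb] := pg _ _ Uz (TH b).
    by rewrite /F pb phb (chart_invK HN iz) -surjective_pairing TK.
- split.
  + by apply: smooth_map_sub (smooth_map_crd (atlas_smooth N) AcN) => x [].
  + by move=> x [].
  + exists (cinv cN); split.
    * by apply: smooth_map_sub (smooth_map_cinv (atlas_smooth N) AcN) => z /CN [].
    * by move=> z /CN [].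
    * by move=> x [_ dx _]; exact: (chart_K HN dx).
    * by move=> z /CN [iz _ _]; exact: (chart_invK HN iz).
- by move=> b Ub; rewrite UF.
- move=> b q Ub Hq; have [U0b _ _] := Ub.
  rewrite (scale_act emb gb iK fG _ Hq) -/T -/Ti UF //=.
  by rewrite /F pact // phiM.
- move=> d d' b v Ad Ad' Ub db db'; have [U0b dNb Cb] := Ub.
  have Hd := HB _ Ad; have idb := chart_img Hd db.
  have dbE := chart_K Hd db.
  have oV : open (p @^-1` U).
    by apply: open_comp => // x _; case: sp => cp _; exact: (within_open_at openT cp).
  pose O := [set y | img d y /\ U (p (cinv d y))].
  have oO : open O.
    rewrite openE => y [iy Uy]; rewrite /interior; apply: filterI; first exact: (near_img Hd).
    exact: (cinv_continuous Hd iy (open_nbhs_nbhs (conj oV Uy))).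
  have Oy : O (crd d b) by split=> //; rewrite dbE.
  have sFc : smooth_map (vec_atlas 'rV[R]_(mdim B)) (atlas D') O (F \o cinv d).
    have s1 : smooth_map (vec_atlas 'rV[R]_(mdim B)) (atlas B) O (cinv d).
      by apply: smooth_map_sub (smooth_map_cinv (atlas_smooth B) Ad) => y [].
    by apply: (smooth_map_comp (@vecc _) (atlas_smooth B) HD _ s1 sF) => y [].
  have Fb : (F \o cinv d) (crd d b) = F b by rewrite /= dbE.
  have [|dF EF] := model_push semb v oO sFc Ad' Oy; first by rewrite Fb.
  rewrite Fb in EF.
  have TE : tangent_map F d d' b v = 'D_v (crd d' \o (F \o cinv d)) (crd d b).
    by apply: esym; exact: deriveE.
  rewrite -TE in EF.
  have [oDb sz sq] := bundle_coord_smooth hw oU0 sphi AcN Ad.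
  have Dy : bundle_domain p U0 cN d (crd d b) by exact: (bundle_domain_crd Ad db U0b dNb).
  set zc := base_coord p cN d in sz; set qc := fiber_coord phi d in sq.
  set y := crd d b in Oy EF Dy idb *.
  have zy : zc y = crd cN (p b) by rewrite /zc /base_coord dbE.
  have qy : qc y = phi b by rewrite /qc /fiber_coord dbE.
  have dz := smooth_differentiable sz Dy; have dq := smooth_differentiable sq Dy.
  have dfz : differentiable f (zc y) by exact: (smooth_differentiable sf).
  have dKz : differentiable K (zc y) by exact: (smooth_differentiable sK).
  have dfc : differentiable (f \o zc) y by exact: differentiable_comp.
  have dKc : differentiable (K \o zc) y by exact: differentiable_comp.
  have [dKq EKq] := differentiable_mulmx dKc dq.
  have embF b' : U (p b') -> emb (F b') = (f (crd cN (p b')), K (crd cN (p b')) *m phi b').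
    move=> [Ub' _ _].
    have PK : groupP R m (K (crd cN (p b')) *m phi b').
      apply: groupPM; last exact: (groupH_P (phiH _ Ub')).
      have [s Ks _] := GK (crd cN (p b')); apply/groupPE; split; first exact: iK.
      by exists (expR s); [exact: expR_gt0|exact: Ks].
    exact: (gbK (f (crd cN (p b')), K (crd cN (p b')) *m phi b') PK).
  set zv := 'D_v zc y; set qv := 'D_v qc y.
  (* The velocity of b |-> (f(z), K(z) phi) by the chain and product rules. *)
  have EF2 : 'D_v (emb \o (F \o cinv d)) y =
      ('D_zv f (zc y), K (zc y) *m qv + 'D_zv K (zc y) *m phi b).
    have nE : \forall y' \near y, (emb \o (F \o cinv d)) y' = ((f \o zc) y', (K \o zc) y' *m qc y').
      have : \forall y' \near y, O y' by exact: (open_nbhs_nbhs (conj oO Oy)).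
      by apply: filterS => y' [iy' Uy']; exact: embF.
    apply: etrans (near_eq_derive v nE) _; apply: etrans (derive_pair v dfc dKq) _.
    congr pair; first exact: (derive_comp v dz dfz).
    have EK := derive_comp v dz dKz; rewrite -qy.
    exact: (etrans (EKq v) (f_equal (fun M => K (zc y) *m qv + M *m qc y) EK)).
  rewrite EF2 in EF.
  rewrite /model_form EF /= embF //= -zy.
  have Dz : D (crd cN (p b)) by exact: CD.
  rewrite (form_decomposition hw oU0 phiM sphi phiH sg gK pg AcN Ac v Ad db U0b dNb Dz).
  have CIz := CI (zc y) zv; rewrite zy in CIz; have {}CIz := CIz Cb.
  rewrite -/zc -/qc -/y -/zv -/qv -/al zy.
  set k := K (crd cN (p b)) in CIz *; set q := phi b; set a := al _ _ in CIz *.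
  set th := theta _ _ in CIz *; set dk := 'D_zv K _ in CIz *.
  have kk : J *m k^T *m J *m k = 1%:M by apply: isoJ_inv_mul; [exact: gram_invol|exact: iK].
  (* The gauge identity k al = theta k + dk lets k be factored out on the left, and (k q)^-1 then
     cancels it by k^T J k = J. *)
  have -> : th *m (k *m q) + (k *m qv + dk *m q) = k *m (a *m q + qv).
    rewrite [k *m qv + _]addrC addrA mulmxA -mulmxDl -CIz mulmxDr mulmxA.
    by [].
  rewrite trmx_mul mulmxA; congr (_ *m _).
  have E1 : k^T *m J *m k = J by exact: iK.
  by rewrite -!mulmxA [k^T *m (J *m k)]mulmxA E1.
Qed.

End Assembly.

Theorem mainTheorem7 (R : realType) (m : nat) (hm : (2 <= m)%N)
    (B N : manifold R) (p : B -> N) (act : B -> 'M[R]_(1 + (m + 1)) -> B)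
    (w : preform B 'M[R]_(1 + (m + 1)))
    (hw : lightlike_cartan_geometry p act w) :
  locally_bundle_of_scales p act w <->
  (forall e : 'M[R]_(1 + (m + 1)), lie_g_minus1 R m e ->
     forall (c : chart B 'rV[R]_(mdim B)) (u : B), atlas B c -> dom c u ->
       curvature w c u (const_field w (grading R m) c u)
                       (const_field w e c u) = 0).
Proof.
split=> [lb e _ c u Ac du|hK]; last exact: bundle_of_scales_of_curvature.
have [_ _ conn] := hw.
apply: (curvature_of_bundle_of_scales hw lb) => //.
by apply: (form_surj conn) => //; exact: grading_lie.
Qed.
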